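(* Let $\gamma\in(0,1)$, $N_\gamma=\lfloor\gamma^{-1}\rfloor$, let $f_1,\dots,f_d$ be a family of vector fields on $\mathbb R^n$ of class $C^{N_\gamma+1+k}_b$ for some integer $k\ge0$, and let $\mathbf W$ be a geometric rough path of regularity $\gamma$. Then: 1. the rough differential equation $\mathrm dX_t=\sum_{i=1}^df_i(X_t)\,\mathrm d\mathbf W^i_t$, $X_s=x$, has a unique solution $\mathbf X^{s,x}\in(\mathscr D^{(N_\gamma+1)\gamma}_{\mathbf W})^n$ (write $X^{s,x}_t=\langle\mathbf 1^*,\mathbf X^{s,x}_t\rangle$); 2. the induced flow $x\mapsto X^{s,x}_t$ is a diffeomorphism of class $C^{k+1}$ for each fixed $s<t$; 3. the partial derivatives $\partial^\alpha X^{s,x}_t$ in $x$ (for nonempty words $\alpha$ over $\{1,\dots,n\}$ with $|\alpha|\le k+1$) satisfy the system of rough differential equations $$\mathrm d\,\partial^\alpha X^{s,x}_t=\sum_{i=1}^d\sum_{l=1}^{|\alpha|}\frac1{l!}\sum_{\substack{\beta_1,\dots,\beta_l\\ \alpha\in\operatorname{Sh}(\beta_1,\dots,\beta_l)}}D^lf_i(X^{s,x}_t)\big(\partial^{\beta_1}X^{s,x}_t,\dots,\partial^{\beta_l}X^{s,x}_t\big)\,\mathrm d\mathbf W^i_t,$$ with initial conditions $X^{s,x}_s=x$, $\partial^jX^{s,x}_s=e_j$ (the $j$-th canonical basis vector of $\mathbb R^n$) for $j=1,\dots,n$, and $\partial^\alpha X^{s,x}_s=0$ for all words with $|\alpha|\ge2$.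 Here the inner sum runs over $l$-tuples of nonempty words over $\{1,\dots,n\}$, and $\operatorname{Sh}(\beta_1,\dots,\beta_l)$ is the set of words which occur with nonzero coefficient in the shuffle product of $\beta_1,\dots,\beta_l$.
   Context: Words and rough paths. Fix $T>0$, $d,n\ge1$. A word is a finite sequence $w=(i_1,\dots,i_p)$ of letters in $\{1,\dots,d\}$, $|w|=p$; $\varepsilon$ is the empty word; $uv$ denotes concatenation. $H_N=\bigoplus_{p=0}^N(\mathbb R^d)^{\otimes p}$ has basis $e_w=e_{i_1}\otimes\cdots\otimes e_{i_p}$, $|w|\le N$, with $e_\varepsilon=\mathbf 1$; $(e_w^* )$ is the dual basis and $\mathbf 1^*=e_\varepsilon^*$. Let $ш$ denote the usual shuffle product of words, extended bilinearly; for words $u_1,\dots,u_k$, $\operatorname{Sh}(u_1,\dots,u_k)$ is the set $\{w:\langle e_w^*,e_{u_1}ш\cdotsш e_{u_k}\rangle\neq0\}$. The same notation is used for words over the alphabet $\{1,\dots,n\}$, written with Greek letters; for $\alpha=(\alpha_1,\dots,\alpha_m)$ such a word, $\partial^\alpha=\partial^m/\partial x_{\alpha_1}\cdots\partial x_{\alpha_m}$. For $g,h\in H_N^*$ put $\langle g\star h,e_w\rangle=\sum_{uv=w}\langle g,e_u\rangle\langle h,e_v\rangle$. $G^{(N)}$ is the group (under $\star$, with identity $\mathbf 1^*$) of all $g\in H_N^*$ with $\langle g,\mathbf 1\rangle=1$ and $\langle g,x\,ш\,y\rangle=\langle g,x\rangle\langle g,y\rangle$ for $x\in(\mathbb R^d)^{\otimes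 p}$, $y\in(\mathbb R^d)^{\otimes q}$, $p+q\le N$. A (weakly) geometric rough path of regularity $\gamma$ is a path $\mathbf W:[0,T]\to G^{(N_\gamma)}$ which is $\gamma$-Hölder for a homogeneous left-invariant metric on $G^{(N_\gamma)}$; its increments $\mathbf W_{st}=\mathbf W_s^{-1}\star\mathbf W_t$ satisfy $\sup_{s\ne t}|\langle\mathbf W_{st},e_w\rangle|/|t-s|^{|w|\gamma}<\infty$ for all $|w|\le N_\gamma$. $C^k_b$: functions of class $C^k$ bounded together with all derivatives up to order $k$. $D^l f$ denotes the $l$-th derivative, a symmetric $l$-linear map. Controlled paths. For $1\le N\le N_\gamma+1$, $\mathscr D^{N\gamma}_{\mathbf W}$ is the space of $\mathbf X:[0,T]\to H_{N-1}$ such that for $|w|\le N-1$ the path $t\mapsto\langle e_w^*,\mathbf X_t\rangle$ is $\gamma$-Hölder and $|\langle e_w^*,\mathbf X_t\rangle-\langle\mathbf W_{st}\star e_w^*,\mathbf X_s\rangle|\le C|t-s|^{(N-|w|)\gamma}$ for all $s<t$. $(\mathscr D^{N\gamma}_{\mathbf W})^n$: same for $\mathbb R^n$-valued coefficients. Composition. For $\phi\in C^N(\mathbb R^n,\mathbb R^m)$ and $\mathbf X\in(\mathscr D^{N\gamma}_{\mathbf W})^n$ with $X_t=\langle\mathbf 1^*,\mathbf X_t\rangle$, the lift $\mathbf\Phi(\mathbf X)$ of $\phi(X)$ has $\langle\mathbf 1^*,\mathbf\Phi(\mathbf X)_t\rangle=\phi(X_t)$ and, for $w\ne\varepsilon$,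 $\langle e_w^*,\mathbf\Phi(\mathbf X)_t\rangle=\sum_{k=1}^{|w|}\frac1{k!}\sum_{u_1,\dots,u_k:\,w\in\operatorname{Sh}(u_1,\dots,u_k)}D^k\phi(X_t)(\langle e_{u_1}^*,\mathbf X_t\rangle,\dots,\langle e_{u_k}^*,\mathbf X_t\rangle)$, the sum being over nonempty words $u_j$. Rough integral. For $\mathbf Y\in\mathscr D^{N_\gamma\gamma}_{\mathbf W}$ with $Y=\langle\mathbf 1^*,\mathbf Y\rangle$: $\int_0^tY_u\,\mathrm d\mathbf W^i_u=\lim_{|\pi|\to0}\sum_{[a,b]\in\pi}\sum_{|w|\le N_\gamma-1}\langle e_w^*,\mathbf Y_a\rangle\langle\mathbf W_{ab},e_{wi}\rangle$ over partitions $\pi$ of $[0,t]$; $\int_0^\cdot\mathbf Y_u\,\mathrm d\mathbf W^i_u\in\mathscr D^{(N_\gamma+1)\gamma}_{\mathbf W}$ has $\mathbf 1^*$-coefficient $\int_0^tY\,\mathrm d\mathbf W^i$, $e_{wi}^*$-coefficient $\langle e_w^*,\mathbf Y_t\rangle$, and all others zero; $\int_s^t=\int_0^t-\int_0^s$. RDE solution (for vector fields $f_i$ of class at least $C^{N_\gamma}$). Define $F_\varepsilon=\mathrm{id}$, $F_{iw}(x)=DF_w(x)f_i(x)$. A path $X:[0,T]\to\mathbb R^n$ solves $\mathrm dX=\sum_if_i(X)\,\mathrm d\mathbf W^i$ if there is $\mathbf X\in(\mathscr D^{N_\gamma\gamma}_{\mathbf W})^n$ with $\langle\mathbf 1^*,\mathbf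 X_t\rangle=X_t$, $\langle e_w^*,\mathbf X_0\rangle=F_w(X_0)$ for $|w|\le N_\gamma-1$, and $\mathbf X_t-\mathbf X_s=\sum_{i=1}^d\int_s^t\mathbf F_i(\mathbf X)_u\,\mathrm d\mathbf W^i_u$ for all $s,t$, as an equation in $(\mathscr D^{N_\gamma\gamma}_{\mathbf W})^n$, where $\mathbf F_i(\mathbf X)$ is the lift of $f_i(X)$. Such $\mathbf X$ is also regarded as an element of $(\mathscr D^{(N_\gamma+1)\gamma}_{\mathbf W})^n$, with $\langle e_w^*,\mathbf X_t\rangle=F_w(X_t)$. For initial time $s$, replace time $0$ by $s$.
   Formalization: In the sums over tuples with α in Sh(β_1,…,β_l), and likewise in the composition lift, each tuple is weighted by the multiplicity of the word in the shuffle product; counting it once is false for repeated letters, e.g. α=(1,1), where f″(X)(∂X)² would get the factor 1/2. *)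

(* Defs.v *)
From HB Require Import structures.
From mathcomp Require Import all_boot all_order all_algebra.
From mathcomp Require Import all_classical all_reals all_analysis.

Set Implicit Arguments.
Unset Strict Implicit.
Unset Printing Implicit Defensive.

Import Order.TTheory GRing.Theory Num.Theory.
Import numFieldNormedType.Exports.

Local Open Scope classical_set_scope.
Local Open Scope ring_scope.

(* All words occurring in the shuffle product of two words, repeated according
   to multiplicity: the coefficient of [w] is [count_mem w (shuffle u v)]. *)
Fixpoint shuffle (A : Type) (u : seq A) : seq A -> seq (seq A) :=
  fix shuffle_u (v : seq A) : seq (seq A) :=
    match u, v with
    | [::], _ => [:: v]
    | _, [::] => [:: u]
    | a :: u', b :: v' =>
        map (cons a) (shuffle u' v) ++ map (cons b) (shuffle_u v')
    end.

Definition shuffles (A : Type) (us : seq (seq A)) : seq (seq A) :=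
  foldr (fun u ws => flatten [seq shuffle u w | w <- ws]) [:: [::]] us.

(* [tens d N V] is H_N with coefficients in V (so (H_N)^n for V = R^n); the
   word [w] is the coordinate of e_w.  A functional g in H_N^* is an element of
   [tens d N R] through g w = <g, e_w>. *)
Notation tens d N V := {ffun N.-bseq 'I_d -> V}.

Section TruncatedTensors.
Context {R : realType} {d : nat}.

Definition coef {N : nat} {V : lmodType R} (x : tens d N V) (w : seq 'I_d) : V :=
  oapp x 0 (insub w).

(* For M <= N this is the restriction to words of length at most M. *)
Definition trunc {N : nat} (M : nat) {V : lmodType R} (x : tens d N V) :
    tens d M V :=
  [ffun w : M.-bseq 'I_d => coef x w].

Definition pairing {N : nat} {V : lmodType R} (g : tens d N R) (x : tens d N V) : V :=
  \sum_u g u *: x u.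

Definition basis {N : nat} (w : N.-bseq 'I_d) : tens d N R :=
  [ffun v => (v == w)%:R].

Definition star {N : nat} (g h : tens d N R) : tens d N R :=
  [ffun w : N.-bseq 'I_d =>
    \sum_(p : N.-bseq 'I_d * N.-bseq 'I_d | p.1 ++ p.2 == w :> seq 'I_d)
      g p.1 * h p.2].

Definition star1 {N : nat} : tens d N R := basis [bseq].

Definition star_inv {N : nat} (g : tens d N R) : tens d N R :=
  xget star1 [set h | star g h = star1 /\ star h g = star1].

Definition homogeneous {N : nat} (p : nat) (x : tens d N R) : Prop :=
  forall w : N.-bseq 'I_d, size w != p -> x w = 0.

Definition tens_shuffle {N : nat} (x y : tens d N R) : tens d N R :=
  [ffun w : N.-bseq 'I_d =>
    \sum_u \sum_v x u * y v * (count_mem (w : seq 'I_d) (shuffle u v))%:R].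

Definition grouplike (N : nat) (g : tens d N R) : Prop :=
  g [bseq] = 1 /\
  forall (p q : nat) (x y : tens d N R),
    homogeneous p x -> homogeneous q y -> (p + q <= N)%N ->
    pairing g (tens_shuffle x y) = pairing g x * pairing g y.

Definition dilation {N : nat} (l : R) (g : tens d N R) : tens d N R :=
  [ffun w : N.-bseq 'I_d => l ^+ size w * g w].

Definition homogeneous_left_invariant_metric (N : nat)
    (rho : tens d N R -> tens d N R -> R) : Prop :=
  forall g h k : tens d N R, grouplike g -> grouplike h -> grouplike k ->
  [/\ rho g h = 0 <-> g = h,
      rho g h = rho h g,
      rho g k <= rho g h + rho h k,
      rho (star k g) (star k h) = rho g h &
      forall l : R, 0 < l -> rho (dilation l g) (dilation l h) = l * rho g h].

Definition incr {N : nat} (W : R -> tens d N R) (s t : R) : tens d N R :=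
  star (star_inv (W s)) (W t).

Definition Ngam (gamma : R) : nat := Num.truncn gamma^-1.

(* The last clause is a consequence of the Hölder property for rho, recorded
   here because it is the form in which that property is used. *)
Definition geometric_rough_path (gamma T : R) (W : R -> tens d (Ngam gamma) R) : Prop :=
  [/\ forall t, 0 <= t <= T -> grouplike (W t),
      exists2 rho, homogeneous_left_invariant_metric rho &
        exists C : R, forall s t, 0 <= s <= T -> 0 <= t <= T ->
          rho (W s) (W t) <= C * `|t - s| `^ gamma &
      forall w : (Ngam gamma).-bseq 'I_d, exists C : R,
        forall s t, 0 <= s <= T -> 0 <= t <= T -> s != t ->
          `|incr W s t w| / `|t - s| `^ ((size w)%:R * gamma) <= C].

End TruncatedTensors.

Section Derivatives.
Context {R : realType} {V U : normedModType R}.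

(* D^l f (x)(v_1, ..., v_l) for vs = [:: v_1; ...; v_l]. *)
Definition Dn (f : V -> U) (vs : seq V) : V -> U :=
  foldr (fun v h x => ('d h x : V -> U) v) f vs.

(* Continuity is required of each x |-> D^m f(x)(v_1, ..., v_m); V being finite
   dimensional in all uses, this is continuity of D^m f. *)
Fixpoint Ck (m : nat) (f : V -> U) : Prop :=
  match m with
  | 0 => continuous f
  | m'.+1 => (forall x, differentiable f x) /\
             (forall v, Ck m' (fun x => ('d f x : V -> U) v))
  end.

Definition Ckb (m : nat) (f : V -> U) : Prop :=
  Ck m f /\
  forall j, (j <= m)%N -> exists C : R, forall (x : V) (vs : seq V),
    size vs = j -> `|Dn f vs x| <= C * \prod_(v <- vs) `|v|.

End Derivatives.

Definition Ck_diffeo {R : realType} {V : normedModType R} (m : nat)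
    (phi : V -> V) : Prop :=
  exists psi : V -> V,
    [/\ cancel phi psi, cancel psi phi, Ck m phi & Ck m psi].

Definition hoelder {R : realType} {V : normedModType R} (gamma a b : R)
    (x : R -> V) : Prop :=
  exists C : R, forall s t, a <= s <= b -> a <= t <= b ->
    `|x t - x s| <= C * `|t - s| `^ gamma.

(* Coefficient of the word w in phi composed with the family z; it is both the
   e_w^*-coefficient of the lift of phi and the right-hand side of the equation
   for the partial derivative of index w.  A tuple (u_1, ..., u_k) is counted
   once for each occurrence of w in the shuffle product of u_1, ..., u_k: for
   w = (a, a), k = 2 and u_1 = u_2 = (a) the product is 2 (a, a), and 1/2! must
   be compensated by this 2 for the formula to be the chain rule. *)
Definition faa_di_bruno {R : realType} {q N : nat} {V U : normedModType R}
    (phi : V -> U) (z : tens q N V) (w : seq 'I_q) : U :=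
  if nilp w then phi (z [bseq]) else
  \sum_(1 <= k < (size w).+1) (k`!%:R)^-1 *:
    \sum_(us : k.-tuple (N.-bseq 'I_q) |
            all (fun u : N.-bseq 'I_q => ~~ nilp u) us &&
            (w \in shuffles [seq bseqval u | u <- us]))
      (count_mem w (shuffles [seq bseqval u | u <- us]))%:R *:
        Dn phi [seq z u | u <- us] (z [bseq]).

Definition comp_lift {R : realType} {d N : nat} {V U : normedModType R}
    (phi : V -> U) (X : R -> tens d N V) (t : R) : tens d N U :=
  [ffun w : N.-bseq 'I_d => faa_di_bruno phi (X t) w].

Section RoughEquations.
Context {R : realType} {d : nat} {gamma : R} {V : normedModType R}.
Variable W : R -> tens d (Ngam gamma) R.

Definition controlled (N : nat) (a b : R) (X : R -> tens d N.-1 V) : Prop :=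
  (forall w, hoelder gamma a b (fun t => X t w)) /\
  (forall w : N.-1.-bseq 'I_d, exists C : R,
     forall s t, a <= s -> s < t -> t <= b ->
     `|X t w - pairing (star (trunc N.-1 (incr W s t)) (basis w)) (X s)|
       <= C * (t - s) `^ ((N - size w)%:R * gamma)).

(* A partition a = t_0 < t_1 < ... < t_r = b is encoded, as in [itv_partition],
   by the sequence t_1, ..., t_r. *)
Definition intervals (a : R) (pi : seq R) : seq (R * R) := zip (a :: pi) pi.

Definition mesh (a : R) (pi : seq R) : R :=
  \big[Num.max/0]_(I <- intervals a pi) (I.2 - I.1).

Definition mesh_to_0 (a b : R) : set_system (seq R) :=
  filter_from [set e : R | 0 < e]
    (fun e => [set pi | itv_partition a b pi /\ mesh a pi < e]).

Definition riemann_sum (i : 'I_d) (Y : R -> tens d (Ngam gamma).-1 V) (a : R)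
    (pi : seq R) : V :=
  \sum_(I <- intervals a pi) \sum_(w : (Ngam gamma).-1.-bseq 'I_d)
    coef (incr W I.1 I.2) (rcons w i) *: Y I.1 w.

Definition rough_int (i : 'I_d) (Y : R -> tens d (Ngam gamma).-1 V) (a b : R) : V :=
  lim (riemann_sum i Y a @ mesh_to_0 a b).

Definition lifted_int (i : 'I_d) (Y : R -> tens d (Ngam gamma).-1 V) (a t : R) :
    tens d (Ngam gamma) V :=
  [ffun w : (Ngam gamma).-bseq 'I_d =>
    if nilp w then rough_int i Y a t else
    \sum_(v : (Ngam gamma).-1.-bseq 'I_d | rcons v i == w :> seq 'I_d) Y t v].

Variable f : 'I_d -> V -> V.

Fixpoint Fw (w : seq 'I_d) : V -> V :=
  match w with
  | [::] => id
  | i :: w' => fun x => ('d (Fw w') x : V -> V) (f i x)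
  end.

Definition rde_lifted_solution (a T : R) (X : R -> tens d (Ngam gamma).-1 V) : Prop :=
  [/\ controlled (N := Ngam gamma) a T X,
      forall w : (Ngam gamma).-1.-bseq 'I_d, X a w = Fw w (X a [bseq]) &
      forall s t, a <= s <= T -> a <= t <= T ->
        X t - X s =
        trunc (Ngam gamma).-1
          (\sum_i (lifted_int i (comp_lift (f i) X) a t -
                   lifted_int i (comp_lift (f i) X) a s))].

(* dX = sum_i f_i(X) dW^i on [a, T], for a path X in the state space. *)
Definition rde_solution (a T : R) (X : R -> V) : Prop :=
  exists2 Z : R -> tens d (Ngam gamma).-1 V, rde_lifted_solution a T Z &
    forall t, a <= t <= T -> Z t [bseq] = X t.

(* The same, the solution being regarded as a controlled path one level up. *)
Definition rde_controlled_solution (a T : R) (X : R -> tens d (Ngam gamma) V) : Prop :=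
  [/\ controlled (N := (Ngam gamma).+1) a T X,
      rde_lifted_solution a T (fun t => trunc (Ngam gamma).-1 (X t)) &
      forall t (w : (Ngam gamma).-bseq 'I_d), a <= t <= T ->
        X t w = Fw w (X t [bseq])].

End RoughEquations.

Section DerivativeSystem.
Context {R : realType} {n : nat}.

Definition partial (alpha : seq 'I_n) (phi : 'rV[R]_n -> 'rV[R]_n) :
    'rV[R]_n -> 'rV[R]_n :=
  Dn phi [seq delta_mx 0 j | j <- alpha].

(* A family (y_alpha) of vectors of R^n indexed by the words of length at most
   m is stored as the matrix whose rows are the y_alpha. *)
Notation jets m := 'M[R]_(#|{: m.-bseq 'I_n}|, n).

Definition jet_row {m : nat} (Y : jets m) : tens n m 'rV[R]_n :=
  [ffun alpha => row (enum_rank alpha) Y].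

Definition jet {m : nat} (y : m.-bseq 'I_n -> 'rV[R]_n) : jets m :=
  \matrix_(r, c) y (enum_val r) 0 c.

(* The vector field driving (X, (partial^alpha X)_alpha) along W^i. *)
Definition jet_field {d : nat} (m : nat) (f : 'I_d -> 'rV[R]_n -> 'rV[R]_n)
    (i : 'I_d) (Y : jets m) : jets m :=
  jet (fun alpha => faa_di_bruno (f i) (jet_row Y) alpha).

End DerivativeSystem.

(* Main.v *)
Require Import Defs.
From HB Require Import structures.
From mathcomp Require Import all_boot all_order all_algebra.
From mathcomp Require Import all_classical all_reals all_analysis.
From mathcomp Require Import ring lra.

Import Order.TTheory GRing.Theory Num.Theory.
Import numFieldNormedType.Exports.

Set Implicit Arguments.
Unset Strict Implicit.
Unset Printing Implicit Defensive.

Local Open Scope classical_set_scope.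
Local Open Scope ring_scope.

(** Write [W_st] for the increments of the rough path and consider the one-step map
  [mu s t x = \sum_(size w <= N) W_st w *: F_w x]. The shuffle relations turn the
  Faa di Bruno formula into a Taylor expansion of [g (mu s t x)] along words, so that
  [mu u t \o mu s u] and [mu s t] differ by [O(|t - s|^((N+1)gamma))], with an exponent
  larger than 1: compositions of one-step maps along finer and finer partitions
  converge to a flow [phi]. A path solves the equation if and only if it satisfies
  Davie's expansion [|Y_t - mu s t Y_s| <= C |t - s|^((N+1)gamma)], and a path with
  this expansion is a trajectory of [phi]; this gives existence and uniqueness, and,
  applied to the time-reversed rough path, an inverse of the flow.

  The words [F_w] of the tangent fields [(x, v) |-> (f_i x, Df_i(x) v)] are the tangent
  maps of the [F_w], hence the one-step maps of the tangent equation are the tangent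
  maps of the [mu s t]. Convergence of the tangent schemes, which is proved without
  global bounds on the tangent fields, makes [phi] differentiable with the tangent flow
  as its tangent map; iterating, [phi] is of class C^(k+1) and its iterated
  tangent maps are flows. A jet of order [m] is recorded by its images in
  the m-fold tangent spaces, where the jet field becomes the iterated tangent
  field: so the jets of [phi] satisfy Davie's expansion for the jet field. *)

(** The obstacle is that tangent fields are linear, hence unbounded, in the fibre variable, so the
    convergence argument for bounded fields cannot be repeated for them. The class [good] of
    one-step maps is therefore defined by properties on balls only: fine schemes started in a ball
    stay bounded, stay close to the one-step map over short intervals, and are Cauchy under
    refinement. Bounded fields give such maps, and the class is closed under passage to tangent
    maps, where boundedness in the fibre comes from linearity.

    Derivatives are counted as follows. [F_w] with |w| <= N contains N - 1 derivatives of the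
    fields, Taylor's formula takes one more, and the Lipschitz dependence of the derivative of a
    one-step map on the base point another. A passage to the tangent flow thus requires N + 1
    derivatives of the current fields and leaves fields with one derivative less, so that N + 1 + k
    derivatives allow k + 1 passages. *)

Section LinearExpressions.
Context {R : comRingType} {V : lmodType R}.

(** Reified linear combinations for the tactic [lmod]; an atom is an index into the list of subterms
    that are not themselves sums, opposites or multiples. *)
Inductive lexpr :=
  | LZero | LAtom of nat | LAdd of lexpr & lexpr | LOpp of lexpr
  | LScale of R & lexpr.

Fixpoint leval (env : seq V) (e : lexpr) : V :=
  match e with
  | LZero => 0
  | LAtom i => nth 0 env i
  | LAdd e1 e2 => leval env e1 + leval env e2
  | LOpp e1 => - leval env e1
  | LScale a e1 => a *: leval env e1
  end.

(** [eqn] is used instead of [==] so that [cbn] computes the comparison of two numerals and leaves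
    identities between scalars to [ring]. *)
Fixpoint lcoef (i : nat) (e : lexpr) : R :=
  match e with
  | LZero => 0
  | LAtom j => if eqn i j then 1 else 0
  | LAdd e1 e2 => lcoef i e1 + lcoef i e2
  | LOpp e1 => - lcoef i e1
  | LScale a e1 => a * lcoef i e1
  end.

Fixpoint same_coefs (n : nat) (e1 e2 : lexpr) : Prop :=
  if n is i.+1 then lcoef i e1 = lcoef i e2 /\ same_coefs i e1 e2 else True.

Lemma levalE env e : leval env e = \sum_(i < size env) lcoef i e *: nth 0 env i.
Proof.
elim: e => [|j|e1 IH1 e2 IH2|e IH|a e IH] /=.
- by rewrite big1// => i _; rewrite scale0r.
- under eq_bigr do rewrite -[eqn _ _]/(_ == _).
  have [js|js] := ltnP j (size env).
    rewrite (bigD1 (Ordinal js))//= eqxx scale1r big1 ?addr0// => i.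
    by rewrite -val_eqE /= => /negPf ->; rewrite scale0r.
  rewrite nth_default// big1// => i _.
  by rewrite (ltn_eqF (leq_trans (ltn_ord i) js)) scale0r.
- by rewrite IH1 IH2 -big_split; apply: eq_bigr => i _; rewrite scalerDl.
- by rewrite IH -sumrN; apply: eq_bigr => i _; rewrite scaleNr.
- by rewrite IH scaler_sumr; apply: eq_bigr => i _; rewrite scalerA.
Qed.

Lemma leval_eq env e1 e2 : same_coefs (size env) e1 e2 -> leval env e1 = leval env e2.
Proof.
rewrite !levalE => h; apply: eq_bigr => i _; congr (_ *: _).
case: i => i /=; elim: (size env) h => //= n IH [h1 h2].
by rewrite ltnS leq_eqVlt => /predU1P[->//|/IH]; apply.
Qed.

End LinearExpressions.

Ltac lmod_index x env :=
  lazymatch env with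
  | cons ?y ?t => lazymatch x with
                  | y => constr:(O)
                  | _ => let n := lmod_index x t in constr:(S n)
                  end
  end.
Ltac lmod_member x env :=
  lazymatch env with
  | nil => constr:(false)
  | cons ?y ?t => lazymatch x with y => constr:(true) | _ => lmod_member x t end
  end.
Ltac lmod_atoms t env :=
  lazymatch t with
  | 0%R => env
  | (?a + ?b)%R => let env := lmod_atoms a env in lmod_atoms b env
  | (- ?a)%R => lmod_atoms a env
  | (?k *: ?a)%R => lmod_atoms a env
  | _ => lazymatch lmod_member t env with
         | true => env
         | false => constr:(cons t env)
         end
  end.
Ltac lmod_quote t env :=
  lazymatch t with
  | 0%R => uconstr:(LZero)
  | (?a + ?b)%R => let x := lmod_quote a env in let y := lmod_quote b env in
                   uconstr:(LAdd x y)
  | (- ?a)%R => let x := lmod_quote a env in uconstr:(LOpp x)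
  | (?k *: ?a)%R => let x := lmod_quote a env in uconstr:(LScale k x)
  | _ => let n := lmod_index t env in uconstr:(LAtom n)
  end.
(* [ring] for modules: proves an equality of linear combinations by comparing the
   coefficients of each (syntactically recognized) atom. *)
Ltac lmod :=
  lazymatch goal with
  | |- @eq ?V ?a ?b =>
    let env := lmod_atoms a (@nil V) in
    let env := lmod_atoms b env in
    let x := lmod_quote a env in
    let y := lmod_quote b env in
    refine (@leval_eq _ _ env x y _);
    cbn [same_coefs lcoef size eqn];
    repeat (apply: conj); try exact: I; try ring
  end.

(** * Calculus in finite-dimensional normed spaces *)

Section FrechetDerivative.
Context {R : realType}.
Implicit Types V W U : normedModType R.

(** The candidate derivative is a bare function: linearity and the bound make it a continuous linear
    map, and [diff_unique] then identifies it with the differential. *)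
Lemma is_diff_eps V W (f L : V -> W) (x : V) : linear L ->
    (exists C, forall h, `|L h| <= C * `|h|) ->
    (forall e, 0 < e -> exists2 d, 0 < d &
       forall h, `|h| < d -> `|f (x + h) - f x - L h| <= e * `|h|) ->
  is_diff x f L.
Proof.
move=> linL [C hC] hf.
pose L' : {linear V -> W} := HB.pack L (GRing.isLinear.Build R V W *:%R L linL).
have cL : continuous L'.
  apply/linear_bounded_continuous/linear_boundedP; near=> r => h.
  have : C <= r by near: r; apply: nbhs_pinfty_ge; rewrite num_real.
  by move=> /(ler_wpM2r (normr_ge0 h)); apply: le_trans; exact: hC.
have key : f \o shift x = cst (f x) + (L' : V -> W) +o_ 0 id.
  apply/eqaddoP => e e0; have [d d0 hd] := hf _ e0.
  apply/nbhs_normP; exists d => // h /=.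
  rewrite sub0r normrN => /hd; rewrite !fctE /= (addrC h).
  by rewrite opprD addrA.
have dL := diff_unique cL key.
split; last exact: dL.
by apply/diff_locallyP; rewrite dL.
Unshelve. all: by end_near. Qed.

Lemma diff_eps V W (f : V -> W) (x : V) : differentiable f x ->
  forall e, 0 < e -> exists2 d, 0 < d &
       forall h, `|h| < d -> `|f (x + h) - f x - 'd f x h| <= e * `|h|.
Proof.
move=> /diff_locallyP[_ /eqaddoP hf] e e0; have /nbhs_normP[d /= d0 hd] := hf _ e0.
exists d => // h hh; have := hd h; rewrite /= sub0r normrN => /(_ hh).
by rewrite !fctE /= (addrC h) opprD addrA.
Qed.

Lemma is_diff_lin V W (L : V -> W) x : linear L ->
    (exists C, forall h, `|L h| <= C * `|h|) -> is_diff x L L.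
Proof.
move=> linL hL; apply: is_diff_eps => // e e0; exists 1 => // h _.
have LD : L (x + h) = L x + L h by have := linL 1 x h; rewrite !scale1r.
have -> : L (x + h) - L x - L h = 0 by rewrite LD; lmod.
by rewrite normr0 mulr_ge0// ltW.
Qed.

Lemma is_diff_eval V W (f : V -> W) (df : V -> W) x v : is_diff x f df ->
  'd f x v = df v.
Proof. by move=> h; rewrite diff_val. Qed.

Lemma diff_sum_eval V W (I : Type) (r : seq I) (P : pred I) (F : I -> V -> W) x :
    (forall i, differentiable (F i) x) ->
  is_diff x (fun y => \sum_(i <- r | P i) F i y) (fun v => \sum_(i <- r | P i) 'd (F i) x v).
Proof.
move=> dF; elim: r => [|i r IH].
  have -> : (fun y => \sum_(i <- [::] | P i) F i y) = cst 0.
    by apply/funext => y; rewrite big_nil.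
  by apply: is_diff_eq; apply/funext => v; rewrite big_nil.
have -> : (fun y => \sum_(j <- i :: r | P j) F j y) =
    (if P i then F i else cst 0) + (fun y => \sum_(j <- r | P j) F j y).
  by apply/funext => y; rewrite big_cons fctE; case: ifP => // _; rewrite fctE add0r.
have dFi : is_diff x (if P i then F i else cst 0) (if P i then ('d (F i) x : V -> W) else 0).
  by case: ifP => _; [apply/differentiableP/dF|apply: is_diff_cst].
apply: is_diff_eq; apply/funext => v; rewrite big_cons -[LHS]/(_ v + _ v).
by case: ifP => // _; exact: add0r.
Qed.

Lemma is_diffZv V W (c dc : V -> R) (g dg : V -> W) x :
    is_diff x c dc -> is_diff x g dg ->
  is_diff x (fun y => c y *: g y) (fun v => dc v *: g x + c x *: dg v).
Proof.
move=> hc hg.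
have Ec : 'd c x = dc :> (V -> R) by exact: diff_val.
have Eg : 'd g x = dg :> (V -> W) by exact: diff_val.
have lc a u v : dc (a *: u + v) = a * dc u + dc v.
  by rewrite -Ec; exact: linearP.
have lg a u v : dg (a *: u + v) = a *: dg u + dg v.
  by rewrite -Eg; exact: linearP.
have [C1 C10 hC1] : exists2 k, k > 0 & forall v, `|dc v| <= k * `|v|.
  rewrite -Ec.
  exact/linear_lipschitz/diff_continuous.
have [C2 C20 hC2] : exists2 k, k > 0 & forall v, `|dg v| <= k * `|v|.
  rewrite -Eg.
  exact/linear_lipschitz/diff_continuous.
apply: is_diff_eps.
- by move=> a u v; rewrite lc lg; lmod.
- exists (C1 * `|g x| + `|c x| * C2) => h; apply: (le_trans (ler_normD _ _)).
  rewrite !normrZ mulrDl lerD// ?mulrA; last by rewrite -mulrA ler_wpM2l.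
  by rewrite mulrAC ler_wpM2r.
move=> e e0.
have gcont : exists2 d, 0 < d & forall h, `|h| < d -> `|g (x + h) - g x| <= (C2 + 1) * `|h|.
  have [d d0 hd] := diff_eps (@ex_diff _ _ _ _ _ _ _ hg) ltr01.
  exists d => // h /hd; rewrite Eg mul1r => hh.
  rewrite -(subrK (dg h) (g (x + h) - g x)) (le_trans (ler_normD _ _))//.
  by rewrite mulrDl addrC lerD// mul1r.
have [d0 d00 hd0] := gcont.
pose M := `|g x| + (C2 + 1).
have M0 : 0 < M by rewrite /M ltr_wpDl// addr_gt0.
have e3 : 0 < e / 3 by rewrite divr_gt0.
have [d1 d10 hd1] := diff_eps (@ex_diff _ _ _ _ _ _ _ hc) (divr_gt0 e3 M0).
have [d2 d20 hd2] := diff_eps (@ex_diff _ _ _ _ _ _ _ hg) (divr_gt0 e3 (ltr_wpDl (normr_ge0 (c x)) ltr01)).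
pose d3 := e / 3 / (C1 * (C2 + 1)).
have C2p : 0 < C2 + 1 by rewrite addr_gt0.
have d30 : 0 < d3 by rewrite /d3 divr_gt0// mulr_gt0.
exists (Num.min (Num.min d0 d1) (Num.min d2 (Num.min d3 1))).
  by rewrite !lt_min d00 d10 d20 d30 ltr01.
move=> h; rewrite !lt_min => /andP[/andP[h0 h1] /andP[h2 /andP[h3 h4]]].
have := hd0 _ h0; have := hd1 _ h1; have := hd2 _ h2; rewrite Ec Eg => E2 E1 E0.
(* The remainder is the error of [c], a product of two first-order increments, and the error of [g];
   the choice of radii makes each at most e / 3 times the norm of [h]. *)
have -> : c (x + h) *: g (x + h) - c x *: g x - (dc h *: g x + c x *: dg h) =
   (c (x + h) - c x - dc h) *: g (x + h) + dc h *: (g (x + h) - g x) +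
   c x *: (g (x + h) - g x - dg h).
  by lmod.
apply: (le_trans (ler_normD _ _)); apply: (le_trans (lerD (ler_normD _ _) (lexx _))).
rewrite !normrZ.
have h0' : 0 <= `|h| by [].
have t1 : `|c (x + h) - c x - dc h| * `|g (x + h)| <= e / 3 * `|h|.
  have gM : `|g (x + h)| <= M.
    rewrite -(subrK (g x) (g (x + h))) addrC (le_trans (ler_normD _ _))// /M lerD2l.
    by rewrite (le_trans E0)// ler_piMr// ltW.
  apply: (le_trans (ler_pM _ _ E1 gM)) => //.
  by rewrite mulrAC divfK// gt_eqF.
have t2 : `|dc h| * `|g (x + h) - g x| <= e / 3 * `|h|.
  apply: (le_trans (ler_pM _ _ (hC1 h) E0)) => //.
  rewrite mulrA ler_wpM2r// mulrAC mulrC -ler_pdivlMr ?mulr_gt0//.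
  exact: ltW.
have t3 : `|c x| * `|g (x + h) - g x - dg h| <= e / 3 * `|h|.
  apply: (le_trans (ler_wpM2l _ E2)) => //.
  rewrite mulrA ler_wpM2r// mulrCA ler_piMr// ?(ltW e3)//.
  by rewrite ler_pdivrMr ?mul1r ?lerDl// ltr_wpDl.
have -> : e * `|h| = e / 3 * `|h| + e / 3 * `|h| + e / 3 * `|h| by lra.
by rewrite !lerD.
Qed.

Lemma is_diff_compc V W U (f df : V -> W) (L : W -> U) x :
    linear L -> (exists C, forall h, `|L h| <= C * `|h|) ->
  is_diff x f df -> is_diff x (L \o f) (L \o df).
Proof. by move=> lL cL hf; have := is_diff_lin (f x) lL cL; move=> ?; exact: is_diff_comp. Qed.

(** Finite dimension is presented by vectors with bounded linear coefficient functions. This form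
    passes to products and matrices, and reduces vector-valued mean value, completeness and
    continuity arguments to real ones. *)
Definition findim V := exists m (e : 'I_m -> V) (c : 'I_m -> V -> R),
  [/\ forall i, linear (c i : V -> R^o),
      forall i, exists C, forall v, `|c i v| <= C * `|v| &
      forall v, v = \sum_i c i v *: e i].

Lemma findim_coord_bound V m (c : 'I_m -> V -> R) :
    (forall i, exists C, forall v, `|c i v| <= C * `|v|) ->
  exists2 C, 0 <= C & forall i v, `|c i v| <= C * `|v|.
Proof.
move=> hc; pose C i := xget 0 [set C | forall v, `|c i v| <= C * `|v|].
have CP i v : `|c i v| <= C i * `|v| by have [C' hC'] := hc i; exact: (xgetI (P := [set C | forall v, `|c i v| <= C * `|v|]) 0 hC').
exists (\sum_i `|C i|); first exact: sumr_ge0.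
move=> i v; apply: (le_trans (CP i v)); rewrite ler_wpM2r// (bigD1 i)//=.
by rewrite (le_trans (ler_norm _))// lerDl sumr_ge0.
Qed.

Lemma findim_prod V W : findim V -> findim W -> findim (V * W)%type.
Proof.
move=> [m [e [c [lc bc ec]]]] [m' [e' [c' [lc' bc' ec']]]].
exists (m + m')%N, (fun i : 'I_(m + m') => match fintype.split i with inl j => (e j, 0) | inr j => (0, e' j) end).
exists (fun (i : 'I_(m + m')) (v : V * W) => match fintype.split i with inl j => c j v.1 | inr j => c' j v.2 end); split.
- by move=> i a u v; case: (fintype.split i) => j; rewrite ?lc ?lc'.
- move=> i; case: (fintype.split i) => j.
    have [C hC] := bc j; exists `|C| => v; rewrite (le_trans (hC _))//.
    by rewrite (le_trans (ler_wpM2r _ (ler_norm C)))// ler_wpM2l// prod_normE le_max lexx.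
  have [C hC] := bc' j; exists `|C| => v; rewrite (le_trans (hC _))//.
  by rewrite (le_trans (ler_wpM2r _ (ler_norm C)))// ler_wpM2l// prod_normE le_max lexx orbT.
move=> [v w]; rewrite big_split_ord /=.
under eq_bigr do rewrite (unsplitK (inl _)).
under [X in _ + X]eq_bigr do rewrite (unsplitK (inr _)).
rewrite [LHS](_ : _ = (v, 0) + (0, w)); last by congr pair; rewrite ?addr0 ?add0r.
congr (_ + _); apply: injective_projections => /=.
- rewrite (big_morph (fun x : V * W => x.1) (id1 := 0) (op1 := +%R))//.
- rewrite (big_morph (fun x : V * W => x.2) (id1 := 0) (op1 := +%R))//.
  by rewrite big1// => i _ /=; rewrite scaler0.
- rewrite (big_morph (fun x : V * W => x.1) (id1 := 0) (op1 := +%R))//.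
  by rewrite big1// => i _ /=; rewrite scaler0.
- by rewrite (big_morph (fun x : V * W => x.2) (id1 := 0) (op1 := +%R)).
Qed.

Lemma coord_le_mx_norm p q (M : 'M[R]_(p, q)) i j : `|M i j| <= `|M|.
Proof.
rewrite -[leRHS]/(mx_norm M) mx_normrE.
exact: (le_bigmax 0 (fun ij : 'I_p * 'I_q => `|M ij.1 ij.2|) (i, j)).
Qed.

Lemma mx_norm_le p q (M : 'M[R]_(p, q)) C : 0 <= C ->
  (forall i j, `|M i j| <= C) -> `|M| <= C.
Proof. by move=> C0 h; rewrite -[leLHS]/(mx_norm M) mx_normrE; apply: bigmax_le => // ij _. Qed.

Lemma findim_mx p q : findim 'M[R]_(p, q).
Proof.
exists (#|{: 'I_p * 'I_q}|)%N, (fun i => delta_mx (enum_val i).1 (enum_val i).2).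
exists (fun i (M : 'M[R]_(p, q)) => M (enum_val i).1 (enum_val i).2); split.
- by move=> i a u v; rewrite !mxE.
- by move=> i; exists 1 => M; rewrite mul1r; exact: coord_le_mx_norm.
move=> M; rewrite [LHS]matrix_sum_delta pair_big /=.
by rewrite (reindex (enum_val (A := predT)))//; exact/onW_bij/enum_val_bij.
Qed.

Lemma is_derive_line W (g : W -> R) (x D : W) (t : R) : differentiable g (x + t *: D) ->
  is_derive t 1 (fun r : R => g (x + r *: D)) ('d g (x + t *: D) D).
Proof.
move=> dg; have dl : is_diff t (fun r : R => x + r *: D) (fun r : R => r *: D).
  have h1 : is_diff t (fun r : R => r *: D) (fun r : R => r *: D).
    exact: is_diff_scalel.
  by apply: is_diff_eq; rewrite add0r.
have hc : is_diff t (fun r : R => g (x + r *: D)) (fun r => 'd g (x + t *: D) (r *: D)).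
  have hg : is_diff (x + t *: D) g ('d g (x + t *: D)) by apply/differentiableP.
  exact: (is_diff_comp (f := fun r : R => x + r *: D)).
apply: DeriveDef; first exact/diff_derivable/ex_diff.
by rewrite deriveE ?diff_val ?scale1r//; exact: ex_diff.
Qed.

(** The one-variable mean value theorem is used coordinate by coordinate. This is the origin of [K],
    which depends on the coordinates of [V] and not on [g]. *)
Lemma mean_value_ineq V : findim V -> exists2 K, 0 <= K & forall W (g : W -> V) (x D : W) B,
  (forall y, differentiable g y) ->
  (forall t, 0 <= t <= 1 -> `|'d g (x + t *: D) D| <= B) ->
  `|g (x + D) - g x| <= K * B.
Proof.
move=> [m [e [c [lc bc ec]]]]; have [C C0 hC] := findim_coord_bound bc.
exists (\sum_i C * `|e i|); first by apply: sumr_ge0 => i _; rewrite mulr_ge0.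
move=> W g x D B dg hB; rewrite [X in `|X|]ec (le_trans (ler_norm_sum _ _ _))//.
rewrite mulr_suml; apply: ler_sum => i _; rewrite normrZ mulrAC ler_wpM2r//.
have ci_sub u v : c i (u - v) = c i u - c i v.
  by have := lc i (-1) v u; rewrite !scaleN1r [- v + u]addrC [- c i v + _]addrC.
rewrite ci_sub; pose h (r : R) := c i (g (x + r *: D)).
have dh (t : R) : is_derive t 1 h (c i ('d g (x + t *: D) D)).
  have hg : is_diff (x + t *: D) (c i \o g) (c i \o 'd g (x + t *: D)).
    exact: (is_diff_compc (lc i) (bc i) (differentiableP (dg _))).
  have := is_derive_line (g := c i \o g) (@ex_diff _ _ _ _ _ _ _ hg).
  by rewrite (is_diff_eval _ hg).
have [t t01] : exists2 t, t \in `]0, 1[%R & h 1 - h 0 = c i ('d g (x + t *: D) D) * (1 - 0).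
  apply: (@MVT _ h (fun t => c i ('d g (x + t *: D) D)) 0 1 ltr01).
  apply: derivable_within_continuous => t _; exact: (@ex_derive _ _ _ _ _ _ _ (dh t)).
rewrite /h scale1r scale0r addr0 subr0 mulr1 => ->.
apply: (le_trans (hC _ _)); rewrite ler_wpM2l// hB//.
by move: t01; rewrite in_itv /= => /andP[/ltW -> /ltW ->].
Qed.
End FrechetDerivative.

(** * Regularity classes with bounds on a set *)

Section Regularity.
Context {R : realType}.
Implicit Types V W U : normedModType R.

Definition dird V W (g : V -> W) (v : V) : V -> W := fun x => 'd g x v.

Definition bounded_onto V W (B : set V) (g : V -> W) :=
  exists C, forall x, B x -> `|g x| <= C.

(* Bounds on [B] are asked direction by direction; in finite dimension they are
   uniform in the directions ([reg_Dn_bound]). *)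
Fixpoint reg V W (m : nat) (B : set V) (g : V -> W) : Prop :=
  match m with
  | 0 => continuous g /\ bounded_onto B g
  | m'.+1 => [/\ forall x, differentiable g x, bounded_onto B g &
               forall v, reg m' B (dird g v)]
  end.

Lemma reg_bounded V W m B (g : V -> W) : reg m B g -> bounded_onto B g.
Proof. by case: m => [[]|m []]. Qed.

Lemma reg_continuous V W m B (g : V -> W) : reg m B g -> continuous g.
Proof. by case: m => [[]|m [dg _ _]] // x; exact/differentiable_continuous. Qed.

Lemma reg_diff V W m B (g : V -> W) x : (0 < m)%N -> reg m B g -> differentiable g x.
Proof. by case: m => // m _ []. Qed.

Lemma regW V W m m' B (g : V -> W) : (m' <= m)%N -> reg m B g -> reg m' B g.
Proof.
elim: m m' g => [|m IH] [|m'] g // mm' hg.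
  by split; [exact: reg_continuous hg|exact: reg_bounded hg].
by case: hg => h1 h2 h3; split => // v; exact: IH (h3 v).
Qed.

Lemma reg_sub V W m (B B' : set V) (g : V -> W) : B' `<=` B -> reg m B g -> reg m B' g.
Proof.
move=> BB; have bB (h : V -> W) : bounded_onto B h -> bounded_onto B' h.
  by move=> [C hC]; exists C => x /BB; exact: hC.
elim: m g => [|m IH] g /=; first by case=> ? /bB.
by case=> ? /bB ? h; split => // v; exact: IH (h v).
Qed.

Lemma reg_Ck V W m (B : set V) (g : V -> W) : reg m B g -> Ck m g.
Proof.
elim: m g => [|m IH] g /=; first by case.
by case=> ? _ h; split => // v; exact: IH (h v).
Qed.

(** On the empty set the bounds are void, so [reg m set0] expresses [Ck m]; the calculus of [reg]
    serves both notions at once. *)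
Lemma Ck_reg V W m (g : V -> W) : Ck m g -> reg m set0 g.
Proof.
elim: m g => [|m IH] g /= => [cg|[dg hg]]; split => //; try by exists 0.
by move=> v; exact/IH/hg.
Qed.

Lemma CkW V W m m' (g : V -> W) : (m' <= m)%N -> Ck m g -> Ck m' g.
Proof. by move=> mm' /Ck_reg/(regW mm')/reg_Ck. Qed.

(** The last vector of the list is the direction of the first differentiation, so [Dn] is unfolded
    from the right and inductions on directions use [last_ind]. *)
Lemma Dn_rcons V W (g : V -> W) vs v : Dn g (rcons vs v) = Dn (dird g v) vs.
Proof. by rewrite /Dn foldr_rcons. Qed.

Lemma Dn_cat V W (g : V -> W) us vs : Dn g (us ++ vs) = Dn (Dn g vs) us.
Proof. by rewrite /Dn foldr_cat. Qed.

Lemma Ckb_reg V W m (g : V -> W) : Ckb m g -> reg m setT g.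
Proof.
move=> [cg bg].
have : forall j, (j <= m)%N -> forall vs, size vs = j -> bounded_onto setT (Dn g vs).
  move=> j /bg[C hC] vs vsj; exists (C * \prod_(v <- vs) `|v|) => x _; exact: hC.
elim: m g cg {bg} => [|m IH] g.
  by move=> cg bg; split => //; exact: (bg 0%N _ [::]).
move=> [dg cg] bg; split => //; first exact: (bg 0%N _ [::]).
move=> v; apply: (IH _ (cg v)) => j jm vs vsj.
by rewrite -Dn_rcons; apply: (bg j.+1); rewrite ?size_rcons ?vsj.
Qed.

Lemma bounded_ontoD V W (B : set V) (f g : V -> W) :
  bounded_onto B f -> bounded_onto B g -> bounded_onto B (fun x => f x + g x).
Proof.
move=> [C hC] [C' hC']; exists (C + C') => x Bx.
by rewrite (le_trans (ler_normD _ _))// lerD// ?hC ?hC'.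
Qed.

Lemma regD V W m (B : set V) (f g : V -> W) :
  reg m B f -> reg m B g -> reg m B (fun x => f x + g x).
Proof.
elim: m f g => [|m IH] f g /=.
  move=> [cf bf] [cg bg]; split; last exact: bounded_ontoD.
  by move=> x; apply: cvgD; [exact: cf|exact: cg].
move=> [df bf hf] [dg bg hg]; split; last first.
- move=> v; rewrite (_ : dird _ _ = fun x => dird f v x + dird g v x); first exact: IH.
  by apply/funext => x; rewrite /dird -[LHS]/('d (f + g) x v) diffD.
- exact: bounded_ontoD.
by move=> x; exact: differentiableD.
Qed.

Lemma reg_cst V W m (B : set V) (a : W) : reg m B (fun=> a).
Proof.
have b (k : W) : bounded_onto B (fun=> k) by exists `|k|.
elim: m a => [|m IH] a /=; first by split => // x; exact: cvg_cst.
split => // v; rewrite (_ : dird _ _ = fun=> 0) //.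
by apply/funext => x; rewrite /dird -[LHS]/('d (cst a) x v) diff_cst.
Qed.

Lemma reg_sum V W m (B : set V) (I : Type) (r : seq I) (P : pred I) (F : I -> V -> W) :
  (forall i, P i -> reg m B (F i)) -> reg m B (fun x => \sum_(i <- r | P i) F i x).
Proof.
move=> hF; elim: r => [|i r IH].
  rewrite (_ : (fun x => _) = fun=> 0); first exact: reg_cst.
  by apply/funext => x; rewrite big_nil.
case Pi : (P i).
  rewrite (_ : (fun x => _) = fun x => F i x + \sum_(j <- r | P j) F j x).
    by apply: regD => //; exact: hF.
  by apply/funext => x; rewrite big_cons Pi.
by rewrite (_ : (fun x => _) = fun x => \sum_(j <- r | P j) F j x)//; apply/funext => x; rewrite big_cons Pi.
Qed.

Lemma regZ V W m (B : set V) (c : V -> R) (g : V -> W) :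
  reg m B c -> reg m B g -> reg m B (fun x => c x *: g x).
Proof.
have bZ (c' : V -> R) (g' : V -> W) : bounded_onto B c' -> bounded_onto B g' ->
    bounded_onto B (fun x => c' x *: g' x).
  move=> [C hC] [C' hC']; exists (C * C') => x Bx.
  by rewrite normrZ ler_pM// ?hC ?hC'.
elim: m c g => [|m IH] c g /=.
  move=> [cc bc] [cg bg]; split; last exact: bZ.
  by move=> x; apply: cvgZ; [exact: cc|exact: cg].
move=> hc hg; have [[dc bc c'] [dg bg g']] := (hc, hg); split; last first.
- move=> v; rewrite (_ : dird _ _ = fun x => dird c v x *: g x + c x *: dird g v x).
    apply: regD; apply: IH => //.
      exact: (regW (leqnSn m) (hg : reg m.+1 B g)).
    exact: (regW (leqnSn m) (hc : reg m.+1 B c)).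
  apply/funext => x; rewrite /dird.
  exact: (is_diff_eval _ (is_diffZv (differentiableP (dc x)) (differentiableP (dg x)))).
- exact: bZ.
move=> x; exact: (@ex_diff _ _ _ _ _ _ _ (is_diffZv (differentiableP (dc x)) (differentiableP (dg x)))).
Qed.

Lemma reg_postlin V W U m (B : set V) (L : W -> U) (g : V -> W) : linear L ->
    (exists C, forall h, `|L h| <= C * `|h|) ->
  reg m B g -> reg m B (L \o g).
Proof.
move=> lL cL; have bL (h : V -> W) : bounded_onto B h -> bounded_onto B (L \o h).
  move=> [C hC]; have [C' hC'] := cL; exists (`|C'| * C) => x Bx /=.
  rewrite (le_trans (hC' _))// (le_trans (ler_wpM2r _ (ler_norm C')))//.
  by rewrite ler_wpM2l// hC.
have dL x : differentiable L x by have h := is_diff_lin x lL cL; exact: ex_diff.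
elim: m g => [|m IH] g /=.
  move=> [cg bg]; split; last exact: bL.
  move=> x; apply: continuous_comp; first exact: cg.
  exact/differentiable_continuous/dL.
move=> [dg bg hg]; split; last first.
- move=> v; rewrite (_ : dird _ _ = L \o dird g v); first exact: IH.
  apply/funext => x; rewrite /dird.
  exact: (is_diff_eval _ (is_diff_compc lL cL (differentiableP (dg x)))).
- exact: bL.
by move=> x; apply: differentiable_comp.
Qed.

Lemma is_diff_affine V W (L : V -> W) b x : linear L ->
    (exists C, forall h, `|L h| <= C * `|h|) -> is_diff x (fun y => L y + b) L.
Proof.
move=> lL cL; have h := is_diff_lin x lL cL.
have : is_diff x (L + cst b) (L + 0) by apply: is_diffD.
by rewrite addr0.
Qed.

Lemma is_diff_preaffine V W U (L : V -> W) b (g : W -> U) x : linear L ->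
    (exists C, forall h, `|L h| <= C * `|h|) -> differentiable g (L x + b) ->
  is_diff x (fun y => g (L y + b)) (fun v => 'd g (L x + b) (L v)).
Proof.
move=> lL cL dg; have h1 := is_diff_affine b x lL cL.
have h2 : is_diff (L x + b) g ('d g (L x + b)) by exact/differentiableP.
exact: (is_diff_comp (f := fun y => L y + b)).
Qed.

Lemma reg_preaffine V W U m (B : set V) (B' : set W) (L : V -> W) b (g : W -> U) :
    linear L -> (exists C, forall h, `|L h| <= C * `|h|) ->
    (forall x, B x -> B' (L x + b)) ->
  reg m B' g -> reg m B (fun x => g (L x + b)).
Proof.
move=> lL cL hB; have bL (h : W -> U) : bounded_onto B' h ->
    bounded_onto B (fun x => h (L x + b)).
  by move=> [C hC]; exists C => x /hB; exact: hC.
elim: m g => [|m IH] g /=.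
  move=> [cg bg]; split; last exact: bL.
  move=> x; apply: (continuous_comp (f := fun y => L y + b)); last exact: cg.
  have h := is_diff_affine b x lL cL.
  exact: (differentiable_continuous (@ex_diff _ _ _ _ _ _ _ h)).
move=> [dg bg hg]; split; last first.
- move=> v; rewrite (_ : dird _ _ = fun x => dird g (L v) (L x + b)); first exact: IH.
  by apply/funext => x; exact: (is_diff_eval _ (is_diff_preaffine lL cL (dg _))).
- exact: bL.
by move=> x; exact: (@ex_diff _ _ _ _ _ _ _ (is_diff_preaffine lL cL (dg (L x + b)))).
Qed.

Lemma reg_lin V W m (B : set V) (L : V -> W) : linear L ->
    (exists C, forall h, `|L h| <= C * `|h|) -> bounded_onto B L -> reg m B L.
Proof.
move=> lL cL bL; have dL x : differentiable L x.
  by have h := is_diff_lin x lL cL; exact: ex_diff.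
case: m => [|m] /=.
  by split => // x; exact/differentiable_continuous/dL.
split => // v; rewrite (_ : dird _ _ = fun=> L v); first exact: reg_cst.
by apply/funext => x; exact: (is_diff_eval _ (is_diff_lin x lL cL)).
Qed.

Lemma reg_pair V W U m (B : set V) (f : V -> W) (g : V -> U) :
  reg m B f -> reg m B g -> reg m B (fun x => (f x, g x)).
Proof.
have bp (f' : V -> W) (g' : V -> U) : bounded_onto B f' -> bounded_onto B g' ->
    bounded_onto B (fun x => (f' x, g' x)).
  move=> [C hC] [C' hC']; exists (Num.max C C') => x Bx.
  by rewrite prod_normE /= ge_max !le_max hC// hC'// orbT.
elim: m f g => [|m IH] f g /=.
  move=> [cf bf] [cg bg]; split; last exact: bp.
  by move=> x; apply: cvg_pair; [exact: cf|exact: cg].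
move=> [df bf hf] [dg bg hg]; split; last first.
- move=> v; rewrite (_ : dird _ _ = fun x => (dird f v x, dird g v x)); first exact: IH.
  by apply/funext => x; rewrite /dird diff_pair.
- exact: bp.
by move=> x; exact: differentiable_pair.
Qed.

Lemma reg_Dn V W m j (B : set V) (g : V -> W) vs : (j + size vs <= m)%N ->
  reg m B g -> reg j B (Dn g vs).
Proof.
elim/last_ind: vs m g => [|vs v IH] m g.
  by rewrite addn0 => jm; exact: regW.
rewrite size_rcons addnS Dn_rcons; case: m => // m jm [_ _ hg].
exact: (IH m _ jm (hg v)).
Qed.

End Regularity.

(** * Iterated directional derivatives: bounds, symmetry, Taylor's formula *)

Section IteratedDerivatives.
Context {R : realType}.
Implicit Types V W U : normedModType R.

Lemma dird_basis V W m (e : 'I_m -> V) (c : 'I_m -> V -> R) (g : V -> W) v :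
    (forall v, v = \sum_i c i v *: e i) ->
  dird g v = fun x => \sum_i c i v *: dird g (e i) x.
Proof.
move=> ec; apply/funext => x; rewrite /dird [in LHS](ec v) linear_sum.
by apply: eq_bigr => i _; rewrite linearZ.
Qed.

Lemma Dn_sum V W (I : finType) (a : I -> R) (G : I -> V -> W) vs x :
    (forall i, Ck (size vs) (G i)) ->
  Dn (fun x => \sum_i a i *: G i x) vs x = \sum_i a i *: Dn (G i) vs x.
Proof.
elim/last_ind: vs G => [|vs v IH] G //; rewrite size_rcons => hG.
rewrite Dn_rcons (_ : dird _ v = fun x => \sum_i a i *: dird (G i) v x).
  by rewrite IH => [|i]; [apply: eq_bigr => i _; rewrite Dn_rcons|case: (hG i) => _; apply].
apply/funext => y; have dF i : differentiable (fun x => a i *: G i x) y.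
  by apply: differentiableZ; case: (hG i) => + _; apply.
rewrite /dird (is_diff_eval v (diff_sum_eval _ xpredT dF)).
apply: eq_bigr => i _; rewrite -[LHS]/('d (a i *: G i) y v) diffZ //.
by case: (hG i) => + _; apply.
Qed.

Lemma Dn_rcons_basis V W m (e : 'I_m -> V) (c : 'I_m -> V -> R) (g : V -> W) vs v x :
    (forall v, v = \sum_i c i v *: e i) -> Ck (size vs).+1 g ->
  Dn g (rcons vs v) x = \sum_i c i v *: Dn (dird g (e i)) vs x.
Proof. by move=> ec [_ hg]; rewrite Dn_rcons (dird_basis _ _ ec) Dn_sum// => i; exact: hg. Qed.

Lemma reg_Dn_bound V W m j B (g : V -> W) : findim V -> reg m B g -> (j <= m)%N ->
  exists2 C, 0 <= C & forall x vs, B x -> size vs = j ->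
    `|Dn g vs x| <= C * \prod_(v <- vs) `|v|.
Proof.
move=> [p [e [c [lc /findim_coord_bound[K K0 hK] ec]]]].
elim: j m g => [|j IH] m g hg jm.
  have [C hC] := reg_bounded hg; exists `|C| => // x [|//] Bx _.
  by rewrite big_nil mulr1 (le_trans (hC x Bx))// ler_norm.
case: m jm hg => // m jm hg.
have hC i : exists C, 0 <= C /\ forall x vs, B x -> size vs = j ->
    `|Dn (dird g (e i)) vs x| <= C * \prod_(v <- vs) `|v|.
  have [_ _ /(_ (e i)) h] := hg.
  have [C C0 hC] := IH _ _ h jm.
  by exists C; split.
have [C {}hC] := choice hC.
exists (\sum_i K * C i).
  by apply: sumr_ge0 => i _; rewrite mulr_ge0//; case: (hC i).
move=> x vs Bx; case/lastP: vs => // vs v; rewrite size_rcons => -[vsj].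
rewrite (Dn_rcons_basis _ _ ec); last by rewrite vsj; exact: CkW jm (reg_Ck hg).
rewrite big_rcons /= (le_trans (ler_norm_sum _ _ _))// mulr_suml ler_sum// => i _.
have [C0 hCi] := hC i; rewrite normrZ.
rewrite (_ : K * C i * _ = K * `|v| * (C i * \prod_(i0 <- vs) `|i0|)); last by ring.
by apply: ler_pM => //; exact: hCi.
Qed.

(** The mean value inequality for the path r |-> g (x + r D) - r a. With [a] subtracted first, the
    constant [K] multiplies only the deviation of the derivative from [a]. *)
Lemma mean_value_affine V : findim V -> exists2 K, 0 <= K & forall W (g : W -> V) (x D : W) a B,
  (forall y, differentiable g y) ->
  (forall t, 0 <= t <= 1 -> `|'d g (x + t *: D) D - a| <= B) ->
  `|g (x + D) - g x - a| <= K * B.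
Proof.
move=> fV; have [K K0 hK] := mean_value_ineq fV; exists K => // W g x D a B dg hB.
pose h (r : R) := g (x + r *: D) - r *: a.
have dh (r : R) : is_diff r h (fun s => s *: ('d g (x + r *: D) D - a)).
  have h1 : is_diff r (fun r : R => r *: D) (fun r : R => r *: D) by exact: is_diff_scalel.
  have h2 : is_diff r (fun r : R => x + r *: D) (fun r : R => r *: D).
    by apply: is_diff_eq; rewrite add0r.
  have h3 : is_diff (x + r *: D) g ('d g (x + r *: D)) by exact/differentiableP.
  have h4 : is_diff r (fun r : R => g (x + r *: D)) (fun s => 'd g (x + r *: D) (s *: D)).
    exact: (is_diff_comp (f := fun r : R => x + r *: D)).
  have h5 : is_diff r (fun r : R => r *: a) (fun r : R => r *: a) by exact: is_diff_scalel.
  have : is_diff r h ((fun s => 'd g (x + r *: D) (s *: D)) - (fun r : R => r *: a)).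
    exact: is_diffB.
  move=> /is_diff_eq; apply; apply/funext => s.
  by rewrite -[LHS]/('d g (x + r *: D) (s *: D) - s *: a) linearZ scalerBr.
have := hK _ h 0 1 B (fun y => @ex_diff _ _ _ _ _ _ _ (dh y)).
rewrite add0r /h scale1r scale0r addr0 scale0r subr0 scale1r.
rewrite (_ : g (x + D) - a - g x = g (x + D) - g x - a); last by lmod.
apply => t t01; rewrite add0r (is_diff_eval _ (dh _)) scale1r [t *: 1]mulr1.
exact: hB.
Qed.

Lemma dird_sub V W (f g : V -> W) x v : differentiable f x -> differentiable g x ->
  'd (fun y => f y - g y) x v = 'd f x v - 'd g x v.
Proof. by move=> df dg; rewrite -[LHS]/('d (f - g) x v) diffB. Qed.

Lemma is_diff_shift V W (g : V -> W) b x : differentiable g (x + b) ->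
  is_diff x (fun y => g (y + b)) ('d g (x + b)).
Proof.
move=> dg; apply: (is_diff_preaffine (L := id)) => //.
by exists 1 => h; rewrite mul1r.
Qed.

(** The second difference [S h u v] is symmetric in [u] and [v], and divided by h^2 it tends to
    either mixed derivative, by two applications of the mean value inequality, one in each
    direction. *)
Lemma Schwarz V W (g : V -> W) u v : findim W -> Ck 2 g ->
  dird (dird g u) v = dird (dird g v) u.
Proof.
move=> fW cg; have [K K0 hK] := mean_value_affine fW; apply/funext => x.
pose a u v := dird (dird g u) v x.
pose S (h : R) u v := g (x + h *: u + h *: v) - g (x + h *: u) - (g (x + h *: v) - g x).
have main u' v' : forall e, 0 < e -> exists2 d, 0 < d & forall h : R, 0 < h -> h < d ->
    `|S h u' v' - h ^+ 2 *: a u' v'| <= K * (K * (h ^+ 2 * e)).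
  move=> e e0.
  have : {for x, continuous (dird (dird g u') v')} by case: cg => _ /(_ u')[_]; apply.
  move=> /cvgrPdist_lt/(_ e e0)/nbhs_normP[d /= d0 hd].
  have N0 : 0 < `|u'| + `|v'| + 1 by rewrite ltr_wpDl// addr_ge0.
  (* This radius keeps every point of the parallelogram spanned by h u' and h v' within distance [d]
     of [x]. *)
  exists (d / (`|u'| + `|v'| + 1)); first by rewrite divr_gt0.
  move=> h h0; rewrite ltr_pdivlMr// => hdh.
  have dg y : differentiable g y by case: cg.
  have ddg y : differentiable (dird g u') y by case: cg => _ /(_ u')[+ _]; apply.
  have dsh y : is_diff y (fun y => g (y + h *: v')) ('d g (y + h *: v')).
    exact: is_diff_shift.
  have dsh' y := @ex_diff _ _ _ _ _ _ _ (dsh y).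
  have dk y : differentiable (fun y => g (y + h *: v') - g y) y.
    exact: differentiableB.
  rewrite /S; apply: (hK _ (fun y => g (y + h *: v') - g y) x (h *: u') _ (K * (h ^+ 2 * e)) dk) => t t01.
  rewrite dird_sub// (is_diff_eval _ (dsh _)).
  have dZ y : 'd g y (h *: u') = h *: dird g u' y by rewrite linearZ.
  rewrite !dZ expr2 -scalerA -!scalerBr normrZ gtr0_norm//.
  rewrite -mulrA [K * _]mulrCA ler_pM2l//.
  apply: hK => [y|s s01]; first exact: ddg.
  have dZ' y : 'd (dird g u') y (h *: v') = h *: dird (dird g u') v' y by rewrite linearZ.
  rewrite dZ' -scalerBr normrZ gtr0_norm// ler_pM2l//.
  rewrite distrC; apply/ltW/hd => /=.
  rewrite -addrA opprD addrA subrr add0r normrN (le_lt_trans _ hdh)//.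
  rewrite (le_trans (ler_normD _ _))// !normrZ (gtr0_norm h0).
  have /andP[t0 t1] := t01; have /andP[s0 s1] := s01.
  rewrite !ger0_norm// mulrDr mulr1 -[leLHS]addr0 lerD ?(ltW h0)// mulrDr.
  by rewrite lerD// ler_piMl// mulr_ge0// ltW.
have SC h : S h v u = S h u v  by rewrite /S (_ : x + h *: v + h *: u = x + h *: u + h *: v); lmod.
apply/eqP; rewrite -subr_eq0 -normr_eq0 eq_le normr_ge0 andbT.
rewrite -[dird (dird g u) v x]/(a u v) -[dird (dird g v) u x]/(a v u).
apply/ler_addgt0Pr => e e0; rewrite add0r.
have e' : 0 < e / (2 * K * K + 1) by rewrite divr_gt0// ltr_wpDl// !mulr_ge0.
have [d1 d10 h1] := main u v _ e'; have [d2 d20 h2] := main v u _ e'.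
pose h := Num.min d1 d2 / 2.
have m0 : 0 < Num.min d1 d2 by rewrite lt_min d10.
have h0 : 0 < h by rewrite divr_gt0.
have /andP[hd1 hd2] : (h < d1) && (h < d2).
  by rewrite -lt_min /h ltr_pdivrMr// ltr_pMr// ltr1n.
have hh : 0 < h ^+ 2 by rewrite exprn_gt0.
rewrite -(ler_pM2l hh) -[X in X * _](gtr0_norm hh) -normrZ.
rewrite (_ : _ *: _ = (S h v u - h ^+ 2 *: a v u) - (S h u v - h ^+ 2 *: a u v)); last first.
  by rewrite SC; lmod.
rewrite (le_trans (ler_normB _ _))// (le_trans (lerD (h2 _ h0 hd2) (h1 _ h0 hd1)))//.
have -> : K * (K * (h ^+ 2 * (e / (2 * K * K + 1)))) + K * (K * (h ^+ 2 * (e / (2 * K * K + 1)))) =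
  h ^+ 2 * ((2 * K * K) * (e / (2 * K * K + 1))) by ring.
rewrite ler_pM2l// mulrCA ler_piMr ?(ltW e0)// ler_pdivrMr ?mul1r ?lerDl//.
by rewrite ltr_wpDl// !mulr_ge0.
Qed.

Lemma Dn_swap V W (g : V -> W) us a b ws : findim W -> Ck (size ws).+2 g ->
  Dn g (us ++ a :: b :: ws) = Dn g (us ++ b :: a :: ws).
Proof.
move=> fW cg; rewrite !Dn_cat; congr (Dn _ us).
apply: (Schwarz (g := Dn g ws)) => //.
by apply: (reg_Ck (B := set0)); apply: (reg_Dn (m := (size ws).+2)) => //; exact: Ck_reg.
Qed.

Lemma Dn_front V W (g : V -> W) us a ws : findim W -> Ck (size (us ++ a :: ws)) g ->
  Dn g (us ++ a :: ws) = Dn g (a :: us ++ ws).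
Proof.
move=> fW; elim/last_ind: us ws => [//|us b IH] ws cg.
rewrite cat_rcons Dn_swap//; last first.
  by apply: CkW cg; rewrite size_cat size_rcons /= addSnnS leq_addl.
by rewrite IH ?cat_rcons//; apply: CkW cg; rewrite !size_cat size_rcons /= addSnnS.
Qed.

(** The derivative in [t] of the remainder of order [n.+1] is the remainder of order [n] for
    [dird g D]; the mean value inequality is used once per order, whence [K ^+ n]. The claim covers
    all [t] in [0, 1] so that it can be used under the derivative. *)
Lemma taylor V W : findim W -> exists2 K, 0 <= K & forall n (g : V -> W) (x D : V) B,
  Ck n g ->
  (forall t, 0 <= t <= 1 -> `|Dn g (nseq n D) (x + t *: D)| <= B) ->
  forall t, 0 <= t <= 1 ->
  `|g (x + t *: D) - \sum_(j < n) (t ^+ j / j`!%:R) *: Dn g (nseq j D) x| <= K ^+ n * B.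
Proof.
move=> fW; have [K K0 hK] := mean_value_ineq fW; exists K => //.
elim=> [|n IH] g x D B cg hB t t01.
  by rewrite big_ord0 subr0 mul1r; exact: hB.
have dg y : differentiable g y by case: cg.
have cg' : Ck n (dird g D) by case: cg => _; apply.
have DnS j : Dn g (nseq j.+1 D) = Dn (dird g D) (nseq j D).
  by rewrite -Dn_rcons -cats1 -[X in _ ++ X]/(nseq 1 D) -nseqD addn1.
pose c j := Dn g (nseq j D) x.
pose q (r : R) := \sum_(j < n) (r ^+ j.+1 / (j.+1)`!%:R) *: c j.+1.
pose dq (r : R) := \sum_(j < n) (r ^+ j / j`!%:R) *: c j.+1.
have hq (r : R) : is_diff r q (fun s => s *: dq r).
  have hqj (j : 'I_n) : is_diff r (fun r : R => (r ^+ j.+1 / (j.+1)`!%:R) *: c j.+1)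
      (fun s => s *: ((r ^+ j / j`!%:R) *: c j.+1)).
    have h1 : is_diff r (fun r : R => r ^+ j.+1) (j.+1%:R * r ^+ j *: (id : R -> R)).
      have := is_diffX j (is_diff_id (r : R)); rewrite exprfctE; exact.
    have h2 := is_diffZv h1 (is_diff_cst (((j.+1)`!%:R)^-1 *: c j.+1) r).
    rewrite (_ : (fun r0 : R => _) = fun y : R => y ^+ j.+1 *: cst (((j.+1)`!%:R)^-1 *: c j.+1) y); last first.
      by apply/funext => y; rewrite scalerA.
    apply: is_diff_eq; apply/funext => s.
    rewrite scaler0 addr0 !scalerA; congr (_ *: _).
    rewrite -[LHS]/(j.+1%:R * r ^+ j * s / (j.+1)`!%:R) factS natrM.
    have nz1 : (j.+1)%:R != 0 :> R by rewrite pnatr_eq0.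
    have nz2 : (j`!)%:R != 0 :> R by rewrite pnatr_eq0 -lt0n fact_gt0.
    move: (j.+1%:R : R) (j`!%:R : R) nz1 nz2 => p p' nz1 nz2.
    by field; rewrite nz1 nz2.
  have := diff_sum_eval (index_enum 'I_n) xpredT (fun i => @ex_diff _ _ _ _ _ _ _ (hqj i)).
  move=> h; apply: (is_diff_eq h); apply/funext => s; rewrite /dq scaler_sumr.
  by apply: eq_bigr => j _; rewrite (is_diff_eval _ (hqj j)).
pose h (r : R) := g (x + r *: D) - q r.
have dh (r : R) : is_diff r h (fun s => s *: (dird g D (x + r *: D) - dq r)).
  have h1 : is_diff r (fun r : R => r *: D) (fun r : R => r *: D) by exact: is_diff_scalel.
  have h2 : is_diff r (fun r : R => x + r *: D) (fun r : R => r *: D).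
    by apply: is_diff_eq; rewrite add0r.
  have h3 : is_diff (x + r *: D) g ('d g (x + r *: D)) by exact/differentiableP.
  have h4 : is_diff r (fun r : R => g (x + r *: D)) (fun s => 'd g (x + r *: D) (s *: D)).
    exact: (is_diff_comp (f := fun r : R => x + r *: D)).
  have h5 := hq r.
  have : is_diff r h ((fun s => 'd g (x + r *: D) (s *: D)) - (fun s : R => s *: dq r)).
    exact: is_diffB.
  move=> /is_diff_eq; apply; apply/funext => s.
  by rewrite -[LHS]/('d g (x + r *: D) (s *: D) - s *: dq r) linearZ scalerBr.
have := hK _ h 0 t (K ^+ n * B) (fun y => @ex_diff _ _ _ _ _ _ _ (dh y)).
have -> : h (0 + t) - h 0 = g (x + t *: D) -
    \sum_(j < n.+1) (t ^+ j / j`!%:R) *: Dn g (nseq j D) x.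
  rewrite /h add0r scale0r addr0 /q [X in _ - (g x - X)]big1; last first.
    by move=> j _; rewrite expr0n mul0r scale0r.
  rewrite big_ord_recl expr0 fact0 divr1 scale1r /c.
  by rewrite -[Dn g (nseq _ D) x]/(g x) subr0 opprD addrA addrAC.
rewrite exprS -mulrA.
have /andP[t0 t1] := t01.
apply => s /andP[s0 s1]; rewrite add0r (is_diff_eval _ (dh _)) normrZ ger0_norm//.
have -> : s *: t = s * t by [].
have st : 0 <= s * t <= 1 by rewrite mulr_ge0// mulr_ile1.
have : `|dird g D (x + (s * t) *: D) - dq (s * t)| <= K ^+ n * B.
  rewrite /dq /c; under eq_bigr do rewrite DnS.
  by apply: IH => // r r01; rewrite -DnS; exact: hB.
by apply: le_trans; rewrite ler_piMl.
Qed.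

End IteratedDerivatives.
(** * Words, shuffles and set partitions *)

Section Words.
Context {A : eqType}.
Implicit Types (u v w : seq A) (us bs cs : seq (seq A)).

(* The pairs (subword, complementary subword), indexed by the sets of positions. *)
Fixpoint splits w : seq (seq A * seq A) :=
  if w is a :: w' then
    [seq (a :: p.1, p.2) | p <- splits w'] ++ [seq (p.1, a :: p.2) | p <- splits w']
  else [:: ([::], [::])].

(** Deconcatenation, the coproduct dual to the product [star]; [splits] is the one dual to the
    shuffle product. *)
Fixpoint cuts w : seq (seq A * seq A) :=
  if w is a :: w' then ([::], w) :: [seq (a :: p.1, p.2) | p <- cuts w']
  else [:: ([::], [::])].

(* The ordered set partitions of the positions of [w] into [k] blocks. *)
Fixpoint oparts k w : seq (seq (seq A)) :=
  if k is k'.+1 then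
    flatten [seq [seq p.1 :: us | us <- oparts k' p.2] | p <- splits w & ~~ nilp p.1]
  else if nilp w then [:: [::]] else [::].

(** The Leibniz rule on lists: the terms obtained when a derivation acts on a product of the entries
    of [s]. *)
Fixpoint ders (T : Type) (f : T -> T) (s : seq T) : seq (seq T) :=
  if s is a :: s' then (f a :: s') :: [seq a :: t | t <- ders f s'] else [::].

Fixpoint inserts (T : Type) (x : T) (s : seq T) : seq (seq T) :=
  if s is a :: s' then (x :: s) :: [seq a :: t | t <- inserts x s'] else [:: [:: x]].

(* The set partitions of the positions of [w]. *)
Fixpoint parts w : seq (seq (seq A)) :=
  if w is a :: w' then
    flatten [seq ([:: a] :: bs) :: ders (cons a) bs | bs <- parts w']
  else [:: [::]].

Lemma shuffle0s u : shuffle [::] u = [:: u]. Proof. by case: u. Qed.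
Lemma shuffles0 u : shuffle u [::] = [:: u]. Proof. by case: u. Qed.

Lemma shuffle_cons a b u v : shuffle (a :: u) (b :: v) =
  map (cons a) (shuffle u (b :: v)) ++ map (cons b) (shuffle (a :: u) v).
Proof. by []. Qed.

Lemma size_shuffle u v w : w \in shuffle u v -> size w = (size u + size v)%N.
Proof.
elim: u v w => [|a u IHu] v w; first by rewrite shuffle0s inE => /eqP ->.
elim: v w => [|b v IHv] w; first by rewrite shuffles0 inE => /eqP ->; rewrite addn0.
rewrite shuffle_cons mem_cat => /orP[] /mapP[w' hw' ->] /=.
  by rewrite (IHu _ _ hw').
by rewrite (IHv _ hw') addnS.
Qed.

Lemma size_shuffles us w : w \in shuffles us -> size w = sumn (map size us).
Proof.
elim: us w => [|u us IH] w /=; first by rewrite inE => /eqP ->.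
by move=> /flattenP[s /mapP[v hv ->]] /size_shuffle ->; rewrite (IH _ hv).
Qed.

Lemma count_mem_map_cons a w (s : seq (seq A)) :
  count_mem w (map (cons a) s) = if w is b :: w' then if b == a then count_mem w' s else 0%N else 0%N.
Proof.
rewrite count_map; case: w => [|b w] /=; first by rewrite -(count_pred0 s); exact: eq_count.
case: eqP => [->|ab].
  by apply: eq_count => x /=; rewrite eqseq_cons eqxx.
rewrite -(count_pred0 s); apply: eq_count => x /=; rewrite eqseq_cons.
by case: eqP => // ba; case: ab.
Qed.

Lemma count_map_consl a x y (s : seq (seq A * seq A)) :
  count_mem (x, y) [seq (a :: p.1, p.2) | p <- s] =
  if x is b :: x' then if b == a then count_mem (x', y) s else 0%N else 0%N.
Proof.
rewrite count_map; case: x => [|b u'] /=.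
  by rewrite -(count_pred0 s); apply: eq_count => -[].
case: eqP => [->|ab].
  by apply: eq_count => -[x' y'] /=; rewrite !xpair_eqE eqseq_cons eqxx.
rewrite -(count_pred0 s); apply: eq_count => -[x' y'] /=.
by rewrite xpair_eqE eqseq_cons; case: eqP => // ba; case: ab.
Qed.

(** Duality of shuffling and unshuffling: a way to shuffle [u] and [v] into [w] is a choice of the
    positions taken by [u]. Multiplicities are then computed on the side of [splits]. *)
Lemma count_shuffle u v w : count_mem w (shuffle u v) = count_mem (u, v) (splits w).
Proof.
have mapr a w' (x y : seq A) : count_mem (x, y) [seq (p.1, a :: p.2) | p <- splits w'] =
    if y is b :: v' then if b == a then count_mem (x, v') (splits w') else 0%N else 0%N.
  rewrite count_map; case: y => [|b v'] /=.
    rewrite -(count_pred0 (splits w')); apply: eq_count => -[x' y'] /=.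
    by rewrite xpair_eqE; case: (x' == x).
  case: eqP => [->|ab].
    by apply: eq_count => -[x' y'] /=; rewrite !xpair_eqE eqseq_cons eqxx.
  rewrite -(count_pred0 (splits w')); apply: eq_count => -[x' y'] /=.
  by rewrite xpair_eqE eqseq_cons; case: (x' == x) => //=; case: eqP => // ba; case: ab.
elim: w u v => [|c w IH] u v.
  case: u v => [|a u] [|b v] //=; rewrite ?addn0//.
  by apply/eqP; rewrite -leqn0 leqNgt -has_count; apply/hasPn => x;
    rewrite mem_cat => /orP[]/mapP[y _ ->].
rewrite [splits _]/= count_cat count_map_consl mapr.
case: u v => [|a u] [|b v].
- by [].
- rewrite shuffle0s /= addn0 add0n -IH shuffle0s /= addn0 eqseq_cons.
  by case: eqP.
- rewrite shuffles0 /= !addn0 -IH shuffles0 /= addn0 eqseq_cons.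
  by case: eqP.
rewrite shuffle_cons count_cat !count_mem_map_cons -!IH.
by rewrite ![c == _]eq_sym.
Qed.

Lemma count_shuffles_cons u us w : count_mem w (shuffles (u :: us)) =
  (\sum_(p <- splits w) (p.1 == u) * count_mem p.2 (shuffles us))%N.
Proof.
rewrite /= count_flatten -map_comp sumnE big_map.
transitivity (\sum_(j <- shuffles us) \sum_(p <- splits w) (p.1 == u) * (p.2 == j))%N.
  apply: eq_bigr => v _; rewrite /= count_shuffle -sum1_count big_mkcond /=.
  apply: eq_bigr => -[x y] _; rewrite xpair_eqE /=.
  by case: (x == u); case: (y == v).
rewrite exchange_big /=; apply: eq_bigr => p _; rewrite -big_distrr /=; congr (_ * _)%N.
rewrite -[RHS]sum1_count [RHS]big_mkcond /=; apply: eq_bigr => v _.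
by rewrite eq_sym; case: eqP.
Qed.

Lemma splits_size w p : p \in splits w -> (size p.1 + size p.2 = size w)%N.
Proof.
elim: w p => [|a w IH] p /=; first by rewrite inE => /eqP ->.
by rewrite mem_cat => /orP[]/mapP[q /IH <- ->] /=; rewrite ?addnS.
Qed.

Lemma oparts_size k w us : us \in oparts k w -> size us = k.
Proof.
elim: k w us => [|k IH] w us /=; first by case: ifP => // _; rewrite inE => /eqP ->.
by move=> /flattenP[s /mapP[p _ ->] /mapP[vs /IH <- ->]].
Qed.

Section Sums.
Context {Z : nmodType}.

Lemma sum_splits_nil_right (F : seq A -> seq (seq A) -> Z) w :
  \sum_(p <- splits w) \sum_(us <- oparts 0 p.2) F p.1 us = F w [::].
Proof.
elim: w F => [|b w IH] F; first by rewrite big_seq1 /= big_seq1.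
rewrite /= big_cat !big_map /= [X in _ + X]big1 ?addr0; last by move=> p _; rewrite big_nil.
exact: (IH (fun x => F (b :: x))).
Qed.

Lemma sum_splits_nil_left (F : seq A -> seq A -> Z) w :
  \sum_(p <- splits w | nilp p.1) F p.1 p.2 = F [::] w.
Proof.
elim: w F => [|b w IH] F; first by rewrite big_mkcond big_seq1.
rewrite /= big_cat !big_map /= big_pred0 // add0r.
exact: (IH (fun x y => F x (b :: y))).
Qed.

(** The position of the new letter [a] either forms a block of its own, inserted anywhere among the
    others, or joins an existing block as its first letter. Since [oparts] recurses on the first
    block and not on the first letter, this takes an induction on [k]. *)
Lemma oparts_cons (S : seq (seq A) -> Z) k a w :
  \sum_(us <- oparts k.+1 (a :: w)) S us =
  \sum_(us <- oparts k w) \sum_(cs <- inserts [:: a] us) S cs +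
  \sum_(us <- oparts k.+1 w) \sum_(cs <- ders (cons a) us) S cs.
Proof.
have unfold (S' : seq (seq A) -> Z) j v : \sum_(us <- oparts j.+1 v) S' us =
    \sum_(p <- splits v | ~~ nilp p.1) \sum_(us <- oparts j p.2) S' (p.1 :: us).
  by rewrite /= big_flatten /= big_map big_filter; apply: eq_bigr => p _; rewrite big_map.
elim: k S w => [|k IH] S w.
  rewrite !unfold [splits (a :: w)]/= big_cat !big_map /=.
  rewrite [X in _ + X]big1 ?addr0; last by move=> p _; rewrite big_nil.
  rewrite (sum_splits_nil_right (fun x us => S ((a :: x) :: us))).
  case: w => [|b w].
    by rewrite /= !big_seq1 [X in _ + X]big_mkcond big_seq1 addr0.
  rewrite [X in X + _]big_nil add0r /= big_cat !big_map /=.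
  rewrite [X in _ + X]big1 ?addr0; last by move=> p _; rewrite big_nil.
  rewrite (sum_splits_nil_right (fun x us =>
    \sum_(cs <- ((a :: b :: x) :: us) :: [seq (b :: x) :: t | t <- ders (cons a) us]) S cs)).
  by rewrite /= big_seq1.
rewrite unfold [splits (a :: w)]/= big_cat !big_map.
transitivity (\sum_(us <- oparts k.+1 w) S ([:: a] :: us) +
    \sum_(p <- splits w | ~~ nilp p.1) \sum_(us <- oparts k.+1 p.2) S ((a :: p.1) :: us) +
    \sum_(p <- splits w | ~~ nilp p.1)
      (\sum_(us <- oparts k p.2) \sum_(cs <- inserts [:: a] us) S (p.1 :: cs) +
       \sum_(us <- oparts k.+1 p.2) \sum_(cs <- ders (cons a) us) S (p.1 :: cs))).
  congr (_ + _); last by apply: eq_bigr => p _; exact: (IH (fun us => S (p.1 :: us))).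
  rewrite (bigID (fun p : seq A * seq A => nilp p.1)) /=; congr (_ + _).
  exact: (sum_splits_nil_left (fun x y => \sum_(us <- oparts k.+1 y) S ((a :: x) :: us))).
set X1 := \sum_(us <- oparts k.+1 w) S ([:: a] :: us).
have -> : \sum_(us <- oparts k.+1 w) \sum_(cs <- inserts [:: a] us) S cs =
    X1 + \sum_(p <- splits w | ~~ nilp p.1) \sum_(us <- oparts k p.2)
       \sum_(cs <- inserts [:: a] us) S (p.1 :: cs).
  rewrite /X1 !unfold -big_split; apply: eq_bigr => p _ /=.
  rewrite -big_split; apply: eq_bigr => us _ /=.
  by rewrite big_cons big_map.
rewrite unfold big_split /= -!addrA; congr (_ + _); rewrite addrCA; congr (_ + _).
rewrite -big_split; apply: eq_bigr => p _ /=.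
rewrite -big_split; apply: eq_bigr => us _ /=.
by rewrite big_cons big_map.
Qed.

End Sums.
End Words.

(** * Symmetric sums over ordered and unordered set partitions *)

Section SymmetricSums.
Context {A : eqType} {Z : nmodType}.
Implicit Types (u v w : seq A) (us ws bs cs : seq (seq A)) (S : seq (seq A) -> Z).

(** Moving an entry to the front generates all permutations. The length is fixed because the
    symmetry of [Dn] is available only up to the order of differentiability. *)
Definition front_sym k S := forall us a ws, size (us ++ a :: ws) = k ->
  S (us ++ a :: ws) = S (a :: us ++ ws).

Lemma front_symW k S a : front_sym k.+1 S -> front_sym k (fun us => S (a :: us)).
Proof.
move=> sS us b ws h; rewrite -[a :: us ++ _]/((a :: us) ++ b :: ws) sS /= ?h//.
rewrite -[RHS]/(S ([:: a] ++ b :: (us ++ ws))) sS //=.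
by rewrite -h !size_cat /= addnS.
Qed.

Lemma sum_inserts S x us : front_sym (size us).+1 S ->
  \sum_(cs <- inserts x us) S cs = S (x :: us) *+ (size us).+1.
Proof.
move=> sS.
suff h pre us' : (size pre + size us' = size us)%N ->
    \sum_(cs <- inserts x us') S (pre ++ cs) = S (x :: pre ++ us') *+ (size us').+1.
  exact: (h [::]).
elim: us' pre => [|a us' IH] pre h /=.
  by rewrite big_seq1 sS ?size_cat /= ?addn1 -?h ?addn0.
rewrite big_cons big_map sS; last by rewrite size_cat -h /= !addnS.
under eq_bigr do rewrite -cat_rcons.
by rewrite IH ?size_rcons ?addSnnS// cat_rcons [RHS]mulrS.
Qed.

Lemma size_ders f us cs : cs \in ders f us -> size cs = size us.
Proof.
elim: us cs => [|u us IH] cs //=; rewrite inE => /orP[/eqP ->//|/mapP[t /IH <- ->]].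
by [].
Qed.

Lemma big_ders_cat f us ws S : \sum_(cs <- ders f (us ++ ws)) S cs =
  \sum_(cs <- ders f us) S (cs ++ ws) + \sum_(cs <- ders f ws) S (us ++ cs).
Proof.
elim: us S => [|u us IH] S /=; first by rewrite big_nil add0r.
by rewrite !big_cons !big_map IH addrA.
Qed.

Lemma front_sym_ders k S f : front_sym k S ->
  front_sym k (fun us => \sum_(cs <- ders f us) S cs).
Proof.
move=> sS us a ws h; rewrite big_ders_cat /= !big_cons !big_map big_ders_cat addrCA.
congr (_ + (_ + _)).
- by rewrite sS // -h !size_cat.
- rewrite !big_seq; apply: eq_bigr => cs /size_ders e.
  by rewrite sS // -h !size_cat /= e.
- rewrite !big_seq; apply: eq_bigr => cs /size_ders e.
  by rewrite sS // -h !size_cat /= e.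
Qed.

(** A set partition into [k] blocks has k! orderings, on which a symmetric [S] is constant. In the
    induction on [w], inserting a singleton block into an ordered partition of [k] blocks gives k +
    1 equal terms, the factor between k! and (k + 1)!. *)
Lemma sum_oparts_parts k w S : front_sym k S ->
  \sum_(us <- oparts k w) S us = (\sum_(bs <- parts w | size bs == k) S bs) *+ k`!.
Proof.
elim: w k S => [|a w IH] k S sS.
  case: k sS => [|k] sS; rewrite /= [in RHS]big_mkcond [in RHS]big_seq1 /=.
    by rewrite big_seq1.
  by rewrite big_nil mul0rn.
have step (S' : seq (seq A) -> Z) j : \sum_(bs <- parts (a :: w) | size bs == j) S' bs =
    \sum_(bs <- parts w | (size bs).+1 == j) S' ([:: a] :: bs) +
    \sum_(bs <- parts w | size bs == j) \sum_(cs <- ders (cons a) bs) S' cs.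
  rewrite /= big_mkcond big_flatten /= big_map [X in _ = X + _]big_mkcond.
  rewrite [X in _ = _ + X]big_mkcond -big_split; apply: eq_bigr => bs _ /=.
  rewrite big_cons; congr (_ + _); rewrite big_seq.
  under eq_bigr => cs hcs do rewrite (size_ders hcs).
  by rewrite -big_seq; case: ifP => // _; rewrite big1.
case: k sS => [|k] sS.
  rewrite step /= big_nil big_pred0 // add0r.
  by rewrite big1 ?mul0rn// => bs /nilP ->; rewrite big_nil.
rewrite oparts_cons step mulrnDl (IH _ _ (@front_sym_ders k.+1 S (cons a) sS)).
congr (_ + _).
transitivity ((\sum_(us <- oparts k w) (fun us => S ([:: a] :: us)) us) *+ k.+1).
  by rewrite -sumrMnl !big_seq; apply: eq_bigr => us /oparts_size e; rewrite sum_inserts e.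
by rewrite (IH _ _ (@front_symW k S [:: a] sS)) factS mulnC mulrnA.
Qed.

End SymmetricSums.

Section TupleSums.
Local Arguments shuffles : simpl never.
Context {A : finType} {Z : nmodType} {M : nat}.

Lemma sum_tuple_cons (T : finType) k (P : seq T -> bool) (F : seq T -> Z) :
  \sum_(t : k.+1.-tuple T | P t) F t = \sum_(x : T) \sum_(t : k.-tuple T | P (x :: t)) F (x :: t).
Proof.
rewrite pair_big_dep /=.
rewrite (reindex (fun p : T * k.-tuple T => [tuple of p.1 :: p.2])) /=; first by [].
exists (fun t : k.+1.-tuple T => (thead t, [tuple of behead t])) => [[x t] _|t _] /=.
  by congr pair; apply: val_inj.
by apply: val_inj => /=; rewrite [in RHS](tuple_eta t).
Qed.

(** The multiplicity of [w] in the shuffle product of a tuple counts the ordered partitions of the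
    positions of [w] whose blocks spell the tuple. The weighted sums of [faa_di_bruno] thus become
    sums over partitions of positions. *)
Lemma sum_tuples_oparts k (w : seq A) (S : seq (seq A) -> Z) : (size w <= M)%N ->
  \sum_(us : k.-tuple (M.-bseq A) | all (fun u : M.-bseq A => ~~ nilp u) us)
    S [seq bseqval u | u <- us] *+ count_mem w (shuffles [seq bseqval u | u <- us]) =
  \sum_(us <- oparts k w) S us.
Proof.
elim: k w S => [|k IH] w S wM.
  rewrite (big_pred1 [tuple]); last by move=> t; rewrite [t]tuple0 /= eqxx.
  by case: w wM => [|a w] wM /=; rewrite ?big_nil ?mulr0n// big_seq1 mulr1n.
rewrite (sum_tuple_cons k (fun us => all (fun u : M.-bseq A => ~~ nilp u) us)
  (fun us => S [seq bseqval u | u <- us] *+ count_mem w (shuffles [seq bseqval u | u <- us]))).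
rewrite [RHS]/= big_flatten big_map big_filter /=.
transitivity (\sum_(p <- splits w) \sum_(u : M.-bseq A | ~~ nilp u && (p.1 == u))
  \sum_(us : k.-tuple (M.-bseq A) | all (fun u : M.-bseq A => ~~ nilp u) us)
    S (bseqval u :: [seq bseqval u | u <- us]) *+ count_mem p.2 (shuffles [seq bseqval u | u <- us])).
  rewrite (eq_bigr (fun p : seq A * seq A => \sum_(u : M.-bseq A) if ~~ nilp u && (p.1 == u) then
   \sum_(us : k.-tuple (M.-bseq A) | all (fun u : M.-bseq A => ~~ nilp u) us)
    S (bseqval u :: [seq bseqval u | u <- us]) *+ count_mem p.2 (shuffles [seq bseqval u | u <- us]) else 0)); last first.
    by move=> p _; rewrite -big_mkcond.
  rewrite exchange_big /=; apply: eq_bigr => u _.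
  case: (boolP (nilp u)) => nu /=.
    by rewrite big_pred0 // big1.
  rewrite -big_mkcond /= exchange_big /=; apply: eq_bigr => us _.
  rewrite count_shuffles_cons.
  rewrite -sumrMnr [RHS]big_mkcond /=; apply: eq_bigr => p _.
  by case: eqP => _; rewrite ?mul1n// mul0n mulr0n.
rewrite big_seq_cond [RHS]big_seq_cond.
rewrite (bigID (fun p : seq A * seq A => nilp p.1)) /= [X in X + _]big1 ?add0r; last first.
  move=> p /andP[_ /nilP ->]; rewrite big_pred0 // => u.
  by apply/negP => /andP[/negP nu /eqP e]; apply: nu; rewrite -e.
apply: eq_big => [p|p /andP[/andP[hp _] np]]; first by rewrite andbT.
have sp := splits_size hp.
have h1 : (size p.1 <= M)%N by rewrite (leq_trans _ wM)// -sp leq_addr.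
rewrite (big_pred1 (Bseq h1)); last first.
  move=> u /=; rewrite -val_eqE /= eq_sym.
  by case: eqP => [->|]; rewrite ?andbF// andbT.
rewrite big_map (IH p.2 (fun us => S (p.1 :: us))) //.
by rewrite (leq_trans _ wM)// -sp leq_addl.
Qed.

End TupleSums.

(** * Characters of the shuffle algebra *)

Section ShuffleCharacters.
Context {A : eqType}.
Implicit Types (u v w : seq A).

(** Deconcatenation is multiplicative for the shuffle product, the compatibility axiom of the
    shuffle bialgebra. After unfolding the first letter of a shuffle, [E1] to [E5] sort the terms by
    whether the left piece is empty and by which word supplies its first letter. *)
Lemma sum_shuffle_cuts {Z : nmodType} (F : seq A -> seq A -> Z) u v :
  \sum_(w <- shuffle u v) \sum_(p <- cuts w) F p.1 p.2 =
  \sum_(p <- cuts u) \sum_(q <- cuts v)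
     \sum_(x <- shuffle p.1 q.1) \sum_(y <- shuffle p.2 q.2) F x y.
Proof.
elim: u v F => [|a u IHu] v F.
  rewrite shuffle0s big_seq1 /= big_seq1; apply: eq_bigr => q _.
  by rewrite -[(_, _).1]/[::] -[(_, _).2]/[::] !shuffle0s !big_seq1.
elim: v F => [|b v IHv] F.
  rewrite shuffles0 big_seq1; apply: eq_bigr => q _.
  by rewrite /= big_seq1 /= !shuffles0 !big_seq1.
have cutsE c w : cuts (c :: w) = ([::], c :: w) :: [seq (c :: p.1, p.2) | p <- cuts w] by [].
have LE c (s : seq (seq A)) : \sum_(w <- map (cons c) s) \sum_(p <- cuts w) F p.1 p.2 =
    \sum_(w <- map (cons c) s) F [::] w + \sum_(w <- s) \sum_(p <- cuts w) F (c :: p.1) p.2.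
  rewrite !big_map -big_split; apply: eq_bigr => w _.
  by rewrite cutsE big_cons big_map.
rewrite shuffle_cons big_cat !LE (IHu (b :: v) (fun x y => F (a :: x) y)) (IHv (fun x y => F (b :: x) y)).
rewrite [in RHS](cutsE a) [RHS]big_cons [in RHS]big_map.
have E1 : \sum_(q <- cuts (b :: v)) \sum_(x <- shuffle [::] q.1) \sum_(y <- shuffle (a :: u) q.2) F x y =
   \sum_(y <- shuffle (a :: u) (b :: v)) F [::] y +
   \sum_(q <- cuts v) \sum_(y <- shuffle (a :: u) q.2) F (b :: q.1) y.
  rewrite (cutsE b) [LHS]big_cons big_map shuffle0s big_seq1; congr (_ + _).
  by apply: eq_bigr => q _; rewrite shuffle0s big_seq1.
have E2 p : \sum_(q <- cuts (b :: v)) \sum_(x <- shuffle (a :: p.1) q.1) \sum_(y <- shuffle p.2 q.2) F x y =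
   \sum_(q <- cuts (b :: v)) \sum_(x <- shuffle p.1 q.1) \sum_(y <- shuffle p.2 q.2) F (a :: x) y +
   \sum_(q <- cuts v) \sum_(x <- shuffle (a :: p.1) q.1) \sum_(y <- shuffle p.2 q.2) F (b :: x) y.
  rewrite !(cutsE b) [LHS]big_cons [X in _ = X + _]big_cons !big_map !shuffles0 !big_seq1 -addrA.
  congr (_ + _).
  by rewrite -big_split; apply: eq_bigr => q _; rewrite shuffle_cons big_cat !big_map.
have E3 : \sum_(q <- cuts v) \sum_(x <- shuffle [::] q.1) \sum_(y <- shuffle (a :: u) q.2) F (b :: x) y =
   \sum_(q <- cuts v) \sum_(y <- shuffle (a :: u) q.2) F (b :: q.1) y.
  by apply: eq_bigr => q _; rewrite shuffle0s big_seq1.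
have E4 : \sum_(p <- cuts (a :: u)) \sum_(q <- cuts v) \sum_(x <- shuffle p.1 q.1) \sum_(y <- shuffle p.2 q.2) F (b :: x) y =
   \sum_(q <- cuts v) \sum_(y <- shuffle (a :: u) q.2) F (b :: q.1) y +
   \sum_(p <- cuts u) \sum_(q <- cuts v) \sum_(x <- shuffle (a :: p.1) q.1) \sum_(y <- shuffle p.2 q.2) F (b :: x) y.
  by rewrite (cutsE a) [LHS]big_cons big_map E3.
have E5 : \sum_(p <- cuts u) \sum_(q <- cuts (b :: v)) \sum_(x <- shuffle (a :: p.1) q.1) \sum_(y <- shuffle p.2 q.2) F x y =
   \sum_(p <- cuts u) \sum_(q <- cuts (b :: v)) \sum_(x <- shuffle p.1 q.1) \sum_(y <- shuffle p.2 q.2) F (a :: x) y +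
   \sum_(p <- cuts u) \sum_(q <- cuts v) \sum_(x <- shuffle (a :: p.1) q.1) \sum_(y <- shuffle p.2 q.2) F (b :: x) y.
  by rewrite -big_split; apply: eq_bigr => p _; rewrite E2.
rewrite E4 [X in _ = X + _]E1 [X in _ = _ + X]E5 shuffle_cons big_cat.
set Y1 := \sum_(p <- cuts u) _; set Y2 := \sum_(q <- cuts v) _; set Y3 := \sum_(p <- cuts u) _.
set X1 := \sum_(i <- map (cons a) _) _; set X2 := \sum_(i <- map (cons b) _) _.
rewrite -[LHS]/(X1 + Y1 + (X2 + (Y2 + Y3))) -[RHS]/(X1 + X2 + Y2 + (Y1 + Y3)).
by rewrite addrACA -!addrA; congr (_ + (_ + _)); rewrite addrCA.
Qed.

Lemma cuts_size w p : p \in cuts w -> (size p.1 + size p.2 = size w)%N.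
Proof.
elim: w p => [|a w IH] p /=; first by rewrite inE => /eqP ->.
by rewrite inE => /orP[/eqP ->//|/mapP[q /IH <- ->]].
Qed.

(** The group-like condition for functions on all words, which constrains only lengths up to [N];
    the algebra is then free of the truncated word type. *)
Definition shuffle_character {R : comRingType} N (g : seq A -> R) :=
  g [::] = 1 /\ forall u v, (size u + size v <= N)%N ->
    g u * g v = \sum_(w <- shuffle u v) g w.

Definition convol {R : comRingType} (g h : seq A -> R) w := \sum_(p <- cuts w) g p.1 * h p.2.

Lemma cuts_nil_left w : exists2 s, cuts w = ([::], w) :: s &
  forall p, p \in s -> (size p.2 < size w)%N.
Proof.
elim: w => [|a w [s e hs]]; first by exists [::].
exists [seq (a :: p.1, p.2) | p <- cuts w] => // p /mapP[q + ->] /=.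
by rewrite e inE => /orP[/eqP ->|/hs /ltnW]; rewrite ltnS.
Qed.

(** Replaces the antipode: increments of a group-valued path are characters because W_s and W_t are.
    The product [k u * k v] is expanded in two ways, through the shuffle product of [u] and [v] and
    as a product of two convolutions, and the claim is the equality of the top terms. *)
Lemma convol_quotient {R : comRingType} N (g h k : seq A -> R) :
    shuffle_character N g -> shuffle_character N k ->
    (forall w, (size w <= N)%N -> convol g h w = k w) ->
  shuffle_character N h.
Proof.
move=> [g0 gM] [k0 kM] ghk.
split; first by have := ghk [::] isT; rewrite /convol /= big_seq1 g0 mul1r k0.
move=> u v; have [n] := ubnP (size u + size v)%N.
elim: n u v => // n IH u v nuv uvN.
pose H p q := \sum_(w <- shuffle p q) h w.
have E : \sum_(p <- cuts u) \sum_(q <- cuts v) (g p.1 * g q.1) * H p.2 q.2 =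
    \sum_(p <- cuts u) \sum_(q <- cuts v) (g p.1 * g q.1) * (h p.2 * h q.2).
  transitivity (k u * k v).
    rewrite kM//; transitivity (\sum_(w <- shuffle u v) convol g h w); last first.
      by rewrite !big_seq; apply: eq_bigr => w /size_shuffle e; rewrite ghk ?e.
    rewrite /convol (sum_shuffle_cuts (fun x y => g x * h y)) big_seq [RHS]big_seq.
    apply: eq_bigr => p hp; rewrite big_seq [RHS]big_seq; apply: eq_bigr => q hq.
    rewrite gM; last first.
      by rewrite (leq_trans _ uvN)// -(cuts_size hp) -(cuts_size hq) leq_add// leq_addr.
    by rewrite mulr_suml; apply: eq_bigr => x _; rewrite mulr_sumr.
  rewrite -(ghk u) -?(ghk v) ?(leq_trans _ uvN) ?leq_addr ?leq_addl// /convol mulr_suml.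
  by apply: eq_bigr => p _; rewrite mulr_sumr; apply: eq_bigr => q _; ring.
(* The cuts with both left parts empty carry the top term; in all others the right parts are shorter
   in total, and the induction hypothesis cancels them. *)
have [su eu hu] := cuts_nil_left u; have [sv ev hv] := cuts_nil_left v.
move: E; rewrite eu ev !big_cons /= g0 !mul1r => E.
have small p q : (size p + size q < size u + size v)%N -> h p * h q = H p q.
  move=> pq; apply: IH; first exact: leq_trans pq _.
  exact: leq_trans (ltnW pq) uvN.
have E1 : \sum_(q <- sv) g q.1 * H u q.2 = \sum_(q <- sv) g q.1 * (h u * h q.2).
  rewrite !big_seq; apply: eq_bigr => q /hv hq; congr (_ * _).
  by rewrite small// ltn_add2l.
have E2 : \sum_(p <- su) \sum_(q <- ([::], v) :: sv) g p.1 * g q.1 * H p.2 q.2 =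
    \sum_(p <- su) \sum_(q <- ([::], v) :: sv) g p.1 * g q.1 * (h p.2 * h q.2).
  rewrite !big_seq; apply: eq_bigr => p /hu hp; rewrite -ev !big_seq; apply: eq_bigr => q hq.
  congr (_ * _); rewrite small// -addSn leq_add//.
  by rewrite -(cuts_size hq) leq_addl.
move: E; under eq_bigr do rewrite mul1r; under [X in _ = _ + X + _ -> _]eq_bigr do rewrite mul1r.
by rewrite E1 E2 => /addIr/addIr/esym.
Qed.

Lemma shuffle_character_prod {R : comRingType} N (g : seq A -> R) us :
    shuffle_character N g -> (sumn (map size us) <= N)%N ->
  \prod_(u <- us) g u = \sum_(w <- shuffles us) g w.
Proof.
move=> [g0 gM]; elim: us => [|u us IH] /= h; first by rewrite big_nil big_seq1.
rewrite big_cons IH ?(leq_trans _ h) ?leq_addl// mulr_sumr big_flatten /= big_map.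
rewrite !big_seq; apply: eq_bigr => w /size_shuffles e.
by rewrite gM// e.
Qed.

End ShuffleCharacters.

(** * Iterated derivatives along vector fields and the Faa di Bruno formula *)

Section WordDerivatives.
Context {R : realType}.
Implicit Types V W E : normedModType R.

Lemma ders_rcons (T : Type) (f : T -> T) (s : seq T) a :
  ders f (rcons s a) = rcons [seq rcons t a | t <- ders f s] (rcons s (f a)).
Proof.
elim: s => //= b s ->; rewrite map_rcons -!map_comp; congr (_ :: rcons _ _).
Qed.

(** Chain and Leibniz rules for D^l g evaluated at moving arguments: either the base point supplies
    a new argument, or one argument is differentiated. Expanding the last argument in coordinates
    removes it and allows an induction on the number of arguments. *)
Lemma Dn_compose_diff E V W (A : eqType) (g : V -> W) (Y : A -> E -> V) (Y0 : E -> V)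
    (bs : seq A) (x : E) : findim V -> Ck (size bs).+1 g ->
    (forall b, b \in bs -> differentiable (Y b) x) -> differentiable Y0 x ->
  let F := fun z => Dn g [seq Y b z | b <- bs] (Y0 z) in
  differentiable F x /\
  forall h u, (forall b, b \in bs -> 'd (Y b) x h = Y (u b) x) ->
   'd F x h = Dn g ('d Y0 x h :: [seq Y b x | b <- bs]) (Y0 x) +
     \sum_(cs <- ders u bs) Dn g [seq Y b x | b <- cs] (Y0 x).
Proof.
move=> fV; have [p [e [c [lc bc ec]]]] := fV.
elim/last_ind: bs g => [|bs b IH] g cg dY dY0 /=.
  have [dg _] := cg.
  have h1 : is_diff x (g \o Y0) ('d g (Y0 x) \o 'd Y0 x).
    have a1 : is_diff x Y0 ('d Y0 x) by exact/differentiableP.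
    have a2 : is_diff (Y0 x) g ('d g (Y0 x)) by exact/differentiableP.
    exact: is_diff_comp.
  split; first exact: ex_diff.
  by move=> h u _; rewrite big_nil addr0 -[LHS]/('d (g \o Y0) x h) (is_diff_eval _ h1).
rewrite size_rcons in cg.
have dYb : differentiable (Y b) x by apply: dY; rewrite mem_rcons mem_head.
have dY' b' : b' \in bs -> differentiable (Y b') x.
  by move=> hb; apply: dY; rewrite mem_rcons inE hb orbT.
have cgi i : Ck (size bs).+1 (dird g (e i)) by case: cg => _; apply.
pose G i z := Dn (dird g (e i)) [seq Y b z | b <- bs] (Y0 z).
have EF : (fun z => Dn g [seq Y b z | b <- rcons bs b] (Y0 z)) =
   fun z => \sum_i c i (Y b z) *: G i z.
  apply/funext => z; rewrite map_rcons (Dn_rcons_basis _ _ ec)// size_map.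
  exact: CkW cg.
have dG i : differentiable (G i) x by case: (IH _ (cgi i) dY' dY0).
have dc i : is_diff x (c i \o Y b) (c i \o 'd (Y b) x).
  exact: (is_diff_compc (lc i) (bc i) (differentiableP dYb)).
have dt i : is_diff x (fun z => c i (Y b z) *: G i z)
    (fun h => c i ('d (Y b) x h) *: G i x + c i (Y b x) *: 'd (G i) x h).
  exact: (is_diffZv (dc i) (differentiableP (dG i))).
have dS := diff_sum_eval (index_enum 'I_p) xpredT (fun i => @ex_diff _ _ _ _ _ _ _ (dt i)).
rewrite EF; split; first exact: ex_diff.
move=> h u hu; rewrite (is_diff_eval _ dS).
rewrite (eq_bigr _ (fun i _ => is_diff_eval h (dt i))).
rewrite big_split /= ders_rcons big_rcons /= big_map hu ?mem_rcons ?mem_head//.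
have hu' b' : b' \in bs -> 'd (Y b') x h = Y (u b') x.
  by move=> hb; apply: hu; rewrite mem_rcons inE hb orbT.
have E1 : \sum_i c i (Y (u b) x) *: G i x = Dn g [seq Y b x | b <- rcons bs (u b)] (Y0 x).
  by rewrite map_rcons (Dn_rcons_basis _ _ ec)// size_map; exact: CkW cg.
rewrite E1; under eq_bigr => i _.
  have [_ /(_ h u hu') ->] := IH _ (cgi i) dY' dY0.
  rewrite scalerDr scaler_sumr; over.
rewrite big_split /= exchange_big /=.
have E2 : \sum_i c i (Y b x) *: Dn (dird g (e i)) ('d Y0 x h :: [seq Y b x | b <- bs]) (Y0 x) =
   Dn g ('d Y0 x h :: [seq Y b x | b <- rcons bs b]) (Y0 x).
  by rewrite map_rcons -rcons_cons (Dn_rcons_basis _ _ ec)//= size_map.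
have E3 cs : cs \in ders u bs ->
   \sum_i c i (Y b x) *: Dn (dird g (e i)) [seq Y b x | b <- cs] (Y0 x) =
   Dn g [seq Y b x | b <- rcons cs b] (Y0 x).
  move=> hcs; rewrite map_rcons (Dn_rcons_basis _ _ ec)// size_map.
  suff -> : size cs = size bs by exact: CkW cg.
  by elim: (bs) cs hcs => [|a s IHs] cs //=; rewrite inE => /orP[/eqP ->|/mapP[t /IHs <- ->]].
rewrite -[in LHS]/(Dn _ (_ :: _) _) E2 addrCA; congr (_ + _).
rewrite big_seq (eq_bigr _ E3) -big_seq addrC; congr (_ + _).
Qed.

(** Iterated Lie derivatives along the fields [h a]; the last letter of the word acts first. *)
Fixpoint dwords E W (A : Type) (h : A -> E -> E) (q : E -> W) (w : seq A) : E -> W :=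
  if w is a :: w' then fun x => 'd (dwords h q w') x (h a x) else q.

Lemma parts_size (A : eqType) (w : seq A) bs : bs \in parts w ->
  (size bs <= size w)%N /\ forall b, b \in bs -> (size b <= size w)%N.
Proof.
elim: w bs => [|a w IH] bs /=; first by rewrite inE => /eqP ->.
move=> /flattenP[s /mapP[cs /IH[h1 h2] ->]]; rewrite inE => /orP[/eqP ->|].
  split => //= b; rewrite inE => /orP[/eqP ->//|/h2/leqW]; exact.
move=> hbs; split; first by rewrite (size_ders hbs) ltnW.
elim: cs bs hbs h2 {h1} => [|c cs IHcs] bs //=; rewrite inE => /orP[/eqP ->|/mapP[t ht ->]] h2 b.
  rewrite inE => /orP[/eqP ->|hb] /=; first by rewrite ltnS h2// mem_head.
  by rewrite ltnW// ltnS h2// inE hb orbT.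
rewrite inE => /orP[/eqP ->|hb]; first by rewrite ltnW// ltnS h2// mem_head.
by apply: (IHcs _ ht) => // b' hb'; apply: h2; rewrite inE hb' orbT.
Qed.

(* The chain rule along vector fields [h a] acting by [h a . Y b = Y (a :: b)]. *)
Lemma dwords_parts E V W (A : eqType) (m : nat) (h : A -> E -> E) (g : V -> W)
    (Y : seq A -> E -> V) : findim V -> Ck m g ->
    (forall b, (size b < m)%N -> (forall x, differentiable (Y b) x) /\
        forall a x, 'd (Y b) x (h a x) = Y (a :: b) x) ->
  forall w, (size w <= m)%N -> dwords h (g \o Y [::]) w =
    fun x => \sum_(bs <- parts w) Dn g [seq Y b x | b <- bs] (Y [::] x).
Proof.
move=> fV cg hY; elim=> [|a w IH] wm.
  by apply/funext => x; rewrite /= big_seq1.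
apply/funext => x /=; rewrite IH ?(ltnW wm)// big_flatten /= big_map.
have hbs bs : bs \in parts w -> Ck (size bs).+1 g /\ forall b, b \in bs -> (size b < m)%N.
  move=> /parts_size[h1 h2]; split; first by apply: CkW cg; rewrite (leq_ltn_trans h1).
  by move=> b /h2 hb; exact: leq_ltn_trans hb wm.
have dY b x' : (size b < m)%N -> differentiable (Y b) x' by move=> /hY[].
have m0 : (0 < m)%N by exact: leq_ltn_trans wm.
have D bs : bs \in parts w ->
    differentiable (fun z => Dn g [seq Y b z | b <- bs] (Y [::] z)) x /\
    'd (fun z => Dn g [seq Y b z | b <- bs] (Y [::] z)) x (h a x) =
    \sum_(cs <- ([:: a] :: bs) :: ders (cons a) bs) Dn g [seq Y b x | b <- cs] (Y [::] x).
  move=> /hbs[cgb hb].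
  have [d1 d2] := Dn_compose_diff fV cgb (fun b hb' => dY b x (hb b hb')) (dY [::] x m0).
  split=> //; rewrite (d2 _ (cons a)); last by move=> b /hb /hY[].
  by rewrite big_cons /=; have [_ ->] := hY [::] m0.
rewrite big_seq; under eq_bigr => bs hb do rewrite -(proj2 (D bs hb)).
pose F bs := if bs \in parts w then fun z => Dn g [seq Y b z | b <- bs] (Y [::] z) else cst 0.
have dF bs : differentiable (F bs) x.
  by rewrite /F; case: ifP => [/D[]|_].
have := diff_sum_eval (parts w) xpredT dF.
have -> : (fun y => \sum_(i <- parts w) F i y) =
    (fun x => \sum_(bs <- parts w) Dn g [seq Y b x | b <- bs] (Y [::] x)).
  by apply/funext => y; rewrite big_seq [RHS]big_seq; apply: eq_bigr => bs hb; rewrite /F hb.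
move=> hd; rewrite (is_diff_eval _ hd) big_seq; apply: eq_bigr => bs hb.
by rewrite /F hb.
Qed.

(** Ordered set partitions absorb the multiplicities, and the symmetry of the derivatives gives k!
    equal terms, which cancel 1/k!. The sum over set partitions carries no coefficients and is the
    form in which the chain rule is proved. *)
Lemma faa_di_bruno_parts (q N : nat) V W (g : V -> W) (z : tens q N V) (w : seq 'I_q) :
    findim W -> Ck (size w) g -> (size w <= N)%N ->
  faa_di_bruno g z w = \sum_(bs <- parts w) Dn g [seq coef z b | b <- bs] (z [bseq]).
Proof.
move=> fW cg wN; rewrite /faa_di_bruno; case: nilP => [->|wn]; first by rewrite /= big_seq1.
pose S (us : seq (seq 'I_q)) := Dn g [seq coef z b | b <- us] (z [bseq]).
have symS k : (k <= size w)%N -> front_sym k S.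
  move=> kw us a ws h; rewrite /S map_cat /= map_cat Dn_front //.
  by apply: CkW cg; rewrite size_cat /= !size_map; move: h; rewrite size_cat /= => ->.
transitivity (\sum_(1 <= k < (size w).+1) \sum_(bs <- parts w | size bs == k) S bs).
  apply: eq_big_nat => k /andP[k1 kw].
  transitivity ((k`!%:R)^-1 *: \sum_(us : k.-tuple (N.-bseq 'I_q) |
       all (fun u : N.-bseq 'I_q => ~~ nilp u) us)
    S [seq bseqval u | u <- us] *+ count_mem w (shuffles [seq bseqval u | u <- us]) : W).
    congr (_ *: _); rewrite big_mkcondr; apply: eq_bigr => us _.
    case: ifP => [_|/negbT/count_memPn ->]; last by rewrite mulr0n.
    rewrite scaler_nat; congr (_ *+ _).
    rewrite /S -map_comp; congr (Dn g _ _); apply: eq_map => u /=.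
    by rewrite /coef valK.
  rewrite (sum_tuples_oparts _ S wN) (sum_oparts_parts _ (symS k _))// -[X in _ *: X]scaler_nat scalerA.
  by rewrite mulVf ?scale1r// pnatr_eq0 -lt0n fact_gt0.
have sz bs : bs \in parts w -> (0 < size bs < (size w).+1)%N.
  move=> hb; have [h1 _] := parts_size hb; rewrite ltnS h1 andbT.
  case: bs hb {h1} => // hb; exfalso; case: (w) wn hb => // a w' _ /flattenP[s /mapP[cs _ ->]].
  by rewrite inE => /orP[//|]; case: cs => // c cs /size_ders.
under eq_bigr do rewrite big_mkcond big_seq.
rewrite exchange_big /= [RHS]big_seq; apply: eq_bigr => bs /sz /andP[b0 bw].
rewrite -big_mkcond /=; under eq_bigl do rewrite eq_sym.
by rewrite big_nat1_eq b0 bw.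
Qed.
End WordDerivatives.

(** * Reindexing of sums over words of bounded length *)

Section WordSums.
Context {A : finType}.
Implicit Types (u v w : seq A).

Lemma count_cuts u v w : count_mem (u, v) (cuts w) = (u ++ v == w).
Proof.
elim: w u => [|a w IH] u /=.
  by rewrite addn0; case: u => // ; case: v.
rewrite count_map_consl; case: u => [|b u] /=; first by rewrite addn0 eq_sym.
by rewrite add0n eqseq_cons IH; case: (b == a).
Qed.

Lemma sum_pairs_cuts {Z : nmodType} N (G : seq A -> seq A -> Z) w : (size w <= N)%N ->
  \sum_(p : N.-bseq A * N.-bseq A | p.1 ++ p.2 == w :> seq A) G p.1 p.2 =
  \sum_(p <- cuts w) G p.1 p.2.
Proof.
move=> wN; transitivity (\sum_(p <- cuts w) \sum_(q : N.-bseq A * N.-bseq A)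
   if p == (q.1 : seq A, q.2 : seq A) then G q.1 q.2 else 0).
  rewrite exchange_big /= big_mkcond; apply: eq_bigr => q _.
  rewrite -big_mkcond /= big_const_seq iter_addr_0 -[count _ _]/(count_mem _ _) count_cuts.
  by case: eqP; rewrite ?mulr1n// mulr0n.
rewrite big_seq [RHS]big_seq; apply: eq_bigr => p /cuts_size hp; rewrite -big_mkcond /=.
have h1 : (size p.1 <= N)%N by rewrite (leq_trans _ wN)// -hp leq_addr.
have h2 : (size p.2 <= N)%N by rewrite (leq_trans _ wN)// -hp leq_addl.
by rewrite (big_pred1 (Bseq h1, Bseq h2)).
Qed.

Lemma sum_words_cuts {Z : nmodType} N M (G : seq A -> seq A -> Z) : (M <= N)%N ->
  \sum_(w : N.-bseq A | (size w <= M)%N) \sum_(p <- cuts w) G p.1 p.2 =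
  \sum_(v : N.-bseq A) \sum_(u : N.-bseq A | (size u + size v <= M)%N) G u v.
Proof.
move=> MN; under eq_bigr do rewrite -(sum_pairs_cuts (N := N)) ?size_bseq//.
rewrite (exchange_big_dep xpredT) //= [RHS]pair_big_dep /=.
rewrite [RHS](reindex (fun p : N.-bseq A * N.-bseq A => (p.2, p.1))) /=; last first.
  by exists (fun p : N.-bseq A * N.-bseq A => (p.2, p.1)) => -[].
rewrite [RHS]big_mkcond; apply: eq_bigr => -[u v] _ /=; case: ifP => uvM.
  have h : (size (u ++ v) <= N)%N by rewrite size_cat (leq_trans uvM).
  rewrite (big_pred1 (Bseq h)) // => w /=; rewrite -val_eqE /= eq_sym.
  by case: eqP => [->|]; rewrite ?andbF// size_cat uvM.
rewrite big_pred0 // => w; apply/negP => /andP[wM /eqP e].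
by move: uvM; rewrite -size_cat e wM.
Qed.

Lemma sum_widen_words {Z : nmodType} N M (G : seq A -> Z) : (M <= N)%N ->
  \sum_(w : M.-bseq A) G (w : seq A) =
  \sum_(w : N.-bseq A | (size w <= M)%N) G (w : seq A).
Proof.
move=> MN; pose h (w : M.-bseq A) : N.-bseq A := Bseq (leq_trans (size_bseq w) MN).
(* [insubd] falls back to the empty word on words longer than [M], which the range of summation
   excludes. *)
rewrite [RHS](reindex_onto h (fun w : N.-bseq A => insubd ([bseq] : M.-bseq A) (w : seq A))) /=; last first.
  by move=> w wM; apply: val_inj; rewrite /= val_insubd wM.
apply: eq_big => // w; rewrite size_bseq /=; apply/esym/eqP.
by apply: val_inj; rewrite /= val_insubd size_bseq.
Qed.

End WordSums.

Lemma sum_tuple_rcons {Z : nmodType} (T : finType) k (P : seq T -> bool) (F : seq T -> Z) :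
  \sum_(t : k.+1.-tuple T | P t) F t =
  \sum_(x : T) \sum_(t : k.-tuple T | P (rcons t x)) F (rcons t x).
Proof.
rewrite pair_big_dep /=.
rewrite (reindex (fun p : T * k.-tuple T => [tuple of rcons p.2 p.1])) /=; first by [].
exists (fun t : k.+1.-tuple T => (last (thead t) (behead t), [tuple of belast (thead t) (behead t)])).
  move=> [x t] _ /=; set t' := [tuple of rcons t x].
  have e : thead t' :: behead t' = rcons t x by rewrite -[RHS]/(tval t') [in RHS](tuple_eta t').
  have /rcons_inj[e1 e2] : rcons (belast (thead t') (behead t')) (last (thead t') (behead t')) = rcons t x.
    by rewrite -lastI e.
  by congr pair => //; apply: val_inj.
by move=> t _; apply: val_inj => /=; rewrite -lastI [in RHS](tuple_eta t).
Qed.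

Lemma Dn_multilinear {R : realType} {V W : normedModType R} (I : finType) (P : pred I)
    (a : I -> R) (e : I -> V) (g : V -> W) j x : Ck j g ->
  Dn g (nseq j (\sum_(i | P i) a i *: e i)) x =
  \sum_(us : j.-tuple I | all P us) (\prod_(i <- us) a i) *: Dn g [seq e i | i <- us] x.
Proof.
set v := \sum_(i | P i) _; elim: j g => [|j IH] g cg.
  rewrite (big_pred1 [tuple]) /=; first by rewrite big_nil scale1r.
  by move=> t; rewrite [t]tuple0 /= eqxx.
rewrite (sum_tuple_rcons j (fun us => all P us)
  (fun us => (\prod_(i <- us) a i) *: Dn g [seq e i | i <- us] x)).
have -> : nseq j.+1 v = rcons (nseq j v) v by rewrite -cats1 -[[:: v]]/(nseq 1 v) -nseqD addn1.
rewrite Dn_rcons.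
have -> : dird g v = fun x => \sum_i (if P i then a i else 0) *: dird g (e i) x.
  apply/funext => y; rewrite /dird /v linear_sum big_mkcond; apply: eq_bigr => i _.
  by case: ifP => _; [rewrite linearZ|rewrite scale0r].
rewrite Dn_sum; last by move=> i; rewrite size_nseq; case: cg => _; apply.
apply: eq_bigr => i _; rewrite IH; last by case: cg => _; apply.
under [RHS]eq_bigl do rewrite all_rcons.
case: ifP => Pi; last by rewrite scale0r big_pred0.
rewrite scaler_sumr; apply: eq_bigr => us _.
by rewrite map_rcons Dn_rcons big_rcons /= scalerA [_ * a i]mulrC.
Qed.

(** * Words in the driving vector fields *)

Section FieldWords.
Context {R : realType} {d : nat} {V : normedModType R}.
Implicit Type W : normedModType R.
Variables (fV : findim V) (f : 'I_d -> V -> V).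

Lemma Fw1 i : Fw f [:: i] = f i.
Proof. by apply/funext => x /=; rewrite (is_diff_eval _ (is_diff_id x)). Qed.

Lemma reg_dird_field W m B (g : V -> W) (h : V -> V) :
  reg m.+1 B g -> reg m B h -> reg m B (fun x => 'd g x (h x)).
Proof.
move=> [_ _ hg] hh; have [p [e [c [lc bc ec]]]] := fV.
rewrite (_ : (fun x => _) = fun x => \sum_i c i (h x) *: dird g (e i) x).
  apply: reg_sum => i _; apply: regZ; last exact: hg.
  by apply: (reg_postlin (L := c i : V -> R^o)); [exact: lc|exact: bc|exact: hh].
by apply/funext => x; rewrite -[LHS]/(dird g (h x) x) (dird_basis _ _ ec).
Qed.

(** The last letter contributes its field undifferentiated and every further letter costs one
    derivative, so a word of length p uses p - 1 derivatives of the fields. *)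
Lemma reg_Fw m B : (forall i, reg m B (f i)) ->
  forall i w, (size w <= m)%N -> reg (m - size w) B (Fw f (i :: w)).
Proof.
move=> hf i w; elim: w i => [|j w IH] i wm; first by rewrite Fw1 subn0.
have := IH j (ltnW wm); rewrite -[(m - size w)%N]prednK ?subn_gt0// => h.
rewrite -[(m - size (j :: w))%N]/(m - (size w).+1)%N subnS.
apply: reg_dird_field => //; apply: regW (hf i).
by rewrite (leq_trans (leq_pred _))// leq_subr.
Qed.

Lemma Fw_diff m : (forall i, reg m set0 (f i)) -> forall w x, (size w <= m)%N -> differentiable (Fw f w) x.
Proof.
move=> hf [|i w] x wm /=; first exact: (@ex_diff _ _ _ _ _ _ _ (is_diff_id x)).
by apply: reg_diff (reg_Fw hf i (ltnW wm)); rewrite subn_gt0.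
Qed.

Lemma dwords_Fw v w : dwords f (Fw f v) w = Fw f (w ++ v).
Proof. by elim: w => //= i w ->. Qed.

Lemma dwords_field W m (g : V -> W) w : (forall i, reg m.-1 set0 (f i)) -> Ck m g -> (size w <= m)%N ->
  dwords f g w = fun x => \sum_(bs <- parts w) Dn g [seq Fw f b x | b <- bs] x.
Proof.
move=> hf cg wm; rewrite (dwords_parts (m := m) (h := f) (g := g) (Y := Fw f))// => b bm; split.
  by move=> x; apply: (Fw_diff hf); rewrite -ltnS prednK// (leq_ltn_trans _ bm).
by [].
Qed.

End FieldWords.
(** * Davie expansions *)

Section ChainExpansion.
Context {R : realType} {d : nat} {V : normedModType R}.
Variables (fV : findim V) (f : 'I_d -> V -> V).
Implicit Type W : normedModType R.

(** Surplus powers of [om] are traded for constants, so that the estimates hold on intervals of any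
    length once [om] is bounded by [L]. *)
Lemma expr_le_expr (om L : R) p m M : 0 <= om -> om <= L -> 1 <= L ->
  (p <= m <= M)%N -> om ^+ m <= L ^+ M * om ^+ p.
Proof.
move=> om0 omL L1 /andP[pm mM]; rewrite -(subnK pm) exprD ler_wpM2r ?exprn_ge0//.
have L0 : 0 <= L by exact: le_trans L1.
rewrite (le_trans (lerXn2r _ _ _ omL))// ler_weXn2l//.
by rewrite (leq_trans (leq_subr _ _)).
Qed.

Lemma bounded_Fw N B : (forall i, reg N B (f i)) ->
  exists2 M, 0 <= M & forall x (w : N.-bseq 'I_d), B x -> ~~ nilp w -> `|Fw f w x| <= M.
Proof.
move=> hf; have hC (w : N.-bseq 'I_d) : exists C, ~~ nilp w -> forall x, B x -> `|Fw f w x| <= C.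
  case: w => -[|i w] wN; first by exists 0.
  by have [C hC] := reg_bounded (reg_Fw fV hf i (ltnW wN)); exists C => _; exact: hC.
have [C {}hC] := choice hC; exists (\sum_w `|C w|); first exact: sumr_ge0.
move=> x w Bx wn; rewrite (le_trans (hC w wn x Bx))// (bigD1 w)//=.
by rewrite (le_trans (ler_norm _))// lerDl sumr_ge0.
Qed.

Definition increment N (a : seq 'I_d -> R) (x : V) : V :=
  \sum_(w : N.-bseq 'I_d | ~~ nilp w) a w *: Fw f w x.

Lemma increment_bound N B (K L : R) : (forall i, reg N B (f i)) -> 0 <= K -> 1 <= L ->
  exists2 C, 0 <= C & forall (a : seq 'I_d -> R) om x, 0 <= om <= L ->
    (forall w, (size w <= N)%N -> `|a w| <= K * om ^+ size w) -> B x ->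
    `|increment N a x| <= C * om.
Proof.
move=> hf K0 L1; have [M M0 hM] := bounded_Fw hf.
have L0 : 0 <= L by exact: le_trans L1.
exists (\sum_(w : N.-bseq 'I_d) K * L ^+ N * M).
  by apply: sumr_ge0 => w _; rewrite !mulr_ge0// exprn_ge0.
move=> a om x /andP[om0 omL] ha Bx; rewrite (le_trans (ler_norm_sum _ _ _))//.
rewrite big_mkcond mulr_suml ler_sum// => w _; case: ifP => wn; last first.
  by rewrite !mulr_ge0// exprn_ge0.
rewrite normrZ mulrAC; apply: ler_pM => //; last exact: hM.
rewrite (le_trans (ha _ (size_bseq w)))// -mulrA ler_wpM2l//.
rewrite -[X in _ <= _ * X]expr1; apply: expr_le_expr => //.
by rewrite size_bseq andbT lt0n.
Qed.

Lemma prod_character_shuffles N r (a : seq 'I_d -> R) (us : seq (N.-bseq 'I_d)) :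
    (r <= N)%N -> shuffle_character N a ->
  (if (sumn [seq size u | u : N.-bseq 'I_d <- us] <= r)%N then \prod_(u <- us) a (u : N.-bseq 'I_d) else 0) =
  \sum_(w : N.-bseq 'I_d | (size w <= r)%N) a w *+ count_mem (w : seq 'I_d) (shuffles [seq bseqval u | u <- us]).
Proof.
move=> rN ha; set vs := [seq bseqval u | u <- us].
have -> : [seq size u | u : N.-bseq 'I_d <- us] = map size vs by rewrite -map_comp.
case: ifP => hr; last first.
  rewrite big1 // => w wr; have /count_memPn -> : (w : seq 'I_d) \notin shuffles vs.
    by apply/negP => /size_shuffles e; move: hr; rewrite -e wr.
  by rewrite mulr0n.
transitivity (\sum_(w <- shuffles vs) a w).
  by rewrite -(shuffle_character_prod ha) ?(leq_trans hr)// /vs big_map.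
transitivity (\sum_(v <- shuffles vs) \sum_(w : N.-bseq 'I_d | (size w <= r)%N) if v == w then a w else 0).
  rewrite !big_seq; apply: eq_bigr => v /size_shuffles e; rewrite -big_mkcondr /=.
  have vN : (size v <= N)%N by rewrite e (leq_trans hr).
  rewrite (big_pred1 (Bseq vN)) // => w /=; rewrite -val_eqE /= eq_sym.
  by case: eqP => [->|]; rewrite ?andbF// e hr.
rewrite exchange_big /=; apply: eq_bigr => w _.
by rewrite -big_mkcond big_const_seq iter_addr_0.
Qed.

Lemma sum_parts_size (Z : lmodType R) (A : eqType) r (w : seq A) (S : seq (seq A) -> Z) :
    (size w <= r)%N -> (forall k, (k <= size w)%N -> front_sym k S) ->
  \sum_(j < r.+1) (j`!%:R)^-1 *: \sum_(us <- oparts j w) S us = \sum_(bs <- parts w) S bs.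
Proof.
move=> wr hS.
transitivity (\sum_(j < r.+1) \sum_(bs <- parts w | size bs == j) S bs).
  apply: eq_bigr => j _; have [jw|jw] := leqP j (size w).
    rewrite (sum_oparts_parts _ (hS j jw)) -[X in _ *: X]scaler_nat scalerA.
    by rewrite mulVf ?scale1r// pnatr_eq0 -lt0n fact_gt0.
  rewrite [RHS]big_seq_cond [RHS]big_pred0; last first.
    move=> bs; apply/negP => /andP[/parts_size[h _] /eqP e].
    by move: jw; rewrite ltnNge -e h.
  suff -> : oparts j w = [::] by rewrite big_nil scaler0.
  case Eo : (oparts j w) => [//|us s]; exfalso.
  have hus : us \in oparts j w by rewrite Eo mem_head.
  move: jw; rewrite ltnNge => /negP; apply; move: hus.
  elim: (j : nat) (w) (us) {wr hS Eo} => // k IH v vs /flattenP[s' /mapP[p]].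
  rewrite mem_filter => /andP[pn hp] -> /mapP[ws hws _].
  rewrite -(splits_size hp) -add1n leq_add ?lt0n//.
  exact: IH hws.
under eq_bigr do rewrite big_mkcond.
rewrite exchange_big /= big_seq [RHS]big_seq; apply: eq_bigr => bs /parts_size[h _].
have hr : (size bs < r.+1)%N by rewrite ltnS (leq_trans h).
by rewrite -big_mkcond (big_pred1 (Ordinal hr)).
Qed.

(** Taylor's formula for the displacement [increment f N a x], expanded multilinearly over words. By
    the shuffle relations the products of the coefficients of u_1, ..., u_j of total length at most
    [r] are sums of single coefficients [a w], and they recombine to the set partition formula for
    [dwords f g w]. [C1] bounds the Taylor remainder, [C2] the products of total length above
    [r]. *)
Lemma chain_expansion W N r B (g : V -> W) (K L : R) : findim W -> (r <= N)%N ->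
    (forall i, reg N B (f i)) -> reg r.+1 B g -> 0 <= K -> 1 <= L ->
  exists2 C, 0 <= C & forall (a : seq 'I_d -> R) om x, 0 <= om <= L ->
    shuffle_character N a ->
    (forall w, (size w <= N)%N -> `|a w| <= K * om ^+ size w) ->
    (forall t, 0 <= t <= 1 -> B (x + t *: increment N a x)) ->
    `|g (x + increment N a x) - \sum_(w : N.-bseq 'I_d | (size w <= r)%N) a w *: dwords f g w x|
      <= C * om ^+ r.+1.
Proof.
move=> fW rN hf hg K0 L1; have [M M0 hM] := bounded_Fw hf.
have L0 : 0 <= L by exact: le_trans L1.
have [CD CD0 hCD] := increment_bound hf K0 L1.
have [KT KT0 hT] := @taylor R V W fW.
have hCg (j : 'I_r.+2) : exists C, 0 <= C /\ forall x vs, B x -> size vs = j -> `|Dn g vs x| <= C * \prod_(v <- vs) `|v|.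
  by have [C C0 hC] := reg_Dn_bound fV hg (ltn_ord j : (j <= r.+1)%N); exists C.
have [Cg {}hCg] := choice hCg.
pose C1 := KT ^+ r.+1 * (Cg ord_max * CD ^+ r.+1).
(* A product has at most [r] factors, each of a word of length at most [N], whence the power
   [r * N]. *)
pose C2 := \sum_(j < r.+1) \sum_(us : j.-tuple (N.-bseq 'I_d)) K ^+ j * L ^+ (r * N) * (Cg (widen_ord (leqnSn _) j) * M ^+ j).
exists (C1 + C2).
  rewrite addr_ge0// /C1 ?mulr_ge0 ?exprn_ge0//; first by case: (hCg ord_max).
  apply: sumr_ge0 => j _; apply: sumr_ge0 => us _; rewrite !mulr_ge0 ?exprn_ge0//.
  by case: (hCg (widen_ord (leqnSn _) j)).
move=> a om x /andP[om0 omL] cha ha hB; set D := increment N a x.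
have Bx : B x by have := hB 0; rewrite scale0r addr0; apply; rewrite lexx ler01.
have hD : `|D| <= CD * om by apply: hCD => //; rewrite om0.
have cg := reg_Ck hg.
have T1 : `|g (x + D) - \sum_(j < r.+1) (j`!%:R)^-1 *: Dn g (nseq j D) x| <= C1 * om ^+ r.+1.
  have := hT _ g x D (Cg ord_max * (CD * om) ^+ r.+1) cg.
  move=> /(_ _ 1); rewrite scale1r ler01 lexx exprMn /C1 -!mulrA => T.
  rewrite (eq_bigr (fun j : 'I_r.+1 => (1 ^+ j / j`!%:R) *: Dn g (nseq j D) x)); last first.
    by move=> j _; rewrite expr1n mul1r.
  apply: T => // t t01; have [Cg0 /(_ (x + t *: D) (nseq r.+1 D) (hB t t01))] := hCg ord_max.
  rewrite size_nseq => /(_ erefl) h; rewrite (le_trans h)// ler_wpM2l// big_nseq.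
  by rewrite iter_mulr_1 -exprMn lerXn2r ?nnegrE ?mulr_ge0.
pose S us := Dn g [seq Fw f u x | u <- us] x.
pose tot (us : seq (N.-bseq 'I_d)) := sumn [seq size u | u : N.-bseq 'I_d <- us].
have E : \sum_(w : N.-bseq 'I_d | (size w <= r)%N) a w *: dwords f g w x =
    \sum_(j < r.+1) (j`!%:R)^-1 *: \sum_(us : j.-tuple (N.-bseq 'I_d) | all (fun u : N.-bseq 'I_d => ~~ nilp u) us)
       (if (tot us <= r)%N then \prod_(u <- us) a (u : N.-bseq 'I_d) else 0) *: S [seq bseqval u | u <- us].
  transitivity (\sum_(w : N.-bseq 'I_d | (size w <= r)%N) a w *:
      \sum_(j < r.+1) (j`!%:R)^-1 *: \sum_(us : j.-tuple (N.-bseq 'I_d) | all (fun u : N.-bseq 'I_d => ~~ nilp u) us)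
       S [seq bseqval u | u <- us] *+ count_mem (w : seq 'I_d) (shuffles [seq bseqval u | u <- us])).
    apply: eq_bigr => w wr; congr (_ *: _).
    have hf' i : reg r set0 (f i) by apply: reg_sub (regW rN (hf i)).
    rewrite (dwords_field fV (m := r.+1) hf' cg); last by rewrite (leq_trans wr).
    rewrite -(sum_parts_size wr); last first.
      move=> k kw us u ws h; rewrite /S map_cat /= map_cat Dn_front //.
      by apply: CkW cg; rewrite size_cat /= !size_map; move: h; rewrite size_cat /= => ->; rewrite (leq_trans kw)// (leq_trans wr).
    by apply: eq_bigr => j _; rewrite sum_tuples_oparts// size_bseq.
  under eq_bigr do rewrite scaler_sumr.
  rewrite exchange_big /=; apply: eq_bigr => j _.
  under eq_bigr do rewrite scalerA mulrC -scalerA scaler_sumr.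
  rewrite -scaler_sumr exchange_big /=; congr (_ *: _); apply: eq_bigr => us _.
  rewrite (prod_character_shuffles us rN cha) scaler_suml; apply: eq_bigr => w _.
  by rewrite -scalerMnr scalerMnl.
have T2 : `|\sum_(j < r.+1) (j`!%:R)^-1 *: Dn g (nseq j D) x -
    \sum_(w : N.-bseq 'I_d | (size w <= r)%N) a w *: dwords f g w x| <= C2 * om ^+ r.+1.
  rewrite E -sumrB (le_trans (ler_norm_sum _ _ _))// mulr_suml; apply: ler_sum => j _.
  have jr : (j <= r.+1)%N by rewrite ltnW.
  rewrite /D /increment Dn_multilinear; last exact: CkW cg.
  rewrite -scalerBr -sumrB normrZ (le_trans (ler_piMl _ _))//.
    rewrite ger0_norm ?invr_ge0// invf_le1 ?ltr0n ?fact_gt0// ler1n fact_gt0.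
    by [].
  rewrite (le_trans (ler_norm_sum _ _ _))// big_mkcond mulr_suml; apply: ler_sum => us _.
  have [Cg0 hCgj] := hCg (widen_ord (leqnSn _) j).
  have pos : 0 <= K ^+ j * L ^+ (r * N) * (Cg (widen_ord (leqnSn _) j) * M ^+ j) * om ^+ r.+1.
    by rewrite !mulr_ge0 ?exprn_ge0.
  case: ifP => // nus; rewrite /S -map_comp -scalerBl.
  have [tr|tr] := leqP (tot us) r; first by rewrite subrr scale0r normr0.
  rewrite subr0 normrZ mulrAC; apply: ler_pM => //.
    have totj : (tot us <= r * N)%N.
      have : (tot us <= j * N)%N.
        rewrite /tot -{2}(size_tuple us); elim: (tval us) => //= u s IHs.
        by rewrite mulSn leq_add// size_bseq.
      by move=> /leq_trans; apply; rewrite leq_mul2r -ltnS ltn_ord orbT.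
    have h1 : `|\prod_(u <- us) a (u : N.-bseq 'I_d)| <= K ^+ j * om ^+ tot us.
      rewrite normr_prod -[X in K ^+ X](size_tuple us) /tot; elim: (tval us) => [|u s IHs] /=.
        by rewrite big_nil mul1r.
      rewrite big_cons exprS exprD mulrACA; apply: ler_pM => //; first exact: prodr_ge0.
      exact: (ha _ (size_bseq u)).
    rewrite (le_trans h1)// -mulrA ler_wpM2l ?exprn_ge0//.
    by apply: expr_le_expr => //; rewrite tr.
  apply: (le_trans (hCgj _ _ Bx _)); first by rewrite size_map size_tuple.
  rewrite ler_wpM2l// big_map -[X in M ^+ X](size_tuple us).
  elim: (tval us) nus => [|u s IHs] /=; first by rewrite big_nil.
  move=> /andP[un sn]; rewrite big_cons exprS.
  by apply: ler_pM => //; [exact: prodr_ge0|exact: hM|exact: IHs].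
rewrite mulrDl -[X in `|X|](subrKA (\sum_(j < r.+1) (j`!%:R)^-1 *: Dn g (nseq j D) x)).
by rewrite (le_trans (ler_normD _ _))// lerD.
Qed.

End ChainExpansion.

(** * One-step maps, their local error and their tangent maps *)

Section DavieMaps.
Context {R : realType} {d : nat}.
Implicit Types V W : normedModType R.

Definition davie_map V (N : nat) (f : 'I_d -> V -> V) (a : seq 'I_d -> R) (x : V) : V :=
  \sum_(w : N.-bseq 'I_d) a w *: Fw f w x.

Lemma davie_mapE V N (f : 'I_d -> V -> V) (a : seq 'I_d -> R) x : a [::] = 1 ->
  davie_map N f a x = x + increment f N a x.
Proof.
move=> a0; rewrite /davie_map /increment (bigD1 [bseq])//= a0 scale1r; congr (_ + _).
apply: eq_bigl => w; rewrite -val_eqE /=.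
by case: (bseqval w).
Qed.

Lemma davie_map_id V N (f : 'I_d -> V -> V) (a : seq 'I_d -> R) x :
  (forall w, (size w <= N)%N -> a w = (nilp w)%:R) -> davie_map N f a x = x.
Proof.
move=> ha; rewrite davie_mapE ?ha// /increment big1 ?addr0// => w wn.
by rewrite ha ?size_bseq// (negbTE wn) scale0r.
Qed.

(** Each [F_v] is expanded at the intermediate point to order N - |v|; multiplied by [b v], of order
    |v|, its remainder has order N + 1. The terms a(u) b(v) F_uv(x) with |u| + |v| <= N that remain
    add up to the one-step map of [c], by Chen's relation. *)
Lemma local_error V N B (f : 'I_d -> V -> V) (K L : R) : findim V ->
    (forall i, reg N B (f i)) -> 0 <= K -> 1 <= L ->
  exists2 C, 0 <= C & forall (a b c : seq 'I_d -> R) om x, 0 <= om <= L ->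
    shuffle_character N a -> shuffle_character N b ->
    (forall w, (size w <= N)%N -> c w = convol a b w) ->
    (forall w, (size w <= N)%N -> `|a w| <= K * om ^+ size w) ->
    (forall w, (size w <= N)%N -> `|b w| <= K * om ^+ size w) ->
    (forall t, 0 <= t <= 1 -> B (x + t *: increment f N a x)) ->
    `|davie_map N f b (davie_map N f a x) - davie_map N f c x| <= C * om ^+ N.+1.
Proof.
move=> fV hf K0 L1.
have hC (v : N.-bseq 'I_d) : exists C, 0 <= C /\ (~~ nilp v ->
   forall (a : seq 'I_d -> R) om x, 0 <= om <= L -> shuffle_character N a ->
    (forall w, (size w <= N)%N -> `|a w| <= K * om ^+ size w) ->
    (forall t, 0 <= t <= 1 -> B (x + t *: increment f N a x)) ->
    `|Fw f v (x + increment f N a x) - \sum_(w : N.-bseq 'I_d | (size w <= N - size v)%N) a w *: dwords f (Fw f v) w x|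
      <= C * om ^+ (N - size v).+1).
  case: v => -[|i v] vN; first by exists 0.
  have hg : reg (N - size (i :: v)).+1 B (Fw f (i :: v)).
    by rewrite subnSK//; apply: reg_Fw => //; exact: ltnW.
  have [C C0 hC] := chain_expansion fV fV (leq_subr (size (i :: v)) N) hf hg K0 L1.
  by exists C; split.
have [C {}hC] := choice hC.
exists (\sum_v K * C v).
  by apply: sumr_ge0 => v _; rewrite mulr_ge0//; case: (hC v).
move=> a b c om x /andP[om0 omL] ca cb hc ha hb hB.
have a0 : a [::] = 1 by case: ca.
rewrite (davie_mapE _ _ _ a0); set y := x + _.
have -> : davie_map N f c x = \sum_(v : N.-bseq 'I_d) b v *:
    \sum_(u : N.-bseq 'I_d | (size u + size v <= N)%N) a u *: Fw f (u ++ v) x.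
  transitivity (\sum_(w : N.-bseq 'I_d | (size w <= N)%N)
      \sum_(p <- cuts (w : seq 'I_d)) (a p.1 * b p.2) *: Fw f (p.1 ++ p.2) x).
    rewrite /davie_map; apply: eq_big => [w|w _]; first by rewrite size_bseq.
    rewrite hc ?size_bseq// /convol scaler_suml !big_seq; apply: eq_bigr => p hp.
    congr (_ *: Fw f _ x); apply/eqP; rewrite eq_sym.
    have := count_cuts p.1 p.2 w; rewrite -surjective_pairing.
    by case: eqP => // _ /count_memPn; rewrite hp.
  rewrite (sum_words_cuts (fun u v => (a u * b v) *: Fw f (u ++ v) x) (leqnn N)).
  apply: eq_bigr => v _; rewrite scaler_sumr; apply: eq_bigr => u _.
  by rewrite scalerA mulrC.
rewrite /davie_map -sumrB (le_trans (ler_norm_sum _ _ _))// mulr_suml.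
apply: ler_sum => v _; rewrite -scalerBr normrZ.
have -> : \sum_(u : N.-bseq 'I_d | (size u + size v <= N)%N) a u *: Fw f (u ++ v) x =
    \sum_(w : N.-bseq 'I_d | (size w <= N - size v)%N) a w *: dwords f (Fw f v) w x.
  apply: eq_big => [u|u _]; last by rewrite dwords_Fw.
  by rewrite leq_subRL ?size_bseq// addnC.
(* For the empty word the expansion is exact: both terms are the intermediate point [y]. *)
have [C0 hv] := hC v; have := size_bseq v; case: (boolP (nilp v)) => [/nilP v0 _|vn vN].
  rewrite v0 subn0 (_ : \sum_(w : N.-bseq 'I_d | _) _ = y); last first.
    rewrite /y -(davie_mapE N f x a0); apply: eq_big => [w|w _]; first by rewrite size_bseq.
    by rewrite dwords_Fw cats0.
  by rewrite subrr normr0 mulr0 mulr_ge0 ?exprn_ge0// mulr_ge0.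
have := hv vn a om x; rewrite om0 omL => /(_ isT ca ha hB) h.
rewrite (le_trans (ler_pM _ _ (hb _ vN) h))//.
by rewrite mulrACA -exprD addnS subnKC.
Qed.

Definition tangent V W (g : V -> W) (p : V * V) : W * W := (g p.1, 'd g (p.1) p.2).

Lemma is_diff_fst V W (p : V * W) : is_diff p (fun q : V * W => q.1) (fun q => q.1).
Proof.
apply: (is_diff_lin (L := fun q : V * W => q.1)) => [a u v//|].
by exists 1 => h; rewrite mul1r prod_normE le_max lexx.
Qed.

Lemma is_diff_snd V W (p : V * W) : is_diff p (fun q : V * W => q.2) (fun q => q.2).
Proof.
apply: (is_diff_lin (L := fun q : V * W => q.2)) => [a u v//|].
by exists 1 => h; rewrite mul1r prod_normE le_max lexx orbT.
Qed.

Lemma is_diff_dsnd V W (g : V -> W) (p : V * V) : findim V -> Ck 2 g ->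
  is_diff p (fun q : V * V => 'd g (q.1) q.2)
    (fun h => dird (dird g p.2) h.1 p.1 + 'd g (p.1) h.2).
Proof.
move=> [m [e [c [lc bc ec]]]] cg.
have dgi i : differentiable (dird g (e i)) p.1 by case: cg => _ /(_ (e i))[].
have h1 i : is_diff p (fun q : V * V => dird g (e i) q.1) (fun h => 'd (dird g (e i)) (p.1) h.1).
  have a1 := is_diff_fst p; have a2 : is_diff (p.1) (dird g (e i)) ('d (dird g (e i)) (p.1)).
    exact/differentiableP.
  exact: (is_diff_comp (f := fun q : V * V => q.1)).
have h2 i : is_diff p (fun q : V * V => c i q.2) (fun h => c i h.2).
  exact: (is_diff_compc (lc i) (bc i) (is_diff_snd p)).
have h3 i := is_diffZv (h2 i) (h1 i).
have h4 := diff_sum_eval (index_enum 'I_m) xpredT (fun i => @ex_diff _ _ _ _ _ _ _ (h3 i)).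
have -> : (fun q : V * V => 'd g (q.1) q.2) = fun q => \sum_i c i q.2 *: dird g (e i) q.1.
  by apply/funext => q; rewrite -[LHS]/(dird g q.2 q.1) (dird_basis _ _ ec).
apply: (is_diff_eq h4); apply/funext => h.
under eq_bigr do rewrite (is_diff_eval h (h3 _)).
rewrite big_split /= addrC; congr (_ + _).
  rewrite (dird_basis g p.2 ec).
  have h5 := diff_sum_eval (index_enum 'I_m) xpredT
    (fun i => @differentiableZ _ _ _ _ (c i p.2) _ (dgi i)).
  rewrite /dird -[RHS]/('d (fun x => \sum_i (c i p.2 *: dird g (e i)) x) (p.1) h.1).
  rewrite (is_diff_eval h.1 h5); apply: eq_bigr => i _.
  by rewrite diffZ.
by rewrite -[RHS]/(dird g h.2 p.1) (dird_basis _ _ ec).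
Qed.

Lemma is_diff_tangent V W (g : V -> W) (p : V * V) : findim V -> Ck 2 g ->
  is_diff p (tangent g) (fun h => ('d g (p.1) h.1, dird (dird g p.2) h.1 p.1 + 'd g (p.1) h.2)).
Proof.
move=> fV cg; have h1 := is_diff_dsnd p fV cg.
have h2 : is_diff p (fun q : V * V => g q.1) (fun h => 'd g (p.1) h.1).
  have a1 := is_diff_fst p; have a2 : is_diff (p.1) g ('d g (p.1)).
    by apply/differentiableP; case: cg.
  exact: (is_diff_comp (f := fun q : V * V => q.1)).
exact: is_diff_pair.
Qed.

Lemma is_diff_field V W (g : V -> W) (h : V -> V) x : findim V -> Ck 2 g -> differentiable h x ->
  is_diff x (fun y => 'd g y (h y)) (fun v => dird (dird g (h x)) v x + 'd g x ('d h x v)).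
Proof.
move=> fV cg dh; have h1 := is_diff_dsnd (x, h x) fV cg.
have h2 : is_diff x (fun y => (y, h y)) (fun v => (v, 'd h x v)).
  have a1 := is_diff_id x; have a2 : is_diff x h ('d h x) by exact/differentiableP.
  exact: is_diff_pair.
exact: (is_diff_comp (f := fun y => (y, h y))).
Qed.

(** In the fibre component of the induction step, the two sides differ by the order of
    differentiation in the directions [f i x] and [v], which [Schwarz] exchanges. *)
Lemma Fw_tangent V m (f : 'I_d -> V -> V) w : findim V ->
    (forall i, Ck m.+1 (f i)) -> (size w <= m.+1)%N ->
  Fw (fun i => tangent (f i)) w = tangent (Fw f w).
Proof.
move=> fV cf; have hf i : reg m.+1 set0 (f i) by exact/Ck_reg.
elim: w => [|i w IH] wm.
  apply/funext => -[x v] /=; rewrite /tangent /=.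
  by rewrite (is_diff_eval v (is_diff_id x)).
apply/funext => -[x v] /=; rewrite IH ?(ltnW wm)//.
have cw : Ck 2 (Fw f w).
  case: w wm {IH} => [|j w] wm; last first.
    apply: CkW (reg_Ck (reg_Fw fV hf j (w := w) _)); last by rewrite ltnW// ltnW.
    by rewrite ltn_subRL addn1.
  apply: (reg_Ck (B := set0)); apply: (reg_lin _ (L := id)) => //.
    by exists 1 => h; rewrite mul1r.
  by exists 0.
have dfx : differentiable (f i) x by case: (cf i).
rewrite (is_diff_eval _ (is_diff_tangent (x, v) fV cw)) /=; congr pair.
rewrite (is_diff_eval v (is_diff_field fV cw dfx)); congr (_ + _).
have fW := fV; by rewrite Schwarz.
Qed.

(** The fibre component is linear in the vector, so bounds are available only over bounded sets of
    vectors, even for a globally bounded [g]. *)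
Lemma reg_tangent V W m B M (g : V -> W) : findim V -> reg m.+1 B g ->
  reg m [set p : V * V | B p.1 /\ `|p.2| <= M] (tangent g).
Proof.
move=> [p [e [c [lc bc ec]]]] hg; have [_ _ dg] := hg.
have pre (U : normedModType R) (q : V -> U) : reg m B q -> reg m [set p : V * V | B p.1 /\ `|p.2| <= M] (fun z => q z.1).
  move=> hq; have := @reg_preaffine R (V * V)%type V U m [set p : V * V | B p.1 /\ `|p.2| <= M] B
    (fun z => z.1) 0 q.
  rewrite (_ : (fun x => q (x.1 + 0)) = fun z => q z.1); last by apply/funext => z; rewrite addr0.
  apply => //; last by move=> x [+ _]; rewrite addr0.
  by exists 1 => h; rewrite mul1r prod_normE le_max lexx.
apply: reg_pair; first exact: pre (regW (leqnSn m) hg).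
rewrite (_ : (fun x => _) = fun z => \sum_i c i z.2 *: dird g (e i) z.1); last first.
  by apply/funext => z; rewrite -[LHS]/(dird g z.2 z.1) (dird_basis _ _ ec).
apply: reg_sum => i _; apply: regZ; last exact: pre (dg (e i)).
have [C hC] := bc i; apply: (reg_lin _ (L := fun z : V * V => c i z.2 : R^o)).
- by move=> a u v /=; exact: lc.
- exists `|C| => h; rewrite (le_trans (hC _))// (le_trans (ler_wpM2r _ (ler_norm C)))//.
  by rewrite ler_wpM2l// prod_normE le_max lexx orbT.
- exists (`|C| * M) => z [_ zM]; rewrite (le_trans (hC _))// (le_trans (ler_wpM2r _ (ler_norm C)))//.
  by rewrite ler_wpM2l.
Qed.

Lemma is_diff_davie V N (f : 'I_d -> V -> V) a x : findim V -> (forall i, reg N set0 (f i)) ->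
  is_diff x (davie_map N f a) (fun v => \sum_(w : N.-bseq 'I_d) a w *: 'd (Fw f w) x v).
Proof.
move=> fV hf; have dF (w : N.-bseq 'I_d) : differentiable (a w *: Fw f w) x.
  by apply: differentiableZ; exact: (Fw_diff fV hf _ (size_bseq w)).
have h := diff_sum_eval (index_enum (N.-bseq 'I_d)) xpredT dF.
apply: (is_diff_eq h); apply/funext => v; apply: eq_bigr => w _.
by rewrite diffZ//; exact: (Fw_diff fV hf _ (size_bseq w)).
Qed.

Lemma davie_map_tangent V m N (f : 'I_d -> V -> V) a : findim V -> (N <= m.+1)%N ->
    (forall i, Ck m.+1 (f i)) ->
  davie_map N (fun i => tangent (f i)) a = tangent (davie_map N f a).
Proof.
move=> fV Nm cf; apply/funext => p; rewrite /davie_map.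
under eq_bigr => w _.
  rewrite (Fw_tangent fV cf); last by rewrite (leq_trans (size_bseq w)).
  over.
have hf i : reg N set0 (f i) by apply: regW Nm _; exact/Ck_reg.
rewrite {2}/tangent -[fun x => \sum_(w : N.-bseq 'I_d) a w *: Fw f w x]/(davie_map N f a).
rewrite (is_diff_eval _ (is_diff_davie a p.1 fV hf)) /davie_map.
apply: injective_projections => /=.
  by rewrite (big_morph (fun q : V * V => q.1) (id1 := 0) (op1 := +%R)).
by rewrite (big_morph (fun q : V * V => q.2) (id1 := 0) (op1 := +%R)).
Qed.

End DavieMaps.
(** * Approximate flows *)

Section Partitions.
Context {R : realType}.
Implicit Types (s t u h : R) (p q : seq R).

Definition step (dl : R) : rel R := fun u v => (u < v) && (v - u <= dl).

Lemma path_step_last dl s p : path (step dl) s p -> s <= last s p.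
Proof.
elim: p s => //= u p IH s /andP[/andP[su _] /IH]; exact: le_trans (ltW su).
Qed.

Lemma path_stepW dl dl' s p : dl <= dl' -> path (step dl) s p -> path (step dl') s p.
Proof.
move=> h; apply: sub_path => u v /andP[uv d]; rewrite /step uv /=; exact: le_trans h.
Qed.

Lemma path_step_cat dl s p q : path (step dl) s (p ++ q) =
  path (step dl) s p && path (step dl) (last s p) q.
Proof. exact: cat_path. Qed.

Lemma first_after dl s m p : path (step dl) s p -> s < m -> m <= last s p ->
  exists p1 u p2, [/\ p = p1 ++ u :: p2, last s p1 < m & m <= u].
Proof.
elim: p s => [|u p IH] s /=; first by move=> _ sm; rewrite leNgt sm.
move=> /andP[/andP[su _] hp] sm hm; have [mu|um] := leP m u.
  by exists [::], u, p.
by have [p1 [v [p2 [-> h1 h2]]]] := IH u hp um hm; exists (u :: p1), v, p2.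
Qed.

(* Young's argument: cut a partition at the interval containing the
   midpoint, so that both remaining pieces have at most half the length. *)
Lemma young_ind dl (P : R -> seq R -> Prop) :
    (forall s, P s [::]) ->
    (forall s p1 u p2, path (step dl) s (p1 ++ u :: p2) ->
       last s p1 - s <= (last u p2 - s) / 2 -> last u p2 - u <= (last u p2 - s) / 2 ->
       P s p1 -> P u p2 -> P s (p1 ++ u :: p2)) ->
  forall s p, path (step dl) s p -> P s p.
Proof.
move=> P0 PS s p; have [n] := ubnP (size p); elim: n s p => // n IH s p np hp.
case: p np hp => [|u0 p0] // np hp; set p := u0 :: p0 in np hp *.
have slt : s < last s p.
  by move: hp => /= /andP[/andP[su _] /path_step_last]; exact: lt_le_trans.
have m1 : s < (s + last s p) / 2 by rewrite midf_lt.
have m2 : (s + last s p) / 2 <= last s p by rewrite ltW// midf_lt.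
have [p1 [u [p2 [e h1 h2]]]] := first_after hp m1 m2.
have hp' := hp; rewrite e path_step_cat /= in hp'; case/and3P: hp' => hp1 hu hp2.
have le : last s p = last u p2 by rewrite e last_cat.
rewrite e; apply: PS; rewrite -?le -?e//; first by lra.
- by lra.
- by apply: IH => //; rewrite ltnS in np; apply: leq_trans np; rewrite e size_cat /= addnS ltnS leq_addr.
- by apply: IH => //; rewrite ltnS in np; apply: leq_trans np; rewrite e size_cat /= addnS ltnS leq_addl.
Qed.

(** Cutting at the first point beyond [s + h] gives pieces of length between h and 2h, except
    perhaps the last. The number of pieces is thus controlled by the length of the interval and not
    by the number of points. *)
Lemma chunk_ind h (P : nat -> R -> seq R -> Prop) : 0 < h ->
    (forall m s p, path (step h) s p -> last s p - s <= 2 * h -> P m s p) ->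
    (forall m s p q, path (step h) s (p ++ q) -> last s p - s <= 2 * h ->
       P m (last s p) q -> P m.+1 s (p ++ q)) ->
  forall m s p, path (step h) s p -> last s p - s <= m.+2%:R * h -> P m s p.
Proof.
move=> h0 P0 PS; elim=> [|m IH] s p hp hm; first exact: P0.
have [short|long] := leP (last s p - s) (2 * h); first exact: P0.
have [p1 [u [p2 [e h1 h2]]]] : exists p1 u p2, [/\ p = p1 ++ u :: p2, last s p1 < s + h & s + h <= u].
  by apply: first_after hp _ _; lra.
have e' : p = rcons p1 u ++ p2 by rewrite cat_rcons.
have hp' := hp; rewrite e path_step_cat /= in hp'; case/and3P: hp' => hp1 /andP[uu ud] hp2.
rewrite e'; apply: PS; rewrite -?e' ?last_rcons//; first by lra.
apply: IH => //; move: hm; rewrite e last_cat /= -[m.+3]addn1 natrD mulrDl mul1r; lra.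
Qed.

(** [q] is divided into consecutive pieces, one for each step of [p], the form on which comparisons
    of schemes recurse. Refinements are produced from inclusions of point sets by
    [refines_subset]. *)
Fixpoint refines s p q : Prop :=
  if p is t :: p' then exists q1 q2, [/\ q = q1 ++ q2, last s q1 = t & refines t p' q2]
  else q = [::].

Lemma refines_last s p q : refines s p q -> last s q = last s p.
Proof.
elim: p s q => [|t p IH] s q /=; first by move=> ->.
by move=> [q1 [q2 [-> e /IH <-]]]; rewrite last_cat e.
Qed.

Lemma refines_cat s p1 p2 q : refines s (p1 ++ p2) q ->
  exists q1 q2, [/\ q = q1 ++ q2, refines s p1 q1 & refines (last s p1) p2 q2].
Proof.
elim: p1 s q => [|t p IH] s q /=; first by move=> h; exists [::], q.
move=> [q1 [q2 [-> e /IH[r1 [r2 [-> h1 h2]]]]]].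
exists (q1 ++ r1), r2; split; rewrite ?catA//.
by exists q1, r1.
Qed.

Lemma refines_subset s p q : path <%R s p -> path <%R s q -> last s p = last s q ->
  {subset p <= q} -> refines s p q.
Proof.
elim: p s q => [|t p IH] s q /= hp hq hl hs.
  case: q hq hl {hs} => // u q /= /andP[su hq] e.
  suff : s < last u q by rewrite -e ltxx.
  move: (order_path_min lt_trans (hq : path <%R u q)) => /allP h.
  by have := mem_last u q; rewrite inE => /orP[/eqP -> //|/h]; exact: lt_trans.
have /andP[st hp'] := hp.
have tq : t \in q by apply: hs; rewrite mem_head.
case/path.splitP: tq hq hl hs => q1 q2 hq hl hs.
exists (rcons q1 t), q2; split; rewrite ?last_rcons//.
move: hq; rewrite cat_path last_rcons => /andP[hq1 hq2].
apply: IH => //; first by rewrite hl last_cat last_rcons.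
move=> v vp; have := hs v; rewrite inE vp orbT mem_cat => /(_ isT) /orP[|//].
have tv : t < v by have /allP := order_path_min lt_trans hp'; exact.
rewrite mem_rcons inE => /orP[/eqP vt|vq]; first by rewrite vt ltxx in tv.
move: hq1; rewrite -cats1 cat_path /= andbT => /andP[hq1 hlt].
suff : v < v by rewrite ltxx.
apply: (le_lt_trans _ (lt_trans hlt tv)).
case/path.splitP: vq hq1 => r1 r2; rewrite cat_path last_cat last_rcons => /andP[_ hr].
have := mem_last v r2; rewrite inE => /orP[/eqP -> //|h].
by apply: ltW; have /allP := order_path_min lt_trans hr; exact.
Qed.

Lemma path_step_lt dl s p : path (step dl) s p -> path <%R s p.
Proof. by apply: sub_path => u v /andP[]. Qed.

Lemma refines_step dl s p q : path (step dl) s p -> path <%R s q -> refines s p q ->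
  path (step dl) s q.
Proof.
elim: p s q => [|t p IH] s q /=; first by move=> _ _ ->.
move=> /andP[/andP[st ts] hp] hq [q1 [q2 [e h1 h2]]]; subst q.
move: hq; rewrite path_step_cat cat_path => /andP[hq1 hq2].
rewrite h1 in hq2 *; rewrite (IH _ _ hp hq2 h2) andbT.
have hall u : u \in s :: q1 -> s <= u <= t.
  rewrite inE => /orP[/eqP ->|uq]; first by rewrite lexx ltW.
  have su : s < u by have /allP := order_path_min lt_trans hq1; exact.
  rewrite (ltW su) /= -h1; case/path.splitP: uq hq1 {su h1} => r1 r2.
  rewrite cat_path last_cat last_rcons => /andP[_ hr].
  have := mem_last u r2; rewrite inE => /orP[/eqP -> //|h].
  by apply: ltW; have /allP := order_path_min lt_trans hr; exact.
have gen s' q' : path <%R s' q' -> (forall u, u \in s' :: q' -> s <= u <= t) ->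
    path (step dl) s' q'.
  elim: q' s' => //= u q' IHq s' /andP[su hq'] hu.
  have /andP[_ ut] : s <= u <= t by apply: hu; rewrite !inE eqxx orbT.
  have /andP[ss' _] : s <= s' <= t by apply: hu; rewrite !inE eqxx.
  rewrite /step su /= IHq//; last by move=> v hv; apply: hu; rewrite inE hv orbT.
  by rewrite andbT; apply: le_trans ts; rewrite lerB.
exact: gen.
Qed.

Lemma common_refinement dl s t p q : path (step dl) s p -> path (step dl) s q ->
    last s p = t -> last s q = t ->
  exists r, [/\ path (step dl) s r, refines s p r & refines s q r].
Proof.
move=> hp hq pt qt.
pose r := sort <=%R (undup (p ++ q)).
have hr : path <%R s r.
  rewrite lt_path_sortedE; apply/andP; split.
    apply/allP => u; rewrite mem_sort mem_undup mem_cat => /orP[]hu.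
      by have /allP := order_path_min lt_trans (path_step_lt hp); exact.
    by have /allP := order_path_min lt_trans (path_step_lt hq); exact.
  by rewrite lt_sorted_uniq_le sort_uniq undup_uniq sort_le_sorted.
have mr u : (u \in r) = (u \in p) || (u \in q) by rewrite mem_sort mem_undup mem_cat.
have le_last v p' : v \in p' -> path <%R s p' -> v <= last s p'.
  move=> hv h; case/path.splitP: hv h => r1 r2.
  rewrite cat_path last_cat last_rcons => /andP[_ h].
  have := mem_last v r2; rewrite inE => /orP[/eqP -> //|hv].
  by apply: ltW; have /allP := order_path_min lt_trans h; exact.
have rt : last s r = t.
  apply/eqP; rewrite eq_le; apply/andP; split.
    have := mem_last s r; rewrite inE => /orP[/eqP ->|].
      by rewrite -pt; exact: path_step_last hp.
    rewrite mr => /orP[h|h].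
      by rewrite -pt; apply: (le_last _ _ h); exact: path_step_lt hp.
    by rewrite -qt; apply: (le_last _ _ h); exact: path_step_lt hq.
  have := mem_last s p; rewrite pt inE => /orP[/eqP ->|tp].
    elim: (r) (s) hr => //= u r' IH s' /andP[su /IH]; exact: le_trans (ltW su).
  by apply: le_last => //; rewrite mr tp.
have rp : refines s p r.
  by apply: refines_subset; rewrite ?rt//; [exact: path_step_lt hp|move=> u up; rewrite mr up].
have rq : refines s q r.
  by apply: refines_subset; rewrite ?rt//; [exact: path_step_lt hq|move=> u up; rewrite mr up orbT].
by exists r; split => //; exact: refines_step hp hr rp.
Qed.

Lemma fine_partition dl s t : 0 < dl -> s <= t ->
  exists p, path (step dl) s p /\ last s p = t.
Proof.
move=> dl0; have : t - s <= (Num.truncn ((t - s) / dl)).+1%:R * dl.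
  by rewrite -ler_pdivrMr// ltW// truncnS_gt.
move: (Num.truncn _).+1 => n h st; elim: n s h st => [|n IH] s h st; first by exists [::]; split => //=; lra.
have [ts|ts] := leP (t - s) dl.
  move: st; rewrite le_eqVlt => /predU1P[<-|st]; first by exists [::].
  by exists [:: t]; rewrite /= /step st ts.
have [| |p [hp pt]] := IH (s + dl).
- by move: h; rewrite -addn1 natrD mulrDl mul1r; lra.
- by lra.
- by exists (s + dl :: p); split => //=; rewrite hp /step andbT ltrDl dl0 addrAC subrr add0r lexx.
Qed.

End Partitions.

(** * Nonlinear sewing: schemes and cocycles along partitions *)

Section Sewing.
Context {R : realType}.
Implicit Types (E V : normedModType R).
Variables (T : R) (th : R -> R) (ka : R).

(* [th] controls the local errors: [th h = h `^ a] with [a > 1]. *)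
Record gauge : Prop := Gauge {
  gauge_ge0 : forall h, 0 <= h -> 0 <= th h;
  gauge_le : forall h h', 0 <= h -> h <= h' -> th h <= th h';
  gauge_half : forall h, 0 <= h -> th (h / 2) <= ka * th h;
  gauge_ka : 0 < ka < 2^-1;
  gauge_small : forall e, 0 < e -> exists2 dl, 0 < dl & forall h, 0 <= h -> h <= dl -> th h <= e * h }.
Hypothesis hth : gauge.

Fixpoint scheme E (mu : R -> R -> E -> E) s p x : E :=
  if p is t :: p' then scheme mu t p' (mu s t x) else x.

Lemma scheme_cat E (mu : R -> R -> E -> E) s p q x :
  scheme mu s (p ++ q) x = scheme mu (last s p) q (scheme mu s p x).
Proof. by elim: p s x => //= t p IH s x. Qed.

(** The product of the fibre maps [A] along the trajectory of [x]; when [A] is the derivative of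
    [mu], this is the derivative of the scheme. *)
Fixpoint cocycle E V (mu : R -> R -> E -> E) (A : R -> R -> E -> V -> V) s p x v : V :=
  if p is t :: p' then cocycle mu A t p' (mu s t x) (A s t x v) else v.

Lemma cocycle_cat E V (mu : R -> R -> E -> E) (A : R -> R -> E -> V -> V) s p q x v :
  cocycle mu A s (p ++ q) x v =
  cocycle mu A (last s p) q (scheme mu s p x) (cocycle mu A s p x v).
Proof. by elim: p s x v => //= t p IH s x v. Qed.

Definition stable E (mu : R -> R -> E -> E) dl (S : R -> set E) :=
  forall s t x, 0 <= s -> s <= t -> t <= T -> t - s <= dl -> S s x -> S t (mu s t x).

Lemma stable_scheme E (mu : R -> R -> E -> E) dl S s p x : stable mu dl S ->
  0 <= s -> path (step dl) s p -> last s p <= T -> S s x -> S (last s p) (scheme mu s p x).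
Proof.
move=> hS; elim: p s x => //= t p IH s x s0 /andP[/andP[st ts] hp] lT Sx.
apply: IH => //; first exact: le_trans (ltW st).
by apply: hS => //; [exact: ltW|exact: le_trans (path_step_last hp) lT].
Qed.

(** By Young's induction the scheme is compared with the one-step map through two pieces of at most
    half the length and the interval between them; halving gives the factor [ka], and two local
    errors rejoin the three parts. *)
Lemma scheme_close E (mu : R -> R -> E -> E) dl (S : R -> set E) C lam : stable mu dl S ->
    (forall s x, mu s s x = x) -> 0 <= C -> 0 <= lam -> (1 + lam) * ka < 1 ->
    (forall s u t x, 0 <= s -> s <= u -> u <= t -> t <= T -> t - s <= dl -> S s x ->
       `|mu u t (mu s u x) - mu s t x| <= C * th (t - s)) ->
    (forall s t x y, 0 <= s -> s <= t -> t <= T -> t - s <= dl -> S s x -> S s y ->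
       `|mu s t x - mu s t y| <= lam * `|x - y|) ->
  exists2 K, 0 <= K & forall s p x, 0 <= s -> path (step dl) s p -> last s p <= T ->
    last s p - s <= dl -> S s x -> `|scheme mu s p x - mu s (last s p) x| <= K * th (last s p - s).
Proof.
move=> hS mid C0 lam0 hk h1 h2; have kl : 0 < 1 - (1 + lam) * ka by rewrite subr_gt0.
(* [K] solves K (1 + lam) ka + 2 C = K: the two pieces contribute K ka and lam K ka, the two local
   errors [C] each. *)
pose K := 2 * C / (1 - (1 + lam) * ka).
have K0 : 0 <= K by rewrite divr_ge0 ?mulr_ge0// ltW.
have KE : K * (1 + lam) * ka + 2 * C = K by rewrite /K; field; rewrite gt_eqF.
exists K => // s p + + hp; move: s p hp; apply: young_ind => [s x s0 _ _ _|].
  by rewrite /= mid subrr normr0 mulr_ge0// gauge_ge0// subrr.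
move=> s p1 u p2 hp l1 l2 IH1 IH2 x s0; rewrite last_cat /= => lT lsd Sx.
move: (hp); rewrite path_step_cat /= => /and3P[hp1 /andP[au ud] hp2].
set t := last u p2 in l1 l2 lT lsd IH2 *; set r := last s p1 in l1 au ud hp2 *.
have sr : s <= r := path_step_last hp1; have ut : u <= t := path_step_last hp2.
have rT : r <= T by rewrite (le_trans (ltW au))// (le_trans ut).
have u0 : 0 <= u by rewrite (le_trans s0)// (le_trans sr)// ltW.
have r0 : 0 <= r by exact: le_trans sr.
have st : 0 <= t - s by rewrite subr_ge0 (le_trans sr)// (le_trans (ltW au)).
have hat : th ((t - s) / 2) <= ka * th (t - s) by exact: gauge_half.
rewrite scheme_cat /= -/r; set y := scheme mu s p1 x; set y' := mu r u y.
have rsd : r - s <= dl by rewrite (le_trans _ lsd)// lerB// (le_trans (ltW au)).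
have tud : t - u <= dl by rewrite (le_trans _ lsd)// lerB// (le_trans sr)// ltW.
have trd : t - r <= dl by rewrite (le_trans _ lsd)// lerB.
have urd : u - s <= dl by rewrite (le_trans _ lsd)// lerB.
have Sy : S r y by apply: stable_scheme hS s0 hp1 _ Sx.
have Sy' : S u y' by apply: (hS r) => //; [exact: ltW|exact: le_trans lT].
have e1 : `|scheme mu u p2 y' - mu u t y'| <= K * (ka * th (t - s)).
  rewrite (le_trans (IH2 y' u0 lT tud Sy'))// ler_wpM2l// (le_trans _ hat)//.
  by apply: gauge_le => //; rewrite subr_ge0.
have e2 : `|mu u t y' - mu r t y| <= C * th (t - s).
  rewrite (le_trans (h1 r u t y r0 (ltW au) ut lT trd Sy))// ler_wpM2l// gauge_le//.
    by rewrite subr_ge0 (le_trans (ltW au)).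
  by rewrite lerB.
have Smx : S r (mu s r x) by exact: hS.
have e3 : `|mu r t y - mu r t (mu s r x)| <= lam * (K * (ka * th (t - s))).
  rewrite (le_trans (h2 r t _ _ r0 _ lT trd Sy Smx))//; first by rewrite (le_trans (ltW au)).
  rewrite ler_wpM2l// (le_trans (IH1 x s0 rT rsd Sx))// ler_wpM2l// (le_trans _ hat)//.
  by apply: gauge_le => //; rewrite subr_ge0.
have e4 : `|mu r t (mu s r x) - mu s t x| <= C * th (t - s).
  by apply: h1 => //; rewrite (le_trans (ltW au)).
have -> : scheme mu u p2 y' - mu s t x = (scheme mu u p2 y' - mu u t y') + (mu u t y' - mu r t y) +
   (mu r t y - mu r t (mu s r x)) + (mu r t (mu s r x) - mu s t x) by lmod.
rewrite (le_trans (ler_normD _ _))// (le_trans (lerD (ler_normD _ _) e4))//.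
rewrite (le_trans (lerD (lerD (ler_normD _ _) e3) (lexx _)))//.
rewrite (le_trans (lerD (lerD (lerD e1 e2) (lexx _)) (lexx _)))//.
by rewrite -[in leRHS]KE le_eqVlt; apply/orP; left; apply/eqP; ring.
Qed.

(** [K] is again the fixed point of the recursive estimate. Compared with [scheme_close], the moving
    base point adds the term c K0 lam, and the cocycle over the left piece is bounded by
    [lam + eta], which the induction hypothesis supplies thanks to [K * th dl <= eta]. *)
Lemma cocycle_close E V (mu : R -> R -> E -> E) (A : R -> R -> E -> V -> V) dl (S : R -> set E)
      C c lam eta K0 K : stable mu dl S ->
    (forall s x v, A s s x v = v) -> 0 <= C -> 0 <= c -> 0 <= lam -> 0 <= eta -> 0 <= K0 ->
    K = (C * (lam + eta) + c * K0 * lam + C) / (1 - lam * (lam + eta + 1) * ka) ->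
    lam * (lam + eta + 1) * ka < 1 -> K * th dl <= eta ->
    (forall s t x v w, A s t x (v - w) = A s t x v - A s t x w) ->
    (forall s p x, 0 <= s -> path (step dl) s p -> last s p <= T -> last s p - s <= dl ->
       S s x -> `|scheme mu s p x - mu s (last s p) x| <= K0 * th (last s p - s)) ->
    (forall s u t x v, 0 <= s -> s <= u -> u <= t -> t <= T -> t - s <= dl -> S s x ->
       `|A u t (mu s u x) (A s u x v) - A s t x v| <= C * th (t - s) * `|v|) ->
    (forall s t x v, 0 <= s -> s <= t -> t <= T -> t - s <= dl -> S s x ->
       `|A s t x v| <= lam * `|v|) ->
    (forall s t x y v, 0 <= s -> s <= t -> t <= T -> t - s <= dl -> S s x -> S s y ->
       `|A s t x v - A s t y v| <= c * `|x - y| * `|v|) ->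
  forall s p x v, 0 <= s -> path (step dl) s p -> last s p <= T -> last s p - s <= dl ->
    S s x -> `|cocycle mu A s p x v - A s (last s p) x v| <= K * th (last s p - s) * `|v|.
Proof.
move=> hS Aid C0 c0 lam0 eta0 K00 KE0 hk Keta Alin hbase h1 h2 h3.
have kl : 0 < 1 - lam * (lam + eta + 1) * ka by rewrite subr_gt0.
have num0 : 0 <= C * (lam + eta) + c * K0 * lam + C.
  by rewrite !addr_ge0 ?mulr_ge0 ?addr_ge0.
have K0' : 0 <= K by rewrite KE0 divr_ge0// ltW.
have KE : K * (lam * (lam + eta + 1) * ka) + (C * (lam + eta) + c * K0 * lam + C) = K.
  by rewrite KE0; field; rewrite gt_eqF.
move=> s p + + + hp; move: s p hp; apply: young_ind => [s x v s0 _ _ _|].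
  by rewrite /= Aid subrr normr0 !mulr_ge0// gauge_ge0// subrr.
move=> s p1 u p2 hp l1 l2 IH1 IH2 x v s0; rewrite last_cat /= => lT lsd Sx.
move: (hp); rewrite path_step_cat /= => /and3P[hp1 /andP[au ud] hp2].
set t := last u p2 in l1 l2 lT lsd IH2 *; set r := last s p1 in l1 au ud hp2 *.
have sr : s <= r := path_step_last hp1; have ut : u <= t := path_step_last hp2.
have rt : r <= t by rewrite (le_trans (ltW au)).
have su : s <= u by rewrite (le_trans sr)// ltW.
have rT : r <= T by exact: le_trans lT.
have uT : u <= T by exact: le_trans lT.
have u0 : 0 <= u by exact: le_trans su.
have r0 : 0 <= r by exact: le_trans sr.
have st : 0 <= t - s by rewrite subr_ge0 (le_trans sr).
have hat : th ((t - s) / 2) <= ka * th (t - s) by exact: gauge_half.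
have th0 : 0 <= th (t - s) by exact: gauge_ge0.
have [k0 _] := andP (gauge_ka hth).
have thm a b : s <= a -> a <= b -> b <= t -> th (b - a) <= th (t - s).
  by move=> sa ab bt; apply: gauge_le; rewrite ?subr_ge0// lerB.
rewrite cocycle_cat /= -/r; set y := scheme mu s p1 x; set y' := mu r u y.
set v1 := cocycle mu A s p1 x v; set v' := A r u y v1.
have rsd : r - s <= dl by rewrite (le_trans _ lsd)// lerB.
have tud : t - u <= dl by rewrite (le_trans _ lsd)// lerB.
have trd : t - r <= dl by rewrite (le_trans _ lsd)// lerB.
have Sy : S r y by apply: stable_scheme hS s0 hp1 _ Sx.
have Sy' : S u y' by apply: (hS r) => //; exact: ltW.
have dv1 : `|v1 - A s r x v| <= K * (ka * th (t - s)) * `|v|.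
  rewrite (le_trans (IH1 x v s0 rT rsd Sx))// ler_wpM2r// ler_wpM2l// (le_trans _ hat)//.
  by apply: gauge_le => //; rewrite subr_ge0.
have nv1 : `|v1| <= (lam + eta) * `|v|.
  rewrite -(subrK (A s r x v) v1) (le_trans (ler_normD _ _))// addrC mulrDl lerD//.
    exact: h2.
  rewrite (le_trans (IH1 x v s0 rT rsd Sx))// ler_wpM2r// (le_trans _ Keta)// ler_wpM2l//.
  by apply: gauge_le => //; rewrite subr_ge0.
have nv' : `|v'| <= lam * ((lam + eta) * `|v|).
  rewrite (le_trans (h2 r u y v1 r0 (ltW au) uT ud Sy))// ler_wpM2l//.
have e1 : `|cocycle mu A u p2 y' v' - A u t y' v'| <= K * (ka * th (t - s)) * (lam * ((lam + eta) * `|v|)).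
  rewrite (le_trans (IH2 y' v' u0 lT tud Sy'))//; apply: ler_pM => //.
    by rewrite mulr_ge0// gauge_ge0// subr_ge0.
  rewrite ler_wpM2l// (le_trans _ hat)//.
  by apply: gauge_le => //; rewrite subr_ge0.
have e2 : `|A u t y' v' - A r t y v1| <= C * th (t - s) * ((lam + eta) * `|v|).
  rewrite (le_trans (h1 r u t y v1 r0 (ltW au) ut lT trd Sy))//; apply: ler_pM => //.
    by rewrite mulr_ge0// gauge_ge0// subr_ge0.
  by rewrite ler_wpM2l// thm.
have e3 : `|A r t y v1 - A r t y (A s r x v)| <= lam * (K * (ka * th (t - s)) * `|v|).
  by rewrite -Alin (le_trans (h2 r t y _ r0 rt lT trd Sy))// ler_wpM2l.
have Smx : S r (mu s r x) by exact: hS.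
have e4 : `|A r t y (A s r x v) - A r t (mu s r x) (A s r x v)| <= c * (K0 * th (t - s)) * (lam * `|v|).
  rewrite (le_trans (h3 r t _ _ _ r0 rt lT trd Sy Smx))//; apply: ler_pM => //.
  - by rewrite mulr_ge0.
  - rewrite ler_wpM2l// (le_trans (hbase s p1 x s0 hp1 rT rsd Sx))// ler_wpM2l//.
    exact: thm.
  - exact: h2.
have e5 : `|A r t (mu s r x) (A s r x v) - A s t x v| <= C * th (t - s) * `|v|.
  exact: h1.
have -> : cocycle mu A u p2 y' v' - A s t x v = (cocycle mu A u p2 y' v' - A u t y' v') +
   (A u t y' v' - A r t y v1) + (A r t y v1 - A r t y (A s r x v)) +
   (A r t y (A s r x v) - A r t (mu s r x) (A s r x v)) +
   (A r t (mu s r x) (A s r x v) - A s t x v) by lmod.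
rewrite (le_trans (ler_normD _ _))// (le_trans (lerD (ler_normD _ _) e5))//.
rewrite (le_trans (lerD (lerD (ler_normD _ _) e4) (lexx _)))//.
rewrite (le_trans (lerD (lerD (lerD (ler_normD _ _) e3) (lexx _)) (lexx _)))//.
rewrite (le_trans (lerD (lerD (lerD (lerD e1 e2) (lexx _)) (lexx _)) (lexx _)))//.
by rewrite -[in leRHS]KE le_eqVlt; apply/orP; left; apply/eqP; ring.
Qed.

End Sewing.

(** * Good one-step maps *)

Section ApproximateFlows.
Context {R : realType}.
Implicit Types (E V : normedModType R) (s t u : R) (p q : seq R).
Variables (T : R) (th : R -> R) (ka : R).
Hypothesis hth : gauge th ka.

Definition bounded_on E (mu : R -> R -> E -> E) (P : set E) := exists M' dl,
  0 < dl /\ forall s p x, 0 <= s -> path (step dl) s p -> last s p <= T -> P x ->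
    `|scheme mu s p x| <= M'.

Definition close_on E (mu : R -> R -> E -> E) (P : set E) := exists K dl,
  [/\ 0 <= K, 0 < dl & forall s p x, 0 <= s -> path (step dl) s p -> last s p <= T ->
    last s p - s <= dl -> P x ->
    `|scheme mu s p x - mu s (last s p) x| <= K * th (last s p - s)].

Definition cauchy_on E (mu : R -> R -> E -> E) (P : set E) := forall e, 0 < e -> exists dl,
  0 < dl /\ forall s p q x, 0 <= s -> path (step dl) s p -> path (step dl) s q ->
    refines s p q -> last s p <= T -> P x -> `|scheme mu s q x - scheme mu s p x| <= e.

Definition cball E (M : R) : set E := [set x | `|x| <= M].

Definition good E (mu : R -> R -> E -> E) := forall M,
  [/\ bounded_on mu (cball M), close_on mu (cball M) & cauchy_on mu (cball M)].

(** The norms of the fibre maps must tend to 1 with the mesh: the contraction condition of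
    [cocycle_close] can be met only for [lam] near 1 when [ka] is near 1/2. *)
Definition cocycle_hyp E V (mu : R -> R -> E -> E) (A : R -> R -> E -> V -> V) (P : set E) :=
  exists C c, [/\ 0 <= C, 0 <= c & forall lam, 1 < lam -> exists2 dl, 0 < dl &
    [/\ forall s u t x v, 0 <= s -> s <= u -> u <= t -> t <= T -> t - s <= dl -> P x ->
         `|A u t (mu s u x) (A s u x v) - A s t x v| <= C * th (t - s) * `|v|,
        forall s t x v, 0 <= s -> s <= t -> t <= T -> t - s <= dl -> P x ->
         `|A s t x v| <= lam * `|v| &
        forall s t x y v, 0 <= s -> s <= t -> t <= T -> t - s <= dl -> P x -> P y ->
         `|A s t x v - A s t y v| <= c * `|x - y| * `|v|]].

Definition prolong E V (mu : R -> R -> E -> E) (A : R -> R -> E -> V -> V) s t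
  (z : E * V) : E * V := (mu s t z.1, A s t z.1 z.2).

Lemma scheme_prolong E V (mu : R -> R -> E -> E) (A : R -> R -> E -> V -> V) s p z :
  scheme (prolong mu A) s p z = (scheme mu s p z.1, cocycle mu A s p z.1 z.2).
Proof. by elim: p s z => [|t p IH] s [x v] //=; rewrite IH. Qed.

Lemma gauge_lt e : 0 < e -> exists2 dl, 0 < dl & th dl <= e.
Proof.
move=> e0; have [dl dl0 h] := gauge_small hth ltr01.
have m0 : 0 < Num.min dl e by rewrite lt_min dl0.
exists (Num.min dl e) => //; rewrite (le_trans (h _ (ltW m0) _)) ?ge_min ?lexx// mul1r.
by rewrite ge_min lexx orbT.
Qed.

Lemma cocycleB E V (mu : R -> R -> E -> E) (A : R -> R -> E -> V -> V) s p x v w :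
    (forall s t x v w, A s t x (v - w) = A s t x v - A s t x w) ->
  cocycle mu A s p x (v - w) = cocycle mu A s p x v - cocycle mu A s p x w.
Proof. by move=> Alin; elim: p s x v w => //= t p IH s x v w; rewrite Alin IH. Qed.

(** Closeness to [A] bounds the cocycle on short intervals; [0, T] is covered by a number of chunks
    fixed by the mesh bound, which gives a bound [L] independent of the partition. *)
Lemma cocycle_bounds E V (mu : R -> R -> E -> E) (A : R -> R -> E -> V -> V)
     (S : R -> set E) (P : set E) dl0 K0 : 0 < dl0 -> 0 <= K0 ->
    stable T mu dl0 S -> (forall s x, S s x -> P x) ->
    (forall s x v, A s s x v = v) ->
    (forall s t x v w, A s t x (v - w) = A s t x v - A s t x w) ->
    (forall s p x, 0 <= s -> path (step dl0) s p -> last s p <= T -> last s p - s <= dl0 ->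
       S s x -> `|scheme mu s p x - mu s (last s p) x| <= K0 * th (last s p - s)) ->
    cocycle_hyp mu A P ->
  exists K L dl, [/\ 0 <= K, 1 <= L, 0 < dl <= dl0,
    forall s p x v, 0 <= s -> path (step dl) s p -> last s p <= T -> last s p - s <= dl ->
      S s x -> `|cocycle mu A s p x v - A s (last s p) x v| <= K * th (last s p - s) * `|v| &
    forall s p x v, 0 <= s -> path (step dl) s p -> last s p <= T -> S s x ->
      `|cocycle mu A s p x v| <= L * `|v|].
Proof.
move=> dl00 K00 hS SP Aid Alin hbase [C [c [C0 c0 hA]]].
have [ka0 ka1] := andP (gauge_ka hth).
(* With lam = 1 + ep and eta = ep the contraction factor is (1 + ep)^2 (1 - 4 ep), which is less
   than 1. *)
pose ep := (1 - 2 * ka) / 4; have ep0 : 0 < ep by rewrite /ep; lra.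
have kaE : ka = (1 - 4 * ep) / 2 by rewrite /ep; field.
pose lam := 1 + ep; have lam1 : 1 < lam by rewrite /lam; lra.
have lam0 : 0 <= lam by rewrite /lam; lra.
have hk : lam * (lam + ep + 1) * ka < 1 by rewrite /lam kaE; nra.
pose K := (C * (lam + ep) + c * K0 * lam + C) / (1 - lam * (lam + ep + 1) * ka).
have K0' : 0 <= K.
  have lep : 0 <= lam + ep by rewrite addr_ge0// ltW.
  by rewrite /K divr_ge0 ?subr_ge0 ?(ltW hk)// addr_ge0// addr_ge0 ?mulr_ge0.
have [dl1 dl10 [h1 h2 h3]] := hA lam lam1.
have [dl2 dl20 hdl2] : exists2 dl, 0 < dl & K * th dl <= ep.
  have K1 : 0 < K + 1 by rewrite ltr_wpDl.
  have [dl d0 hdl] := gauge_lt (divr_gt0 ep0 K1); exists dl => //.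
  have th0 : 0 <= th dl by exact/(gauge_ge0 hth)/ltW.
  rewrite -(@ler_pM2r _ (K + 1)^-1) ?invr_gt0//; apply: le_trans hdl.
  by rewrite mulrAC ler_piMl// ler_pdivrMr// mul1r lerDl.
pose dl := Num.min dl0 (Num.min dl1 dl2).
have dl0' : 0 < dl by rewrite !lt_min dl00 dl10.
have [e0 e1 e2] : [/\ dl <= dl0, dl <= dl1 & dl <= dl2].
  by rewrite /dl !ge_min !lexx !orbT.
have Kdl : K * th dl <= ep.
  by apply: le_trans hdl2; rewrite ler_wpM2l// (gauge_le hth)// ltW.
have close s p x v : 0 <= s -> path (step dl) s p -> last s p <= T -> last s p - s <= dl ->
      S s x -> `|cocycle mu A s p x v - A s (last s p) x v| <= K * th (last s p - s) * `|v|.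
  apply: (cocycle_close hth (S := S) (C := C) (c := c) (lam := lam) (eta := ep) (K0 := K0)) => //.
  - by move=> s' t' x' a b cc d; apply: hS => //; exact: le_trans d e0.
  - exact: ltW.
  - move=> s' p' x' a b cc d; apply: hbase => //; first exact: path_stepW b.
    exact: le_trans d _.
  - by move=> s' u' t' x' v' a b cc d e /SP; apply: h1 => //; exact: le_trans e _.
  - by move=> s' t' x' v' a b cc d /SP; apply: h2 => //; exact: le_trans d _.
  - by move=> s' t' x' y' v' a b cc d /SP Px /SP; apply: h3 => //; exact: le_trans d _.
(* Chunks have length at most 2 h = dl, within reach of the closeness estimate, and at most [m.+1]
   of them cover [0, T]. *)
pose h := dl / 2; have h0 : 0 < h by rewrite divr_gt0.
pose m := (Num.truncn (T / h)).
pose Lam := lam + ep; have Lam1 : 1 <= Lam by rewrite /Lam /lam; lra.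
have hdl : h <= dl by rewrite /h; lra.
exists K, (Lam ^+ m.+1), h; split => //.
- by rewrite exprn_ege1.
- by rewrite h0 (le_trans hdl).
- move=> s p x v s0 hp lT lh; apply: close => //; first exact: path_stepW hp.
  exact: le_trans hdl.
have short s p x v : 0 <= s -> path (step h) s p -> last s p <= T -> last s p - s <= 2 * h ->
    S s x -> `|cocycle mu A s p x v| <= Lam * `|v|.
  move=> s0 hp lT lh Sx; have lh' : last s p - s <= dl by move: lh; rewrite /h; lra.
  have sp := path_step_last hp.
  rewrite -(subrK (A s (last s p) x v) (cocycle _ _ _ _ _ _)) (le_trans (ler_normD _ _))//.
  rewrite /Lam addrC mulrDl lerD//; first by apply: h2 => //; [exact: le_trans lh' _|exact: SP Sx].
  rewrite (le_trans (close _ _ _ _ s0 (path_stepW hdl hp) lT lh' Sx))// ler_wpM2r//.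
  by rewrite (le_trans _ Kdl)// ler_wpM2l// (gauge_le hth)// subr_ge0.
suff gen : forall m s p, path (step h) s p -> last s p - s <= m.+2%:R * h ->
    forall x v, 0 <= s -> last s p <= T -> S s x -> `|cocycle mu A s p x v| <= Lam ^+ m.+1 * `|v|.
  move=> s p x v s0 hp lT Sx; apply: gen => //.
  have : T / h < (m.+1)%:R by exact: truncnS_gt.
  rewrite ltr_pdivrMr// => hT; rewrite -addn1 natrD mulrDl mul1r.
  move: h0 s0 lT hT; lra.
apply: (chunk_ind (P := fun m s p => forall x v, 0 <= s -> last s p <= T -> S s x ->
   `|cocycle mu A s p x v| <= Lam ^+ m.+1 * `|v|)) => //.
  move=> m' s p hp lh x v s0 lT Sx; rewrite (le_trans (short _ _ _ _ s0 hp lT lh Sx))//.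
  by rewrite ler_wpM2r// exprS ler_peMr ?exprn_ege1// (le_trans ler01).
move=> m' s p q hpq lh IH x v s0 lT Sx; rewrite last_cat in lT.
move: hpq; rewrite path_step_cat => /andP[hp hq].
have lpT : last s p <= T by rewrite (le_trans _ lT)// (path_step_last hq).
have lp0 : 0 <= last s p by rewrite (le_trans s0)// (path_step_last hp).
rewrite cocycle_cat (le_trans (IH _ _ lp0 lT _))//.
  by apply: (stable_scheme hS s0 _ lpT Sx); apply: path_stepW hp; exact: le_trans hdl e0.
rewrite [Lam ^+ m'.+2]exprSr -mulrA ler_wpM2l ?exprn_ge0//; first exact: le_trans Lam1.
exact: short.
Qed.

(** The steps of [p] are replaced one after another by their refinements. Each replacement costs L K
    th of the step, and [th] of a short step is at most [ep] times its length, so the costs add up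
    to a multiple of [ep]. *)
Lemma cauchy_of_lipschitz E (mu : R -> R -> E -> E) K L dl : 0 <= K -> 0 <= L -> 0 < dl ->
    (forall s p x, 0 <= s -> path (step dl) s p -> last s p <= T -> last s p - s <= dl ->
       `|scheme mu s p x - mu s (last s p) x| <= K * th (last s p - s)) ->
    (forall s p x y, 0 <= s -> path (step dl) s p -> last s p <= T ->
       `|scheme mu s p x - scheme mu s p y| <= L * `|x - y|) ->
  cauchy_on mu setT.
Proof.
move=> K0 L0 dl0 hK hL e e0.
have e1 : 0 < e / (L * K * `|T| + 1) by rewrite divr_gt0// ltr_wpDl// !mulr_ge0.
have [dl1 dl10 h1] := gauge_small hth e1.
set ep := e / _ in e1 h1.
exists (Num.min dl dl1); split; first by rewrite lt_min dl0.
move=> s p q x s0 hp hq hr lT _.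
have ed : Num.min dl dl1 <= dl by rewrite ge_min lexx.
have ed1 : Num.min dl dl1 <= dl1 by rewrite ge_min lexx orbT.
suff main : `|scheme mu s q x - scheme mu s p x| <= L * (K * ep) * (last s p - s).
  rewrite (le_trans main)//.
  have : L * (K * ep) * (last s p - s) <= L * (K * ep) * `|T|.
    have lT' : last s p - s <= `|T| by move: s0 lT (ler_norm T); lra.
    by apply: ler_wpM2l => //; rewrite mulr_ge0// mulr_ge0// (ltW e1).
  move=> /le_trans; apply; rewrite (_ : _ * `|T| = L * K * `|T| * ep); last by ring.
  rewrite /ep mulrA ler_pdivrMr ?ltr_wpDl ?mulr_ge0// mulrC ler_pM2l//.
  by rewrite lerDl.
elim: p s q x s0 hp hq hr lT => [|t p IH] s q x s0 /=.
  by move=> _ _ -> _; rewrite /= !subrr normr0 mulr0.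
move=> /andP[/andP[st sd] hp] hq [q1 [q2 [e2 lq1 hr]]] lT; subst q.
move: hq; rewrite path_step_cat lq1 => /andP[hq1 hq2].
have t0 : 0 <= t by rewrite (le_trans s0)// ltW.
have tT : t <= T by rewrite (le_trans _ lT)// (path_step_last hp).
rewrite scheme_cat lq1.
rewrite -(subrKA (scheme mu t q2 (mu s t x))) (le_trans (ler_normD _ _))//.
have -> : last t p - s = (t - s) + (last t p - t) by ring.
rewrite mulrDr lerD//; last exact: IH.
have lq2 : last t q2 <= T by rewrite (refines_last hr).
rewrite (le_trans (hL _ _ _ _ t0 (path_stepW ed hq2) lq2))// -mulrA ler_wpM2l//.
have := hK s q1 x s0 (path_stepW ed hq1); rewrite lq1 => /(_ tT (le_trans sd ed)) h.
rewrite (le_trans h)// -mulrA; apply: ler_wpM2l => //.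
by apply: h1; [rewrite subr_ge0 ltW|exact: le_trans sd ed1].
Qed.

Lemma scheme_diff E (mu : R -> R -> E -> E) (A : R -> R -> E -> E -> E) s p x :
  (forall s t x, is_diff x (mu s t) (A s t x)) -> is_diff x (scheme mu s p) (cocycle mu A s p x).
Proof.
move=> hd; elim: p s x => [|t p IH] s x /=; first exact: is_diff_id.
have h1 := hd s t x; have h2 := IH t (mu s t x).
exact: (is_diff_comp (f := mu s t)).
Qed.

(** A product of one-step Lipschitz constants would grow with the number of steps. The uniform
    Lipschitz bound for schemes comes from the mean value inequality instead, the derivative of a
    scheme being a cocycle bounded by [cocycle_bounds]. *)
Lemma good_global E (mu : R -> R -> E -> E) (A : R -> R -> E -> E -> E) C D dl0 : findim E ->
    0 <= C -> 0 <= D -> 0 < dl0 ->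
    (forall s x, mu s s x = x) -> (forall s x v, A s s x v = v) ->
    (forall s t x, is_diff x (mu s t) (A s t x)) ->
    (forall s u t x, 0 <= s -> s <= u -> u <= t -> t <= T -> t - s <= dl0 ->
       `|mu u t (mu s u x) - mu s t x| <= C * th (t - s)) ->
    (forall lam, 1 < lam -> exists2 dl, 0 < dl & forall s t x y, 0 <= s -> s <= t -> t <= T ->
       t - s <= dl -> `|mu s t x - mu s t y| <= lam * `|x - y|) ->
    (forall s t x, 0 <= s -> s <= t -> t <= T -> t - s <= dl0 -> `|mu s t x - x| <= D) ->
    cocycle_hyp mu A setT ->
  good mu /\ exists K L dl, [/\ 0 <= K, 0 <= L, 0 < dl,
    forall s p x, 0 <= s -> path (step dl) s p -> last s p <= T -> last s p - s <= dl ->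
      `|scheme mu s p x - mu s (last s p) x| <= K * th (last s p - s) &
    forall s p x y, 0 <= s -> path (step dl) s p -> last s p <= T ->
      `|scheme mu s p x - scheme mu s p y| <= L * `|x - y|].
Proof.
move=> fE C0 D0 dl00 mid Aid hd h1 h2 h3 hA.
have [ka0 ka1] := andP (gauge_ka hth).
have Alin s t x v w : A s t x (v - w) = A s t x v - A s t x w.
  have -> : A s t x = 'd (mu s t) x by rewrite (@diff_val _ _ _ _ _ _ _ (hd s t x)).
  exact: linearB.
pose lam := 1 + (1 - 2 * ka) / 2; have lam1 : 1 < lam by rewrite /lam; lra.
have [dl1 dl10 hlam] := h2 lam lam1.
pose dl2 := Num.min dl0 dl1.
have dl20 : 0 < dl2 by rewrite lt_min dl00.
have [ed0 ed1] : dl2 <= dl0 /\ dl2 <= dl1 by rewrite !ge_min !lexx orbT.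
have lam0 : 0 <= lam by rewrite /lam; lra.
have hk : (1 + lam) * ka < 1 by rewrite /lam; nra.
have [K0 K00 hK0] := scheme_close hth (E := E) (mu := mu) (dl := dl2) (T := T) (S := fun=> setT)
  (C := C) (lam := lam) (fun _ _ _ _ _ _ _ _ => I) mid C0 lam0 hk
  (fun s u t x a b c d e _ => h1 s u t x a b c d (le_trans e ed0))
  (fun s t x y a b c d _ _ => hlam s t x y a b c (le_trans d ed1)).
have [K [L [dl [K0' L1 /andP[dl0' dle] hc hb]]]] := cocycle_bounds (S := fun=> setT) (P := setT)
  dl20 K00 (fun _ _ _ _ _ _ _ _ => I) (fun _ _ _ => I) Aid Alin
  (fun s p x a b c d _ => hK0 s p x a b c d I) hA.
have [KE KE0 hKE] := mean_value_ineq fE.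
have L0 : 0 <= L by exact: le_trans L1.
have lip s p x y : 0 <= s -> path (step dl) s p -> last s p <= T ->
    `|scheme mu s p x - scheme mu s p y| <= (KE * L) * `|x - y|.
  move=> s0 hp lT; have := hKE _ (scheme mu s p) y (x - y) (L * `|x - y|).
  rewrite (_ : y + (x - y) = x) ?mulrA; last by lmod.
  apply.
    by move=> z; exact: (@ex_diff _ _ _ _ _ _ _ (scheme_diff s p z hd)).
  move=> r _; rewrite (is_diff_eval _ (scheme_diff s p _ hd)).
  exact: hb.
have close s p x : 0 <= s -> path (step dl) s p -> last s p <= T -> last s p - s <= dl ->
      `|scheme mu s p x - mu s (last s p) x| <= K0 * th (last s p - s).
  move=> s0 hp lT ld; apply: hK0 => //; first exact: path_stepW hp.
  exact: le_trans ld dle.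
have KL0 : 0 <= KE * L by exact: mulr_ge0.
have cau : cauchy_on mu setT by exact: cauchy_of_lipschitz close lip.
split; last by exists K0, (KE * L), dl.
pose h := dl / 2; have h0 : 0 < h by rewrite divr_gt0.
have hdl : h <= dl by rewrite /h; lra.
(* Bounds the displacement over one chunk; multiplied by the number of chunks it bounds all schemes
   started in a ball. *)
pose DD := K0 * th dl + D.
have thdl0 : 0 <= th dl by exact/(gauge_ge0 hth)/ltW.
have DD0 : 0 <= DD by rewrite addr_ge0// mulr_ge0.
have short s p x : 0 <= s -> path (step h) s p -> last s p <= T -> last s p - s <= 2 * h ->
    `|scheme mu s p x - x| <= DD.
  move=> s0 hp lT lh; have lh' : last s p - s <= dl by move: lh; rewrite /h; lra.
  have sp := path_step_last hp.
  rewrite -(subrKA (mu s (last s p) x)) (le_trans (ler_normD _ _))// lerD//.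
    rewrite (le_trans (close _ _ _ s0 (path_stepW hdl hp) lT lh'))// ler_wpM2l//.
    by rewrite (gauge_le hth)// subr_ge0.
  by apply: h3 => //; exact: le_trans lh' (le_trans dle ed0).
have disp : forall m s p, path (step h) s p -> last s p - s <= m.+2%:R * h ->
    forall x, 0 <= s -> last s p <= T -> `|scheme mu s p x - x| <= m.+1%:R * DD.
  apply: (chunk_ind (P := fun m s p => forall x, 0 <= s -> last s p <= T ->
      `|scheme mu s p x - x| <= m.+1%:R * DD)) => //.
    move=> m s p hp lh x s0 lT; rewrite (le_trans (short _ _ _ s0 hp lT lh))//.
    by rewrite ler_peMl// ler1n.
  move=> m s p q; rewrite path_step_cat => /andP[hp hq] lh IH x s0; rewrite last_cat => lT.
  have lpT : last s p <= T by rewrite (le_trans _ lT)// (path_step_last hq).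
  have lp0 : 0 <= last s p by rewrite (le_trans s0)// (path_step_last hp).
  rewrite scheme_cat -(subrKA (scheme mu s p x)) (le_trans (ler_normD _ _))//.
  by rewrite -[m.+2]addn1 natrD mulrDl mul1r lerD// ?IH// short.
move=> M; split.
- exists (`|M| + (Num.truncn (T / h)).+1%:R * DD), h; split => // s p x s0 hp lT xM.
  rewrite -(subrK x (scheme mu s p x)) addrC (le_trans (ler_normD _ _))// lerD//.
    by rewrite (le_trans xM)// ler_norm.
  apply: disp => //; have : T / h < ((Num.truncn (T / h)).+1)%:R by exact: truncnS_gt.
  rewrite ltr_pdivrMr// => hT; rewrite -addn1 natrD mulrDl mul1r.
  move: h0 s0 lT hT; lra.
- by exists K0, dl; split => // s p x a b c d _; exact: close.
- move=> e e0; have [d [d0 hd']] := cau e e0; exists d; split => // s p q x a b c r l _.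
  exact: hd'.
Qed.

End ApproximateFlows.

(** * Prolongation by a linear cocycle *)

Section Prolongation.
Context {R : realType}.
Implicit Types (E V : normedModType R) (s t u : R) (p q : seq R).
Variables (T : R) (th : R -> R) (ka : R).
Hypothesis hth : gauge th ka.

(** On a chunk each cocycle is within [K * th (2 * h)] of the one-step map [A], and the two copies
    of [A] have base points at distance at most [ep]. Relative to the bound [B] of the coarse
    cocycle this gives the factor in parentheses; [L] carries the discrepancy to the final time, and
    there are at most [m.+1] chunks. *)
Lemma cocycle_refine E V (mu : R -> R -> E -> E) (A : R -> R -> E -> V -> V) (S : R -> set E)
     K L c h ep : 0 < h -> 0 <= K -> 1 <= L -> 0 <= c -> 0 <= ep ->
    stable T mu h S ->
    (forall s t x v w, A s t x (v - w) = A s t x v - A s t x w) ->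
    (forall s p x v, 0 <= s -> path (step h) s p -> last s p <= T -> last s p - s <= 2 * h ->
      S s x -> `|cocycle mu A s p x v - A s (last s p) x v| <= K * th (2 * h) * `|v|) ->
    (forall s p x v, 0 <= s -> path (step h) s p -> last s p <= T -> S s x ->
      `|cocycle mu A s p x v| <= L * `|v|) ->
    (forall s t x y v, 0 <= s -> s <= t -> t <= T -> t - s <= 2 * h -> S s x -> S s y ->
       `|A s t x v - A s t y v| <= c * `|x - y| * `|v|) ->
  0 <= th (2 * h) -> forall m s p, path (step h) s p -> last s p - s <= m.+2%:R * h ->
  forall q x y v B, refines s p q -> path (step h) s q -> 0 <= s -> last s p <= T ->
    S s x -> S s y ->
    (forall p1 p2 q1 q2, p = p1 ++ p2 -> q = q1 ++ q2 -> refines s p1 q1 ->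
       `|scheme mu s q1 y - scheme mu s p1 x| <= ep) ->
    (forall p1 p2, p = p1 ++ p2 -> `|cocycle mu A s p1 x v| <= B) ->
  `|cocycle mu A s q y v - cocycle mu A s p x v| <=
    m.+1%:R * (L * (2 * (K * th (2 * h)) + c * ep) * B).
Proof.
move=> h0 K0 L1 c0 ep0 hS Alin hc hb hl th0.
set be := 2 * (K * th (2 * h)) + c * ep.
have be0 : 0 <= be by rewrite addr_ge0 ?mulr_ge0.
have L0 : 0 <= L by exact: le_trans L1.
have base s p q x y v B : path (step h) s p -> last s p - s <= 2 * h -> refines s p q ->
    path (step h) s q -> 0 <= s -> last s p <= T -> S s x -> S s y -> `|y - x| <= ep ->
    `|v| <= B -> `|cocycle mu A s q y v - cocycle mu A s p x v| <= be * B.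
  move=> hp lh hr hq s0 lT Sx Sy yx vB; have lq := refines_last hr.
  have sp := path_step_last hp.
  have e1 : `|cocycle mu A s q y v - A s (last s p) y v| <= K * th (2 * h) * `|v|.
    by rewrite -lq; apply: hc => //; rewrite lq.
  have e2 : `|cocycle mu A s p x v - A s (last s p) x v| <= K * th (2 * h) * `|v| by exact: hc.
  have e3 : `|A s (last s p) y v - A s (last s p) x v| <= c * ep * `|v|.
    rewrite (le_trans (hl _ _ _ _ _ s0 sp lT lh Sy Sx))// ler_wpM2r// ler_wpM2l//.
  have -> : cocycle mu A s q y v - cocycle mu A s p x v = (cocycle mu A s q y v - A s (last s p) y v)
     - (cocycle mu A s p x v - A s (last s p) x v) + (A s (last s p) y v - A s (last s p) x v) by lmod.
  rewrite (le_trans (ler_normD _ _))// (le_trans (lerD (ler_normB _ _) e3))//.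
  rewrite (le_trans (lerD (lerD e1 e2) (lexx _)))//.
  rewrite (_ : _ + _ = be * `|v|); last by rewrite /be; ring.
  by rewrite ler_wpM2l.
apply: (chunk_ind (P := fun m s p => forall q x y v B, refines s p q -> path (step h) s q -> 0 <= s -> last s p <= T ->
    S s x -> S s y ->
    (forall p1 p2 q1 q2, p = p1 ++ p2 -> q = q1 ++ q2 -> refines s p1 q1 ->
       `|scheme mu s q1 y - scheme mu s p1 x| <= ep) ->
    (forall p1 p2, p = p1 ++ p2 -> `|cocycle mu A s p1 x v| <= B) ->
  `|cocycle mu A s q y v - cocycle mu A s p x v| <= m.+1%:R * (L * be * B))) => //.
  move=> m s p hp lh q x y v B hr hq s0 lT Sx Sy hcl hB.
  have vB : `|v| <= B by exact: (hB [::] p).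
  have B0 : 0 <= B by exact: le_trans vB.
  rewrite (le_trans (base _ _ _ _ _ _ _ hp lh hr hq s0 lT Sx Sy _ vB))//.
    exact: (hcl [::] p [::] q).
  rewrite -mulrA (le_trans _ (ler_peMl _ _)) ?ler1n ?mulr_ge0//.
  by rewrite ler_peMl// mulr_ge0.
move=> m s p p'; rewrite path_step_cat => /andP[hp hp'] lh IH q x y v B hr hq s0.
rewrite last_cat => lT Sx Sy hcl hB.
have [q1 [q2 [e hr1 hr2]]] := refines_cat hr; subst q.
have vB : `|v| <= B by exact: (hB [::] (p ++ p')).
have B0 : 0 <= B by exact: le_trans vB.
have lq := refines_last hr1.
move: hq; rewrite path_step_cat lq => /andP[hq1 hq2].
have lpT : last s p <= T by rewrite (le_trans (path_step_last hp')).
have lp0 : 0 <= last s p by rewrite (le_trans s0)// (path_step_last hp).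
rewrite !cocycle_cat lq.
set x1 := scheme mu s p x; set y1 := scheme mu s q1 y.
set v1 := cocycle mu A s p x v; set w1 := cocycle mu A s q1 y v.
have Sx1 : S (last s p) x1 by exact: stable_scheme hS s0 hp lpT Sx.
have Sy1 : S (last s p) y1 by rewrite -lq; apply: stable_scheme hS s0 hq1 _ Sy; rewrite lq.
have d1 : `|w1 - v1| <= be * B.
  apply: base hp lh hr1 hq1 s0 lpT Sx Sy _ vB.
  exact: (hcl [::] (p ++ p') [::] (q1 ++ q2)).
have lq2 : last (last s p) q2 <= T by rewrite (refines_last hr2).
have d2 : `|cocycle mu A (last s p) q2 y1 w1 - cocycle mu A (last s p) q2 y1 v1| <= L * be * B.
  rewrite -cocycleB// -mulrA (le_trans (hb _ _ _ _ lp0 hq2 lq2 Sy1))// ler_wpM2l//.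
have d3 : `|cocycle mu A (last s p) q2 y1 v1 - cocycle mu A (last s p) p' x1 v1| <=
    m.+1%:R * (L * be * B).
  apply: IH => //.
    move=> p1 p2 r1 r2 ep' er hrr; rewrite /y1 /x1 -[X in scheme mu X r1]lq -!scheme_cat.
    apply: (hcl _ p2 _ r2); rewrite ?ep' ?er ?catA//.
    elim: (p) (s) q1 hr1 hrr {lq d1 d2 hcl hr hr2 hq1 hq2 hp hp' lh lT Sx Sy hB s0 lpT lp0 x1 y1 v1 w1 Sx1 Sy1 lq2} => [|a pp IHp] ss qq /=.
      by move=> ->.
    move=> [a1 [a2 [-> la hra]]] hrr; exists a1, (a2 ++ r1); rewrite catA; split => //.
    exact: IHp.
  by move=> p1 p2 ep'; rewrite /v1 /x1 -cocycle_cat; apply: (hB _ p2); rewrite ep' catA.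
rewrite -(subrKA (cocycle mu A (last s p) q2 y1 v1)) (le_trans (ler_normD _ _))//.
by rewrite -[m.+2]addn1 natrD mulrDl mul1r addrC lerD.
Qed.

(* The cocycle along a coarse partition is compared with its refinement chunk by chunk;
   the errors are measured against the a priori bound on the coarse cocycle, so no
   Lipschitz bound for the prolonged scheme is needed. *)
Lemma good_prolong E V (mu : R -> R -> E -> E) (A : R -> R -> E -> V -> V) :
    good T th mu -> (forall s x, mu s s x = x) -> (forall s x v, A s s x v = v) ->
    (forall s t x v w, A s t x (v - w) = A s t x v - A s t x w) ->
    (forall M, cocycle_hyp T th mu A (cball M)) ->
  good T th (prolong mu A).
Proof.
move=> hg mid Aid Alin hA M.
have [[M1 [dl1 [dl10 hM1]]] _ hcau] := hg M.
(* The points of the ball of radius [M1] whose fine schemes all remain in it; this family is stable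
   by definition, which the ball itself need not be. *)
pose S s x := `|x| <= M1 /\ forall p, path (step dl1) s p -> last s p <= T -> `|scheme mu s p x| <= M1.
have hS : stable T mu dl1 S.
  move=> s t x s0 st tT td [Sx0 Sx]; move: st; rewrite le_eqVlt => /predU1P[<-|st].
    by rewrite mid.
  split; first by apply: (Sx [:: t]) => //=; rewrite /step st td.
  by move=> p hp lT; apply: (Sx (t :: p)) => //=; rewrite /step st td.
have [_ [K0 [dl2 [K00 dl20 hcl]]] _] := hg M1.
pose dl0 := Num.min dl1 dl2; have dl00 : 0 < dl0 by rewrite lt_min dl10.
have [e1 e2] : dl0 <= dl1 /\ dl0 <= dl2 by rewrite !ge_min !lexx orbT.
have hS0 : stable T mu dl0 S by move=> s t x a b cc d; apply: hS => //; exact: le_trans d e1.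
have SP s x : S s x -> cball M1 x by case.
have hbase s p x : 0 <= s -> path (step dl0) s p -> last s p <= T -> last s p - s <= dl0 ->
    S s x -> `|scheme mu s p x - mu s (last s p) x| <= K0 * th (last s p - s).
  move=> a b cc d Sx; apply: hcl => //; [exact: path_stepW b|exact: le_trans d e2|exact: SP Sx].
have [K [L [dl [K0' L1 /andP[dlp dle] hc hb]]]] :=
  cocycle_bounds hth dl00 K00 hS0 SP Aid Alin hbase (hA M1).
have L0 : 0 <= L by exact: le_trans L1.
have inS s x : 0 <= s -> s <= T -> `|x| <= M -> S s x.
  move=> s0 sT xM; split; first exact: (hM1 s [::]).
  by move=> p hp lT; exact: hM1.
have sT s p d : path (step d) s p -> last s p <= T -> s <= T by move=> /path_step_last; exact: le_trans.
have nM (z : E * V) : `|z| <= M -> `|z.1| <= M /\ `|z.2| <= M.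
  by rewrite prod_normE ge_max => /andP.
have nM0 (z : E * V) : `|z| <= M -> 0 <= M by exact: le_trans.
split.
- exists (Num.max M1 (L * M)), dl; split => // s p z s0 hp lT /nM[z1 z2].
  rewrite scheme_prolong prod_normE ge_max !le_max; apply/andP; split; apply/orP.
    left; apply: hM1 => //; apply: path_stepW hp; exact: le_trans dle e1.
  right; rewrite (le_trans (hb _ _ _ _ s0 hp lT _))//; last by rewrite ler_wpM2l.
  by apply: inS => //; exact: sT hp lT.
- exists (Num.max K0 (K * `|M|)), dl; split => //; first by rewrite le_max K00.
  move=> s p z s0 hp lT ld zM; have [z1 z2] := nM _ zM.
  have sp := path_step_last hp.
  have th0 : 0 <= th (last s p - s) by apply: (gauge_ge0 hth); rewrite subr_ge0.
  have Sz := inS _ _ s0 (sT _ _ _ hp lT) z1.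
  rewrite scheme_prolong /prolong prod_normE /= ge_max; apply/andP; split.
    rewrite (le_trans (hbase _ _ _ s0 (path_stepW dle hp) lT (le_trans ld dle) Sz))//.
    by rewrite ler_wpM2r// le_max lexx.
  rewrite (le_trans (hc _ _ _ _ s0 hp lT ld Sz))// [K * _ * _]mulrAC ler_wpM2r// le_max.
  by rewrite ler_wpM2l ?orbT// (le_trans z2)// ler_norm.
move=> e e0.
have [C [c [C0 c0 hAM]]] := hA M1; have [dl3 dl30 [_ _ hl]] := hAM 2 (ltr1n _ 2).
have Q0 : 0 < L * L * `|M| * (2 * K) * (2 * `|T| + 4) + 1.
  by rewrite ltr_wpDl// !mulr_ge0// addr_ge0// mulr_ge0.
(* About T / h chunks contribute errors [th (2 * h) <= e3 * (2 * h)], in total at most e3 (2|T| +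
   4). The denominator is the coefficient of this total in the final estimate, increased by 1 to be
   positive. *)
pose e3 := e / 2 / (L * L * `|M| * (2 * K) * (2 * `|T| + 4) + 1).
have e30 : 0 < e3 by rewrite /e3 !divr_gt0.
have [d4 d40 h4] := gauge_small hth e30.
pose h := Num.min 1 (Num.min dl (Num.min dl3 d4)) / 2.
have mn0 : 0 < Num.min 1 (Num.min dl (Num.min dl3 d4)) by rewrite !lt_min ltr01 dlp dl30.
have h0 : 0 < h by rewrite divr_gt0.
have [g1 g2 g3 g4] : [/\ 2 * h <= 1, 2 * h <= dl, 2 * h <= dl3 & 2 * h <= d4].
  have -> : 2 * h = Num.min 1 (Num.min dl (Num.min dl3 d4)) by rewrite /h; field.
  by rewrite !ge_min !lexx !orbT.
have hh : h <= 2 * h by lra.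
pose m := Num.truncn (T / h).
(* The number of chunks is fixed by [h]; only afterwards is the mesh reduced until base points
   differ by at most [ep], which depends on that number. *)
pose ep := Num.min e (e / 2 / (m.+1%:R * (L * L * `|M| * c) + 1)).
have P0 : 0 < m.+1%:R * (L * L * `|M| * c) + 1 by rewrite ltr_wpDl// !mulr_ge0.
have ep0 : 0 < ep by rewrite lt_min e0 !divr_gt0.
have [dl5 [dl50 h5]] := hcau ep ep0.
exists (Num.min h dl5); split; first by rewrite lt_min h0.
have [f1 f2] : Num.min h dl5 <= h /\ Num.min h dl5 <= dl5 by rewrite !ge_min !lexx orbT.
move=> s p q z s0 hp hq hr lT zM; have [z1 z2] := nM _ zM; have M0 := nM0 _ zM.
have sp := path_step_last hp; have sT' := sT _ _ _ hp lT.
have Sz := inS _ _ s0 sT' z1.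
have hp' := path_stepW f1 hp; have hq' := path_stepW f1 hq.
rewrite !scheme_prolong prod_normE /= ge_max; apply/andP; split.
  rewrite (le_trans (h5 _ _ _ _ s0 (path_stepW f2 hp) (path_stepW f2 hq) hr lT z1))//.
  by rewrite ge_min lexx.
have th2 : 0 <= th (2 * h) by apply: (gauge_ge0 hth); rewrite mulr_ge0// ltW.
have TE : last s p - s <= m.+2%:R * h.
  have : T / h < (m.+1)%:R by exact: truncnS_gt.
  rewrite ltr_pdivrMr// => hT; rewrite -addn1 natrD mulrDl mul1r.
  move: h0 s0 lT hT; lra.
have hS2 : stable T mu h S.
  move=> s' t' x' a b cc d; apply: hS0 => //; apply: le_trans d _.
  by rewrite (le_trans hh)// (le_trans g2).
have main := @cocycle_refine E V mu A S K L c h ep h0 K0' L1 c0 (ltW ep0) hS2 Alin _ _ _ th2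
  m s p hp' TE q z.1 z.1 z.2 (L * `|M|) hr hq' s0 lT Sz Sz _ _.
apply: le_trans.
  apply: main.
  - move=> s' p' x' v' a b cc d Sx'; have d' : last s' p' - s' <= dl by exact: le_trans d g2.
    have b' : path (step dl) s' p' by apply: path_stepW b; exact: le_trans hh g2.
    rewrite (le_trans (hc _ _ _ _ a b' cc d' Sx'))// ler_wpM2r// ler_wpM2l//.
    by apply: (gauge_le hth) => //; rewrite subr_ge0 (path_step_last b).
  - move=> s' p' x' v' a b cc Sx'; apply: hb => //; apply: path_stepW b; exact: le_trans hh g2.
  - move=> s' t' x' y' v' a b cc d Sx' Sy'; apply: hl => //; first exact: le_trans d g3.
      exact: SP Sx'.
    exact: SP Sy'.
  - move=> p1 p2 q1 q2 e' er hrr; subst p q; apply: h5 => //.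
    + by move: hp; rewrite path_step_cat => /andP[hp1 _]; exact: path_stepW hp1.
    + by move: hq; rewrite path_step_cat => /andP[hq1 _]; exact: path_stepW hq1.
    + move: hp; rewrite path_step_cat => /andP[hp1 /path_step_last lp2].
      by move: lT; rewrite last_cat; exact: le_trans.
  - move=> p1 p2 e'; subst p; move: hp'; rewrite path_step_cat => /andP[hp1 hp2].
    rewrite (le_trans (hb _ _ _ _ s0 _ _ Sz))//.
    + by apply: path_stepW hp1; exact: le_trans hh g2.
    + by move: lT; rewrite last_cat; apply: le_trans; exact: path_step_last hp2.
    + by rewrite ler_wpM2l// (le_trans z2)// ler_norm.
have mT : m.+1%:R * (2 * h) <= 2 * `|T| + 4.
  have [Tneg|Tpos] := ltP T 0.
    by move: s0 lT sp; lra.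
  have : m%:R <= T / h by rewrite /m truncn_le divr_ge0// ltW.
  rewrite ler_pdivlMr// => hm; rewrite -addn1 natrD mulrDl mul1r.
  by move: hm g1 (ler_norm T); lra.
have frac (x y : R) : 0 <= x -> 0 <= y -> x * (y / (x + 1)) <= y.
  move=> x0 y0; have x1 : 0 < x + 1 by rewrite ltr_wpDl.
  rewrite -subr_ge0 (_ : _ - _ = y / (x + 1)) ?divr_ge0 ?(ltW x1)//.
  by field; rewrite gt_eqF.
rewrite (_ : _ * _ = L * L * `|M| * (2 * K) * (m.+1%:R * th (2 * h)) +
   m.+1%:R * (L * L * `|M| * c) * ep); last by ring.
have -> : e = e / 2 + e / 2 by field.
have e20 : 0 <= e / 2 by rewrite divr_ge0// ltW.
have LK0 : 0 <= L * L * `|M| * (2 * K) by rewrite !mulr_ge0.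
apply: lerD; last first.
  have P0' : 0 <= m.+1%:R * (L * L * `|M| * c) by rewrite !mulr_ge0.
  apply: le_trans (frac _ _ P0' e20); apply: ler_wpM2l => //.
  by rewrite ge_min lexx orbT.
have th4 : m.+1%:R * th (2 * h) <= (2 * `|T| + 4) * e3.
  rewrite (le_trans (ler_wpM2l _ (h4 _ _ g4)))//; first by rewrite mulr_ge0// ltW.
  by rewrite [e3 * _]mulrC mulrA ler_wpM2r// ltW.
have Q0' : 0 <= L * L * `|M| * (2 * K) * (2 * `|T| + 4).
  by rewrite mulr_ge0// addr_ge0// mulr_ge0.
apply: le_trans (frac _ _ Q0' e20).
by apply: le_trans (ler_wpM2l LK0 th4) _; rewrite /e3 -!mulrA.
Qed.

End Prolongation.
(** * The flow of a rough differential equation *)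

Section RoughFlow.
Context {R : realType} {d : nat}.
Implicit Types E V : normedModType R.
Variables (T gamma : R) (N : nat) (Om : R -> R -> seq 'I_d -> R).
Hypotheses (gamma01 : 0 < gamma < 1) (gammaN : 1 < N.+1%:R * gamma).

(** Increments are given for all pairs of real times in either order, and Chen's relation holds for
    any three times; reversing time is then a mere change of parameter. *)
Record rough_increments : Prop := RoughIncrements {
  ri_char : forall s t, shuffle_character N (Om s t);
  ri_chen : forall s u t w, (size w <= N)%N -> Om s t w = convol (Om s u) (Om u t) w;
  ri_id : forall s w, (size w <= N)%N -> Om s s w = (nilp w)%:R;
  ri_bound : exists2 K, 0 <= K & forall s t w, (size w <= N)%N ->
    `|Om s t w| <= K * (`|t - s| `^ gamma) ^+ size w }.
Hypothesis hOm : rough_increments.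

Let gamma0 : 0 < gamma. Proof. by case/andP: gamma01. Qed.

Definition theta (h : R) := (h `^ gamma) ^+ N.+1.

Lemma thetaE h : 0 <= h -> theta h = h `^ (N.+1%:R * gamma).
Proof. by move=> h0; rewrite /theta -powR_mulrn ?powR_ge0// -powRrM mulrC. Qed.

Lemma powR_le (a b : R) : 0 <= a -> a <= b -> a `^ gamma <= b `^ gamma.
Proof. by move=> a0 ab; apply: ge0_ler_powR => //; rewrite ?nnegrE// ?(ltW gamma0)// (le_trans a0). Qed.

Lemma powR_small e : 0 < e -> exists2 dl, 0 < dl & forall h, 0 <= h -> h <= dl -> h `^ gamma <= e.
Proof.
move=> e0; exists (e `^ gamma^-1); first exact: powR_gt0.
move=> h h0 hd; apply: (le_trans (powR_le h0 hd)).
by rewrite -powRrM mulVf ?gt_eqF// powRr1// ltW.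
Qed.

(** [ka] is 2^(-(N + 1) gamma), below 1/2 because the exponent exceeds 1; for the same reason
    [theta h] is small compared with [h]. *)
Lemma theta_gauge : gauge theta (theta 2^-1).
Proof.
have p1 : 0 < N.+1%:R * gamma - 1 by rewrite subr_gt0.
split.
- by move=> h h0; rewrite /theta exprn_ge0// powR_ge0.
- by move=> h h' h0 hh; rewrite /theta lerXn2r ?nnegrE ?powR_ge0//; exact: powR_le.
- by move=> h h0; rewrite /theta powRM ?invr_ge0// exprMn mulrC.
- have half0 : 0 < 2^-1 :> R by rewrite invr_gt0.
  rewrite /theta exprn_gt0 ?powR_gt0//= -/(theta _) thetaE ?(ltW half0)//.
  have half1 : 2^-1 < 1 :> R by rewrite invf_lt1// ltr1n.
  have sp : forall b p : R, 0 < b -> b < 1 -> 0 < p - 1 -> b `^ p < b.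
    move=> b p b0 b1 p0; rewrite -{1}(subrK 1 p) powRD ?(gt_eqF b0) ?implybT// (powRr1 (ltW b0)).
    rewrite gtr_pMl//; have := @gt0_ltr_powR R _ p0 b 1; rewrite !nnegrE powR1; apply=> //.
    exact: ltW.
  exact: sp.
move=> e e0; exists (e `^ (N.+1%:R * gamma - 1)^-1); first exact: powR_gt0.
move=> h h0 hd; rewrite thetaE//; move: h0; rewrite le_eqVlt => /predU1P[<-|h0].
  by rewrite powR0 ?mulr0// gt_eqF// (lt_trans ltr01).
rewrite -[N.+1%:R * gamma](subrK 1) powRD ?(gt_eqF h0) ?implybT// (powRr1 (ltW h0)).
rewrite ler_wpM2r ?(ltW h0)//.
have := ge0_ler_powR (ltW p1) (_ : h \in Num.nneg) (_ : e `^ (N.+1%:R * gamma - 1)^-1 \in Num.nneg) hd.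
rewrite !nnegrE (ltW h0) powR_ge0 => /(_ isT isT) /le_trans; apply.
by rewrite -powRrM mulVf ?gt_eqF// powRr1// ltW.
Qed.

Definition mu E (f : 'I_d -> E -> E) (s t : R) : E -> E := davie_map N f (Om s t).

Lemma Om0 s t : Om s t [::] = 1. Proof. by have [] := ri_char hOm s t. Qed.

Lemma mu_id E (f : 'I_d -> E -> E) s x : mu f s s x = x.
Proof. by apply: davie_map_id => w wN; exact: ri_id. Qed.

Lemma muE E (f : 'I_d -> E -> E) s t x : mu f s t x = x + increment f N (Om s t) x.
Proof. by rewrite /mu davie_mapE// Om0. Qed.

Definition dmu E (f : 'I_d -> E -> E) (s t : R) (x v : E) : E := 'd (mu f s t) x v.

Lemma is_diff_mu E (f : 'I_d -> E -> E) s t x : findim E -> (forall i, reg N set0 (f i)) ->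
  is_diff x (mu f s t) (dmu f s t x).
Proof.
move=> fE hf; have h := is_diff_davie (Om s t) x fE hf.
by apply: is_diff_eq; rewrite /dmu; apply/funext => v; rewrite (is_diff_eval _ h).
Qed.

Lemma mu_tangent E (f : 'I_d -> E -> E) : findim E -> (forall i, Ck N.+1 (f i)) ->
  mu (fun i => tangent (f i)) = prolong (mu f) (dmu f).
Proof.
move=> fE cf; apply/funext => s; apply/funext => t.
by rewrite /mu (davie_map_tangent _ fE (leqnSn N) cf).
Qed.

Lemma dmu_id E (f : 'I_d -> E -> E) s x v : dmu f s s x v = v.
Proof.
rewrite /dmu (_ : mu f s s = id); last by apply/funext => y; exact: mu_id.
by rewrite (is_diff_eval v (is_diff_id x)).
Qed.

Lemma dmuB E (f : 'I_d -> E -> E) s t x v w : dmu f s t x (v - w) = dmu f s t x v - dmu f s t x w.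
Proof. exact: linearB. Qed.

Lemma norm_le_unit E V (Q : E -> V) c : (forall k v, Q (k *: v) = k *: Q v) ->
  (forall v, `|v| <= 1 -> `|Q v| <= c) -> forall v, `|Q v| <= c * `|v|.
Proof.
move=> Qk h v; have [->|v0] := eqVneq v 0.
  by have := Qk 0 0; rewrite !scale0r => ->; rewrite !normr0 mulr0.
have nv : 0 < `|v| by rewrite normr_gt0.
have -> : Q v = `|v| *: Q (`|v|^-1 *: v) by rewrite -Qk scalerA mulfV ?gt_eqF// scale1r.
rewrite normrZ normr_id mulrC ler_wpM2r// h//.
by rewrite normrZ normfV normr_id mulVf// gt_eqF.
Qed.

Lemma increment_Om_bound E B (f : 'I_d -> E -> E) : findim E -> (forall i, reg N B (f i)) ->
  exists2 C, 0 <= C & forall s t x, `|t - s| `^ gamma <= 1 -> B x ->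
    `|increment f N (Om s t) x| <= C * `|t - s| `^ gamma.
Proof.
move=> fE hf; have [K K0 hK] := ri_bound hOm.
have [C C0 hC] := increment_bound fE hf K0 (lexx 1).
exists C => // s t x h1 Bx; apply: hC => //; first by rewrite powR_ge0.
by move=> w wN; exact: hK.
Qed.

Lemma local_error_Om E B (f : 'I_d -> E -> E) : findim E -> (forall i, reg N B (f i)) ->
  exists2 C, 0 <= C & forall h s u t x, h `^ gamma <= 1 ->
    `|u - s| <= h -> `|t - u| <= h ->
    (forall r, 0 <= r <= 1 -> B (x + r *: increment f N (Om s u) x)) ->
    `|mu f u t (mu f s u x) - mu f s t x| <= C * theta h.
Proof.
move=> fE hf; have [K K0 hK] := ri_bound hOm.
have [C C0 hC] := local_error fE hf K0 (lexx 1).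
exists C => // h s u t x h1 us tu hB.
have le_om a b w : `|b - a| <= h -> (size w <= N)%N -> `|Om a b w| <= K * (h `^ gamma) ^+ size w.
  move=> ab wN; rewrite (le_trans (hK _ _ _ wN))// ler_wpM2l// lerXn2r ?nnegrE ?powR_ge0//.
  exact: powR_le.
apply: hC => //.
- by rewrite powR_ge0.
- exact: (ri_char hOm).
- exact: (ri_char hOm).
- by move=> w wN; exact: ri_chen.
- by move=> w wN; exact: le_om.
- by move=> w wN; exact: le_om.
Qed.

(** The one-step map of the tangent fields is [prolong (mu f) (dmu f)]. Estimates for it over
    vectors of norm at most 1 are read in the second component and extended to all vectors by
    homogeneity ([norm_le_unit]). The margin 1 between [P] and [B] keeps the segments of the tangent
    increments over [B]. *)
Lemma field_cocycle_hyp E (P B : set E) (f : 'I_d -> E -> E) : findim E ->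
    (forall i, reg N.+1 B (f i)) ->
    (forall x y, P x -> `|y - x| <= 1 -> B y) ->
    (forall x y r, P x -> P y -> 0 <= r <= 1 -> B (x + r *: (y - x))) ->
  cocycle_hyp T theta (mu f) (dmu f) P.
Proof.
move=> fE hf hPB hconv.
have fE2 := findim_prod fE fE.
(* Radius 2 leaves room for a displacement of norm 1 from a vector of the unit ball. *)
pose B2 := [set p : E * E | B p.1 /\ `|p.2| <= 2].
have hTf i : reg N B2 (tangent (f i)) by apply: reg_tangent.
have cf i : Ck N.+1 (f i) := reg_Ck (hf i).
have [C C0 hC] := local_error_Om fE2 hTf.
have [CD CD0 hCD] := increment_Om_bound fE2 hTf.
have [K K0 hK] := ri_bound hOm.
have [KE KE0 hKE] := mean_value_ineq fE.
(* The derivative of [F_w] is Lipschitz in the base point because second derivatives are bounded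
   along the segment; for |w| = N this takes N + 1 derivatives of the fields. *)
have hw (w : N.-bseq 'I_d) : exists c, 0 <= c /\ forall x y v, P x -> P y ->
    `|'d (Fw f w) x v - 'd (Fw f w) y v| <= c * `|x - y| * `|v|.
  case: w => -[|i w] wN.
    exists 0; split => // x y v _ _ /=.
    by rewrite (is_diff_eval v (is_diff_id x)) (is_diff_eval v (is_diff_id y)) subrr normr0 !mul0r.
  have wN1 : (size w < N)%N by [].
  have hg : reg (N.+1 - size w) B (Fw f (i :: w)) by apply: reg_Fw => //; rewrite ltnW// ltnS ltnW.
  have h2 : (2 <= N.+1 - size w)%N by rewrite subSn ?(ltnW wN1)// ltnS subn_gt0.
  have [c c0 hc] := reg_Dn_bound fE hg h2.
  exists (KE * c); split; first exact: mulr_ge0.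
  move=> x y v Px Py; have := hKE _ (dird (Fw f (i :: w)) v) y (x - y) (c * (`|x - y| * `|v|)).
  rewrite (_ : y + (x - y) = x); last by lmod.
  rewrite !mulrA; apply.
    by case: (CkW h2 (reg_Ck hg)) => _ /(_ v)[].
  move=> r r01; have := hc (y + r *: (x - y)) [:: x - y; v] (hconv _ _ _ Py Px r01) erefl.
  by rewrite !big_cons big_nil mulr1 mulrA.
have [c hc] := choice hw.
exists C, (\sum_w K * c w); split => //.
  by apply: sumr_ge0 => w _; rewrite mulr_ge0//; case: (hc w).
move=> lam lam1.
(* The mesh makes tangent increments over [B2] at most min(1, lam - 1): the bound 1 keeps segments
   in [B2], and lam - 1 yields the norm bound for [dmu]. *)
have e0 : 0 < Num.min 1 (Num.min 1 (lam - 1) / (CD + 1)).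
  by rewrite lt_min ltr01 divr_gt0 ?ltr_wpDl// lt_min ltr01 subr_gt0.
have [dl dl0 hdl] := powR_small e0.
have small (s t : R) : `|t - s| <= dl -> `|t - s| `^ gamma <= 1 /\ CD * `|t - s| `^ gamma <= Num.min 1 (lam - 1).
  move=> h; have := hdl _ (normr_ge0 _) h; rewrite le_min => /andP[h1 h2]; split => //.
  have CD1 : 0 < CD + 1 by rewrite ltr_wpDl.
  have m0 : 0 <= Num.min 1 (lam - 1) by rewrite le_min ler01 subr_ge0 ltW.
  rewrite (le_trans (ler_wpM2l CD0 h2))// mulrCA ler_piMr// ler_pdivrMr// mul1r lerDl.
  by [].
have inB2 s t x v r : `|t - s| <= dl -> P x -> `|v| <= 1 -> 0 <= r <= 1 ->
    B2 ((x, v) + r *: increment (fun i => tangent (f i)) N (Om s t) (x, v)).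
  move=> /small[h1 h2] Px v1 /andP[r0 r1].
  have Bxv : B2 (x, v).
    by split=> /=; [apply: hPB Px _; rewrite subrr normr0|rewrite (le_trans v1)// ler1n].
  have := hCD _ _ _ h1 Bxv; set D := increment _ _ _ _ => hD.
  have : `|r *: D| <= 1.
    rewrite normrZ ger0_norm// mulr_ile1// (le_trans hD)// (le_trans h2)//.
    by rewrite ge_min lexx.
  rewrite prod_normE ge_max => /andP[d1 d2]; split => /=.
    by apply: hPB Px _; rewrite addrC addKr.
  by rewrite (le_trans (ler_normD _ _))// (_ : 2 = 1 + 1)// lerD.
exists dl => //; split.
- move=> s u t x v s0 su ut tT td Px.
  move: v; apply: (norm_le_unit (Q := fun v => dmu f u t (mu f s u x) (dmu f s u x v) - dmu f s t x v)).
    by move=> k v; rewrite /dmu scalerBr !linearZ_LR.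
  move=> v v1; have st : 0 <= t - s by rewrite subr_ge0 (le_trans su).
  have hus : `|u - s| <= t - s by rewrite ger0_norm ?subr_ge0// lerB.
  have htu : `|t - u| <= t - s by rewrite ger0_norm ?subr_ge0// lerB.
  have h1 : (t - s) `^ gamma <= 1.
    by have [] := small s t; rewrite ger0_norm.
  have := hC (t - s) s u t (x, v) h1 hus htu (fun r => inB2 s u x v r (le_trans hus td) Px v1).
  rewrite (mu_tangent fE cf) prod_normE ge_max => /andP[_]; exact.
- move=> s t x v s0 st tT td Px.
  have tdn : `|t - s| <= dl by rewrite ger0_norm// subr_ge0.
  have [h1 h2] := small _ _ tdn.
  suff h : `|dmu f s t x v - v| <= (lam - 1) * `|v|.
    rewrite -(subrK v (dmu f s t x v)) (le_trans (ler_normD _ _))//.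
    by rewrite -[X in _ <= X * _](subrK 1 lam) mulrDl mul1r lerD2r.
  move: v; apply: (norm_le_unit (Q := fun v => dmu f s t x v - v)).
    by move=> k v; rewrite /dmu scalerBr linearZ_LR.
  move=> v v1.
  have Bxv : B2 (x, v).
    by split=> /=; [apply: hPB Px _; rewrite subrr normr0|rewrite (le_trans v1)// ler1n].
  have := hCD _ _ _ h1 Bxv.
  have -> : increment (fun i => tangent (f i)) N (Om s t) (x, v) = mu (fun i => tangent (f i)) s t (x, v) - (x, v).
    by rewrite muE addrC addKr.
  rewrite (mu_tangent fE cf) prod_normE ge_max => /andP[_ /le_trans]; apply.
  by rewrite (le_trans h2)// ge_min lexx orbT.
move=> s t x y v s0 st tT td Px Py.
have tdn : `|t - s| <= dl by rewrite ger0_norm// subr_ge0.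
have [h1 h2] := small _ _ tdn.
have hf0 i : reg N set0 (f i) by apply: reg_sub (regW (leqnSn N) (hf i)).
have ev z : dmu f s t z v = \sum_(w : N.-bseq 'I_d) Om s t w *: 'd (Fw f w) z v.
  by rewrite /dmu (is_diff_eval v (is_diff_davie (Om s t) z fE hf0)).
rewrite !ev -sumrB (le_trans (ler_norm_sum _ _ _))// !mulr_suml ler_sum// => w _.
have [c0 hcw] := hc w.
rewrite -scalerBr normrZ -!mulrA; apply: ler_pM => //; last by rewrite mulrA; exact: hcw.
rewrite (le_trans (hK _ _ _ (size_bseq w)))// ler_piMr// exprn_ile1// powR_ge0.
Qed.

(** Bounds on every ball: unlike global bounds, this survives [tangent], with [m] lowered by one. *)
Definition locreg E m (f : 'I_d -> E -> E) := forall i M, reg m (cball M) (f i).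

Lemma locregW E m m' (f : 'I_d -> E -> E) : (m' <= m)%N -> locreg m f -> locreg m' f.
Proof. by move=> h hf i M; exact: regW h (hf i M). Qed.

Lemma locreg_Ck E m (f : 'I_d -> E -> E) i : locreg m f -> Ck m (f i).
Proof. by move=> hf; exact: reg_Ck (hf i 0). Qed.

Lemma locreg_tangent E m (f : 'I_d -> E -> E) : findim E -> locreg m.+1 f ->
  locreg m (fun i => tangent (f i)).
Proof.
move=> fE hf i M; apply: reg_sub (reg_tangent M fE (hf i M)) => z.
by rewrite /cball /= prod_normE ge_max => /andP[].
Qed.

Lemma cball_segment E M (x y : E) r : cball M x -> cball M y -> 0 <= r <= 1 ->
  cball M (x + r *: (y - x)).
Proof.
rewrite /cball /= => xM yM /andP[r0 r1].
have -> : x + r *: (y - x) = (1 - r) *: x + r *: y by lmod.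
rewrite (le_trans (ler_normD _ _))// !normrZ !ger0_norm ?subr_ge0//.
have -> : M = (1 - r) * M + r * M by ring.
by rewrite lerD// ler_wpM2l// subr_ge0.
Qed.

Lemma good_tangent E (f : 'I_d -> E -> E) : findim E -> locreg N.+1 f ->
  good T theta (mu f) -> good T theta (mu (fun i => tangent (f i))).
Proof.
move=> fE hf hg; rewrite (mu_tangent fE); last by move=> i; exact: locreg_Ck hf.
apply: (good_prolong theta_gauge) => //.
- exact: mu_id.
- exact: dmu_id.
- exact: dmuB.
move=> M; apply: (field_cocycle_hyp (B := cball (M + 1))) => //.
  move=> x y xM xy; rewrite /cball /= -(subrK x y) addrC (le_trans (ler_normD _ _))//.
  by rewrite lerD.
move=> x y r xM yM r01; apply: cball_segment => //; rewrite /cball /=.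
  by rewrite (le_trans xM)// lerDl.
by rewrite (le_trans yM)// lerDl.
Qed.

Lemma dmu_sub_id E (f : 'I_d -> E -> E) : findim E -> (forall i, reg N.+1 setT (f i)) ->
  exists2 C, 0 <= C & forall s t x v, `|t - s| `^ gamma <= 1 ->
    `|dmu f s t x v - v| <= C * `|t - s| `^ gamma * `|v|.
Proof.
move=> fE hf; pose B2 := [set p : E * E | setT p.1 /\ `|p.2| <= 1].
have hTf i : reg N B2 (tangent (f i)) by apply: reg_tangent.
have [C C0 hC] := increment_Om_bound (findim_prod fE fE) hTf.
exists C => // s t x v h1.
move: v; apply: (norm_le_unit (Q := fun v => dmu f s t x v - v)).
  by move=> k v; rewrite /dmu scalerBr linearZ_LR.
move=> v v1; have := hC s t (x, v) h1 (conj I v1).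
have -> : increment (fun i => tangent (f i)) N (Om s t) (x, v) = mu (fun i => tangent (f i)) s t (x, v) - (x, v).
  by rewrite muE addrC addKr.
rewrite (mu_tangent fE); last by move=> i; exact: reg_Ck (hf i).
by rewrite prod_normE ge_max => /andP[].
Qed.

Lemma good_mu E (f : 'I_d -> E -> E) : findim E -> (forall i, reg N.+1 setT (f i)) ->
  good T theta (mu f) /\ exists K L dl, [/\ 0 <= K, 0 <= L, 0 < dl,
    forall s p x, 0 <= s -> path (step dl) s p -> last s p <= T -> last s p - s <= dl ->
      `|scheme (mu f) s p x - mu f s (last s p) x| <= K * theta (last s p - s) &
    forall s p x y, 0 <= s -> path (step dl) s p -> last s p <= T ->
      `|scheme (mu f) s p x - scheme (mu f) s p y| <= L * `|x - y|].
Proof.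
move=> fE hf; have hfN i : reg N setT (f i) := regW (leqnSn N) (hf i).
have hf0 i : reg N set0 (f i) by apply: reg_sub (hfN i).
have hA : cocycle_hyp T theta (mu f) (dmu f) setT.
  exact: (field_cocycle_hyp (B := setT)).
have [C C0 hC] := local_error_Om fE hfN.
have [CD CD0 hCD] := increment_Om_bound fE hfN.
have [dl dl0 hdl] := powR_small ltr01.
have [KE KE0 hKE] := mean_value_affine fE.
have [CT CT0 hdm] := dmu_sub_id fE hf.
apply: (good_global theta_gauge (A := dmu f) (C := C) (D := CD) (dl0 := dl)) => //.
- exact: mu_id.
- exact: dmu_id.
- by move=> s t x; exact: is_diff_mu.
- move=> s u t x s0 su ut tT td; have st : 0 <= t - s by rewrite subr_ge0 (le_trans su).
  apply: hC => //; first exact: hdl.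
    by rewrite ger0_norm ?subr_ge0// lerB.
  by rewrite ger0_norm ?subr_ge0// lerB.
- move=> lam lam1.
  have e0 : 0 < (lam - 1) / (KE * CT + 1).
    by rewrite divr_gt0 ?subr_gt0// ltr_wpDl// mulr_ge0.
  have [d3 d30 hd3] := powR_small e0.
  exists (Num.min dl d3); first by rewrite lt_min dl0.
  move=> s t x y s0 st tT; rewrite le_min => /andP[td td3].
  have tE : `|t - s| = t - s by rewrite ger0_norm// subr_ge0.
  have om1 : `|t - s| `^ gamma <= 1 by rewrite tE; apply: hdl; rewrite // subr_ge0.
  have om3 : `|t - s| `^ gamma <= (lam - 1) / (KE * CT + 1) by rewrite tE; apply: hd3; rewrite // subr_ge0.
  have KT0 : 0 <= KE * CT by rewrite mulr_ge0.
  (* Subtracting x - y leaves only the small part of the derivative to be multiplied by [KE], so the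
     Lipschitz constant can be as near to 1 as required. *)
  have hmv := hKE _ (mu f s t) y (x - y) (x - y) (CT * `|t - s| `^ gamma * `|x - y|).
  rewrite [y + _]addrC subrK in hmv.
  rewrite -(subrK (x - y) (mu f s t x - _)) (le_trans (ler_normD _ _))//.
  rewrite -[X in _ <= X * _](subrK 1 lam) mulrDl mul1r lerD2r (le_trans (hmv _ _))//.
    by move=> z; exact: (@ex_diff _ _ _ _ _ _ _ (is_diff_mu s t z fE hf0)).
    by move=> r _; exact: hdm.
  rewrite !mulrA ler_wpM2r// (le_trans (ler_wpM2l KT0 om3))//.
  rewrite mulrCA ler_piMr ?subr_ge0 ?(ltW lam1)// ler_pdivrMr ?mul1r ?lerDl//.
  by rewrite ltr_wpDl.
- move=> s t x s0 st tT td; rewrite muE addrC addKr.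
  have h1 : `|t - s| `^ gamma <= 1 by apply: hdl => //; rewrite ger0_norm// subr_ge0.
  by rewrite (le_trans (hCD _ _ _ h1 I))// ler_piMr.
Qed.

End RoughFlow.

(** * Limit flows *)

Section Limits.
Context {R : realType}.
Implicit Types (E V : normedModType R) (s t u : R) (p q : seq R).

Lemma half_pos (e : R) : 0 < e -> 0 < e / 2.
Proof. by move=> e0; rewrite divr_gt0. Qed.

Lemma real_complete (u : nat -> R) :
    (forall e, 0 < e -> exists n0, forall m n, (n0 <= m)%N -> (n0 <= n)%N -> `|u m - u n| <= e) ->
  exists l, forall e, 0 < e -> exists n0, forall n, (n0 <= n)%N -> `|u n - l| <= e.
Proof.
move=> h; have /cauchy_cvgP/cvg_ex[l hl] : cauchy (u @ \oo).
  apply/cauchy_exP => e e0; have [n0 h0] := h (e / 2) (half_pos e0).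
  exists (u n0); exists n0 => // n /= n0n; rewrite /ball /=.
  by apply: le_lt_trans (h0 _ _ (leqnn _) n0n) _; rewrite ltr_pdivrMr// ltr_pMr// ltr1n.
exists l => e e0; have /cvgrPdist_le /(_ e e0)[n0 _ h0] := hl.
by exists n0 => n n0n; rewrite distrC; exact: h0.
Qed.

Lemma findim_complete E (u : nat -> E) : findim E ->
    (forall e, 0 < e -> exists n0, forall m n, (n0 <= m)%N -> (n0 <= n)%N -> `|u m - u n| <= e) ->
  exists l, forall e, 0 < e -> exists n0, forall n, (n0 <= n)%N -> `|u n - l| <= e.
Proof.
move=> [m [b [c [lc bc ec]]]] h; have [C C0 hC] := findim_coord_bound bc.
have cB i v w : c i (v - w) = c i v - c i w.
  by rewrite addrC -scaleN1r lc scaleN1r addrC.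
have hl i : exists l, forall e, 0 < e -> exists n0, forall n, (n0 <= n)%N -> `|c i (u n) - l| <= e.
  apply: real_complete => e e0; have [n0 h0] := h (e / (C + 1)) (divr_gt0 e0 (ltr_wpDl C0 ltr01)).
  exists n0 => p q n0p n0q; rewrite -cB (le_trans (hC _ _))//.
  rewrite (le_trans (ler_wpM2l C0 (h0 _ _ n0p n0q)))// mulrCA ler_piMr ?(ltW e0)//.
  by rewrite ler_pdivrMr ?ltr_wpDl// mul1r lerDl.
have [l {}hl] := choice hl; exists (\sum_i l i *: b i) => e e0.
have D0 : 0 < \sum_i `|b i| + 1 by rewrite ltr_wpDl// sumr_ge0.
have [k hk] := choice (fun i => hl i (e / (\sum_i `|b i| + 1)) (divr_gt0 e0 D0)).
exists (\max_i k i) => n hn; rewrite [u n]ec -sumrB (le_trans (ler_norm_sum _ _ _))//.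
apply: (@le_trans _ _ (\sum_i e / (\sum_i `|b i| + 1) * `|b i|)).
  apply: ler_sum => i _; rewrite -scalerBl normrZ ler_wpM2r// hk//.
  exact: leq_trans (leq_bigmax i) hn.
rewrite -mulr_sumr -mulrA ler_piMr ?(ltW e0)//.
by rewrite mulrC ler_pdivrMr// mul1r lerDl.
Qed.

Lemma findim_lin_bound E V (L : E -> V) : findim E -> linear L -> exists C, forall v, `|L v| <= C * `|v|.
Proof.
move=> [m [b [c [lc bc ec]]]] lL; have [C C0 hC] := findim_coord_bound bc.
exists (\sum_i C * `|L (b i)|) => v.
have Ls : forall r : seq 'I_m, L (\sum_(i <- r) c i v *: b i) = \sum_(i <- r) c i v *: L (b i).
  elim=> [|i r IH]; last by rewrite !big_cons lL IH.
  by rewrite !big_nil; have := lL (-1) 0 0; rewrite scaler0 addr0 scaleN1r addNr.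
rewrite {1}[v]ec Ls (le_trans (ler_norm_sum _ _ _))// mulr_suml ler_sum// => i _.
by rewrite normrZ mulrAC ler_wpM2r.
Qed.

Variables (T : R) (th : R -> R) (ka : R).
Hypothesis hth : gauge th ka.

Lemma cauchy_pair E (mu : R -> R -> E -> E) M e : cauchy_on T mu (cball M) -> 0 < e ->
  exists2 dl, 0 < dl & forall s p q x, 0 <= s -> path (step dl) s p -> path (step dl) s q ->
    last s p = last s q -> last s p <= T -> `|x| <= M -> `|scheme mu s p x - scheme mu s q x| <= e.
Proof.
move=> hc e0; have [dl [dl0 h]] := hc (e / 2) (half_pos e0).
exists dl => // s p q x s0 hp hq pq pT xM.
have [r [hr rp rq]] := common_refinement hp hq pq erefl.
rewrite -(subrKA (scheme mu s r x)) (le_trans (ler_normD _ _))//.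
have -> : e = e / 2 + e / 2 by field.
by rewrite lerD//; [rewrite distrC|]; apply: h => //; rewrite -pq.
Qed.

(** Convergence as the mesh tends to 0, uniform on balls and in the two times; nothing is asked of
    [phi] outside 0 <= s <= t <= T. *)
Definition limit_flow E (mu phi : R -> R -> E -> E) := forall M e, 0 < e ->
  exists2 dl, 0 < dl & forall s p x, 0 <= s -> path (step dl) s p -> last s p <= T ->
    `|x| <= M -> `|scheme mu s p x - phi s (last s p) x| <= e.

(** Two fine partitions are compared through a common refinement, so a sequence of partitions with
    mesh tending to 0 gives a Cauchy sequence whose limit serves all fine partitions. Completeness
    comes from finite dimension. *)
Lemma good_limit E (mu : R -> R -> E -> E) : findim E ->
  (forall M, cauchy_on T mu (cball M)) -> exists phi, limit_flow mu phi.
Proof.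
move=> fE hc; pose D := (R * R * E)%type; pose dom (z : D) := 0 <= z.1.1 /\ z.1.1 <= z.1.2 <= T.
(* [choice] asks for a limit at every triple; the value 0 is taken outside the domain. *)
have hl (z : D) : exists l, dom z -> forall e, 0 < e -> exists2 dl, 0 < dl &
    forall p, path (step dl) z.1.1 p -> last z.1.1 p = z.1.2 -> `|scheme mu z.1.1 p z.2 - l| <= e.
  have [[s0 /andP[st tT]]|ndom] := pselect (dom z); last by exists 0.
  have pn n : exists p, path (step n.+1%:R^-1) z.1.1 p /\ last z.1.1 p = z.1.2.
    by apply: fine_partition => //; rewrite invr_gt0.
  have [P hP] := choice pn.
  have fine e : 0 < e -> exists2 dl, 0 < dl & exists n0, forall n p, (n0 <= n)%N ->
      path (step dl) z.1.1 p -> last z.1.1 p = z.1.2 ->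
      `|scheme mu z.1.1 p z.2 - scheme mu z.1.1 (P n) z.2| <= e /\
      path (step dl) z.1.1 (P n).
    move=> e0; have [dl dl0 h] := cauchy_pair (hc `|z.2|) e0.
    exists dl => //; exists (Num.truncn dl^-1) => n p hn hp hl; have [Pn1 Pn2] := hP n.
    have Pn : path (step dl) z.1.1 (P n).
      apply: path_stepW Pn1; rewrite invf_ple ?posrE// ltW// (lt_le_trans (truncnS_gt _))//.
      by rewrite ler_nat ltnS.
    by split => //; apply: h => //; rewrite hl.
  have [l hl] : exists l, forall e, 0 < e -> exists n0, forall n, (n0 <= n)%N ->
      `|scheme mu z.1.1 (P n) z.2 - l| <= e.
    apply: findim_complete => // e e0; have [dl dl0 [n0 h0]] := fine e e0.
    have [p [hp lp]] := fine_partition dl0 st.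
    exists n0 => m n hm hn; have [_ Pm] := h0 _ _ hm hp lp.
    by have [] := h0 n (P m) hn Pm (hP m).2.
  exists l => _ e e0; have [dl dl0 [n0 h0]] := fine (e / 2) (half_pos e0).
  have [n1 h1] := hl (e / 2) (half_pos e0).
  exists dl => // p hp lp; rewrite -(subrKA (scheme mu z.1.1 (P (maxn n0 n1)) z.2)).
  rewrite (le_trans (ler_normD _ _))// (_ : e = e / 2 + e / 2); last by field.
  rewrite lerD ?h1 ?leq_maxr//.
  by have [] := h0 _ p (leq_maxl n0 n1) hp lp.
have [l {}hl] := choice hl; exists (fun s t x => l (s, t, x)) => M e e0.
have [dl dl0 h] := cauchy_pair (hc M) (half_pos e0).
exists dl => // s p x s0 hp pT xM.
have [|dl' dl0' h'] := hl (s, last s p, x) _ (e / 2) (half_pos e0).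
  by split => //=; rewrite (path_step_last hp).
have m0 : 0 < Num.min dl dl' by rewrite lt_min dl0.
have [q [hq lq]] := fine_partition m0 (path_step_last hp).
rewrite -(subrKA (scheme mu s q x)) (le_trans (ler_normD _ _))//.
rewrite (_ : e = e / 2 + e / 2); last by field.
apply: lerD.
  by apply: h => //; apply: path_stepW hq; rewrite ge_min lexx.
by apply: h' => //=; apply: path_stepW hq; rewrite ge_min lexx orbT.
Qed.

Section Flow.
Variables (E : normedModType R) (mu phi : R -> R -> E -> E).
Hypothesis hphi : limit_flow mu phi.

Lemma flow_le_norm M s t B (y : E -> E) : 0 <= s -> s <= t -> t <= T ->
    (exists2 dl, 0 < dl & forall p x, path (step dl) s p -> last s p = t -> `|x| <= M ->
       `|scheme mu s p x - y x| <= B) ->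
  forall x, `|x| <= M -> `|phi s t x - y x| <= B.
Proof.
move=> s0 st tT [dl dl0 h] x xM; apply/ler_addgt0Pr => e e0.
have [dl' dl0' h'] := hphi M e0.
have m0 : 0 < Num.min dl dl' by rewrite lt_min dl0.
have [p [hp lp]] := fine_partition m0 st.
rewrite -(subrKA (scheme mu s p x)) (le_trans (ler_normD _ _))// addrC lerD//.
  by apply: h => //; apply: path_stepW hp; rewrite ge_min lexx.
rewrite distrC -lp h' ?lp//; apply: path_stepW hp; rewrite ge_min lexx orbT//.
Qed.

Lemma flow_id s x : 0 <= s -> s <= T -> phi s s x = x.
Proof.
move=> s0 sT; apply/eqP; rewrite -subr_eq0 -normr_le0.
apply: (@flow_le_norm `|x| s s 0 id) => //; exists 1 => // -[|t p] y /=.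
  by rewrite subrr normr0.
by move=> /andP[/andP[st _] /path_step_last]; rewrite leNgt => /negP h lp; rewrite lp in h.
Qed.

Lemma flow_bounded M : bounded_on T mu (cball M) -> exists M', forall s t x,
  0 <= s -> s <= t -> t <= T -> `|x| <= M -> `|phi s t x| <= M'.
Proof.
move=> [M' [dl [dl0 h]]]; exists M' => s t x s0 st tT xM; rewrite -[phi s t x]subr0.
apply: (@flow_le_norm M s t M' (fun=> 0)) => //; exists dl => // p y hp lp yM.
by rewrite subr0; apply: h => //; rewrite lp.
Qed.

(** Partitions of [s, t] through [r] are considered. On [r, t] the scheme starts from a point of the
    ball [M1] that contains all fine schemes over [s, r], so its distance to [mu r t] is controlled,
    and continuity of [mu r t] passes this to the limit. *)
Lemma flow_davie M : good T th mu -> (forall s t, continuous (mu s t)) ->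
  exists K dl, [/\ 0 <= K, 0 < dl & forall s r t x, 0 <= s -> s <= r -> r <= t -> t <= T ->
    t - r <= dl -> `|x| <= M -> `|phi s t x - mu r t (phi s r x)| <= K * th (t - r)].
Proof.
move=> hg cmu; have [[M1 [dl1 [dl10 h1]]] _ _] := hg M.
have [_ [K [dl2 [K0 dl20 h2]]] _] := hg M1.
exists K, dl2; split => // s r t x s0 sr rt tT td xM; apply/ler_addgt0Pr => e e0.
have e20 : 0 < e / 2 by rewrite divr_gt0.
have /cvgrPdist_le /(_ _ e20) /nbhs_normP[d /= d0 hd] := cmu r t (phi s r x).
have dd0 : 0 < Num.min (d / 2) (e / 2) by rewrite lt_min !divr_gt0.
have [dl3 dl30 h3] := hphi M dd0.
pose dl := Num.min dl1 (Num.min dl2 dl3); have dl0 : 0 < dl by rewrite !lt_min dl10 dl20.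
have [e1 e2 e3] : [/\ dl <= dl1, dl <= dl2 & dl <= dl3].
  by rewrite /dl !ge_min !lexx !orbT.
have [p [hp lp]] := fine_partition dl0 sr; have [q [hq lq]] := fine_partition dl0 rt.
have rT : r <= T by exact: le_trans tT.
have r0 : 0 <= r by exact: le_trans sr.
have hpq : path (step dl) s (p ++ q) by rewrite path_step_cat hp lp.
have a1 : `|scheme mu s p x - phi s r x| <= Num.min (d / 2) (e / 2).
  by rewrite -lp; apply: h3; rewrite ?lp//; exact: path_stepW hp.
have a2 : `|scheme mu s (p ++ q) x - phi s t x| <= Num.min (d / 2) (e / 2).
  have := h3 s (p ++ q) x s0 (path_stepW e3 hpq); rewrite last_cat lp lq; exact.
rewrite scheme_cat lp in a2.
have a3 : `|scheme mu r q (scheme mu s p x) - mu r t (scheme mu s p x)| <= K * th (t - r).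
  have := h2 r q (scheme mu s p x) r0 (path_stepW e2 hq); rewrite lq; apply=> //.
  by apply: h1; rewrite ?lp//; exact: path_stepW hp.
have a4 : `|mu r t (phi s r x) - mu r t (scheme mu s p x)| <= e / 2.
  apply: hd; rewrite /ball_ /= distrC (le_lt_trans a1)// gt_min.
  by rewrite ltr_pdivrMr// ltr_pMr// ltr1n.
have {}a2 : `|scheme mu r q (scheme mu s p x) - phi s t x| <= e / 2.
  by rewrite (le_trans a2)// ge_min lexx orbT.
set y := scheme mu s p x in a2 a3 a4 *.
have -> : phi s t x - mu r t (phi s r x) = (scheme mu r q y - mu r t y) -
   (scheme mu r q y - phi s t x) - (mu r t (phi s r x) - mu r t y) by lmod.
rewrite (le_trans (ler_normB _ _))// (le_trans (lerD (ler_normB _ _) (lexx _)))//.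
rewrite (le_trans (lerD (lerD a3 a2) a4))// -addrA lerD2l.
by rewrite [leRHS](_ : e = e / 2 + e / 2)//; field.
Qed.

Lemma flow_continuous s t : 0 <= s -> s <= t -> t <= T -> (forall s t, continuous (mu s t)) ->
  continuous (phi s t).
Proof.
move=> s0 st tT cmu x; apply/cvgrPdist_le => e e0.
have e30 : 0 < e / 3 by rewrite divr_gt0.
have [dl dl0 h] := hphi (`|x| + 1) e30; have [p [hp lp]] := fine_partition dl0 st.
have cs : continuous (scheme mu s p).
  elim: (p) (s) => [|u q IH] v /=; first by move=> ?; exact: cvg_id.
  by move=> z; apply: (continuous_comp (cmu _ _ z) (IH _ _)).
have /cvgrPdist_le /(_ _ e30) hx := cs x.
near=> y.
have yx : `|x - y| <= 1.
  by near: y; apply: (@cvgr_dist_le _ _ _ (nbhs x) _ id) => //; exact: cvg_id.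
have xM : `|x| <= `|x| + 1 by rewrite lerDl.
have yM : `|y| <= `|x| + 1.
  by rewrite -(subrK x y) addrC (le_trans (ler_normD _ _))// lerD// distrC.
have b1 := h s p x s0 hp _ xM; have b2 := h s p y s0 hp _ yM; rewrite lp in b1 b2.
have b3 : `|scheme mu s p x - scheme mu s p y| <= e / 3 by near: y.
have -> : phi s t x - phi s t y = (scheme mu s p x - scheme mu s p y) -
  (scheme mu s p x - phi s t x) + (scheme mu s p y - phi s t y) by lmod.
rewrite (le_trans (ler_normD _ _))// (le_trans (lerD (ler_normB _ _) (lexx _)))//.
rewrite (le_trans (lerD (lerD b3 (b1 tT)) (b2 tT)))//.
by rewrite [leRHS](_ : e = e / 3 + e / 3 + e / 3)//; field.
Unshelve. all: by end_near.
Qed.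

End Flow.

End Limits.

(** * Differentiability of limit flows *)

Section LimitDerivative.
Context {R : realType}.
Implicit Types (E : normedModType R) (s t u : R) (p q : seq R).
Variables (T : R) (th : R -> R) (ka : R).
Hypothesis hth : gauge th ka.

Lemma le_small (a b c : R) : 0 <= c -> (forall e, 0 < e -> a <= b + c * e) -> a <= b.
Proof.
move=> c0 h; apply/ler_addgt0Pr => e e0; have c1 : 0 < c + 1 by rewrite ltr_wpDl.
rewrite (le_trans (h (e / (c + 1)) _)) ?divr_gt0// lerD2l mulrCA ler_piMr ?(ltW e0)//.
by rewrite ler_pdivrMr// mul1r lerDl.
Qed.

(** The derivatives of the schemes are cocycles, which converge uniformly on balls. Their limit is
    therefore linear in the vector and continuous in the base point, and the mean value inequality
    for the schemes passes to the limit. *)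
Lemma limit_flow_diff E (mu phi : R -> R -> E -> E) (A : R -> R -> E -> E -> E)
    (psi : R -> R -> E * E -> E * E) : findim E ->
    (forall s t x, is_diff x (mu s t) (A s t x)) ->
    (forall s t, continuous (prolong mu A s t)) ->
    limit_flow T mu phi -> limit_flow T (prolong mu A) psi ->
  forall s t x, 0 <= s -> s <= t -> t <= T ->
    (forall v, (psi s t (x, v)).1 = phi s t x) /\
    is_diff x (phi s t) (fun v => (psi s t (x, v)).2).
Proof.
move=> fE hd cA hphi hpsi s t x s0 st tT.
have approx M e : 0 < e -> exists2 p, path (step 1) s p /\ last s p = t &
    forall y v, `|y| <= M -> `|v| <= M -> [/\ `|scheme mu s p y - phi s t y| <= e,
       `|scheme mu s p y - (psi s t (y, v)).1| <= e &
       `|cocycle mu A s p y v - (psi s t (y, v)).2| <= e].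
  move=> e0; have [d1 d10 h1] := hphi M e e0; have [d2 d20 h2] := hpsi M e e0.
  have d0 : 0 < Num.min 1 (Num.min d1 d2) by rewrite !lt_min ltr01 d10.
  have [p [hp lp]] := fine_partition d0 st; exists p.
    by split => //; apply: path_stepW hp; rewrite ge_min lexx.
  move=> y v yM vM; have hp1 : path (step d1) s p by apply: path_stepW hp; rewrite !ge_min lexx !orbT.
  have hp2 : path (step d2) s p by apply: path_stepW hp; rewrite !ge_min lexx !orbT.
  have b1 := h1 s p y s0 hp1; rewrite lp in b1.
  have b2 := h2 s p (y, v) s0 hp2; rewrite lp scheme_prolong !prod_normE /= in b2.
  have /andP[b3 b4] : (`|scheme mu s p y - (psi s t (y, v)).1| <= e) &&
     (`|cocycle mu A s p y v - (psi s t (y, v)).2| <= e).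
    by rewrite -ge_max; apply: b2 => //; rewrite ge_max yM.
  by split => //; exact: b1.
have Alin s' t' y : linear (A s' t' y).
  have -> : A s' t' y = 'd (mu s' t') y by apply/funext => v; rewrite (is_diff_eval _ (hd s' t' y)).
  exact: linearP.
have clin p s' y : linear (cocycle mu A s' p y).
  by elim: p s' y => //= u p IH s' y a v w; rewrite Alin IH.
pose D y v := (psi s t (y, v)).2.
have Dlin y : linear (D y).
  move=> a v w; apply/eqP; rewrite -subr_eq0 -normr_le0.
  apply: (@le_small _ _ (`|a| + 2)) => [|e e0]; first by rewrite addr_ge0.
  pose M := `|y| + `|a *: v + w| + `|v| + `|w|.
  have [p _ hp] := approx M e e0.
  have [b1 b2 b3 b4] : [/\ `|y| <= M, `|a *: v + w| <= M, `|v| <= M & `|w| <= M].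
    have := (normr_ge0 y, normr_ge0 (a *: v + w), normr_ge0 v, normr_ge0 w).
    by rewrite /M => -[[[]]]; move: `|y| `|a *: v + w| `|v| `|w| => ? ? ? ? *; split; lra.
  have [_ _ c1] := hp _ _ b1 b2; have [_ _ c2] := hp _ _ b1 b3; have [_ _ c3] := hp _ _ b1 b4.
  rewrite clin -/(D _ _) in c1; rewrite -/(D _ _) in c2; rewrite -/(D _ _) in c3.
  have -> : D y (a *: v + w) - (a *: D y v + D y w) =
     - (a *: cocycle mu A s p y v + cocycle mu A s p y w - D y (a *: v + w)) +
     a *: (cocycle mu A s p y v - D y v) + (cocycle mu A s p y w - D y w) by lmod.
  rewrite add0r (le_trans (ler_normD _ _))// (le_trans (lerD (ler_normD _ _) c3))//.
  rewrite normrN normrZ (le_trans (lerD (lerD c1 (ler_wpM2l _ c2)) (lexx _)))//.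
  by rewrite le_eqVlt; apply/orP; left; apply/eqP; ring.
split=> [v|].
  apply/eqP; rewrite -subr_eq0 -normr_le0; apply: (@le_small _ _ 2) => // e e0.
  have [p _ hp] := approx (`|x| + `|v|) e e0.
  have [] := hp x v; [by rewrite lerDl|by rewrite lerDr|move=> c1 c2 _].
  have -> : (psi s t (x, v)).1 - phi s t x = (scheme mu s p x - phi s t x) - (scheme mu s p x - (psi s t (x, v)).1) by lmod.
  by rewrite add0r (le_trans (ler_normB _ _))// mulr2n mulrDl mul1r lerD.
apply: is_diff_eps (Dlin x) (findim_lin_bound fE (Dlin x)) _ => e e0.
have [KE KE0 hKE] := mean_value_affine fE.
have [m [b [c [lc bc ec]]]] := fE; have [C C0 hC] := findim_coord_bound bc.
have fE2 := findim_prod fE fE.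
have cpsi := flow_continuous hpsi s0 st tT cA.
pose e1 := e / (KE * (m%:R * C) + 1).
have KC0 : 0 <= KE * (m%:R * C) by rewrite !mulr_ge0.
have e10 : 0 < e1 by rewrite divr_gt0// ltr_wpDl.
have hb i : exists2 dl, 0 < dl & forall y, `|y - x| < dl -> `|D y (b i) - D x (b i)| <= e1.
  have /cvgrPdist_le /(_ _ e10) /nbhs_normP[dl /= dl0 hdl] := cpsi (x, b i).
  exists dl => // y yx; have := hdl (y, b i).
  rewrite /ball_ /= prod_normE /= subrr normr0 gt_max distrC yx dl0 => /(_ isT).
  by rewrite prod_normE ge_max => /andP[_]; rewrite distrC.
have hdl : exists2 dl, 0 < dl & forall y, `|y - x| < dl -> forall i, `|D y (b i) - D x (b i)| <= e1.
  have {hb}[dl hb] := choice (fun i => (let: ex_intro2 a p q := hb i in ex_intro _ a (conj p q))).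
  exists (\big[Num.min/1]_i dl i).
    by apply: lt_bigmin => // i _; case: (hb i).
  move=> y hy i; have [_] := hb i; apply; apply: lt_le_trans hy _; exact: bigmin_le.
have [dl dl0 {}hdl] := hdl.
have Dx y v : `|y - x| < dl -> `|D y v - D x v| <= m%:R * C * e1 * `|v|.
  move=> yx; have Ds z (r : seq 'I_m) : D z (\sum_(i <- r) c i v *: b i) = \sum_(i <- r) c i v *: D z (b i).
    elim: r => [|i r IH]; last by rewrite !big_cons Dlin IH.
    by rewrite !big_nil; have := Dlin z (-1) 0 0; rewrite scaler0 addr0 scaleN1r addNr.
  rewrite [in D y v](ec v) [in D x v](ec v) !Ds -sumrB (le_trans (ler_norm_sum _ _ _))//.
  apply: (@le_trans _ _ (\sum_(i < m) C * e1 * `|v|)); last first.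
    by rewrite sumr_const card_ord -[leLHS]mulr_natl !mulrA.
  apply: ler_sum => i _; rewrite -scalerBr normrZ -mulrA [e1 * _]mulrC mulrA.
  by apply: ler_pM => //; exact: hdl.
(* The increment [h] is fixed; the scheme is then taken so fine that its error [eta] disappears from
   the estimate. *)
exists dl => // h hdlh; apply: (@le_small _ _ (3 + KE * 2)) => [|eta eta0].
  by rewrite addr_ge0// mulr_ge0.
have [p _ hp] := approx (`|x| + `|h|) eta eta0.
have hM : `|h| <= `|x| + `|h| by rewrite lerDr.
have rM r : 0 <= r <= 1 -> `|x + r *: h| <= `|x| + `|h|.
  move=> /andP[r0 r1]; rewrite (le_trans (ler_normD _ _))// lerD2l normrZ ger0_norm//.
  by rewrite ler_piMl.
have xM : `|x| <= `|x| + `|h| by rewrite lerDl.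
have x1M : `|x + h| <= `|x| + `|h| by rewrite ler_normD.
have [a1 _ _] := hp _ _ x1M hM; have [a2 _ a3] := hp _ _ xM hM; rewrite -/(D _ _) in a3.
have mv : `|scheme mu s p (x + h) - scheme mu s p x - D x h| <= KE * (m%:R * C * e1 * `|h| + eta).
  apply: hKE => [y|r r01]; first exact: (@ex_diff _ _ _ _ _ _ _ (scheme_diff s p y hd)).
  rewrite (is_diff_eval _ (scheme_diff s p _ hd)).
  have [_ _ a4] := hp _ _ (rM r r01) hM; rewrite -/(D _ _) in a4.
  rewrite -(subrKA (D (x + r *: h) h)) addrC (le_trans (ler_normD _ _))// lerD//.
  apply: Dx; rewrite addrC addKr normrZ; case/andP: r01 => r0 r1; rewrite ger0_norm//.
  by rewrite (le_lt_trans _ hdlh)// ler_piMl.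
have -> : phi s t (x + h) - phi s t x - D x h = (scheme mu s p (x + h) - scheme mu s p x - D x h) -
   (scheme mu s p (x + h) - phi s t (x + h)) + (scheme mu s p x - phi s t x) by lmod.
rewrite (le_trans (ler_normD _ _))// (le_trans (lerD (ler_normB _ _) (lexx _)))//.
rewrite (le_trans (lerD (lerD mv a1) a2))//.
have h1 : KE * (m%:R * C * e1 * `|h|) <= e * `|h|.
  have : KE * (m%:R * C) * e1 <= e.
    by rewrite /e1 mulrA ler_pdivrMr ?ltr_wpDl// mulrC ler_pM2l// lerDl.
  by rewrite -!mulrA => h1; rewrite !mulrA ler_wpM2r// -!mulrA.
have eK : 0 <= KE * eta by rewrite mulr_ge0// ltW.
rewrite mulrDr; move: h1 eK eta0; move: (KE * (m%:R * C * e1 * `|h|)) => z h1 eK eta0.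
rewrite (_ : (3 + KE * 2) * eta = 3 * eta + 2 * (KE * eta)); last by ring.
by lra.
Qed.

End LimitDerivative.

(** * Smoothness of the rough flow *)

Section SmoothFlow.
Context {R : realType} {d : nat}.
Implicit Types E V : normedModType R.
Variables (T gamma : R) (N : nat) (Om : R -> R -> seq 'I_d -> R).
Hypotheses (gamma01 : 0 < gamma < 1) (gammaN : 1 < N.+1%:R * gamma).
Hypothesis hOm : rough_increments gamma N Om.

Lemma locreg_Ck0 E m (f : 'I_d -> E -> E) i : locreg m f -> reg m set0 (f i).
Proof. by move=> hf; apply: reg_sub (hf i 0). Qed.

Lemma mu_continuous E (f : 'I_d -> E -> E) s t : findim E -> locreg N f ->
  continuous (mu N Om f s t).
Proof.
move=> fE hf x; apply/differentiable_continuous.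
have h := is_diff_mu Om s t x fE (fun i => locreg_Ck0 i hf).
exact: (@ex_diff _ _ _ _ _ _ _ h).
Qed.

Lemma flow_exists E (f : 'I_d -> E -> E) : findim E ->
  good T (theta gamma N) (mu N Om f) -> exists phi, limit_flow T (mu N Om f) phi.
Proof. by move=> fE hg; apply: good_limit => // M; have [] := hg M. Qed.

Lemma flow_tangent E (f : 'I_d -> E -> E) phi psi : findim E -> locreg N.+1 f ->
    limit_flow T (mu N Om f) phi -> limit_flow T (mu N Om (fun i => tangent (f i))) psi ->
  forall s t x, 0 <= s -> s <= t -> t <= T -> (forall v, (psi s t (x, v)).1 = phi s t x) /\
    is_diff x (phi s t) (fun v => (psi s t (x, v)).2).
Proof.
move=> fE hf hphi hpsi; have fE2 := findim_prod fE fE.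
have cT s t : continuous (mu N Om (fun i => tangent (f i)) s t).
  by apply: mu_continuous => //; exact: locreg_tangent.
have mT : mu N Om (fun i => tangent (f i)) = prolong (mu N Om f) (dmu N Om f).
  by apply: mu_tangent => // i; exact: locreg_Ck hf.
rewrite mT in hpsi; apply: (limit_flow_diff (mu := mu N Om f) (A := dmu N Om f)) => //.
  by move=> s t x; apply: is_diff_mu => // i; exact: locreg_Ck0 (locregW (leqnSn N) hf).
by move=> s t; rewrite -mT; exact: cT.
Qed.

(** The induction runs over all finite-dimensional spaces at once: a directional derivative of [phi]
    is a slice of the limit flow of the tangent fields, to which the induction hypothesis applies on
    the doubled space. *)
Lemma flow_Ck k E (f : 'I_d -> E -> E) phi : findim E ->
    good T (theta gamma N) (mu N Om f) -> locreg (N.+1 + k) f -> limit_flow T (mu N Om f) phi ->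
  forall s t, 0 <= s -> s <= t -> t <= T -> Ck k.+1 (phi s t).
Proof.
have slice m E' (psi : E' * E' -> E' * E') v : Ck m psi -> Ck m (fun x => (psi (x, v)).2).
  move=> /Ck_reg hp; have := @reg_preaffine R E' (E' * E')%type (E' * E')%type m set0 set0
    (fun x => (x, 0)) (0, v) psi.
  have -> : (fun x : E' => psi ((x, 0) + (0, v))) = (fun x => psi (x, v)).
    by apply/funext => x; congr psi; congr (_, _); rewrite /= ?addr0 ?add0r.
  move=> h; have {}h := h _ _ _ hp.
  apply: (@reg_Ck _ _ _ m set0).
  apply: (@reg_postlin _ _ _ _ m set0 (fun p : E' * E' => p.2) (fun x => psi (x, v))) => //.
    by exists 1 => -[a b]; rewrite mul1r prod_normE le_max lexx orbT.
  apply: h => //.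
    by move=> a x y; congr (_, _); rewrite /= scaler0 addr0.
  by exists 1 => x; rewrite mul1r prod_normE ge_max lexx /= normr0.
elim: k E f phi => [|k IH] E f phi fE hg hf hphi s t s0 st tT.
all: have hf1 : locreg N.+1 f by apply: locregW hf; rewrite ?leq_addr ?addn0.
all: have fE2 := findim_prod fE fE.
all: have hgT := good_tangent (T := T) gamma01 gammaN hOm fE hf1 hg.
all: have [psi hpsi] := flow_exists fE2 hgT.
all: have hd x := flow_tangent fE hf1 hphi hpsi x s0 st tT.
all: have dE v : (fun x => 'd (phi s t) x v) = (fun x => (psi s t (x, v)).2)
  by apply/funext => x; have [_ h] := hd x; rewrite (is_diff_eval _ h).
all: split=> [x|v]; first by have [_ h] := hd x; exact: (@ex_diff _ _ _ _ _ _ _ h).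
all: rewrite dE; apply: slice.
  apply: (flow_continuous hpsi) => // u v'; apply: mu_continuous => //.
  exact: locreg_tangent.
apply: (IH _ _ _ fE2 hgT) => //.
by apply: locreg_tangent => //; rewrite -addnS.
Qed.

End SmoothFlow.

(** * Solutions and Davie expansions *)

Section PathExpansion.
Context {R : realType} {d : nat}.
Implicit Types E V : normedModType R.

Lemma coef_bseqE (V : lmodType R) N (z : tens d N V) (w : N.-bseq 'I_d) : coef z w = z w.
Proof. by rewrite /coef valK. Qed.

Lemma coef_finfun (V : lmodType R) N (F : seq 'I_d -> V) w : (size w <= N)%N ->
  coef ([ffun u : N.-bseq 'I_d => F u] : tens d N V) w = F w.
Proof. by move=> wN; rewrite -[w]/(bseqval (Bseq wN)) coef_bseqE ffunE. Qed.

(** The coefficients [F_b(y)] are the iterated derivatives of the identity along the fields, so the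
    lift of [f i] at [w] is the derivative of [f i], itself [F_w] of a one-letter word, along
    [w]. *)
Lemma faa_di_bruno_Fw E N (f : 'I_d -> E -> E) (z : tens d N E) w y i : findim E ->
    (forall i, Ck (size w) (f i)) -> (size w <= N)%N ->
    (forall b, (size b <= size w)%N -> coef z b = Fw f b y) ->
  faa_di_bruno (f i) z w = Fw f (rcons w i) y.
Proof.
move=> fE cf wN hz; rewrite faa_di_bruno_parts//.
have -> : z [bseq] = y by rewrite -coef_bseqE hz.
rewrite -cats1 -dwords_Fw Fw1 (@dwords_field _ _ _ fE f _ (size w))//; last first.
  by move=> j; apply: Ck_reg; apply: CkW (cf j); exact: leq_pred.
rewrite big_seq [RHS]big_seq; apply: eq_bigr => bs /parts_size[_ h]; congr (Dn _ _ _).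
by apply/eq_in_map => b /h; exact: hz.
Qed.

Variables (gamma : R) (N : nat) (Om : R -> R -> seq 'I_d -> R).
Hypothesis hOm : rough_increments gamma N Om.

(** [chain_expansion] at the one-step point, followed by a passage to [y] at cost om^N, admissible
    since r < N. Only order [N] is assumed for the path because a solution is at first known to no
    higher order. *)
Lemma path_expansion E V (f : 'I_d -> E -> E) (g : E -> V) r M C0 L : findim E -> findim V ->
    locreg N f -> (forall M, reg r.+1 (cball M) g) -> (r < N)%N -> 0 <= C0 -> 1 <= L ->
  exists2 C, 0 <= C & forall s u x y, `|u - s| `^ gamma <= L -> `|x| <= M -> `|y| <= M ->
    `|y - mu N Om f s u x| <= C0 * (`|u - s| `^ gamma) ^+ N ->
    `|g y - \sum_(w : N.-bseq 'I_d | (size w <= r)%N) Om s u w *: dwords f g w x| <=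
      C * (`|u - s| `^ gamma) ^+ r.+1.
Proof.
move=> fE fV hf hg rN C00 L1; have [K K0 hK] := ri_bound hOm.
have [CD CD0 hCD] := increment_bound fE (fun i => hf i M) K0 L1.
have L0 : 0 <= L by exact: le_trans L1.
pose M2 := M + CD * L.
have [C1 C10 hC1] := chain_expansion fE fV (ltnW rN) (fun i => hf i M2) (hg M2) K0 L1.
have [KE KE0 hKE] := mean_value_ineq fV.
have [CG CG0 hCG] := reg_Dn_bound fE (hg M2) (ltn0Sn r).
exists (KE * (CG * (C0 * L ^+ N)) + C1); first by rewrite addr_ge0// !mulr_ge0// exprn_ge0.
move=> s u x y omL xM yM hy; set om := `|u - s| `^ gamma in omL hy *.
have om0 : 0 <= om by rewrite powR_ge0.
have a := fun w wN => hK s u w wN.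
have hD : `|increment f N (Om s u) x| <= CD * L.
  rewrite (le_trans (hCD _ om x _ a xM)) ?om0//; exact: ler_wpM2l.
have E1 : mu N Om f s u x = x + increment f N (Om s u) x by apply: muE; exact: hOm.
have seg t : 0 <= t <= 1 -> cball M2 (x + t *: increment f N (Om s u) x).
  move=> /andP[t0 t1]; rewrite /cball /= (le_trans (ler_normD _ _))// lerD// normrZ ger0_norm//.
  by rewrite (le_trans _ hD)// ler_piMl.
have m2 : cball M2 (mu N Om f s u x).
  by rewrite E1 -[increment _ _ _ _]scale1r; apply: seg; rewrite ler01 lexx.
have y2 : cball M2 y by rewrite /cball /= (le_trans yM)// lerDl mulr_ge0.
have e1 := hC1 _ om x (introT andP (conj om0 omL)) (ri_char hOm s u) a seg.
rewrite -E1 in e1.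
have e2 : `|g y - g (mu N Om f s u x)| <= KE * (CG * (C0 * om ^+ N)).
  have := hKE _ g (mu N Om f s u x) (y - mu N Om f s u x) (CG * (C0 * om ^+ N)).
  rewrite [_ + (y - _)]addrC subrK; apply.
    by move=> z; exact: (reg_diff z (ltn0Sn r) (hg 0)).
  move=> t t01; have := hCG _ [:: y - mu N Om f s u x] (cball_segment m2 y2 t01) erefl.
  by rewrite big_seq1 => /le_trans; apply; exact: ler_wpM2l.
rewrite -(subrKA (g (mu N Om f s u x))) (le_trans (ler_normD _ _))// mulrDl lerD//.
rewrite (le_trans e2)// -!mulrA ler_wpM2l// ler_wpM2l// ler_wpM2l//.
by apply: expr_le_expr => //; rewrite rN leqnn.
Qed.

End PathExpansion.

(** * Linear sewing *)

Section LinearSewing.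
Context {R : realType}.
Variables (th : R -> R) (ka : R).
Hypothesis hth : gauge th ka.

Definition riemann (E : normedModType R) (Xi : R -> R -> E) (a : R) (p : seq R) : E :=
  \sum_(I <- intervals a p) Xi I.1 I.2.

Lemma riemann_cons (E : normedModType R) (Xi : R -> R -> E) a t p :
  riemann Xi a (t :: p) = Xi a t + riemann Xi t p.
Proof. by rewrite /riemann /intervals /= big_cons. Qed.

(** Translations by [Xi s t] are one-step maps with Lipschitz constant 1 whose schemes are Riemann
    sums, so the linear sewing lemma is a case of the nonlinear one. *)
Lemma sewing (E : normedModType R) (Xi : R -> R -> E) C a b : findim E -> 0 <= a -> a <= b -> 0 <= C ->
    (forall s, Xi s s = 0) ->
    (forall s u t, a <= s -> s <= u -> u <= t -> t <= b ->
      `|Xi s u + Xi u t - Xi s t| <= C * th (t - s)) ->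
  exists J K, [/\ 0 <= K,
    forall s t, a <= s -> s <= t -> t <= b -> `|J t - J s - Xi s t| <= K * th (t - s) &
    forall t e, a <= t <= b -> 0 < e -> exists2 dl, 0 < dl & forall p, path (step dl) a p ->
      last a p = t -> `|riemann Xi a p - J t| <= e].
Proof.
(* The clamp [c] at [a] extends the germ to times in [0, a], because schemes range over [0, b] and
   [Xi] is controlled only on [a, b]. *)
move=> fE a0 ab C0 Xi0 hXi; pose c (s : R) := Num.max a s.
have cM s t : s <= t -> c s <= c t by move=> st; rewrite /c ge_max !le_max lexx st orbT.
have ca s : a <= c s by rewrite /c le_max lexx.
have cb s : s <= b -> c s <= b by move=> sb; rewrite /c ge_max ab.
have cd s t : s <= t -> c t - c s <= t - s.
  by move=> st; rewrite /c /Num.max; case: ltP => h1; case: ltP => h2; lra.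
have cE s : a <= s -> c s = s by move=> sa; rewrite /c; apply/max_idPr.
pose m (s t : R) (x : E) := x + Xi (c s) (c t).
have [ka0 ka1] := andP (gauge_ka hth).
have h2 : forall s u t (x : E), 0 <= s -> s <= u -> u <= t -> t <= b -> t - s <= b -> setT x ->
    `|m u t (m s u x) - m s t x| <= C * th (t - s).
  move=> s u t x s0 su ut tb _ _; rewrite /m.
  have -> : x + Xi (c s) (c u) + Xi (c u) (c t) - (x + Xi (c s) (c t)) =
    Xi (c s) (c u) + Xi (c u) (c t) - Xi (c s) (c t) by lmod.
  rewrite (le_trans (hXi _ _ _ _ _ _ _))// ?cM ?cb// ler_wpM2l//.
  by apply: (gauge_le hth); rewrite ?subr_ge0 ?cM ?cd ?(le_trans su).
have lip s t (x y : E) : `|m s t x - m s t y| <= 1 * `|x - y| by rewrite mul1r (_ : m s t x - m s t y = x - y)// /m; lmod.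
have hk : (1 + 1) * ka < 1 by lra.
have [K K0 hK] := scheme_close hth (E := E) (mu := m) (dl := b) (T := b) (S := fun=> setT)
  (fun _ _ _ _ _ _ _ _ => I) (fun s x => etrans (congr1 (+%R x) (Xi0 (c s))) (addr0 x)) C0 ler01 hk
  h2 (fun s t x y _ _ _ _ _ _ => lip s t x y).
have sch p s x : a <= s -> path (step b) s p -> scheme m s p x = x + riemann Xi s p.
  elim: p s x => [|t p IH] s x sa /=; first by rewrite /riemann big_nil addr0.
  move=> /andP[/andP[st _] hp]; rewrite riemann_cons IH//; last by rewrite (le_trans sa)// ltW.
  by rewrite /m !cE ?addrA// (le_trans sa)// ltW.
have slip s p (x y : E) : `|scheme m s p x - scheme m s p y| <= 1 * `|x - y|.
  elim: p s x y => [|t p IH] s x y /=; first by rewrite mul1r.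
  by rewrite (le_trans (IH _ _ _))// mul1r lip.
have gap s p : 0 <= s -> last s p <= b -> last s p - s <= b.
  by move=> s0 lb; rewrite (le_trans _ lb)// gerBl.
have b0 : 0 <= b by exact: le_trans ab.
have b1 : 0 < b + 1 by rewrite ltr_wpDl.
have stepb dl s p : 0 <= s -> last s p <= b -> path (step dl) s p -> path (step b) s p.
  elim: p s => //= t p IH s s0 lb /andP[/andP[st _] hp].
  have t0 : 0 <= t by rewrite (le_trans s0)// ltW.
  by rewrite /step st IH//= andbT (le_trans _ lb)// (le_trans _ (path_step_last hp))// gerBl.
have hcau : cauchy_on b m setT.
  apply: (@cauchy_of_lipschitz _ _ _ _ hth E m K 1 (b + 1)) => //.
  move=> s p x s0 hp lb _; apply: hK => //; first exact: stepb hp.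
  exact: gap.
have [phi hphi] : exists phi, limit_flow b m phi.
  apply: good_limit => // M e e0; have [dl [dl0 h]] := hcau e e0.
  by exists dl; split => // s p q x s0 hp hq hr lb _; exact: h.
pose J t := phi a t 0.
have hJ t e : a <= t <= b -> 0 < e -> exists2 dl, 0 < dl & forall p, path (step dl) a p ->
      last a p = t -> `|riemann Xi a p - J t| <= e.
  move=> /andP[at' tb] e0; have [dl dl0 h] := hphi 0 e e0; exists dl => // p hp lp.
  have := h a p 0 a0 hp; rewrite lp normr0 sch ?add0r//; first by apply.
  by apply: stepb hp; rewrite ?lp.
exists J, K; split => // s t sa st tb.
apply: (@le_small _ _ _ 2) => // e e0.
have sb : s <= b by exact: le_trans tb.
have [|d1 d10 h1] := hJ s e _ e0; first by rewrite sa.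
have [|d3 d30 h3] := hJ t e _ e0; first by rewrite (le_trans sa).
have d0 : 0 < Num.min d1 d3 by rewrite lt_min d10.
have [p [hp lp]] := fine_partition d0 sa; have [q [hq lq]] := fine_partition d0 st.
have e1 : `|riemann Xi a p - J s| <= e by apply: h1 => //; apply: path_stepW hp; rewrite ge_min lexx.
have hpq : path (step (Num.min d1 d3)) a (p ++ q) by rewrite path_step_cat hp lp.
have e3 : `|riemann Xi a (p ++ q) - J t| <= e.
  by apply: h3; rewrite ?last_cat ?lp//; apply: path_stepW hpq; rewrite ge_min lexx orbT.
have s0 : 0 <= s by exact: le_trans sa.
have hq' : path (step b) s q by apply: stepb hq; rewrite ?lq.
have e2 : `|riemann Xi s q - Xi s t| <= K * th (t - s).
  have := hK s q 0 s0 hq'; rewrite lq sch// add0r /m !cE// ?(le_trans sa)// add0r; apply=> //.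
  by rewrite -lq; apply: gap; rewrite ?lq.
have rcat : riemann Xi a (p ++ q) = riemann Xi a p + riemann Xi s q.
  rewrite -lp; elim: (p) (a) => [|u r IH] v /=; first by rewrite {2}/riemann big_nil add0r.
  by rewrite !riemann_cons IH addrA.
rewrite rcat in e3.
have -> : J t - J s - Xi s t = (riemann Xi s q - Xi s t) + (riemann Xi a p - J s) -
   (riemann Xi a p + riemann Xi s q - J t) by lmod.
rewrite (le_trans (ler_normB _ _))// (le_trans (lerD (ler_normD _ _) e3))//.
by rewrite mulr2n mulrDl mul1r addrA lerD// lerD.
Qed.

End LinearSewing.

(** * Rough integrals of the driving fields *)

Section RoughIntegrals.
Context {R : realType} {d : nat} {gamma : R}.
Implicit Types E V : normedModType R.
Local Notation N := (Ngam gamma).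
Variables (Om : R -> R -> seq 'I_d -> R) (W : R -> tens d N R) (a b : R).
Hypotheses (gamma01 : 0 < gamma < 1) (gammaN : 1 < N.+1%:R * gamma) (N0 : (0 < N)%N).
Hypotheses (a0 : 0 <= a) (ab : a <= b).
Hypothesis hOm : rough_increments gamma N Om.
Hypothesis hW : forall s t w, a <= s <= b -> a <= t <= b -> (size w <= N)%N ->
  coef (incr W s t) w = Om s t w.

Lemma cuts_rcons (A : eqType) (w : seq A) i :
  cuts (rcons w i) = rcons [seq (p.1, rcons p.2 i) | p <- cuts w] (rcons w i, [::]).
Proof.
elim: w => //= c w ->; rewrite map_rcons -!map_comp.
by [].
Qed.

Lemma convol_rcons (g h : seq 'I_d -> R) w i : h [::] = 1 ->
  convol g h (rcons w i) = \sum_(p <- cuts w) g p.1 * h (rcons p.2 i) + g (rcons w i).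
Proof. by move=> h1; rewrite /convol cuts_rcons big_rcons /= big_map h1 mulr1 addrC. Qed.

Lemma cuts_cat (A : eqType) (w : seq A) p : p \in cuts w -> p.1 ++ p.2 = w.
Proof.
elim: w p => [|c w IH] p /=; first by rewrite inE => /eqP ->.
by rewrite inE => /orP[/eqP -> //|/mapP[q /IH <- ->]].
Qed.

Lemma om_powR (h : R) m : 0 <= h -> (h `^ gamma) ^+ m = h `^ (m%:R * gamma).
Proof. by move=> h0; rewrite -powR_mulrn ?powR_ge0// -powRrM mulrC. Qed.

Lemma size_rcons_bseq (w : N.-1.-bseq 'I_d) i : (size (rcons w i) <= N)%N.
Proof. by rewrite size_rcons (leq_ltn_trans (size_bseq w))// ltn_predL. Qed.

Section Fields.
Variables (E : normedModType R) (f : 'I_d -> E -> E) (Y : R -> E) (M C0 : R).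
Hypotheses (fE : findim E) (hf : locreg N f) (C00 : 0 <= C0).
Hypothesis YM : forall t, a <= t <= b -> `|Y t| <= M.
Hypothesis hY : forall s t, a <= s -> s <= t -> t <= b ->
  `|Y t - mu N Om f s t (Y s)| <= C0 * ((t - s) `^ gamma) ^+ N.

Lemma reg_Fw_ball r v : (r + size v <= N)%N -> (r < N)%N -> forall M, reg r.+1 (cball M) (Fw f v).
Proof.
case: v => [|i v] rv rN M'.
  apply: (@reg_lin _ _ _ r.+1 (cball M') id) => //; first by exists 1 => h; rewrite mul1r.
  by exists M'.
apply: (@regW _ _ _ (N - size v)); first by rewrite ltn_subRL addnC -addnS.
by apply: reg_Fw => //; rewrite (leq_trans _ rv)// (leq_trans (leqnSn _))//= leq_addl.
Qed.

Lemma field_expansion r v : (r + size v <= N)%N -> (r < N)%N ->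
  exists2 C, 0 <= C & forall s t, a <= s -> s <= t -> t <= b ->
    `|Fw f v (Y t) - \sum_(w : N.-bseq 'I_d | (size w <= r)%N) Om s t w *: Fw f (w ++ v) (Y s)|
      <= C * ((t - s) `^ gamma) ^+ r.+1.
Proof.
move=> rv rN; have L1 : 1 <= Num.max 1 ((b - a) `^ gamma) by rewrite le_max lexx.
have [C C1 hC] := path_expansion hOm M fE fE hf (reg_Fw_ball rv rN) rN C00 L1.
exists C => // s t sa st tb; have ts : `|t - s| = t - s by rewrite ger0_norm// subr_ge0.
have := hC s t (Y s) (Y t); rewrite ts => h.
under eq_bigr do rewrite -dwords_Fw; apply: h.
- by rewrite le_max powR_le ?orbT// ?subr_ge0// lerB.
- by apply: YM; rewrite sa (le_trans st).
- by apply: YM; rewrite tb (le_trans sa).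
- exact: hY.
Qed.

Lemma field_hoelder v : (size v <= N)%N -> Defs.hoelder gamma a b (fun t => Fw f v (Y t)).
Proof.
move=> vN; have [C C1 hC] := field_expansion (r := 0) vN N0.
have main s t : a <= s -> s <= t -> t <= b -> `|Fw f v (Y t) - Fw f v (Y s)| <= C * `|t - s| `^ gamma.
  move=> sa st tb; have := hC s t sa st tb; rewrite expr1 ger0_norm ?subr_ge0//.
  rewrite (big_pred1 [bseq]) => [|w]; last by rewrite leqn0 size_eq0 /=; apply/eqP/eqP => [h|->//]; exact: val_inj.
  by rewrite (Om0 hOm) scale1r.
exists C => s t /andP[sa sb] /andP[ta tb]; have [st|ts] := leP s t; first exact: main.
by rewrite distrC [`|t - s|]distrC main// ltW.
Qed.

(** The local approximation of the rough integral of [f i] along [Y], the coefficients of the lift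
    being the [F_(wi)(Y)]. *)
Definition field_germ i s t : E :=
  \sum_(w : N.-1.-bseq 'I_d) Om s t (rcons w i) *: Fw f (rcons w i) (Y s).

(** In Chen's relation for the word w i, the cut with empty right part gives the germ on [s, u]; the
    other terms are regrouped by their right part v i. *)
Lemma field_germ_defect i s u t :
  field_germ i s u + field_germ i u t - field_germ i s t =
  \sum_(v : N.-1.-bseq 'I_d) Om u t (rcons v i) *: (Fw f (rcons v i) (Y u) -
    \sum_(w : N.-bseq 'I_d | (size w <= N.-1 - size v)%N)
       Om s u w *: Fw f (w ++ rcons v i) (Y s)).
Proof.
under [RHS]eq_bigr do rewrite scalerBr.
have -> : field_germ i s u + field_germ i u t - field_germ i s t =
  field_germ i u t - (field_germ i s t - field_germ i s u) by lmod.
rewrite sumrB; congr (_ - _); rewrite /field_germ -sumrB.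
transitivity (\sum_(w : N.-1.-bseq 'I_d | (size w <= N.-1)%N) \sum_(p <- cuts w)
   (Om s u p.1 * Om u t (rcons p.2 i)) *: Fw f (p.1 ++ rcons p.2 i) (Y s)).
  rewrite [RHS]big_mkcond; apply: eq_bigr => w _; rewrite size_bseq -scalerBl.
  have wN : (size (rcons w i) <= N)%N by exact: size_rcons_bseq.
  rewrite (ri_chen hOm s u t wN) convol_rcons ?(Om0 hOm)// addrK scaler_suml.
  rewrite big_seq [RHS]big_seq; apply: eq_bigr => p /cuts_cat <-; rewrite rcons_cat.
  by [].
rewrite (sum_words_cuts (fun p q => (Om s u p * Om u t (rcons q i)) *: Fw f (p ++ rcons q i) (Y s)) (leqnn _)).
apply: eq_bigr => v _; rewrite scaler_sumr.
have vN := size_bseq v.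
rewrite (eq_bigl (fun w : N.-1.-bseq 'I_d => (size w <= N.-1 - size v)%N)); last first.
  by move=> w; rewrite leq_subRL// addnC.
under [RHS]eq_bigr do rewrite scalerA mulrC.
pose G (w : seq 'I_d) := (Om s u w * Om u t (rcons v i)) *: Fw f (w ++ rcons v i) (Y s).
have h : (N.-1 - size v <= N.-1)%N by exact: leq_subr.
rewrite -(sum_widen_words G h) -(sum_widen_words G (leq_trans h (leq_pred N))).
by [].
Qed.

(** In the defect, [Om u t (rcons v i)] has order |v| + 1 and the remainder of [F_(vi)], expanded to
    order N - 1 - |v|, has order N - |v|; together they reach N + 1. *)
Lemma field_sewing i : exists J K, [/\ 0 <= K,
  forall s t, a <= s -> s <= t -> t <= b ->
    `|J t - J s - field_germ i s t| <= K * theta gamma N (t - s) &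
  forall t e, a <= t <= b -> 0 < e -> exists2 dl, 0 < dl & forall p, path (step dl) a p ->
      last a p = t -> `|riemann (field_germ i) a p - J t| <= e].
Proof.
have hC (v : N.-1.-bseq 'I_d) : exists C, 0 <= C /\ forall s t, a <= s -> s <= t -> t <= b ->
    `|Fw f (rcons v i) (Y t) - \sum_(w : N.-bseq 'I_d | (size w <= N.-1 - size v)%N) Om s t w *: Fw f (w ++ rcons v i) (Y s)|
      <= C * ((t - s) `^ gamma) ^+ (N.-1 - size v).+1.
  have [||C C1 h] := @field_expansion (N.-1 - size v) (rcons v i); last by exists C.
    by rewrite size_rcons addnS subnK ?size_bseq// prednK.
  by rewrite (leq_ltn_trans (leq_subr _ _))// ltn_predL.
have [C {}hC] := choice hC; have [K K0 hK] := ri_bound hOm.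
have CK0 : 0 <= \sum_v K * C v by apply: sumr_ge0 => v _; rewrite mulr_ge0//; case: (hC v).
apply: (sewing (theta_gauge gamma01 gammaN) (C := \sum_v K * C v)) => //.
  move=> s; rewrite /field_germ big1// => w _; rewrite (ri_id hOm); last first.
    by exact: size_rcons_bseq.
  by case: (bseqval w) => [|? ?]; rewrite scale0r.
move=> s u t sa su ut tb; rewrite field_germ_defect (le_trans (ler_norm_sum _ _ _))//.
rewrite mulr_suml ler_sum// => v _; rewrite normrZ.
have st : s <= t by exact: le_trans ut.
have om1 : `|t - u| `^ gamma <= (t - s) `^ gamma.
  by rewrite ger0_norm ?subr_ge0// powR_le// ?subr_ge0// lerB.
have om2 : (u - s) `^ gamma <= (t - s) `^ gamma by rewrite powR_le// ?subr_ge0// lerB.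
have [Cv0 hCv] := hC v.
have vN : (size (rcons v i) <= N)%N by exact: size_rcons_bseq.
have -> : K * C v * theta gamma N (t - s) =
   K * ((t - s) `^ gamma) ^+ size (rcons v i) * (C v * ((t - s) `^ gamma) ^+ (N.-1 - size v).+1).
  rewrite /theta (_ : N.+1 = size (rcons v i) + (N.-1 - size v).+1)%N ?exprD; first by ring.
  by rewrite size_rcons addnS addSn subnKC ?size_bseq// prednK.
apply: ler_pM => //.
  by rewrite (le_trans (hK _ _ _ vN))// ler_wpM2l// lerXn2r ?nnegrE ?powR_ge0.
rewrite (le_trans (hCv s u sa su (le_trans ut tb)))// ler_wpM2l//.
by rewrite lerXn2r ?nnegrE ?powR_ge0.
Qed.

End Fields.

End RoughIntegrals.

Lemma sum_words_rcons (A : finType) (Z : nmodType) N (G : seq A -> Z) : (0 < N)%N ->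
  \sum_(w : N.-bseq A | ~~ nilp w) G w = \sum_(v : N.-1.-bseq A) \sum_i G (rcons v i).
Proof.
move=> N0; rewrite pair_bigA /=.
transitivity (\sum_(p : N.-1.-bseq A * A) \sum_(w : N.-bseq A | (w == rcons p.1 p.2 :> seq A)) G w).
  rewrite (exchange_big_dep (fun w : N.-bseq A => ~~ nilp w)) /=; last first.
    by move=> p w _ /eqP ->; rewrite /nilp size_rcons.
  apply: eq_bigr => -[w wN] /= wn; case/lastP: w wN wn => // w x wN _.
  have h : (size w <= N.-1)%N by rewrite -ltnS prednK//; move: (wN); rewrite size_rcons.
  rewrite (big_pred1 (Bseq h, x))// => -[v y] /=; rewrite eqseq_rcons eq_sym [x == y]eq_sym.
  by [].
apply: eq_bigr => p _; have h : (size (rcons p.1 p.2) <= N)%N.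
  by rewrite size_rcons (leq_ltn_trans (size_bseq p.1))// ltn_predL.
by rewrite (big_pred1 (Bseq h)).
Qed.

(** * Riemann sums along the mesh filter *)

Section RiemannSums.
Context {R : realType} {d : nat} {gamma : R}.
Implicit Types (a b t : R) (p : seq R).
Local Notation N := (Ngam gamma).

Lemma mesh_lt_step a p e : path <%R a p -> mesh a p < e -> path (step e) a p.
Proof.
rewrite /mesh /intervals; elim: p a => //= u p IH a /andP[au hp].
by rewrite big_cons gt_max => /andP[h1 h2]; rewrite /step au ltW//= IH.
Qed.

Lemma step_mesh_le a p e : 0 <= e -> path (step e) a p -> mesh a p <= e.
Proof.
move=> e0; rewrite /mesh /intervals; elim: p a => [|u p IH] a /=; first by rewrite big_nil.
by move=> /andP[/andP[_ h] /IH h']; rewrite big_cons ge_max h.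
Qed.

Lemma mesh_to_0_proper a t : a <= t -> ProperFilter (mesh_to_0 a t).
Proof.
move=> at'; apply: filter_from_proper.
  apply: filter_from_filter; first by exists 1 => /=.
  move=> i j /= i0 j0; exists (Num.min i j); first by rewrite /= lt_min i0.
  by move=> p /= [hp]; rewrite lt_min => /andP[h1 h2]; split; split.
move=> e /= e0; have [p [hp lp]] := fine_partition (half_pos e0) at'; exists p; split.
  by split; [exact: path_step_lt hp|exact/eqP].
rewrite (le_lt_trans (step_mesh_le (ltW (half_pos e0)) hp))//.
by rewrite ltr_pdivrMr// ltr_pMr// ltr1n.
Qed.

Lemma rough_int_eq (W : R -> tens d N R) (E : normedModType R) i (Y : R -> tens d N.-1 E) Xi a b t l :
    a <= t <= b ->
    (forall r u, a <= r <= b -> a <= u <= b ->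
      \sum_(w : N.-1.-bseq 'I_d) coef (incr W r u) (rcons w i) *: Y r w = Xi r u) ->
    (forall e, 0 < e -> exists2 dl, 0 < dl & forall p, path (step dl) a p -> last a p = t ->
       `|riemann Xi a p - l| <= e) ->
  rough_int W i Y a t = l.
Proof.
move=> /andP[at' tb] hXi hl; have FF := mesh_to_0_proper at'.
apply: cvg_lim; first exact: norm_hausdorff.
apply/cvgrPdist_le => e e0; have [dl dl0 h] := hl e e0.
exists dl => // p /= [[hp /eqP lp] hm]; have hs := mesh_lt_step hp hm.
rewrite distrC (_ : riemann_sum W i Y a p = riemann Xi a p); first exact: h.
rewrite /riemann_sum /riemann big_seq [RHS]big_seq; apply: eq_bigr => I hI.
have gen q c : path (step dl) c q -> last c q <= b -> a <= c ->
    all (fun I => (a <= I.1 <= b) && (a <= I.2 <= b)) (intervals c q).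
  rewrite /intervals; elim: q c => //= u q IH c /andP[/andP[cu _] hq] lb ac.
  have uq := path_step_last hq; have au : a <= u by rewrite (le_trans ac)// ltW.
  have ub : u <= b by exact: le_trans lb.
  by rewrite ac au ub (le_trans (ltW cu) ub) /= IH.
have hp' := gen _ _ hs (eq_ind_r (fun z => z <= b) tb lp) (lexx a).
by have /allP/(_ _ hI)/andP[h1 h2] := hp'; exact: hXi.
Qed.

Lemma pairing_star_basis m (V : lmodType R) (g : tens d m R) (x : tens d m V) (w : m.-bseq 'I_d) :
  pairing (star g (Defs.basis w)) x =
  \sum_(u : m.-bseq 'I_d | (size u <= m - size w)%N) g u *: coef x (u ++ w).
Proof.
pose G (p q : seq 'I_d) := (coef g p * (q == w :> seq 'I_d)%:R) *: coef x (p ++ q).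
transitivity (\sum_(u : m.-bseq 'I_d | (size u <= m)%N) \sum_(p <- cuts u) G p.1 p.2).
  rewrite [RHS]big_mkcond; apply: eq_bigr => u _; rewrite size_bseq.
  rewrite -(sum_pairs_cuts (N := m)) ?size_bseq// /star ffunE scaler_suml; apply: eq_bigr => p /eqP e.
  by rewrite /G e !coef_bseqE /Defs.basis ffunE.
rewrite sum_words_cuts// (bigD1 w)//= [X in _ + X]big1 ?addr0 => [|v vw]; last first.
  apply: big1 => u _; rewrite /G (_ : (_ == _) = false) ?mulr0 ?scale0r//.
  by apply/negbTE; apply: contra vw => /eqP h; apply/eqP/val_inj.
apply: eq_big => [u|u _]; first by rewrite leq_subRL ?size_bseq// addnC.
by rewrite /G eqxx mulr1 coef_bseqE.
Qed.

End RiemannSums.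

(** * Controlled lifts and lifted integrals *)

Section Equations.
Context {R : realType} {d : nat} {gamma : R}.
Local Notation N := (Ngam gamma).
Variables (Om : R -> R -> seq 'I_d -> R) (W : R -> tens d N R) (a b : R).
Hypotheses (gamma01 : 0 < gamma < 1) (gammaN : 1 < N.+1%:R * gamma) (N0 : (0 < N)%N).
Hypotheses (a0 : 0 <= a) (ab : a <= b).
Hypothesis hOm : rough_increments gamma N Om.
Hypothesis hW : forall s t w, a <= s <= b -> a <= t <= b -> (size w <= N)%N ->
  coef (incr W s t) w = Om s t w.
Variables (E : normedModType R) (f : 'I_d -> E -> E).
Hypotheses (fE : findim E) (hf : locreg N f).

Definition Fw_lift m (Y : R -> E) t : tens d m E := [ffun w : m.-bseq 'I_d => Fw f w (Y t)].

(** The level [N1] is [N] for lifted solutions and [N.+1] for controlled ones; at either level the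
    remainder of the definition is that of a word expansion of [F_w(Y)]. *)
Lemma controlled_lift (N1 : nat) (Y : R -> E) (Z : R -> tens d N1.-1 E) : (0 < N1)%N -> (N1.-1 <= N)%N ->
    (forall t w, a <= t <= b -> Z t w = Fw f w (Y t)) ->
    (forall w : N1.-1.-bseq 'I_d, Defs.hoelder gamma a b (fun t => Fw f w (Y t))) ->
    (forall w : N1.-1.-bseq 'I_d, exists C : R, forall s t, a <= s -> s <= t -> t <= b ->
      `|Fw f w (Y t) - \sum_(u : N.-bseq 'I_d | (size u <= N1.-1 - size w)%N)
          Om s t u *: Fw f (u ++ w) (Y s)| <= C * ((t - s) `^ gamma) ^+ (N1 - size w)) ->
  controlled W (N := N1) a b Z.
Proof.
move=> N10 N1N hZ hh hC; split=> [w|w].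
  have [C hC'] := hh w; exists C => s t sab tab; rewrite !hZ//; exact: hC'.
have [C {}hC] := hC w; exists C => s t sa st tb.
have h1 : a <= s <= b by rewrite sa (le_trans (ltW st)).
have h2 : a <= t <= b by rewrite tb (le_trans sa)// ltW.
rewrite -om_powR ?subr_ge0 ?(ltW st)// hZ// pairing_star_basis.
rewrite (eq_bigr (fun u : N1.-1.-bseq 'I_d => Om s t u *: Fw f (u ++ w) (Y s))); last first.
  move=> u; rewrite leq_subRL ?size_bseq// addnC -size_cat => uw.
  rewrite -[u ++ w]/(bseqval (Bseq uw)) coef_bseqE hZ// /trunc ffunE hW//.
  by rewrite (leq_trans (size_bseq u)).
have := hC s t sa (ltW st) tb.
have h : (N1.-1 - size w <= N1.-1)%N by exact: leq_subr.
pose G (u : seq 'I_d) := Om s t u *: Fw f (u ++ w) (Y s).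
by rewrite -(sum_widen_words G (leq_trans h N1N)) (sum_widen_words G h).
Qed.

Lemma lifted_increment (G : 'I_d -> R -> tens d N.-1 E) s t (w : N.-1.-bseq 'I_d) :
  trunc N.-1 (\sum_i (lifted_int W i (G i) a t - lifted_int W i (G i) a s)) w =
  if nilp w then \sum_i (rough_int W i (G i) a t - rough_int W i (G i) a s) else
  \sum_i (\sum_(v : N.-1.-bseq 'I_d | rcons v i == w :> seq 'I_d) G i t v -
          \sum_(v : N.-1.-bseq 'I_d | rcons v i == w :> seq 'I_d) G i s v).
Proof.
have wN : (size w <= N)%N by rewrite (leq_trans (size_bseq w))// leq_pred.
rewrite /trunc ffunE -[bseqval w]/(bseqval (Bseq wN)) coef_bseqE sum_ffunE.
by case: ifP => hw; apply: eq_bigr => i _; rewrite !ffunE /= hw.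
Qed.

Lemma sum_rcons_eq (G : 'I_d -> N.-1.-bseq 'I_d -> E) v i (h : (size v <= N.-1)%N) :
  \sum_j \sum_(u : N.-1.-bseq 'I_d | rcons u j == rcons v i) G j u = G i (Bseq h).
Proof.
rewrite (bigD1 i)//= [X in _ + X]big1 ?addr0 => [|j ji]; last first.
  by rewrite big_pred0// => u; rewrite eqseq_rcons (negbTE ji) andbF.
rewrite (big_pred1 (Bseq h))// => u; rewrite eqseq_rcons eqxx andbT /=.
by apply/eqP/eqP => [h'|->//]; exact: val_inj.
Qed.

(** Sorted by last letter, the nonempty words turn the sum over [i] of the germs into the increment
    of the one-step map, so sewing bounds the difference at order N + 1. *)
Lemma field_rough_int (Y : R -> E) (Z : R -> tens d N.-1 E) M C0 :
    0 <= C0 -> (forall t, a <= t <= b -> `|Y t| <= M) ->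
    (forall s t, a <= s -> s <= t -> t <= b ->
      `|Y t - mu N Om f s t (Y s)| <= C0 * ((t - s) `^ gamma) ^+ N) ->
    (forall t w, a <= t <= b -> Z t w = Fw f w (Y t)) ->
  exists2 K, 0 <= K & forall s t, a <= s -> s <= t -> t <= b ->
    `|\sum_i (rough_int W i (comp_lift (f i) Z) a t - rough_int W i (comp_lift (f i) Z) a s)
      - increment f N (Om s t) (Y s)| <= K * theta gamma N (t - s).
Proof.
move=> C00 YM hY hZ.
have hi i : exists K, 0 <= K /\ forall s t, a <= s -> s <= t -> t <= b ->
    `|rough_int W i (comp_lift (f i) Z) a t - rough_int W i (comp_lift (f i) Z) a s
      - @field_germ R d gamma Om E f Y i s t| <= K * theta gamma N (t - s).
  have [J [K [K0 h1 h2]]] := field_sewing gamma01 gammaN N0 a0 ab hOm fE hf C00 YM hY i.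
  have JE t : a <= t <= b -> rough_int W i (comp_lift (f i) Z) a t = J t.
    move=> tab; apply: (@rough_int_eq _ _ _ _ _ _ _ (@field_germ R d gamma Om E f Y i) _ b) => //.
      move=> r u rab uab; apply: eq_bigr => w _; rewrite hW ?size_rcons_bseq//.
      congr (_ *: _); rewrite ffunE; apply: faa_di_bruno_Fw; rewrite ?size_bseq//.
        move=> j; apply: CkW (locreg_Ck j hf).
        exact: leq_trans (size_bseq w) (leq_pred N).
      move=> v vw; have vN : (size v <= N.-1)%N by exact: leq_trans vw (size_bseq w).
      by rewrite -[v]/(bseqval (Bseq vN)) coef_bseqE hZ.
    by move=> e e0; exact: h2.
  exists K; split => // s t sa st tb; rewrite !JE//; first exact: h1.
    by rewrite sa (le_trans st).
  by rewrite tb (le_trans sa).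
have [K {}hK] := choice hi; exists (\sum_i K i); first by apply: sumr_ge0 => i _; case: (hK i).
move=> s t sa st tb; have -> : increment f N (Om s t) (Y s) = \sum_i @field_germ R d gamma Om E f Y i s t.
  rewrite exchange_big /= /increment.
  have -> := sum_words_rcons (fun w => Om s t w *: Fw f w (Y s)) N0.
  by [].
rewrite -sumrB (le_trans (ler_norm_sum _ _ _))// mulr_suml ler_sum// => i _.
by have [_] := hK i; apply.
Qed.

End Equations.

(** Along a fine partition the increments of [D] are at most [e] times the steps, up to the factor
    [C], and [e] is arbitrary. *)
Lemma const_of_gauge (R : realType) (E : normedModType R) (th : R -> R) ka (D : R -> E) a b C :
    gauge th ka -> 0 <= C ->
    (forall s t, a <= s -> s <= t -> t <= b -> `|D t - D s| <= C * th (t - s)) ->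
  forall s t, a <= s -> s <= t -> t <= b -> D t = D s.
Proof.
move=> hth C0 hD s t sa st tb; apply/eqP; rewrite -subr_eq0 -normr_le0.
apply: (@le_small _ _ _ (C * (t - s))) => [|e e0]; first by rewrite mulr_ge0// subr_ge0.
have [dl dl0 h] := gauge_small hth e0; have [p [hp lp]] := fine_partition dl0 st.
rewrite add0r -lp; rewrite -lp in tb; elim: p s sa hp {lp st} tb => [|u p IH] s sa /=.
  by move=> _ _; rewrite !subrr normr0 mulr0 mul0r.
move=> /andP[/andP[su ud] hp] tb; have au : a <= u by rewrite (le_trans sa)// ltW.
have ub : u <= b by rewrite (le_trans (path_step_last hp)).
rewrite -(subrKA (D u)) (le_trans (ler_normD _ _))//.
have -> : C * (last u p - s) * e = C * (last u p - u) * e + C * (e * (u - s)) by ring.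
rewrite lerD//; first exact: IH.
rewrite (le_trans (hD _ _ sa (ltW su) ub))// ler_wpM2l// h// subr_ge0 ltW//.
Qed.

(** * Equivalence of the equation with Davie's expansion *)

Section DavieSolutions.
Context {R : realType} {d : nat} (gamma : R).
Local Notation N := (Ngam gamma).
Variables (Om : R -> R -> seq 'I_d -> R) (W : R -> tens d N R) (a b : R).
Hypotheses (gamma01 : 0 < gamma < 1) (gammaN : 1 < N.+1%:R * gamma) (N0 : (0 < N)%N).
Hypotheses (a0 : 0 <= a) (ab : a <= b).
Hypothesis hOm : rough_increments gamma N Om.
Hypothesis hW : forall s t w, a <= s <= b -> a <= t <= b -> (size w <= N)%N ->
  coef (incr W s t) w = Om s t w.
Variables (E : normedModType R) (f : 'I_d -> E -> E).
Hypotheses (fE : findim E) (hf : locreg N f).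

Definition davie (Y : R -> E) := exists2 C, 0 <= C & forall s t, a <= s -> s <= t -> t <= b ->
  `|Y t - mu N Om f s t (Y s)| <= C * theta gamma N (t - s).

Lemma davie_weak Y : davie Y -> exists2 C, 0 <= C & forall s t, a <= s -> s <= t -> t <= b ->
  `|Y t - mu N Om f s t (Y s)| <= C * ((t - s) `^ gamma) ^+ N.
Proof.
move=> [C C0 hC]; exists (C * (b - a) `^ gamma); first by rewrite mulr_ge0// powR_ge0.
move=> s t sa st tb; rewrite (le_trans (hC _ _ sa st tb))// -mulrA ler_wpM2l//.
rewrite /theta exprS ler_wpM2r ?exprn_ge0 ?powR_ge0//.
by rewrite powR_le// ?subr_ge0// lerB.
Qed.

Lemma faa_lift (z : tens d N.-1 E) y (v : seq 'I_d) i : (size v <= N.-1)%N ->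
    (forall u, (size u <= size v)%N -> coef z u = Fw f u y) ->
  faa_di_bruno (f i) z v = Fw f (rcons v i) y.
Proof.
move=> vN hz; apply: faa_di_bruno_Fw => // j; apply: CkW (locreg_Ck j hf).
exact: leq_trans vN (leq_pred N).
Qed.

(** For nonempty words the equation is an identity between coefficients, by [faa_di_bruno_Fw]. For
    the empty word, the path minus its integral has increments of order [theta] and is therefore
    constant. *)
Lemma rde_lifted_of_davie (Y : R -> E) (Z : R -> tens d N.-1 E) M :
    (forall t, a <= t <= b -> `|Y t| <= M) -> davie Y ->
    (forall t w, a <= t <= b -> Z t w = Fw f w (Y t)) ->
  rde_lifted_solution W f a b Z.
Proof.
move=> YM hY hZ; have [C1 C10 hC1] := davie_weak hY; have [C C0 hC] := hY.
have wN (w : N.-1.-bseq 'I_d) : (size w <= N)%N by rewrite (leq_trans (size_bseq w))// leq_pred.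
have hint := field_rough_int gamma01 gammaN N0 a0 ab hOm hW fE hf C10 YM hC1 hZ.
split.
- apply: (controlled_lift hW (f := f) (Y := Y)) => //; first exact: leq_pred.
    move=> w; exact: (field_hoelder gamma01 N0 hOm fE hf C10 YM hC1 (wN w)).
  move=> w; have [||D D0 hD] := field_expansion gamma01 hOm fE hf C10 YM hC1 (r := N.-1 - size w) (v := w).
  + by rewrite subnK ?size_bseq// leq_pred.
  + by rewrite (leq_ltn_trans (leq_subr _ _))// ltn_predL.
  exists D => s t sa st tb; rewrite (le_trans (hD _ _ sa st tb))//.
  by rewrite -subSn ?size_bseq// prednK.
- by move=> w; rewrite !hZ ?lexx.
move=> s t sab tab; apply/ffunP => w; rewrite lifted_increment !ffunE /=.
case: ifP => wn; last first.
  have : (0 < size w)%N by rewrite lt0n; move: wn; rewrite /nilp => ->.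
  case/lastP ew: (bseqval w) => [|v i]// _.
  have vN : (size v <= N.-1)%N.
    by rewrite (leq_trans _ (size_bseq w))// ew size_rcons.
  rewrite sumrB (sum_rcons_eq (fun i => comp_lift (f i) Z t) i vN) (sum_rcons_eq (fun i => comp_lift (f i) Z s) i vN) !ffunE !hZ// ew.
  have coefZ r u : a <= r <= b -> (size u <= size v)%N -> coef (Z r) u = Fw f u (Y r).
    move=> rab uv; have uN : (size u <= N.-1)%N by exact: leq_trans vN.
    by rewrite -[u]/(bseqval (Bseq uN)) coef_bseqE hZ.
  by rewrite (faa_lift i vN (fun u => coefZ t u tab)) (faa_lift i vN (fun u => coefZ s u sab)).
have Z0 r : a <= r <= b -> Z r w = Y r.
  by move=> rab; rewrite hZ//; move/nilP: wn => ->.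
rewrite !Z0//; have [K K0 hK] := hint.
pose D r := Y r - \sum_i rough_int W i (comp_lift (f i) Z) a r.
have hD : forall r u, a <= r -> r <= u -> u <= b -> D u = D r.
  apply: (const_of_gauge (theta_gauge gamma01 gammaN) (C := C + K)); first by rewrite addr_ge0.
  move=> r u ra ru ub; have h1 := hC r u ra ru ub; have h2 := hK r u ra ru ub.
  rewrite sumrB in h2; rewrite /D (muE hOm) in h1 *.
  set P := \sum_i _ in h2 *; set Q := \sum_i _ in h2 *; set I := increment _ _ _ _ in h1 h2.
  have -> : Y u - P - (Y r - Q) = (Y u - (Y r + I)) - (P - Q - I) by lmod.
  by rewrite (le_trans (ler_normB _ _))// mulrDl lerD.
rewrite sumrB; have : D t = D s.
  have [st|ts] := leP s t; case/andP: sab => sa sb; case/andP: tab => ta tb; first exact: hD.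
  by apply/esym/hD => //; exact: ltW.
rewrite /D => /eqP; rewrite subr_eq => /eqP ->.
by rewrite -addrA [Y s - _]addrC -addrA [Y s + _]addrC subrK addrC.
Qed.

Lemma rde_controlled_of_davie (Y : R -> E) M :
    (forall t, a <= t <= b -> `|Y t| <= M) -> davie Y ->
  rde_controlled_solution W f a b (Fw_lift f N Y).
Proof.
move=> YM hY; have [C1 C10 hC1] := davie_weak hY; have [C C0 hC] := hY.
split.
- apply: (controlled_lift hW (f := f) (Y := Y)) => //.
  + by move=> t w _; rewrite /Fw_lift ffunE.
  + by move=> w; exact: (field_hoelder gamma01 N0 hOm fE hf C10 YM hC1 (size_bseq w)).
  (* At the empty word order N + 1 is Davie's expansion itself; at other words [field_expansion]
     suffices, since order N + 1 - |w| is at most N. *)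
  move=> w; case: (posnP (size w)) => [w0|w0].
    exists C => s t sa st tb; rewrite /= w0 subn0 (le_trans _ (hC _ _ sa st tb))//.
    have -> : bseqval w = [::] by apply/nilP; rewrite /nilp w0.
    rewrite le_eqVlt; apply/orP; left; apply/eqP; congr (`|_ - _|).
    rewrite /mu /davie_map big_mkcond; apply: eq_bigr => u _.
    by rewrite size_bseq cats0.
  have [||D D0 hD] := field_expansion gamma01 hOm fE hf C10 YM hC1 (r := N - size w) (v := w).
  + by rewrite subnK ?size_bseq.
  + by rewrite ltn_subrL w0 N0.
  exists D => s t sa st tb; rewrite (le_trans (hD _ _ sa st tb))//.
  by rewrite -subSn ?size_bseq.
- apply: (rde_lifted_of_davie YM hY) => t w tab; rewrite /trunc ffunE /Fw_lift (coef_finfun (fun u => Fw f u (Y t)))//.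
  by rewrite (leq_trans (size_bseq w))// leq_pred.
by move=> t w tab; rewrite /Fw_lift !ffunE.
Qed.

(** By induction on length, the equation gives the coefficient of v i the increments of [F_(vi)(Y)],
    and the initial condition removes the constant. Being controlled then yields an expansion of
    order N only; the estimate of the rough integrals, which needs no more, improves it to order N +
    1. *)
Lemma davie_of_rde (X : R -> tens d N.-1 E) : rde_lifted_solution W f a b X ->
  [/\ exists M, forall t, a <= t <= b -> `|X t [bseq]| <= M,
      forall t (w : N.-1.-bseq 'I_d), a <= t <= b -> X t w = Fw f w (X t [bseq]) &
      davie (fun t => X t [bseq])].
Proof.
move=> [[hh hc] hinit heq]; pose Y t := X t [bseq].
have aab : a <= a <= b by rewrite lexx.
have [M YM] : exists M, forall t, a <= t <= b -> `|Y t| <= M.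
  have [C hC] := hh [bseq]; exists (`|C| * (b - a) `^ gamma + `|Y a|) => t tab.
  rewrite -(subrK (Y a) (Y t)) (le_trans (ler_normD _ _))// lerD2r.
  case/andP: (tab) => ta tb; rewrite (le_trans (hC _ _ aab tab))//.
  apply: (@le_trans _ _ (`|C| * `|t - a| `^ gamma)).
    by rewrite ler_wpM2r ?powR_ge0// ler_norm.
  by rewrite ler_wpM2l// ger0_norm ?subr_ge0// powR_le// ?subr_ge0// lerB.
have hX t w : a <= t <= b -> (size w <= N.-1)%N -> coef (X t) w = Fw f w (Y t).
  move=> tab; have [m] := ubnP (size w); elim: m w t tab => // m IH w t tab wm.
  case/lastP: w wm => [|v i] wm wN; first by rewrite -[[::]]/(bseqval ([bseq] : N.-1.-bseq 'I_d)) coef_bseqE.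
  have vN : (size v <= N.-1)%N by rewrite (leq_trans _ wN)// size_rcons.
  have hv r : a <= r <= b -> forall u, (size u <= size v)%N -> coef (X r) u = Fw f u (Y r).
    move=> rab u uv; apply: IH => //; last exact: leq_trans vN.
    by rewrite ltnS size_rcons in wm; exact: leq_ltn_trans wm.
  pose w : N.-1.-bseq 'I_d := Bseq wN.
  have := heq a t aab tab => /(congr1 (fun z : tens d N.-1 E => z w)).
  rewrite lifted_increment !ffunE /= /nilp size_rcons /=.
  have ew : bseqval w = rcons v i by [].
  rewrite sumrB (sum_rcons_eq (fun i => comp_lift (f i) X t) i vN) (sum_rcons_eq (fun i => comp_lift (f i) X a) i vN) !ffunE (faa_lift i vN (hv t tab)) (faa_lift i vN (hv a aab)).
  rewrite -[rcons v i]/(bseqval w) coef_bseqE (hinit w) => e.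
  by apply/eqP; rewrite -subr_eq0 -[X t w](subrK (Fw f w (Y a))) e subrK subrr.
have hX' t (w : N.-1.-bseq 'I_d) : a <= t <= b -> X t w = Fw f w (Y t).
  by move=> tab; rewrite -coef_bseqE hX// size_bseq.
split => //; first by exists M.
have [K K0 hK] := ri_bound hOm.
have [MF MF0 hMF] := bounded_Fw fE (fun i => hf i M).
have [C hC] := hc [bseq].
(* [C] bounds the controlled remainder; the sum accounts for the words of length [N], absent from a
   lift of level N - 1. *)
pose C1 := `|C| + \sum_(u : N.-bseq 'I_d) K * MF.
have C10 : 0 <= C1 by rewrite addr_ge0// sumr_ge0// => u _; rewrite mulr_ge0.
have weak s t : a <= s -> s <= t -> t <= b ->
    `|Y t - mu N Om f s t (Y s)| <= C1 * ((t - s) `^ gamma) ^+ N.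
  move=> sa; rewrite le_eqVlt => /predU1P[<- _|st tb].
    by rewrite (mu_id hOm) subrr normr0 mulr_ge0// exprn_ge0// powR_ge0.
  have h1 : a <= s <= b by rewrite sa (le_trans (ltW st)).
  have h2 : a <= t <= b by rewrite tb (le_trans sa)// ltW.
  have := hC s t sa st tb; rewrite subn0 -om_powR ?subr_ge0 ?(ltW st)// pairing_star_basis => e1.
  set om := (t - s) `^ gamma in e1 *; have om0 : 0 <= om by exact: powR_ge0.
  pose G (u : seq 'I_d) := Om s t u *: Fw f u (Y s).
  have e2 : mu N Om f s t (Y s) = \sum_(u : N.-1.-bseq 'I_d) G u +
      \sum_(u : N.-bseq 'I_d | ~~ (size u <= N.-1)%N) G u.
    rewrite (sum_widen_words G (leq_pred N)) /mu /davie_map.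
    exact: (bigID (fun u : N.-bseq 'I_d => size u <= N.-1)%N).
  have e3 : `|\sum_(u : N.-bseq 'I_d | ~~ (size u <= N.-1)%N) G u| <= (\sum_(u : N.-bseq 'I_d) K * MF) * om ^+ N.
    rewrite (le_trans (ler_norm_sum _ _ _))// mulr_suml big_mkcond ler_sum// => u _.
    case: ifP => hu; last by rewrite !mulr_ge0// exprn_ge0.
    have uN : size u = N.
      apply/eqP; rewrite eqn_leq size_bseq /=; move: hu; rewrite -ltnNge.
      by rewrite prednK.
    rewrite normrZ mulrAC ler_pM//.
      by have := hK s t u (size_bseq u); rewrite uN [`|t - s|]ger0_norm ?subr_ge0 ?(ltW st)//; exact.
    apply: hMF; first exact: YM.
    by rewrite /nilp uN -lt0n.
  have e4 : \sum_(u : N.-1.-bseq 'I_d | (size u <= N.-1 - 0)%N) trunc N.-1 (incr W s t) u *: coef (X s) (u ++ ([bseq] : N.-1.-bseq 'I_d))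
     = \sum_(u : N.-1.-bseq 'I_d) G u.
    apply: eq_big => [u|u _]; first by rewrite subn0 size_bseq.
    rewrite cats0 coef_bseqE hX'//.
    by rewrite /trunc ffunE hW// (leq_trans (size_bseq u))// leq_pred.
  rewrite e4 in e1; rewrite e2 opprD addrA (le_trans (ler_normB _ _))// mulrDl lerD//.
  by rewrite (le_trans e1)// ler_wpM2r ?exprn_ge0// ler_norm.
have [K2 K20 hK2] := field_rough_int gamma01 gammaN N0 a0 ab hOm hW fE hf C10 YM weak hX'.
exists K2 => // s t sa st tb; rewrite (muE hOm).
have h1 : a <= s <= b by rewrite sa (le_trans st).
have h2 : a <= t <= b by rewrite tb (le_trans sa).
have := heq s t h1 h2 => /(congr1 (fun z : tens d N.-1 E => z [bseq])).
rewrite lifted_increment !ffunE /= => e; rewrite opprD addrA -/(Y t) -/(Y s).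
by rewrite [Y t - Y s]e; exact: hK2.
Qed.

End DavieSolutions.

(** * Trajectories, uniqueness and time reversal *)

Section Uniqueness.
Context {R : realType} {d : nat} {gamma : R}.
Local Notation N := (Ngam gamma).
Implicit Types Om : R -> R -> seq 'I_d -> R.
Hypotheses (gamma01 : 0 < gamma < 1) (gammaN : 1 < N.+1%:R * gamma).

Lemma rough_reparam Om (c : R -> R) : rough_increments gamma N Om ->
    (forall s t, `|c t - c s| <= `|t - s|) ->
  rough_increments gamma N (fun s t => Om (c s) (c t)).
Proof.
move=> h hc; split.
- by move=> s t; exact: ri_char h _ _.
- by move=> s u t w wN; exact: ri_chen h _ _ _ _ wN.
- by move=> s w wN; exact: ri_id h _ _ wN.
have [K K0 hK] := ri_bound h; exists K => // s t w wN.
rewrite (le_trans (hK _ _ _ wN))// ler_wpM2l// lerXn2r ?nnegrE ?powR_ge0// powR_le//.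
Qed.

Variable Om : R -> R -> seq 'I_d -> R.
Hypothesis hOm : rough_increments gamma N Om.
Variables (E : normedModType R) (f : 'I_d -> E -> E).
Hypotheses (fE : findim E) (hf : locreg N f).

Lemma theta_gt0 h : 0 < h -> 0 < theta gamma N h.
Proof. by move=> h0; rewrite /theta exprn_gt0// powR_gt0. Qed.

(** On an interval longer than [dl], [theta] is at least [theta gamma N dl], so a crude bound on
    path and increment, divided by this number, is enough. *)
Lemma davie_extend (Y : R -> E) a b M C dl : 0 <= C -> 0 < dl ->
    (forall t, a <= t <= b -> `|Y t| <= M) ->
    (forall s t, a <= s -> s <= t -> t <= b -> t - s <= dl ->
       `|Y t - mu N Om f s t (Y s)| <= C * theta gamma N (t - s)) ->
  davie gamma Om a b f Y.
Proof.
move=> C0 dl0 YM hY; have [K K0 hK] := ri_bound hOm.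
pose L := Num.max 1 ((b - a) `^ gamma); have L1 : 1 <= L by rewrite le_max lexx.
have [D D0 hD] := increment_bound fE (fun i => hf i M) K0 L1.
have L0 : 0 <= L by exact: le_trans L1.
(* When [a, b] is empty, [M] may be negative and the claim is void. *)
have M0 : 0 <= M + M + D * L \/ forall t, ~ (a <= t <= b).
  have [[t tab]|h] := pselect (exists t, a <= t <= b); last by right=> t tab; apply: h; exists t.
  left; rewrite addr_ge0 ?mulr_ge0// addr_ge0//; exact: le_trans (YM t tab).
have [{}M0|none] := M0; last first.
  exists 0 => // s t sa st tb; case: (none s); rewrite sa (le_trans st)//.
have th0 := theta_gt0 dl0.
exists (C + (M + M + D * L) / theta gamma N dl); first by rewrite addr_ge0// divr_ge0// ltW.
move=> s t sa st tb; have st0 : 0 <= t - s by rewrite subr_ge0.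
have [td|td] := leP (t - s) dl.
  rewrite (le_trans (hY _ _ sa st tb td))// ler_wpM2r//; last first.
    by rewrite lerDl divr_ge0// ltW.
  exact: (gauge_ge0 (theta_gauge gamma01 gammaN)).
have h1 : a <= s <= b by rewrite sa (le_trans st).
have h2 : a <= t <= b by rewrite tb (le_trans sa).
have omL : 0 <= `|t - s| `^ gamma <= L.
  by rewrite powR_ge0 ger0_norm// le_max powR_le ?orbT// lerB.
have e1 := hD (Om s t) _ (Y s) omL (fun w wN => hK s t w wN) (YM s h1).
have e2 : `|increment f N (Om s t) (Y s)| <= D * L.
  by rewrite (le_trans e1)// ler_wpM2l//; case/andP: omL.
rewrite (muE hOm) opprD addrA (le_trans (ler_normB _ _))//.
rewrite (le_trans (lerD (ler_normB _ _) e2))// (le_trans (lerD (lerD (YM t h2) (YM s h1)) (lexx _)))//.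
have thd : theta gamma N dl <= theta gamma N (t - s).
  by apply: (gauge_le (theta_gauge gamma01 gammaN)); exact: ltW.
rewrite mulrDl ler_wpDl ?mulr_ge0//; last first.
  by rewrite (le_trans _ (ler_wpM2l _ thd)) ?divr_ge0 ?(ltW th0)// divfK// gt_eqF.
exact: le_trans (ltW th0) thd.
Qed.

Lemma davie_flow T phi a x : good T (theta gamma N) (mu N Om f) -> limit_flow T (mu N Om f) phi ->
    0 <= a -> a <= T ->
  (exists M, forall t, a <= t <= T -> `|phi a t x| <= M) /\ davie gamma Om a T f (fun t => phi a t x).
Proof.
move=> hg hphi a0 aT; have [hb _ _] := hg `|x|.
have [M hM] := flow_bounded hphi hb.
have YM t : a <= t <= T -> `|phi a t x| <= M by move=> /andP[ta tT]; exact: hM.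
have cmu s t : continuous (mu N Om f s t) by exact: mu_continuous.
have [K [dl [K0 dl0 hK]]] := flow_davie hphi `|x| hg cmu.
split; first by exists M.
by apply: (davie_extend K0 dl0 YM) => s t sa st tT td; exact: hK.
Qed.

Hypothesis hfT : forall i, reg N.+1 setT (f i).

(** Along a fine partition the path departs from the one-step map by C theta at each step, and
    schemes transport this error with the uniform Lipschitz constant [L]; the total is a multiple of
    [e]. *)
Lemma davie_unique T phi a b (Y : R -> E) : limit_flow T (mu N Om f) phi -> 0 <= a -> b <= T ->
  davie gamma Om a b f Y -> forall t, a <= t -> t <= b -> Y t = phi a t (Y a).
Proof.
move=> hphi a0 bT [C C0 hC] t at' tb.
have [_ [_ [L [dl [_ L0 dl0 _ hL]]]]] := good_mu T gamma01 gammaN hOm fE hfT.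
have hth := theta_gauge gamma01 gammaN.
apply/eqP; rewrite -subr_eq0 -normr_le0.
apply: (@le_small _ _ _ (L * C * (t - a) + 1)) => [|e e0].
  by rewrite addr_ge0// !mulr_ge0// subr_ge0.
have [d1 d10 h1] := gauge_small hth e0; have [d2 d20 h2] := hphi `|Y a| e e0.
pose d3 := Num.min dl (Num.min d1 d2); have d30 : 0 < d3 by rewrite !lt_min dl0 d10.
have [e1 e2 e3] : [/\ d3 <= dl, d3 <= d1 & d3 <= d2] by rewrite /d3 !ge_min !lexx !orbT.
have [p [hp lp]] := fine_partition d30 at'.
have main : forall q s, a <= s -> path (step d3) s q -> last s q <= b ->
    `|scheme (mu N Om f) s q (Y s) - Y (last s q)| <= L * C * (last s q - s) * e.
  elim=> [|u q IH] s sa /=; first by move=> _ _; rewrite !subrr normr0 mulr0 mul0r.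
  move=> /andP[/andP[su ud] hq] lb; have au : a <= u by rewrite (le_trans sa)// ltW.
  have ub : u <= b by rewrite (le_trans (path_step_last hq)).
  rewrite -(subrKA (scheme (mu N Om f) u q (Y u))) (le_trans (ler_normD _ _))//.
  have -> : L * C * (last u q - s) * e = L * (C * (e * (u - s))) + L * C * (last u q - u) * e by ring.
  rewrite lerD//; last exact: IH.
  rewrite (le_trans (hL _ _ _ _ (le_trans a0 au) (path_stepW e1 hq) (le_trans lb bT)))//.
  rewrite ler_wpM2l// distrC (le_trans (hC _ _ sa (ltW su) ub))// ler_wpM2l// h1//.
    by rewrite subr_ge0 ltW.
  exact: le_trans ud e2.
have m1 := main p a (lexx a) hp; rewrite lp in m1.
have m2 := h2 a p (Y a) a0 (path_stepW e3 hp); rewrite lp in m2.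
rewrite add0r -(subrKA (scheme (mu N Om f) a p (Y a))) (le_trans (ler_normD _ _))//.
rewrite distrC mulrDl mul1r lerD// ?m1// m2//; exact: le_trans tb bT.
Qed.

Lemma mu_lipschitz : exists2 C, 0 <= C & forall s t x y, `|t - s| `^ gamma <= 1 ->
  `|mu N Om f s t x - mu N Om f s t y| <= C * `|x - y|.
Proof.
have [C C0 hC] := dmu_sub_id hOm fE hfT; have [K K0 hK] := mean_value_ineq fE.
exists (K * (C + 1)); first by rewrite mulr_ge0// addr_ge0.
move=> s t x y h1; have := hK _ (mu N Om f s t) y (x - y) ((C + 1) * `|x - y|).
rewrite [_ + (x - y)]addrC subrK mulrA; apply.
  move=> z; have h := is_diff_mu Om s t z fE (fun i => locreg_Ck0 i hf).
  exact: (@ex_diff _ _ _ _ _ _ _ h).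
move=> r _; rewrite -[X in `|X|](subrK (x - y)) (le_trans (ler_normD _ _))//.
rewrite mulrDl mul1r lerD2r (le_trans (hC _ _ _ _ h1))// ler_wpM2r//.
by rewrite ler_piMr.
Qed.

End Uniqueness.

(* The backward trajectory satisfies Davie's expansion for the reversed increments. *)
Lemma flow_reverse {R : realType} {d : nat} {gamma : R} (Om : R -> R -> seq 'I_d -> R)
    (E : normedModType R) (f : 'I_d -> E -> E) T phi psi s t x :
    0 < gamma < 1 -> 1 < (Ngam gamma).+1%:R * gamma ->
    rough_increments gamma (Ngam gamma) Om -> findim E -> locreg (Ngam gamma) f ->
    (forall i, reg (Ngam gamma).+1 setT (f i)) ->
    0 <= s -> s <= t -> t <= T ->
    limit_flow T (mu (Ngam gamma) Om f) phi ->
    limit_flow T (mu (Ngam gamma) (fun r u => Om (T - r) (T - u)) f) psi ->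
  psi (T - t) (T - s) (phi s t x) = x.
Proof.
move=> gamma01 gammaN hOm fE hf hfT; set N := Ngam gamma.
move=> s0 st tT hphi hpsi.
have hOm' : rough_increments gamma N (fun r u => Om (T - r) (T - u)).
  apply: (rough_reparam gamma01 hOm (c := fun r => T - r)) => r u.
  have -> : T - u - (T - r) = r - u by ring.
  by rewrite distrC.
have [hg _] := good_mu T gamma01 gammaN hOm fE hfT.
have sT : s <= T by exact: le_trans tT.
have [[M YM] [C C0 hC]] := davie_flow gamma01 gammaN hOm fE hf x hg hphi s0 sT.
have [D D0 hD] := local_error_Om gamma01 hOm fE (fun i => regW (leqnSn N) (hfT i)).
have [L L0 hL] := mu_lipschitz hOm fE hf hfT.
have [dl dl0 hdl] := powR_small gamma01 ltr01.
pose Z r := phi s (T - r) x.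
have ZM r : T - t <= r <= T - s -> `|Z r| <= M.
  by move=> /andP[r1 r2]; apply: YM; move: r1 r2 tT; rewrite /Z; lra.
have hZ : davie gamma (fun r u => Om (T - r) (T - u)) (T - t) (T - s) f Z.
  apply: (davie_extend gamma01 gammaN hOm' fE hf (C := D + L * C) _ dl0 ZM); first by rewrite addr_ge0 ?mulr_ge0.
  move=> r u tr ru us ud; pose v' := T - u; pose v := T - r.
  have [sv' vv' vT] : [/\ s <= v', v' <= v & v <= T] by rewrite /v /v'; move: tr ru us tT; split; lra.
  have vE : v - v' = u - r by rewrite /v /v'; lra.
  have om1 : (u - r) `^ gamma <= 1 by apply: hdl; rewrite // subr_ge0.
  rewrite /Z -/v' -/v -[mu N _ f r u _]/(mu N Om f v v' (phi s v x)).
  have e1 := hC v' v sv' vv' vT; rewrite vE in e1.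
  (* Going forth and back is within the local error of [mu N Om f v' v'], the identity, since Chen's
     relation includes backward increments. *)
  have e2 : `|mu N Om f v v' (mu N Om f v' v (phi s v' x)) - phi s v' x| <= D * theta gamma N (u - r).
    have := hD (u - r) v' v v' (phi s v' x) om1; rewrite (mu_id hOm) => h; apply: h => //.
      by rewrite vE ger0_norm// subr_ge0.
    by rewrite distrC vE ger0_norm// subr_ge0.
  have e3 := hL v v' (phi s v x) (mu N Om f v' v (phi s v' x)).
  rewrite distrC vE ger0_norm ?subr_ge0// in e3.
  rewrite -(subrKA (mu N Om f v v' (mu N Om f v' v (phi s v' x)))) (le_trans (ler_normD _ _))//.
  rewrite mulrDl lerD//; first by rewrite distrC.
  by rewrite distrC (le_trans (e3 om1))// -mulrA ler_wpM2l.
have h1 : 0 <= T - t by rewrite subr_ge0.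
have h2 : T - s <= T by rewrite gerBl.
have h3 : T - t <= T - s by rewrite lerD2l lerN2.
have := davie_unique gamma01 gammaN hOm' fE hfT hpsi h1 h2 hZ h3 (lexx _).
rewrite /Z !subKr => <-.
by apply: (flow_id hphi).
Qed.

(** * Increments of a geometric rough path *)

Section Group.
Context {R : realType} {d : nat}.
Implicit Types (g h k : seq 'I_d -> R) (w : seq 'I_d).

Lemma convol_cons g h a w :
  convol g h (a :: w) = g [::] * h (a :: w) + convol (fun u => g (a :: u)) h w.
Proof. by rewrite /convol /= big_cons big_map. Qed.

Lemma convolA g h k w : convol (convol g h) k w = convol g (convol h k) w.
Proof.
elim: w g h => [|a w IH] g h; first by rewrite /convol /= !big_seq1 mulrA.
rewrite 2!convol_cons -IH.
have -> : convol (fun u => convol g h (a :: u)) k w =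
    g [::] * convol (fun u => h (a :: u)) k w + convol (convol (fun u => g (a :: u)) h) k w.
  rewrite -[LHS]/(\sum_(p <- cuts w) convol g h (a :: p.1) * k p.2).
  under eq_bigr do rewrite convol_cons mulrDl -mulrA.
  by rewrite big_split -mulr_sumr.
rewrite (convol_cons h) mulrDr -!addrA; congr (_ + _).
by rewrite /convol /= big_seq1 mulrA.
Qed.

Lemma eq_convol g g' h h' w : (forall u, (size u <= size w)%N -> g u = g' u) ->
    (forall u, (size u <= size w)%N -> h u = h' u) ->
  convol g h w = convol g' h' w.
Proof.
move=> hg hh; rewrite /convol big_seq [RHS]big_seq; apply: eq_bigr => p /cuts_size e.
by rewrite hg ?hh// -e ?leq_addr ?leq_addl.
Qed.

(** As [g] is 1 at the empty word, the value of [h] at a word is forced by its values at shorter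
    ones; each step of the induction redefines [h] only beyond length [m]. *)
Lemma convol_inverse g m : g [::] = 1 ->
  exists h, forall w, (size w <= m)%N -> convol g h w = (nilp w)%:R.
Proof.
move=> g1; elim: m => [|m [h IH]].
  by exists (fun=> 1) => -[|//] _; rewrite /convol /= big_seq1 g1 mulr1.
exists (fun w => if (size w <= m)%N then h w else - \sum_(p <- behead (cuts w)) g p.1 * h p.2) => w wm.
have [le|lt] := leqP (size w) m.
  rewrite -IH//; apply: eq_convol => // u uw.
  by rewrite (leq_trans uw).
have [s e hs] := cuts_nil_left w; rewrite /convol e big_cons /= g1 mul1r leqNgt lt /= e /=.
rewrite (_ : nilp w = false); last by case: (w) lt.
rewrite [X in _ + X](_ : _ = \sum_(p <- s) g p.1 * h p.2) ?addNr//.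
rewrite big_seq [RHS]big_seq; apply: eq_bigr => p /hs hp.
by rewrite -ltnS (leq_trans hp).
Qed.

Variable N : nat.
Implicit Types x y z : tens d N R.

Lemma coef_star x y w : (size w <= N)%N -> coef (star x y) w = convol (coef x) (coef y) w.
Proof.
move=> wN; rewrite -{1}[w]/(bseqval (Bseq wN)) coef_bseqE /star ffunE /convol.
rewrite -(sum_pairs_cuts (N := N) (fun u v => coef x u * coef y v))//.
by apply: eq_bigr => p _; rewrite !coef_bseqE.
Qed.

Lemma coef_star1 w : (size w <= N)%N -> coef (star1 : tens d N R) w = (nilp w)%:R.
Proof.
move=> wN; rewrite -{1}[w]/(bseqval (Bseq wN)) coef_bseqE /star1 /Defs.basis ffunE.
by congr ((_ : bool)%:R); apply/eqP/nilP => [[]|e] //; apply/val_inj.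
Qed.

Lemma coef_inj x y : (forall w, (size w <= N)%N -> coef x w = coef y w) -> x = y.
Proof. by move=> h; apply/ffunP => w; rewrite -!coef_bseqE h ?size_bseq. Qed.

Lemma starA x y z : star x (star y z) = star (star x y) z.
Proof.
apply: coef_inj => w wN; rewrite !coef_star//.
transitivity (convol (coef x) (convol (coef y) (coef z)) w).
  by apply: eq_convol => // u uw; rewrite coef_star// (leq_trans uw).
rewrite -convolA; apply: eq_convol => // u uw; rewrite coef_star// (leq_trans uw)//.
Qed.

Lemma convol_unit g h w : (forall u, (size u <= size w)%N -> g u = (nilp u)%:R) -> convol g h w = h w.
Proof.
move=> hg; have [s e hs] := cuts_nil_left w; rewrite /convol e big_cons /= hg// mul1r.
rewrite big_seq big1 ?addr0// => p ps; rewrite hg.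
  have hp : p \in cuts w by rewrite e inE ps orbT.
  have := hs _ ps; rewrite -(cuts_size hp); case: (p.1) => [|? ?]; last by rewrite mul0r.
  by rewrite add0n ltnn.
have hp : p \in cuts w by rewrite e inE ps orbT.
by rewrite -(cuts_size hp) leq_addr.
Qed.

Lemma star1x x : star star1 x = x.
Proof.
apply: coef_inj => w wN; rewrite coef_star// convol_unit// => u uw.
by rewrite coef_star1// (leq_trans uw).
Qed.

Lemma star_right_inverse x : x [bseq] = 1 -> exists y, y [bseq] = 1 /\ star x y = star1.
Proof.
move=> x1; have c1 : coef x [::] = 1 by rewrite -x1 -coef_bseqE.
have [h hh] := convol_inverse N c1; exists [ffun w : N.-bseq 'I_d => h w]; split.
  by have := hh [::] isT; rewrite ffunE /convol /= big_seq1 c1 mul1r.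
apply: coef_inj => w wN; rewrite coef_star// coef_star1// -hh//.
by apply: eq_convol => // u uw; rewrite coef_finfun// (leq_trans uw).
Qed.

Lemma convol_unitr g w : convol g (fun u => (nilp u)%:R) w = g w.
Proof.
elim: w g => [|a w IH] g; first by rewrite /convol /= big_seq1 mulr1.
by rewrite convol_cons /= mulr0 add0r IH.
Qed.

Lemma star_x1 x : star x star1 = x.
Proof.
apply: coef_inj => w wN; rewrite coef_star// -[RHS]convol_unitr.
by apply: eq_convol => // u uw; rewrite coef_star1// (leq_trans uw).
Qed.

(** Right inverses exist by recursion, and a right inverse has one in its turn; hence it is
    two-sided and the choice in [star_inv] succeeds. *)
Lemma star_invP x : x [bseq] = 1 -> star x (star_inv x) = star1 /\ star (star_inv x) x = star1.
Proof.
move=> x1; have [y [y1 xy]] := star_right_inverse x1; have [z [z1 yz]] := star_right_inverse y1.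
apply: (xgetI (P := [set h | star x h = star1 /\ star h x = star1]) star1 (x := y)).
have xz : x = z by rewrite -[x]star_x1 -yz starA xy star1x.
by split; rewrite // xz.
Qed.

Lemma grouplike_character x : grouplike x -> shuffle_character N (coef x).
Proof.
move=> [x1 hx]; split; first by rewrite -x1 -coef_bseqE.
move=> u v uv.
have uN : (size u <= N)%N by rewrite (leq_trans _ uv)// leq_addr.
have vN : (size v <= N)%N by rewrite (leq_trans _ uv)// leq_addl.
have hom (w : N.-bseq 'I_d) : homogeneous (size w) (Defs.basis w : tens d N R).
  by move=> w' ww'; rewrite /Defs.basis ffunE (_ : (w' == w) = false)//; apply/negbTE; apply: contra ww' => /eqP ->.
have pb (w : N.-bseq 'I_d) : pairing x (Defs.basis w : tens d N R) = x w.
  rewrite /pairing (bigD1 w)//= /Defs.basis ffunE eqxx big1 ?addr0 => [|w' ww'].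
    by rewrite -[_ *: _]/(_ * _) mulr1.
  by rewrite ffunE (negbTE ww') scaler0.
have := hx _ _ _ _ (hom (Bseq uN)) (hom (Bseq vN)) uv.
rewrite !pb -!coef_bseqE /= => <-.
rewrite /pairing; transitivity (\sum_(w : N.-bseq 'I_d) coef x w * (count_mem (w : seq 'I_d) (shuffle u v))%:R).
  apply: eq_bigr => w _; rewrite coef_bseqE /tens_shuffle ffunE; congr (_ * _).
  rewrite (bigD1 (Bseq uN))//= [X in _ + X]big1 ?addr0 => [|u' u'u]; last first.
    by rewrite big1// => v' _; rewrite /Defs.basis ffunE (negbTE u'u) !mul0r.
  rewrite (bigD1 (Bseq vN))//= [X in _ + X]big1 ?addr0 => [|v' v'v]; last first.
    by rewrite /Defs.basis !ffunE (negbTE v'v) mulr0 mul0r.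
  by rewrite /Defs.basis !ffunE !eqxx !mul1r.
have : forall w, w \in shuffle u v -> (size w <= N)%N.
  by move=> w /size_shuffle ->.
elim: (shuffle u v) => [_|w s IH hs]; first by rewrite big_nil big1// => w _; rewrite mulr0.
rewrite big_cons -IH; last by move=> w' hw'; apply: hs; rewrite inE hw' orbT.
have wN := hs w (mem_head _ _).
rewrite (bigD1 (Bseq wN))//= [in RHS](bigD1 (Bseq wN))//= eqxx natrD mulrDr mulr1 addrA; congr (_ + _).
apply: eq_bigr => w' hw'; rewrite (_ : (w == w') = false)//.
by apply/negbTE; apply: contra hw' => /eqP e; apply/eqP/val_inj.
Qed.

End Group.

(** * Increments extended to all real times *)

Section Increments.
Context {R : realType} {d : nat} {gamma T : R}.
Local Notation N := (Ngam gamma).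
Variable W : R -> tens d N R.
Hypotheses (gamma01 : 0 < gamma < 1) (T0 : 0 <= T) (hW : geometric_rough_path T W).

(** Stopping times at 0 and [T] makes the increments total functions of real times; Chen's relation
    is preserved, and so are the bounds because [clip] is 1-Lipschitz. *)
Definition clip (t : R) : R := Num.max 0 (Num.min t T).

Lemma clipE t : 0 <= t <= T -> clip t = t.
Proof. by move=> /andP[t0 tT]; rewrite /clip (min_idPl tT) (max_idPr t0). Qed.

Lemma clip_itv t : 0 <= clip t <= T.
Proof. by rewrite /clip le_max lexx /= ge_max T0 ge_min lexx orbT. Qed.

Lemma clip_dist s t : `|clip t - clip s| <= `|t - s|.
Proof.
wlog st : s t / s <= t => [h|].
  by have [/h//|ts] := leP s t; rewrite distrC [leRHS]distrC h// ltW.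
have cases r : [\/ r <= 0 /\ clip r = 0, (0 <= r /\ r <= T) /\ clip r = r | T <= r /\ clip r = T].
  have [r0|r0] := leP r 0.
    by apply: Or31; split => //; rewrite /clip min_l ?max_l// (le_trans r0).
  have [rT|rT] := leP r T; first by apply: Or32; rewrite clipE ?(ltW r0)// rT.
  by apply: Or33; split; [exact: ltW|rewrite /clip min_r ?max_r// ltW].
rewrite [leRHS]ger0_norm ?subr_ge0// ler_norml.
by apply/andP; case: (cases s) => -[h1 ->]; case: (cases t) => -[h2 ->]; try case: h1 => ? ?;
  try case: h2 => ? ?; move: T0 => ?; split; lra.
Qed.

Lemma rough_increments_clip :
  rough_increments gamma N (fun s t w => coef (incr W (clip s) (clip t)) w).
Proof.
have [hg _ hb] := hW.
have g1 t : W (clip t) [bseq] = 1 by have [] := hg _ (clip_itv t).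
have inv t := star_invP (g1 t).
have Winc s t : star (W (clip s)) (incr W (clip s) (clip t)) = W (clip t).
  by rewrite /incr starA; have [-> _] := inv s; rewrite star1x.
have chen s u t : incr W (clip s) (clip t) = star (incr W (clip s) (clip u)) (incr W (clip u) (clip t)).
  by rewrite {2}/incr -starA Winc.
have idE s : incr W (clip s) (clip s) = star1 by have [] := inv s.
split.
- move=> s t; apply: (convol_quotient (g := coef (W (clip s))) (k := coef (W (clip t)))).
  + exact/grouplike_character/hg/clip_itv.
  + exact/grouplike_character/hg/clip_itv.
  + by move=> w wN; rewrite -coef_star// Winc.
- by move=> s u t w wN; rewrite (chen s u t) coef_star.
- by move=> s w wN; rewrite idE coef_star1.
have [C hC] := choice hb.
(* The summand 1 covers the empty word at equal clipped times, a case outside the bound on the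
   increments. *)
exists (1 + \sum_w `|C w|); first by rewrite addr_ge0// sumr_ge0.
move=> s t w wN; have K1 : 1 <= 1 + \sum_w `|C w| by rewrite lerDl sumr_ge0.
have K0 : 0 <= 1 + \sum_w `|C w| by exact: le_trans K1.
apply: (@le_trans _ _ ((1 + \sum_w `|C w|) * (`|clip t - clip s| `^ gamma) ^+ size w)); last first.
  by rewrite ler_wpM2l// lerXn2r ?nnegrE ?powR_ge0// powR_le// clip_dist.
have [e|st] := eqVneq (clip s) (clip t).
  rewrite e idE coef_star1//; case: (w) => [|a v] /=; first by rewrite normr1 mulr1.
  by rewrite normr0 mulr_ge0// exprn_ge0// powR_ge0.
rewrite om_powR// -ler_pdivrMr; last by rewrite powR_gt0// normr_gt0 subr_eq0 eq_sym.
have := hC (Bseq wN) _ _ (clip_itv s) (clip_itv t) st => /= h.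
rewrite -[w]/(bseqval (Bseq wN)) coef_bseqE (le_trans h)// (bigD1 (Bseq wN))//=.
rewrite (le_trans (ler_norm _))// addrCA lerDl addr_ge0// sumr_ge0//.
Qed.

End Increments.

Lemma Ngam_gt0 (R : realType) (gamma : R) : 0 < gamma < 1 -> (0 < Ngam gamma)%N.
Proof.
move=> /andP[g0 g1]; rewrite /Ngam truncn_gt0// invf_ge1// ltW//.
Qed.

Lemma Ngam_lt (R : realType) (gamma : R) : 0 < gamma < 1 -> 1 < (Ngam gamma).+1%:R * gamma.
Proof. by move=> /andP[g0 g1]; rewrite -ltr_pdivrMr// div1r /Ngam truncnS_gt. Qed.

(** * Iterated tangent maps and jets *)

Section IteratedTangent.
Context {R : realType}.
Implicit Types U V : normedModType R.

Fixpoint tower V j : normedModType R :=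
  if j is j'.+1 then (tower V j' * tower V j')%type : normedModType R else V.

Fixpoint tmap V (g : V -> V) j : tower V j -> tower V j :=
  match j return tower V j -> tower V j with
  | 0 => g
  | j'.+1 => tangent (@tmap V g j')
  end.
Global Arguments tmap {V} g j.

Lemma findim_tower V j : findim V -> findim (tower V j).
Proof. by move=> fV; elim: j => //= j IH; exact: findim_prod. Qed.

Lemma Ck_tmap V (g : V -> V) j m : findim V -> Ck (m + j) g -> Ck m (tmap g j).
Proof.
move=> fV; elim: j m => [|j IH] m; first by rewrite addn0.
rewrite addnS -addSn => /IH /Ck_reg hg.
exact/reg_Ck/(@reg_sub _ _ _ _ _ set0)/(reg_tangent 0 (findim_tower j fV) hg).
Qed.

Section Words.
Context {A : eqType} {V : normedModType R}.
Implicit Types (al be : seq A) (y z : seq A -> V).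

(* The point of the iterated tangent space whose component along a subset of
   the positions of [al] is the member of [y] indexed by the corresponding subword. *)
Fixpoint rho al y : tower V (size al) :=
  match al return tower V (size al) with
  | [::] => y [::]
  | a :: al' => (rho al' y, rho al' (fun be => y (a :: be)))
  end.

Lemma rho_eq al y z : (forall be, (size be <= size al)%N -> y be = z be) -> rho al y = rho al z.
Proof.
elim: al y z => [|a al IH] y z h /=; first exact: h.
congr (_, _); apply: IH => be hb; apply: h => //; exact: leqW.
Qed.

Lemma rho_lin al c y z : rho al (fun be => c *: y be + z be) = c *: rho al y + rho al z.
Proof. by elim: al y z => //= a al IH y z; rewrite !IH. Qed.

(** The component along the full set of positions is the member of [y] indexed by [al] itself. *)
Lemma rho_last al y : `|y al| <= `|rho al y|.
Proof.
elim: al y => //= a al IH y; rewrite prod_normE le_max; apply/orP; right.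
exact: (IH (fun be => y (a :: be))).
Qed.

Lemma rho_diff U al (F dF : seq A -> U -> V) u :
    (forall be, (size be <= size al)%N -> is_diff u (F be) (dF be)) ->
  is_diff u (fun u => rho al (fun be => F be u)) (fun v => rho al (fun be => dF be v)).
Proof.
elim: al F dF => [|a al IH] F dF h /=; first exact: h.
have h1 : is_diff u (fun u => rho al (fun be => F be u)) (fun v => rho al (fun be => dF be v)).
  by apply: IH => be hb; apply: h; exact: leqW.
have h2 : is_diff u (fun u => rho al (fun be => F (a :: be) u)) (fun v => rho al (fun be => dF (a :: be) v)).
  by apply: (IH (fun be => F (a :: be)) (fun be => dF (a :: be))) => be hb; exact: h.
exact: is_diff_pair.
Qed.

(* The iterated tangent map of [g] acts on jets of maps by composition. *)
Lemma rho_tmap (e : A -> V) (g : V -> V) al x : findim V -> Ck (size al) g ->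
  rho al (fun be => Dn g [seq e b | b <- be] x) =
  tmap g (size al) (rho al (fun be => Dn id [seq e b | b <- be] x)).
Proof.
move=> fV; elim: al x => // a al IH x; rewrite [size (a :: al)]/= => cg.
have cg' : Ck (size al) g by apply: CkW cg.
rewrite [LHS]/= [RHS]/=.
have Dd (h : V -> V) be : Ck (size al).+1 h -> (size be <= size al)%N ->
    is_diff x (Dn h [seq e b | b <- be]) (fun v => Dn h (v :: [seq e b | b <- be]) x).
  move=> ch hb; have : reg 1 set0 (Dn h [seq e b | b <- be]).
    by apply: (@reg_Dn _ _ _ (size al).+1 1) => //; [rewrite size_map|exact: Ck_reg].
  by move=> [dh _ _]; exact/differentiableP.
have cid m : Ck m (@id V).
  by apply: (@reg_Ck _ _ _ m set0); apply: reg_lin => //; [exists 1 => v; rewrite mul1r|exists 0].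
have rd (h : V -> V) : Ck (size al).+1 h ->
    is_diff x (fun x => rho al (fun be => Dn h [seq e b | b <- be] x))
      (fun v => rho al (fun be => Dn h (v :: [seq e b | b <- be]) x)).
  move=> ch; apply: (rho_diff (F := fun be => Dn h [seq e b | b <- be])
    (dF := fun be v => Dn h (v :: [seq e b | b <- be]) x)) => be hb; exact: Dd.
have d1 := rd g cg; have d2 := rd id (cid _).
rewrite /tangent /= IH//; congr (_, _).
pose z := rho al (fun be => Dn id [seq e b | b <- be] x).
have d3 : is_diff z (tmap g (size al)) ('d (tmap g (size al)) z).
  by apply/differentiableP; have [] : Ck 1 (tmap g (size al)) by exact: Ck_tmap.
have d4 := is_diff_comp d2 d3.
(* The induction hypothesis is an identity of functions of [x]; its derivative in the direction
   [e a] is the second component. *)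
rewrite -(is_diff_eval (e a) d1).
have -> : (fun x => rho al (fun be => Dn g [seq e b | b <- be] x)) =
   tmap g (size al) \o (fun x => rho al (fun be => Dn id [seq e b | b <- be] x)).
  by apply/funext => u; rewrite IH.
by rewrite (is_diff_eval (e a) d4).
Qed.

End Words.

End IteratedTangent.

Lemma lin_sum (R : realType) (U V : lmodType R) (L : U -> V) (I : Type) (r : seq I) (P : pred I)
    (c : I -> R) (x : I -> U) : linear L ->
  L (\sum_(i <- r | P i) c i *: x i) = \sum_(i <- r | P i) c i *: L (x i).
Proof.
move=> lL; elim: r => [|i r IH].
  by rewrite !big_nil; have := lL (-1) 0 0; rewrite scaler0 addr0 scaleN1r addNr.
by rewrite !big_cons; case: ifP => // _; rewrite lL IH.
Qed.

(** * The jet field and its image in the iterated tangent spaces *)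

Section JetField.
Context {R : realType} {d n : nat}.
Variables (m : nat) (f : 'I_d -> 'rV[R]_n -> 'rV[R]_n).
Local Notation jets := 'M[R]_(#|{: m.-bseq 'I_n}|, n).
Implicit Types (Y : jets) (be al : seq 'I_n).

(** Words longer than [m] have coefficient 0, the default value of [coef]. *)
Definition jcoef be Y : 'rV[R]_n := coef (jet_row Y) be.

Lemma jcoef_lin be : linear (jcoef be).
Proof.
move=> c Y Z; rewrite /jcoef /coef; case: insubP => [b _ _|_] /=.
  by rewrite !ffunE; apply/rowP => j; rewrite !mxE.
by rewrite scaler0 addr0.
Qed.

Lemma jcoef_jet (y : seq 'I_n -> 'rV[R]_n) be : (size be <= m)%N ->
  jcoef be (jet (fun b : m.-bseq 'I_n => y b)) = y be.
Proof.
move=> bm; rewrite /jcoef -[be]/(bseqval (Bseq bm)) coef_bseqE ffunE.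
by apply/rowP => j; rewrite !mxE enum_rankK.
Qed.

Lemma jcoef_bound be : exists C, forall Y, `|jcoef be Y| <= C * `|Y|.
Proof. exact: findim_lin_bound (findim_mx _ _) (jcoef_lin be). Qed.

Lemma jet_norm Y C : 0 <= C -> (forall b : m.-bseq 'I_n, `|jcoef b Y| <= C) -> `|Y| <= C.
Proof.
move=> C0 h; apply: mx_norm_le => // r c; apply: le_trans (h (enum_val r)).
rewrite /jcoef coef_bseqE ffunE enum_valK (le_trans _ (coord_le_mx_norm _ 0 c))//.
by rewrite mxE.
Qed.

(** The total derivative in the direction [a], as a linear vector field on jets; the coordinates of
    order m + 1 that it would require are 0. *)
Definition jshift (a : 'I_n) Y : jets := jet (fun b : m.-bseq 'I_n => jcoef (a :: b) Y).

Lemma jshift_lin a : linear (jshift a).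
Proof. by move=> c Y Z; apply/matrixP => r j; rewrite !mxE jcoef_lin !mxE. Qed.

Lemma jcoef_shift a be Y : (size be <= m)%N -> jcoef be (jshift a Y) = jcoef (a :: be) Y.
Proof. exact: (jcoef_jet (fun be => jcoef (a :: be) Y)). Qed.

Definition jcomp i be : jets -> 'rV[R]_n := dwords jshift (f i \o jcoef [::]) be.

(** The chain rule [dwords_parts] for the fields [jshift] presents the Faa di Bruno expression as an
    iterated total derivative of [f i], in which form it is differentiated and bounded by induction
    on the word. *)
Lemma faa_di_bruno_jet i be Y : Ck m (f i) -> (size be <= m)%N ->
  faa_di_bruno (f i) (jet_row Y) be = jcomp i be Y.
Proof.
move=> cf bm; have fV : findim 'rV[R]_n by exact: findim_mx.
rewrite faa_di_bruno_parts//; last exact: CkW cf.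
rewrite /jcomp (dwords_parts (m := m) (Y := jcoef))//.
  apply: eq_bigr => bs _; rewrite -[jet_row Y [bseq]]coef_bseqE.
  by [].
move=> b bm'; have hd Z : is_diff Z (jcoef b) (jcoef b) := is_diff_lin Z (jcoef_lin b) (jcoef_bound b).
split=> [Z|a Z]; first exact: (@ex_diff _ _ _ _ _ _ _ (hd Z)).
by rewrite (is_diff_eval _ (hd Z)) jcoef_shift// ltnW.
Qed.

Lemma jcoef_field i be Y : Ck m (f i) -> (size be <= m)%N ->
  jcoef be (jet_field f i Y) = jcomp i be Y.
Proof.
move=> cf bm; rewrite /jet_field (jcoef_jet (fun be => faa_di_bruno (f i) (jet_row Y) be))//.
exact: faa_di_bruno_jet.
Qed.

Lemma reg_jcomp N i be M : (forall M, reg (N + size be) (cball M) (f i)) -> reg N (cball M) (jcomp i be).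
Proof.
elim: be N => [|a be IH] N hf.
  have [C hC] := jcoef_bound [::].
  have := @reg_preaffine _ _ _ _ N (cball M) (cball (`|C| * M)) (jcoef [::]) 0 (f i)
    (jcoef_lin _) (jcoef_bound _).
  have -> : (fun Y => f i (jcoef [::] Y + 0)) = f i \o jcoef [::].
    by apply/funext => Y; rewrite addr0.
  apply; last by have := hf (`|C| * M); rewrite addn0.
  move=> Y YM; rewrite /cball /= addr0 (le_trans (hC Y))//.
  by rewrite (le_trans (ler_wpM2r _ (ler_norm C)))// ler_wpM2l.
have fJ : findim jets by exact: findim_mx.
apply: reg_dird_field => //; first by apply: IH => M'; rewrite addSnnS; exact: hf.
apply: reg_lin; [exact: jshift_lin|exact: findim_lin_bound (jshift_lin a)|].
have [C hC] := findim_lin_bound fJ (jshift_lin a).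
exists (`|C| * M) => Y YM; rewrite (le_trans (hC Y))//.
by rewrite (le_trans (ler_wpM2r _ (ler_norm C)))// ler_wpM2l.
Qed.

Lemma reg_jcomp0 N i be : Ck (N + size be) (f i) -> reg N set0 (jcomp i be).
Proof.
have fJ : findim jets by exact: findim_mx.
elim: be N => [|a be IH] N cf.
  have := @reg_preaffine _ _ _ _ N set0 set0 (jcoef [::]) 0 (f i) (jcoef_lin _) (jcoef_bound _).
  have -> : (fun Y => f i (jcoef [::] Y + 0)) = f i \o jcoef [::].
    by apply/funext => Y; rewrite addr0.
  by apply=> //; rewrite addn0 in cf; exact: Ck_reg.
apply: reg_dird_field => //; first by apply: IH; rewrite addSnnS.
apply: reg_lin; [exact: jshift_lin|exact: findim_lin_bound (jshift_lin a)|by exists 0].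
Qed.

Definition jembed (b : m.-bseq 'I_n) (v : 'rV[R]_n) : jets :=
  \matrix_(r, c) (if r == enum_rank b then v 0 c else 0).

Lemma locreg_jet_field N : locreg (N + m) f -> locreg N (fun i => jet_field f i : jets -> jets).
Proof.
move=> hf i M; have cf : Ck m (f i) by apply: CkW (locreg_Ck i hf); exact: leq_addl.
have -> : jet_field f i = (fun Y : jets => \sum_(b : m.-bseq 'I_n) jembed b (jcomp i b Y)).
  apply/funext => Y; apply/matrixP => r c; rewrite summxE !mxE (bigD1 (enum_val r))//= big1 => [|b br].
    by rewrite mxE enum_valK eqxx addr0 faa_di_bruno_jet ?size_bseq.
  rewrite mxE ifN//; apply: contra br => /eqP ->.
  by rewrite enum_rankK.
apply: reg_sum => b _; have lj : linear (jembed b).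
  by move=> k u v; apply/matrixP => r c; rewrite !mxE; case: ifP => _; rewrite ?mulr0 ?addr0.
apply: (@reg_postlin _ _ _ _ _ _ (jembed b) (jcomp i b)) => //.
  exact: findim_lin_bound (findim_mx _ _) lj.
apply: reg_jcomp => M'; apply: regW (hf i M').
by rewrite leq_add2l size_bseq.
Qed.

Definition jrho al Y : tower 'rV[R]_n (size al) := rho al (fun be => jcoef be Y).

Lemma jrho_lin al : linear (jrho al).
Proof. by move=> c Y Z; rewrite /jrho -rho_lin; apply: rho_eq => be _; rewrite jcoef_lin. Qed.

Lemma jrho_bound al : exists C, forall Y, `|jrho al Y| <= C * `|Y|.
Proof. exact: findim_lin_bound (findim_mx _ _) (jrho_lin al). Qed.

(** The second half of [jrho (a :: be) Y] is [jrho be (jshift a Y)], so the tangent map in that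
    direction is a derivative along [jshift a], the operation by which [jcomp] is built. *)
Lemma tmap_jrho i al Y : Ck m.+1 (f i) -> (size al <= m)%N ->
  tmap (f i) (size al) (jrho al Y) = jrho al (jet_field f i Y).
Proof.
move=> cf; have fV : findim 'rV[R]_n by exact: findim_mx.
have cm : Ck m (f i) by apply: CkW cf.
have dcomp be Z : (size be < m)%N -> is_diff Z (jcomp i be) ('d (jcomp i be) Z).
  move=> bm; apply/differentiableP.
  have : reg 1 set0 (jcomp i be) by apply: reg_jcomp0 => //; rewrite add1n; apply: CkW cf; rewrite ltnS ltnW.
  by move=> [].
have E1 be b Y' : (size b <= size be)%N -> (size be <= m)%N -> jcoef b (jet_field f i Y') = jcomp i b Y'.
  by move=> bb bm; apply: jcoef_field => //; exact: leq_trans bm.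
suff main be : (size be <= m)%N -> forall Y', tmap (f i) (size be) (jrho be Y') = rho be (fun b => jcomp i b Y').
  move=> am; rewrite main//; apply: rho_eq => b hb; rewrite (E1 al)//.
elim: be => [|a be IH] bm Y' //.
have bm' : (size be <= m)%N by exact: ltnW.
rewrite [LHS]/= [RHS]/=; congr (_, _); first exact: IH.
have -> : 'd (tmap (f i) (size be)) ((jrho (a :: be) Y').1) (jrho (a :: be) Y').2 =
    'd (tmap (f i) (size be)) (jrho be Y') (jrho be (jshift a Y')).
  congr ('d _ _ _).
  by apply: rho_eq => b hb; rewrite jcoef_shift// (leq_trans hb).
have d1 : is_diff Y' (jrho be) (jrho be) := is_diff_lin Y' (jrho_lin be) (jrho_bound be).
have d2 : is_diff (jrho be Y') (tmap (f i) (size be)) ('d (tmap (f i) (size be)) (jrho be Y')).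
  apply/differentiableP; have [] : Ck 1 (tmap (f i) (size be)); last by [].
  by apply: Ck_tmap => //; apply: CkW cf; rewrite add1n ltnS.
have d3 := is_diff_comp d1 d2.
have d4 : is_diff Y' (fun Y => rho be (fun b => jcomp i b Y)) (fun v => rho be (fun b => 'd (jcomp i b) Y' v)).
  apply: (rho_diff (F := fun b => jcomp i b)) => b hb; apply: dcomp.
  exact: leq_ltn_trans hb bm.
have E2 : tmap (f i) (size be) \o jrho be = (fun Y => rho be (fun b => jcomp i b Y)).
  by apply/funext => Z /=; rewrite IH.
have := is_diff_eval (jshift a Y') d3; rewrite E2 (is_diff_eval _ d4) => h.
exact: (esym h).
Qed.

(** A linear map that intertwines two families of fields intertwines their words: the identity for
    [w] is differentiated along the field of the next letter. *)
Lemma Fw_jrho N al w Y : (0 < N)%N -> locreg (N + m) f -> (size al <= m)%N -> (size w <= N)%N ->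
  Fw (fun i => tmap (f i) (size al)) w (jrho al Y) = jrho al (Fw (fun i => jet_field f i : jets -> jets) w Y).
Proof.
move=> N0 hf am; have fV : findim 'rV[R]_n by exact: findim_mx.
have fJ : findim jets by exact: findim_mx.
have hJ : locreg N (fun i => jet_field f i : jets -> jets).
  exact: locreg_jet_field.
have cT i : Ck N (tmap (f i) (size al)).
  apply: Ck_tmap => //; apply: CkW (locreg_Ck i hf).
  by rewrite leq_add2l.
elim: w Y => // i w IH Y wN; have wN' : (size w <= N)%N by exact: ltnW.
rewrite /=; have cf : Ck m.+1 (f i) by apply: CkW (locreg_Ck i hf); rewrite -add1n leq_add2r.
rewrite tmap_jrho//.
have d0 (Z : jets) : is_diff Z (jrho al) (jrho al) := is_diff_lin Z (jrho_lin al) (jrho_bound al).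
have d1 : is_diff (jrho al Y) (Fw (fun i => tmap (f i) (size al)) w)
    ('d (Fw (fun i => tmap (f i) (size al)) w) (jrho al Y)).
  apply/differentiableP/(@Fw_diff _ _ _ (findim_tower (size al) fV) _ N) => // j; exact: Ck_reg.
have d2 : is_diff Y (Fw (fun i => jet_field f i : jets -> jets) w)
    ('d (Fw (fun i => jet_field f i : jets -> jets) w) Y).
  apply/differentiableP/(@Fw_diff _ _ _ fJ _ N) => // j; exact: locreg_Ck0 hJ.
have d3 := is_diff_comp (d0 Y) d1.
have d4 := is_diff_compc (jrho_lin al) (jrho_bound al) d2.
have E2 : Fw (fun i => tmap (f i) (size al)) w \o jrho al = jrho al \o Fw (fun i => jet_field f i : jets -> jets) w.
  by apply/funext => Z /=; rewrite IH.
have := is_diff_eval (jet_field f i Y) d3; rewrite E2 (is_diff_eval _ d4) => h.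
exact: (esym h).
Qed.

Lemma mu_jrho N Om al s t Y : (0 < N)%N -> locreg (N + m) f -> (size al <= m)%N ->
  jrho al (mu N Om (fun i => jet_field f i : jets -> jets) s t Y) =
  mu N Om (fun i => tmap (f i) (size al)) s t (jrho al Y).
Proof.
move=> N0 hf am; rewrite /mu /davie_map lin_sum; last exact: jrho_lin.
by apply: eq_bigr => w _; rewrite -(@Fw_jrho N)// size_bseq.
Qed.

End JetField.

(** * Flows on iterated tangent spaces and jets of the flow *)

Section TowerFlow.
Context {R : realType} {d : nat} {gamma T : R}.
Local Notation N := (Ngam gamma).
Variable Om : R -> R -> seq 'I_d -> R.
Hypotheses (gamma01 : 0 < gamma < 1) (gammaN : 1 < N.+1%:R * gamma).
Hypothesis hOm : rough_increments gamma N Om.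

Lemma locreg_tmap (E : normedModType R) (f : 'I_d -> E -> E) m j : findim E -> locreg (m + j) f ->
  locreg m (fun i => tmap (f i) j).
Proof.
move=> fE; elim: j m => [|j IH] m; first by rewrite addn0.
by rewrite addnS -addSn => /IH h; exact: (locreg_tangent (findim_tower j fE) h).
Qed.

Lemma tmap_flow (E : normedModType R) (f : 'I_d -> E -> E) phi j : findim E ->
    good T (theta gamma N) (mu N Om f) -> locreg (N + j) f -> limit_flow T (mu N Om f) phi ->
  good T (theta gamma N) (mu N Om (fun i => tmap (f i) j)) /\
  limit_flow T (mu N Om (fun i => tmap (f i) j)) (fun s t => tmap (phi s t) j).
Proof.
move=> fE hg + hphi; elim: j => [|j IH] hf; first by [].
have [] := IH (locregW _ hf); first by rewrite leq_add2l.
move=> {IH} hgj hj; have fj := findim_tower j fE.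
have hfj : locreg N.+1 (fun i => tmap (f i) j) by apply: locreg_tmap => //; rewrite addSnnS.
have hgT := good_tangent (T := T) gamma01 gammaN hOm fj hfj hgj.
split; first exact: hgT.
have [psi hpsi] := flow_exists (findim_prod fj fj) hgT.
have hT := flow_tangent fj hfj hj hpsi.
move=> M e e0; have [dl dl0 h] := hpsi M e e0; exists dl => // s p z s0 hp lT zM.
have st := path_step_last hp; have [h1 h2] := hT s (last s p) z.1 s0 st lT.
have -> : tmap (phi s (last s p)) j.+1 z = psi s (last s p) z.
  case: z h1 h2 {zM} => x v /= h1 h2; rewrite /tangent /= (is_diff_eval _ h2).
  by rewrite -(h1 v) -surjective_pairing.
exact: h.
Qed.

(** For each word [al], the image under [jrho al] of the jet of [phi] is the trajectory of the
    iterated tangent flow that starts at the jet of the identity. Davie's expansion of this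
    trajectory, read in its last component, is the coordinate [al] of the expansion for the jet
    field. *)
Lemma davie_jet {n : nat} (f : 'I_d -> 'rV[R]_n -> 'rV[R]_n) phi m a x :
    (0 < N)%N -> good T (theta gamma N) (mu N Om f) -> locreg (N + m) f ->
    limit_flow T (mu N Om f) phi ->
    (forall t, a <= t <= T -> Ck m (phi a t)) -> 0 <= a -> a <= T ->
  let J t : 'M[R]_(#|{: m.-bseq 'I_n}|, n) :=
    jet (fun al : m.-bseq 'I_n => partial al (phi a t) x) in
  (exists M, forall t, a <= t <= T -> `|J t| <= M) /\
  davie gamma Om a T (fun i => jet_field f i : 'M[R]_(#|{: m.-bseq 'I_n}|, n) -> _) J.
Proof.
move=> N0 hg hf hphi cphi a0 aT J.
have fV : findim 'rV[R]_n by exact: findim_mx.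
have Jc t be : (size be <= m)%N -> jcoef be (J t) = partial be (phi a t) x.
  exact: (jcoef_jet (fun be => partial be (phi a t) x)).
pose z al := rho al (fun be : seq 'I_n => Dn id [seq (delta_mx 0 b : 'rV[R]_n) | b <- be] x).
have Jr al t : a <= t <= T -> (size al <= m)%N -> jrho al (J t) = tmap (phi a t) (size al) (z al).
  move=> tab am; rewrite /z -rho_tmap//; last exact: CkW (cphi t tab).
  by apply: rho_eq => be hb; rewrite Jc// (leq_trans hb).
have hal (al : m.-bseq 'I_n) : exists M C, [/\ 0 <= C,
    forall t, a <= t <= T -> `|jrho al (J t)| <= M &
    forall s t, a <= s -> s <= t -> t <= T ->
      `|jcoef al (J t - mu N Om (fun i => jet_field f i : 'M[R]_(#|{: m.-bseq 'I_n}|, n) -> _) s t (J s))|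
        <= C * theta gamma N (t - s)].
  have am := size_bseq al.
  have hf' : locreg (N + size al) f by apply: locregW hf; rewrite leq_add2l.
  have [hgT hT] := tmap_flow fV hg hf' hphi.
  have lT : locreg N (fun i => tmap (f i) (size al)) by exact: locreg_tmap.
  have [[M hM] [C C0 hC]] := davie_flow gamma01 gammaN hOm (findim_tower (size al) fV) lT (z al) hgT hT a0 aT.
  exists M, C; split => // [t tab|s t sa st tT]; first by rewrite Jr// hM.
  have h1 : a <= s <= T by rewrite sa (le_trans st).
  have h2 : a <= t <= T by rewrite tT (le_trans sa).
  apply: le_trans (hC s t sa st tT).
  rewrite -(Jr _ _ h1 am) -(Jr _ _ h2 am) -mu_jrho//.
  have lB u v : jrho al (u - v) = jrho al u - jrho al v.
    by rewrite addrC -scaleN1r jrho_lin scaleN1r addrC.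
  by rewrite -lB; exact: (rho_last al (fun be => jcoef be _)).
have [M {}hal] := choice hal; have [C {}hal] := choice hal.
split.
  exists (\sum_al `|M al|) => t tab; apply: jet_norm; first exact: sumr_ge0.
  move=> al; have [_ h _] := hal al.
  rewrite (le_trans (rho_last al (fun be => jcoef be (J t))))// (le_trans (h t tab))//.
  by rewrite (bigD1 al)//= (le_trans (ler_norm _))// lerDl sumr_ge0.
exists (\sum_al C al); first by apply: sumr_ge0 => al _; case: (hal al).
move=> s t sa st tT.
have th0 : 0 <= theta gamma N (t - s).
  by apply: (gauge_ge0 (theta_gauge gamma01 gammaN)); rewrite subr_ge0.
apply: jet_norm; first by rewrite mulr_ge0// sumr_ge0// => al _; case: (hal al).
move=> al; have [_ _ h] := hal al; rewrite (le_trans (h s t sa st tT))// ler_wpM2r//.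
by rewrite (bigD1 al)//= lerDl sumr_ge0// => be _; case: (hal be).
Qed.

End TowerFlow.

(** * Initial conditions and conclusion *)

Lemma Dn_cst (R : realType) (V U : normedModType R) (c : U) (v : V) vs x :
  Dn (fun=> c) (v :: vs) x = 0.
Proof.
elim: vs v x => [|w vs IH] v x /=; first by rewrite -[LHS]/('d (cst c) x v) diff_cst.
rewrite (_ : (fun x => _) = cst 0); last by apply/funext => y; exact: (IH w y).
by rewrite diff_cst.
Qed.

Lemma Dn_id (R : realType) (V : normedModType R) (vs : seq V) x : (2 <= size vs)%N ->
  Dn (@id V) vs x = 0.
Proof.
case/lastP: vs => // vs v; rewrite size_rcons ltnS => h.
rewrite Dn_rcons (_ : dird id v = (fun=> v)); last first.
  by apply/funext => y; rewrite /dird (is_diff_eval v (is_diff_id y)).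
by case: vs h => // w vs _; exact: Dn_cst.
Qed.

Theorem theorem3p6 (R : realType) (T gamma : R) (d n k : nat)
    (hT : 0 < T) (hd : (0 < d)%N) (hn : (0 < n)%N) (hgamma : 0 < gamma < 1)
    (f : 'I_d -> 'rV[R]_n -> 'rV[R]_n)
    (hf : forall i, Ckb (Ngam gamma + 1 + k) (f i))
    (W : R -> tens d (Ngam gamma) R)
    (hW : geometric_rough_path T W) :
  (forall (s : R) (x : 'rV[R]_n), 0 <= s <= T ->
    exists X : R -> tens d (Ngam gamma) 'rV[R]_n,
    [/\ rde_controlled_solution W f s T X,
        X s [bseq] = x,
        forall X' : R -> tens d (Ngam gamma) 'rV[R]_n,
          rde_controlled_solution W f s T X' -> X' s [bseq] = x ->
          forall t, s <= t <= T -> X' t = X t &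
        forall Y : R -> 'rV[R]_n,
          rde_solution W f s T Y -> Y s = x ->
          forall t, s <= t <= T -> Y t = X t [bseq]]) /\
  (forall X : R -> 'rV[R]_n -> R -> tens d (Ngam gamma) 'rV[R]_n,
    (forall s x, 0 <= s <= T ->
      rde_controlled_solution W f s T (X s x) /\ X s x s [bseq] = x) ->
    (forall s t, 0 <= s -> s < t -> t <= T ->
      Ck_diffeo k.+1 (fun x => X s x t [bseq])) /\
    (forall s x, 0 <= s <= T ->
      [/\ rde_solution W (jet_field (m := k.+1) f) s T
            (fun t => jet (fun alpha : k.+1.-bseq 'I_n =>
               partial alpha (fun y => X s y t [bseq]) x)),
          X s x s [bseq] = x,
          forall j, partial [:: j] (fun y => X s y s [bseq]) x = delta_mx 0 j &
          forall alpha : seq 'I_n, (2 <= size alpha <= k.+1)%N ->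
            partial alpha (fun y => X s y s [bseq]) x = 0])).

Proof.
have N0 := Ngam_gt0 hgamma; have gammaN := Ngam_lt hgamma.
pose N := Ngam gamma; pose Om s t w := coef (incr W (clip (T := T) s) (clip (T := T) t)) w.
have T0 : 0 <= T by exact: ltW.
have hOm : rough_increments gamma N Om by exact: rough_increments_clip.
have hWOm a s t w : 0 <= a -> a <= s <= T -> a <= t <= T -> (size w <= N)%N ->
    coef (incr W s t) w = Om s t w.
  move=> a0 /andP[sa sT] /andP[ta tT] _; rewrite /Om !clipE ?tT ?sT ?(le_trans a0)//.
have fE : findim 'rV[R]_n by exact: findim_mx.
have hfr i : reg (N + 1 + k) setT (f i) := Ckb_reg (hf i).
have hfl m : (m <= N + 1 + k)%N -> locreg m f.
  by move=> hm i M; apply: reg_sub (regW hm (hfr i)).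
have hf1 i : reg N.+1 setT (f i) by apply: regW (hfr i); rewrite -addn1 leq_addr.
have hfN : locreg N f by apply: hfl; rewrite -addnA leq_addr.
have [hg _] := good_mu T hgamma gammaN hOm fE hf1.
have [phi hphi] := flow_exists fE hg.
have sol s x : 0 <= s <= T -> rde_controlled_solution W f s T (Fw_lift f N (fun t => phi s t x)).
  move=> /andP[s0 sT]; have [[M hM] hD] := davie_flow hgamma gammaN hOm fE hfN x hg hphi s0 sT.
  exact: (rde_controlled_of_davie hgamma gammaN N0 s0 sT hOm (fun r u w => hWOm s r u w s0) fE hfN hM hD).
(* Both kinds of solution in the statement reduce to lifted ones, controlled solutions by
   truncation. *)
have uniq s x Z : 0 <= s <= T -> rde_lifted_solution W f s T Z -> Z s [bseq] = x ->
    forall t, s <= t <= T -> Z t [bseq] = phi s t x.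
  move=> /andP[s0 sT] hZ <- t /andP[st tT].
  have [_ _ hD] := davie_of_rde hgamma gammaN N0 s0 sT hOm (fun r u w => hWOm s r u w s0) fE hfN hZ.
  exact: (davie_unique hgamma gammaN hOm fE hf1 hphi s0 (lexx T) hD st tT).
have trunc0 (X : tens d N 'rV[R]_n) : trunc N.-1 X [bseq] = X [bseq].
  by rewrite /trunc ffunE -[LHS]/(coef X ([bseq] : N.-bseq 'I_d)) coef_bseqE.
have phiid s x : 0 <= s <= T -> phi s s x = x.
  by move=> /andP[s0 sT]; exact: (flow_id hphi).
split=> [s x s0T|X hX].
  exists (Fw_lift f N (fun t => phi s t x)); split.
  - exact: sol.
  - by rewrite /Fw_lift ffunE /= phiid.
  - move=> X' [_ hX' hw] hx t stT; apply/ffunP => w.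
    rewrite hw// /Fw_lift ffunE; congr (Fw f w _).
    by rewrite -trunc0 (uniq s x _ s0T hX')// trunc0.
  - move=> Y [Z hZ hZY] hY t stT; rewrite -hZY// /Fw_lift ffunE /=.
    apply: (uniq s x) => //; rewrite hZY//.
    by case/andP: s0T => _ ->; rewrite lexx.
have XE s x t : 0 <= s <= T -> s <= t <= T -> X s x t [bseq] = phi s t x.
  move=> s0T stT; have [[_ hl _] hx] := hX s x s0T.
  by rewrite -trunc0 (uniq s x _ s0T hl)// trunc0.
split.
  move=> s t s0 st tT; have s0T : 0 <= s <= T by rewrite s0 (le_trans (ltW st)).
  have stT : s <= t <= T by rewrite (ltW st).
  have -> : (fun x => X s x t [bseq]) = phi s t by apply/funext => x; exact: XE.
  (* The inverse of the flow from [s] to [t] is the flow of the reversed increments from T - t to T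
     - s. *)
  pose Om' r u := Om (T - r) (T - u).
  have hOm' : rough_increments gamma N Om'.
    apply: (rough_reparam hgamma hOm (c := fun r => T - r)) => r u.
    by rewrite -normrN opprB -[X in X <= _](_ : `|u - r| = _)//; congr (`|_|); ring.
  have [hg' _] := good_mu T hgamma gammaN hOm' fE hf1.
  have [psi hpsi] := flow_exists fE hg'.
  have t1 : 0 <= T - t by rewrite subr_ge0.
  have t2 : T - t <= T - s by rewrite lerD2l lerN2 ltW.
  have t3 : T - s <= T by rewrite gerBl.
  have hl : locreg (N.+1 + k) f by apply: hfl; rewrite addn1.
  exists (psi (T - t) (T - s)); split.
  - by move=> x; apply: (flow_reverse x hgamma gammaN hOm fE hfN hf1 s0 (ltW st) tT hphi hpsi).
  (* Reversing twice restores [Om], so the same lemma gives the other composition. *)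
  - move=> x; have hphi' : limit_flow T (mu N (fun r u => Om' (T - r) (T - u)) f) phi.
      rewrite (_ : (fun r u => Om' (T - r) (T - u)) = Om)//.
      by apply/funext => r; apply/funext => u; rewrite /Om' !subKr.
    have := flow_reverse x hgamma gammaN hOm' fE hfN hf1 t1 t2 t3 hpsi hphi'.
    by rewrite !subKr.
  - exact: (flow_Ck hgamma gammaN hOm fE hg hl hphi s0 (ltW st) tT).
  - exact: (flow_Ck hgamma gammaN hOm' fE hg' hl hpsi t1 t2 t3).
move=> s x s0T; have [s0 sT] := andP s0T.
(* At time [s] the flow is the identity, whose derivatives are the initial conditions. *)
have Xid : (fun y => X s y s [bseq]) = id.
  by apply/funext => y; rewrite XE ?lexx ?phiid.
split.
(* The jet field of order k + 1 consumes k + 1 of the N + 1 + k derivatives and keeps the [N] that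
   Davie's expansion needs. *)
- have hlm : locreg (N + k.+1) f by apply: hfl; rewrite -addnA add1n.
  have cphi t : s <= t <= T -> Ck k.+1 (phi s t).
    move=> /andP[st tT]; apply: (flow_Ck hgamma gammaN hOm fE hg _ hphi s0 st tT).
    by apply: hfl; rewrite addn1.
  have [[M hM] hD] := davie_jet hgamma gammaN hOm x N0 hg hlm hphi cphi s0 sT.
  have fJ : findim 'M[R]_(#|{: k.+1.-bseq 'I_n}|, n) by exact: findim_mx.
  have hJ : locreg N (fun i => jet_field (m := k.+1) f i) by exact: locreg_jet_field.
  have lift := rde_lifted_of_davie hgamma gammaN N0 s0 sT hOm (fun r u w => hWOm s r u w s0) fJ hJ hM hD.
  exists (Fw_lift (fun i => jet_field (m := k.+1) f i) N.-1
     (fun t => jet (fun al : k.+1.-bseq 'I_n => partial al (phi s t) x))).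
    by apply: lift => t w _; rewrite /Fw_lift ffunE.
  move=> t stT; rewrite /Fw_lift ffunE /=; congr jet; apply/funext => al.
  by congr (partial al _ x); apply/funext => y; rewrite XE.
- by rewrite XE ?lexx ?phiid.
- by move=> j; rewrite Xid /partial /= (is_diff_eval _ (is_diff_id x)).
by move=> al /andP[h _]; rewrite Xid /partial Dn_id// size_map.
Qed.
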